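(* Let $\Omega=(x_W,x_E)\times(y_S,y_N)\subset\mathbb{R}^2$ be a rectangle, with interface $\Gamma$, level-set function $\phi$, subdomains $\Omega^\pm$ and coefficient as in the context. Assume that the data functions $a,b,g,f$ all lie in $C^1(\overline\Omega)$, with $a,b$ vanishing on $\partial\Omega$, and that the coefficient matrix has the form $\beta\,\mathrm{Id}$ with $\beta$ scalar. Let $H^{1,h}_0$, $\|\cdot\|_h$, $B^h$, $F^h$, $B$, $F$ be as in the context. Then: (1) There is a family of linear extension operators $T^h:H^{1,h}_0\to H^1_0(\Omega)$ and positive constants $C_0,C_1,C_2,C_3$ independent of $h$ such that: (i) $\|T^h(\psi^h)\|_{H^1_0(\Omega)}\le C_0\|\psi^h\|_h$ for all $\psi^h\in H^{1,h}_0$; (ii) for every $\psi\in H^1_0(\Omega)$ there exist $\psi^h\in H^{1,h}_0$ with $T^h(\psi^h)\to\psi$ in $H^1_0(\Omega)$ as $h\to0$; (iii) $C_1\|u^h\|_h^2\le B^h[u^h,u^h]$ and $|B^h[u^h,v^h]|\le C_2\|u^h\|_h\|v^h\|_h$ for all $u^h,v^h\in H^{1,h}_0$; (iv) $|F^h(\psi^h)|\le C_3\|\psi^h\|_h$ for all $\psi^h\in H^{1,h}_0$; (v) whenever $v^h,\psi^h\in H^{1,h}_0$ satisfy $T^h(v^h)\rightharpoonup v$ weakly in $H^1_0(\Omega)$ and $T^h(\psi^h)\to\psi$ strongly in $H^1_0(\Omega)$ as $h\to0$, one has $B^h[v^h,\psi^h]\to B[v,\psi]$ and $F^h(\psi^h)\to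 F(\psi)$. (2) For each $h$ let $v^h\in H^{1,h}_0$ be the solution of the discrete weak problem $-B^h[v^h,\psi^h]=F^h(\psi^h)$ for all $\psi^h\in H^{1,h}_0$. Then the extended approximate solutions $T^h(v^h)$ converge weakly in $H^1_0(\Omega)$, as $h\to0$, to the solution $v\in H^1_0(\Omega)$ of the weak problem $-B[v,\psi]=F(\psi)$ for all $\psi\in H^1_0(\Omega)$.
   Context: **Continuous setting.** $\Omega=(x_W,x_E)\times(y_S,y_N)$. $\phi$ is a smooth real function; $\Omega^-=\{\phi<0\}$, $\Omega^+=\{\phi>0\}$, and $\Gamma=\{\phi=0\}\subset\Omega$ is a smooth interface (curve) with $\partial\Omega^-=\Gamma$ and $\Omega=\Omega^+\cup\Omega^-\cup\Gamma$ (disjoint). Locally, $\phi$ is a signed distance function of the interface. The scalar function $\beta$ satisfies $0<m\le\beta\le M$ with constants $m<M$, is continuously differentiable on the closure of each of $\Omega^-$ and $\Omega^+$ (possibly discontinuous across $\Gamma$), and on $\Gamma$ takes the limiting values from within $\Omega^-$. $B[u,v]=\int_\Omega\beta\nabla u\cdot\nabla v$, and $H^1_0(\Omega)$ carries the norm $\|u\|_{H^1_0(\Omega)}=B[u,u]^{1/2}$ (equivalent to the usual norm). $n=(n^{(1)},n^{(2)})=\nabla\phi/|\nabla\phi|$, which on $\Gamma$ is the unit normal pointing from $\Omega^-$ to $\Omega^+$. $$F(\psi)=\int_\Omega f\psi+\int_\Omega\beta\nabla g\cdot\nabla\psi-\int_{\Omega^-}\beta\nabla a\cdot\nabla\psi+\int_{\Omega^-}\nabla\cdot(b\psi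 n).$$ The weak problem $-B[v,\psi]=F(\psi)$ has a unique solution $v\in H^1_0(\Omega)$; $u=v+g-a\chi_{\Omega^-}$ ($\chi_{\Omega^-}$ the characteristic function of $\Omega^-$) is then by definition the weak solution of $\nabla\cdot(\beta\nabla u)=f$ in $\Omega\setminus\Gamma$ with jumps $u^+-u^-=a$ and $(n\cdot\beta\nabla u)^+-(n\cdot\beta\nabla u)^-=b$ on $\Gamma$ and $u=g$ on $\partial\Omega$. **Grids.** For positive integers $I,J$, $\Delta x=(x_E-x_W)/(I+1)$, $\Delta y=(y_N-y_S)/(J+1)$, $x_i=x_W+i\Delta x$, $y_j=y_S+j\Delta y$ (also for half-integer indices), $0\le i\le I+1$, $0\le j\le J+1$; $h=\min(\Delta x,\Delta y)$. The ratio $\Delta x/\Delta y$ is fixed as $h\to0$. $H^{1,h}$ is the space of real grid functions $w^h=(w_{i,j})$, $0\le i\le I+1$, $0\le j\le J+1$; $H^{1,h}_0$ is the subspace of those vanishing on the grid boundary ($i\in\{0,I+1\}$ or $j\in\{0,J+1\}$). Functions $a,b,g,f,\phi$ are restricted to the grid: $a_{i,j}=a(x_i,y_j)$, etc. $(\nabla_xw)_{i+1/2,j}=(w_{i+1,j}-w_{i,j})/\Delta x$, $(\nabla_yw)_{i,j+1/2}=(w_{i,j+1}-w_{i,j})/\Delta y$; $\beta^1_{i+1/2,j}=\beta(x_{i+1/2},y_j)$, $\beta^2_{i,j+1/2}=\beta(x_i,y_{j+1/2})$. **Discrete bilinear form and norm.** For $v^h,\psi^h\in H^{1,h}_0$ (and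 by the same formula for $v^h\in H^{1,h}$), $$B^h[v^h,\psi^h]=\sum_{j=1}^J\sum_{i=0}^I\beta^1_{i+1/2,j}(\nabla_xv)_{i+1/2,j}(\nabla_x\psi)_{i+1/2,j}\Delta x\Delta y+\sum_{i=1}^I\sum_{j=0}^J\beta^2_{i,j+1/2}(\nabla_yv)_{i,j+1/2}(\nabla_y\psi)_{i,j+1/2}\Delta x\Delta y,$$ and $\|\psi^h\|_h^2=B^h[\psi^h,\psi^h]$ on $H^{1,h}_0$. **Discrete normal.** At interior grid points ($1\le i\le I$, $1\le j\le J$), $(\phi_x)_{i,j}=(\phi_{i+1,j}-\phi_{i-1,j})/(2\Delta x)$, $(\phi_y)_{i,j}=(\phi_{i,j+1}-\phi_{i,j-1})/(2\Delta y)$, and $n_{i,j}=(n^{(1)}_{i,j},n^{(2)}_{i,j})$ is $((\phi_x)_{i,j},(\phi_y)_{i,j})$ divided by its Euclidean length. The discrete normal is not used on $\partial\Omega$: the products $(bn^{(k)}\psi)_{i,j}$ below are $0$ at boundary grid points, since $\psi_{i,j}=0$ there. **Discrete characteristic functions.** $\chi_{i,j}=1$ if $\phi_{i,j}\le0$, and $0$ if $\phi_{i,j}>0$. $\theta_{i+1/2,j}=|\phi_{i+1,j}|/(|\phi_{i,j}|+|\phi_{i+1,j}|)$ if the denominator is positive, $0$ otherwise; $\chi^1_{i+1/2,j}=\chi_{i,j}(1-\theta_{i+1/2,j})+\chi_{i+1,j}\theta_{i+1/2,j}$. Likewise $\theta_{i,j+1/2}=|\phi_{i,j+1}|/(|\phi_{i,j}|+|\phi_{i,j+1}|)$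 if the denominator is positive, $0$ otherwise; $\chi^2_{i,j+1/2}=\chi_{i,j}(1-\theta_{i,j+1/2})+\chi_{i,j+1}\theta_{i,j+1/2}$. **Discrete functional.** $F^h=F^h_1+F^h_2+F^h_3+F^h_4$ on $H^{1,h}_0$, where $F^h_1(\psi^h)=\sum_{i=1}^I\sum_{j=1}^Jf_{i,j}\psi_{i,j}\Delta x\Delta y$, $F^h_2(\psi^h)=B^h[g^h,\psi^h]$, $$F^h_3(\psi^h)=-\sum_{j=1}^J\sum_{i=0}^I\beta^1_{i+1/2,j}(\nabla_xa)_{i+1/2,j}(\nabla_x\psi)_{i+1/2,j}\chi^1_{i+1/2,j}\Delta x\Delta y-\sum_{i=1}^I\sum_{j=0}^J\beta^2_{i,j+1/2}(\nabla_ya)_{i,j+1/2}(\nabla_y\psi)_{i,j+1/2}\chi^2_{i,j+1/2}\Delta x\Delta y,$$ $$F^h_4(\psi^h)=\sum_{j=1}^J\sum_{i=0}^I\nabla_x(bn^{(1)}\psi)_{i+1/2,j}\chi^1_{i+1/2,j}\Delta x\Delta y+\sum_{i=1}^I\sum_{j=0}^J\nabla_y(bn^{(2)}\psi)_{i,j+1/2}\chi^2_{i,j+1/2}\Delta x\Delta y.$$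
   Formalization: In F, n need equal ∇φ/|∇φ| only near Γ, and ∇·(bψn) must be an integrable (weak) divergence on Ω^- for all ψ in H^1_0; with the literal quotient the claim can fail, e.g. for an annulus where n jumps across a critical curve of φ. *)

(* Defs.v *)
From HB Require Import structures.
From mathcomp Require Import all_boot all_order all_algebra.
From mathcomp Require Import all_classical all_reals all_analysis.

Set Implicit Arguments.
Unset Strict Implicit.
Unset Printing Implicit Defensive.

Import Order.TTheory GRing.Theory Num.Theory.
Import numFieldNormedType.Exports.

Local Open Scope classical_set_scope.
Local Open Scope ring_scope.

Section Plane.
Context {R : realType}.
Implicit Types (D : set (R * R)) (e p q : R * R) (u v g z : R * R -> R).

Definition plane_measure :
    {measure set (measurableTypeR R * measurableTypeR R) -> \bar R} :=
  (@lebesgue_measure R \x @lebesgue_measure R)%E.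

Definition e1 : R * R := (1, 0).
Definition e2 : R * R := (0, 1).

Definition norm2 p : R := Num.sqrt (p.1 ^+ 2 + p.2 ^+ 2).

Definition frontier D : set (R * R) := closure D `\` interior D.

(* C^k on the closure of the open set D: the partial derivatives in D up to
   order k exist and extend continuously to the closure of D. *)
Fixpoint Ck (k : nat) D u : Prop :=
  {within closure D, continuous u} /\
  match k with
  | 0 => True
  | k'.+1 => exists u1 u2 : R * R -> R,
      [/\ forall p, D p -> is_derive p e1 u (u1 p) /\ is_derive p e2 u (u2 p),
          Ck k' D u1 & Ck k' D u2]
  end.

Definition smooth D u : Prop := forall k, Ck k D u.

Definition test_function D z : Prop :=
  smooth setT z /\
  exists K, [/\ compact K, K `<=` D & forall p, ~ K p -> z p = 0].

(* Elements of L^2(D), H^1(D), H^1_0(D) are represented by functions on the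
   whole plane; their values outside D, or on a null set, are irrelevant. *)
Definition L2 D u : Prop :=
  measurable_fun D (u : measurableTypeR R * measurableTypeR R -> R) /\
  plane_measure.-integrable D (EFin \o (fun p => u p ^+ 2)).

Definition is_weak_derivative D e u g : Prop :=
  L2 D g /\
  forall z, test_function D z ->
    \int[plane_measure]_(p in D) (u p * 'D_e z p) =
    - \int[plane_measure]_(p in D) (g p * z p).

Definition H1 D u : Prop :=
  [/\ L2 D u, exists g, is_weak_derivative D e1 u g
            & exists g, is_weak_derivative D e2 u g].

(* A representative of the weak derivative, chosen when there is one. *)
Definition weak_derivative D e u : R * R -> R :=
  xget (fun=> 0) [set g | is_weak_derivative D e u g].

Definition is_weak_divergence D u v g : Prop :=
  [/\ plane_measure.-integrable D (EFin \o u),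
      plane_measure.-integrable D (EFin \o v),
      plane_measure.-integrable D (EFin \o g)
    & forall z, test_function D z ->
        \int[plane_measure]_(p in D) (u p * 'D_e1 z p + v p * 'D_e2 z p) =
        - \int[plane_measure]_(p in D) (g p * z p)].

Definition weak_divergence D u v : R * R -> R :=
  xget (fun=> 0) [set g | is_weak_divergence D u v g].

Definition H1_normsq D u : R :=
  \int[plane_measure]_(p in D)
    (u p ^+ 2 + weak_derivative D e1 u p ^+ 2 + weak_derivative D e2 u p ^+ 2).

Definition H10 D u : Prop :=
  H1 D u /\
  forall eps : R, 0 < eps ->
    exists z, test_function D z /\ H1_normsq D (u \- z) < eps.

Definition energy D (beta : R * R -> R) u v : R :=
  \int[plane_measure]_(p in D)
    (beta p * (weak_derivative D e1 u p * weak_derivative D e1 v p +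
               weak_derivative D e2 u p * weak_derivative D e2 v p)).

Definition H10_norm D beta u : R := Num.sqrt (energy D beta u u).

Definition bounded_linear_functional D beta (L : (R * R -> R) -> R) : Prop :=
  (forall (c : R) u v, H10 D u -> H10 D v -> L (c *: u + v) = c * L u + L v) /\
  exists C : R, forall u, H10 D u -> `|L u| <= C * H10_norm D beta u.

Definition weak_cvg {X : Type} D beta (F : set_system X)
    (uh : X -> R * R -> R) u : Prop :=
  forall L, bounded_linear_functional D beta L ->
    L (uh x) @[x --> F] --> L u.

Definition strong_cvg {X : Type} D beta (F : set_system X)
    (uh : X -> R * R -> R) u : Prop :=
  H10_norm D beta (uh x - u) @[x --> F] --> (0 : R).

End Plane.

Section Continuous.
Context {R : realType}.
Implicit Types (phi beta a b g f nx ny psi v : R * R -> R).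

Record rectangle := Rectangle { xW : R; xE : R; yS : R; yN : R }.

Definition Omega (Q : rectangle) : set (R * R) :=
  [set p | xW Q < p.1 < xE Q /\ yS Q < p.2 < yN Q].

Definition Omega_minus Q phi : set (R * R) := [set p | Omega Q p /\ phi p < 0].
Definition Omega_plus Q phi : set (R * R) := [set p | Omega Q p /\ 0 < phi p].
Definition Gamma Q phi : set (R * R) :=
  [set p | closure (Omega Q) p /\ phi p = 0].

Definition distance_to (A : set (R * R)) (p : R * R) : R :=
  inf [set norm2 (p - q) | q in A].

(* The sign of the distance function is that of the side of the interface by
   definition of Omega_minus and Omega_plus. A distance function has unit
   gradient where it is smooth, so Gamma is then a smooth curve. *)
Definition interface Q phi : Prop :=
  [/\ smooth (Omega Q) phi,
      Gamma Q phi `<=` Omega Q,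
      frontier (Omega_minus Q phi) = Gamma Q phi
    & exists U : set (R * R), [/\ open U, Gamma Q phi `<=` U &
        forall p, U p -> Omega Q p -> `|phi p| = distance_to (Gamma Q phi) p]].

Definition coefficient Q phi (m M : R) beta : Prop :=
  [/\ 0 < m, m < M,
      forall p, Omega Q p -> m <= beta p <= M,
      exists beta_minus, Ck 1 (Omega_minus Q phi) beta_minus /\
        forall p, (Omega_minus Q phi `|` Gamma Q phi) p ->
          beta p = beta_minus p
    & exists beta_plus, Ck 1 (Omega_plus Q phi) beta_plus /\
        forall p, Omega_plus Q phi p -> beta p = beta_plus p].

(* phi is negative in Omega_minus and vanishes on its boundary, so grad phi
   has zeros there, and the divergence of b psi (grad phi / |grad phi|) may
   have a part that is not a function (if phi is ridged, say). Hence (nx, ny)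
   is only required to be this quotient near Gamma, and to be such that the
   divergences in the functional are integrable functions. This allows the
   quotient itself when possible, and always a C^1 modification of it away
   from Gamma; by the divergence theorem, the integral of the divergence over
   Omega_minus does not depend on the choice. *)
Definition normal_field Q phi b nx ny : Prop :=
  (exists U : set (R * R), [/\ open U, Gamma Q phi `<=` U &
     forall p, U p -> Omega Q p ->
       nx p = 'D_e1 phi p / norm2 ('D_e1 phi p, 'D_e2 phi p) /\
       ny p = 'D_e2 phi p / norm2 ('D_e1 phi p, 'D_e2 phi p)]) /\
  forall psi, H10 (Omega Q) psi ->
    exists d, is_weak_divergence (Omega_minus Q phi)
      (fun p => b p * psi p * nx p) (fun p => b p * psi p * ny p) d.

Definition functional Q phi beta a b g f nx ny psi : R :=
  let O := Omega Q in
  let Om := Omega_minus Q phi in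
  \int[plane_measure]_(p in O) (f p * psi p)
  + \int[plane_measure]_(p in O)
      (beta p * ('D_e1 g p * weak_derivative O e1 psi p +
                 'D_e2 g p * weak_derivative O e2 psi p))
  - \int[plane_measure]_(p in Om)
      (beta p * ('D_e1 a p * weak_derivative O e1 psi p +
                 'D_e2 a p * weak_derivative O e2 psi p))
  + \int[plane_measure]_(p in Om)
      weak_divergence Om (fun q => b q * psi q * nx q)
                         (fun q => b q * psi q * ny q) p.

Definition weak_solution Q phi beta a b g f nx ny v : Prop :=
  H10 (Omega Q) v /\
  forall psi, H10 (Omega Q) psi ->
    - energy (Omega Q) beta v psi = functional Q phi beta a b g f nx ny psi.

End Continuous.
Arguments rectangle R : clear implicits.

Section Discrete.
Context {R : realType} (Q : rectangle R).
Implicit Types (I J i j : nat) (phi beta a b g f : R * R -> R).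

Definition dx I : R := (xE Q - xW Q) / I.+1%:R.
Definition dy J : R := (yN Q - yS Q) / J.+1%:R.
Definition mesh I J : R := Num.min (dx I) (dy J).

(* Real subscripts, so as to allow for half-integers. *)
Definition gx I (s : R) : R := xW Q + s * dx I.
Definition gy J (s : R) : R := yS Q + s * dy J.

Definition gridfun I J := 'M[R]_(I.+2, J.+2).

Section OneGrid.
Variables I J : nat.
Implicit Types (w v psi : gridfun I J).

Definition at_ w i j : R := w (inord i) (inord j).

Definition on_grid (u : R * R -> R) : gridfun I J :=
  \matrix_(i < I.+2, j < J.+2) u (gx I i%:R, gy J j%:R).

Definition interior_point i j : bool := (1 <= i <= I)%N && (1 <= j <= J)%N.

Definition H10h psi : Prop :=
  forall i j, (i <= I.+1)%N -> (j <= J.+1)%N -> ~~ interior_point i j ->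
    at_ psi i j = 0.

(* nabla_x w i j and nabla_y w i j are the difference quotients at
   (i+1/2, j) and (i, j+1/2); similarly for beta, theta and chi below. *)
Definition nabla_x w i j : R := (at_ w i.+1 j - at_ w i j) / dx I.
Definition nabla_y w i j : R := (at_ w i j.+1 - at_ w i j) / dy J.

Definition beta_x beta i j : R := beta (gx I (i%:R + 2^-1), gy J j%:R).
Definition beta_y beta i j : R := beta (gx I i%:R, gy J (j%:R + 2^-1)).

Definition Bh beta v psi : R :=
  \sum_(1 <= j < J.+1) \sum_(0 <= i < I.+1)
     beta_x beta i j * nabla_x v i j * nabla_x psi i j * dx I * dy J
  + \sum_(1 <= i < I.+1) \sum_(0 <= j < J.+1)
     beta_y beta i j * nabla_y v i j * nabla_y psi i j * dx I * dy J.

Definition normh beta psi : R := Num.sqrt (Bh beta psi psi).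

Definition phi_x phi i j : R :=
  (at_ (on_grid phi) i.+1 j - at_ (on_grid phi) i.-1 j) / (2 * dx I).
Definition phi_y phi i j : R :=
  (at_ (on_grid phi) i j.+1 - at_ (on_grid phi) i j.-1) / (2 * dy J).

(* To be used at interior points only. Where the discrete gradient vanishes,
   division by 0 makes the discrete normal 0. *)
Definition normal_x phi i j : R :=
  phi_x phi i j / norm2 (phi_x phi i j, phi_y phi i j).
Definition normal_y phi i j : R :=
  phi_y phi i j / norm2 (phi_x phi i j, phi_y phi i j).

Definition b_normal_x phi b psi : gridfun I J :=
  \matrix_(i < I.+2, j < J.+2)
    if interior_point i j
    then at_ (on_grid b) i j * normal_x phi i j * at_ psi i j else 0.
Definition b_normal_y phi b psi : gridfun I J :=
  \matrix_(i < I.+2, j < J.+2)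
    if interior_point i j
    then at_ (on_grid b) i j * normal_y phi i j * at_ psi i j else 0.

Definition chi phi i j : R := if at_ (on_grid phi) i j <= 0 then 1 else 0.

Definition theta_x phi i j : R :=
  let s := `|at_ (on_grid phi) i j| + `|at_ (on_grid phi) i.+1 j| in
  if 0 < s then `|at_ (on_grid phi) i.+1 j| / s else 0.
Definition theta_y phi i j : R :=
  let s := `|at_ (on_grid phi) i j| + `|at_ (on_grid phi) i j.+1| in
  if 0 < s then `|at_ (on_grid phi) i j.+1| / s else 0.

Definition chi_x phi i j : R :=
  chi phi i j * (1 - theta_x phi i j) + chi phi i.+1 j * theta_x phi i j.
Definition chi_y phi i j : R :=
  chi phi i j * (1 - theta_y phi i j) + chi phi i j.+1 * theta_y phi i j.

Definition Fh1 f psi : R :=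
  \sum_(1 <= i < I.+1) \sum_(1 <= j < J.+1)
     at_ (on_grid f) i j * at_ psi i j * dx I * dy J.

Definition Fh2 beta g psi : R := Bh beta (on_grid g) psi.

Definition Fh3 phi beta a psi : R :=
  - (\sum_(1 <= j < J.+1) \sum_(0 <= i < I.+1)
       beta_x beta i j * nabla_x (on_grid a) i j * nabla_x psi i j
       * chi_x phi i j * dx I * dy J)
  - \sum_(1 <= i < I.+1) \sum_(0 <= j < J.+1)
       beta_y beta i j * nabla_y (on_grid a) i j * nabla_y psi i j
       * chi_y phi i j * dx I * dy J.

Definition Fh4 phi b psi : R :=
  \sum_(1 <= j < J.+1) \sum_(0 <= i < I.+1)
     nabla_x (b_normal_x phi b psi) i j * chi_x phi i j * dx I * dy J
  + \sum_(1 <= i < I.+1) \sum_(0 <= j < J.+1)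
     nabla_y (b_normal_y phi b psi) i j * chi_y phi i j * dx I * dy J.

Definition Fh phi beta a b g f psi : R :=
  Fh1 f psi + Fh2 beta g psi + Fh3 phi beta a psi + Fh4 phi b psi.

Definition discrete_solution phi beta a b g f v : Prop :=
  H10h v /\ forall psi, H10h psi -> - Bh beta v psi = Fh phi beta a b g f psi.

End OneGrid.

Definition is_grid (ratio : R) I J : Prop :=
  [/\ (0 < I)%N, (0 < J)%N & dx I / dy J = ratio].

(* The limit h -> 0 along the grids with the given ratio dx / dy. *)
Definition mesh_to_0 (ratio : R) : set_system (nat * nat) :=
  filter_from [set d : R | 0 < d]
    (fun d => [set IJ | is_grid ratio IJ.1 IJ.2 /\ mesh IJ.1 IJ.2 < d]).

End Discrete.

(* Main.v *)
(** The extension operator is bilinear interpolation with mollified hat functions,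
so that the interpolant of a grid function vanishing on the grid boundary is a test
function, with Dirichlet energy comparable to the discrete one. Summation by parts
shows that the piecewise constant difference quotients and the gradients of the
interpolants have the same weak limits; for a strongly convergent sequence they
have the same strong limit. As the sampled coefficient converges to beta off Gamma,
B^h converges as the pairing of a weakly and a strongly convergent sequence.

On Gamma the gradient of phi is a unit vector, phi being a distance function there;
hence Gamma is a null set, and phi = O(h) at the nodes where chi jumps, so that the
discrete normal differs from grad phi by O(h) at these nodes. Replacing it by
grad phi and summing by parts turns F^h into a pairing with uniformly bounded
arrays that converge almost everywhere. The divergence term of F is brought to the
same form by testing with cut-offs of Omega^-, and the choice of the normal away
from Gamma is immaterial.

Approximants in (ii) are near-minimisers of the distance to the given function. For
(2), a functional is represented as energy w, and the discrete problem is tested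
with the approximants of w: B^h against them differs from energy w (T v^h) by o(1). *)
Require Import Defs.
From HB Require Import structures.
From mathcomp Require Import all_boot all_order all_algebra.
From mathcomp Require Import all_classical all_reals all_analysis.
From mathcomp Require Import measurable_realfun ring lra.
Import Order.TTheory GRing.Theory Num.Theory.
Import numFieldNormedType.Exports.
Set Implicit Arguments.
Unset Strict Implicit.
Unset Printing Implicit Defensive.
Local Open Scope classical_set_scope.
Local Open Scope ring_scope.

(** Elements of H^1_0 are representatives and their weak derivatives are arbitrary choices, linear
    only almost everywhere; every norm is therefore a seminorm, and the Hilbert space arguments are
    stated for semi-inner products on a predicate. This also motivates the mollification: a
    piecewise bilinear interpolant would need its weak derivative computed across cell edges,
    whereas a smooth one has its classical gradient as weak derivative. Bending the hats costs
    little: the slope of the bent ramp is bounded independently of the width of the bend, the bent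
    strips have vanishing relative area, and the lower energy bound only looks at the unbent core of
    each cell. The delicate term contains the discrete normal, which is not controlled away from the
    interface, where the discrete gradient may vanish. Only its difference to the smooth gradient is
    moved onto chi: the differences of chi, divided by the mesh width, are of order 1/h, but they
    live exactly where that error is O(h). Almost everywhere convergence and dominated convergence
    are statements about sequences, so limits along the mesh filter are tested on sequences of
    grids. *)

Section Limits.
Context {R : realType} {T : Type} {F : set_system T} {FF : Filter F}.
Implicit Types (u v : T -> R) (l : R).

Lemma cvg_near u l (e : R) : u x @[x --> F] --> l -> 0 < e ->
  \forall x \near F, `|u x - l| < e.
Proof. by move=> /cvgr_distC_lt ul e0; apply: ul. Qed.

Lemma near_cvg u l : (forall e : R, 0 < e -> \forall x \near F, `|u x - l| <= e) ->
  u x @[x --> F] --> l.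
Proof. by move=> H; apply/cvgrPdistC_le => e e0; exact: H. Qed.
End Limits.

Lemma cvg_lower (R : realType) (T : Type) (F : set_system T)
    (FF : ProperFilter F) (u : T -> R) (l c : R) :
  u x @[x --> F] --> l -> (\forall x \near F, c <= u x) -> c <= l.
Proof.
by move=> ul H; apply: (@closed_cvg _ _ F FF u [set x | c <= x]) ul => //; exact: closed_ge.
Qed.

(** * Semi-inner products on a linear subset: Cauchy-Schwarz, Riesz representation, uniform
    boundedness *)

Section SemiInner.
Context {R : realType} {X : lmodType R}.
Implicit Types (V : X -> Prop) (B : X -> X -> R) (L : X -> R).

Definition linear_set V :=
  V 0 /\ forall (c : R) u v, V u -> V v -> V (c *: u + v).

(** Definiteness cannot hold for functions taken as representatives, and bilinearity is asked on [V]
    only, because the forms of interest involve weak derivatives, which mean nothing outside [V]. *)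
Record semi_inner V B : Prop := SemiInner {
  si_set : linear_set V;
  si_lin : forall (c : R) u v w, V u -> V v -> V w ->
    B (c *: u + v) w = c * B u w + B v w;
  si_sym : forall u v, V u -> V v -> B u v = B v u;
  si_ge0 : forall u, V u -> 0 <= B u u }.

Definition seminorm B u := Num.sqrt (B u u).

Definition linear_on V L :=
  forall (c : R) u v, V u -> V v -> L (c *: u + v) = c * L u + L v.

Definition complete_on V B := forall u : nat -> X,
  (forall n, V (u n)) ->
  (forall eps : R, 0 < eps -> exists N, forall n k, (N <= n)%N -> (N <= k)%N ->
     B (u n - u k) (u n - u k) < eps) ->
  exists2 w, V w & B (u n - w) (u n - w) @[n --> \oo] --> (0 : R).

Section LinearSet.
Variables (V : X -> Prop).
Hypothesis HV : linear_set V.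
Lemma ls0 : V 0. Proof. exact: HV.1. Qed.
Lemma lsZ c u : V u -> V (c *: u).
Proof. by move=> Vu; rewrite -[_ *: _]addr0; apply: HV.2 => //; exact: ls0. Qed.
Lemma lsD u v : V u -> V v -> V (u + v).
Proof. by move=> Vu Vv; rewrite -[u]scale1r; apply: HV.2. Qed.
Lemma lsN u : V u -> V (- u).
Proof. by move=> Vu; rewrite -scaleN1r; apply: lsZ. Qed.
Lemma lsB u v : V u -> V v -> V (u - v).
Proof. by move=> Vu Vv; apply: lsD => //; apply: lsN. Qed.

Lemma linear_onD L u v : linear_on V L -> V u -> V v -> L (u + v) = L u + L v.
Proof. by move=> HL Vu Vv; rewrite -{1}[u]scale1r HL// mul1r. Qed.
Lemma linear_on0 L : linear_on V L -> L 0 = 0.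
Proof.
move=> HL; have := linear_onD HL ls0 ls0; rewrite addr0 => /eqP.
by rewrite -subr_eq0 opprD addrA subrr sub0r oppr_eq0 => /eqP.
Qed.
Lemma linear_onZ L c u : linear_on V L -> V u -> L (c *: u) = c * L u.
Proof.
by move=> HL Vu; rewrite -[_ *: _]addr0 HL ?linear_on0 ?addr0//; exact: ls0.
Qed.
Lemma linear_onB L u v : linear_on V L -> V u -> V v -> L (u - v) = L u - L v.
Proof.
move=> HL Vu Vv; rewrite linear_onD//; last exact: lsN.
by rewrite -scaleN1r linear_onZ// mulN1r.
Qed.
End LinearSet.

Section Theory.
Variables (V : X -> Prop) (B : X -> X -> R).
Hypothesis H : semi_inner V B.
Local Notation nrm := (seminorm B).
Local Notation HV := (si_set H).

Lemma si_linear_on w : V w -> linear_on V (B^~ w).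
Proof. by move=> Vw c u v Vu Vv /=; rewrite (si_lin H). Qed.

Lemma si_linear_onr w : V w -> linear_on V (B w).
Proof.
move=> Vw c u v Vu Vv /=; rewrite (si_sym H)//; last exact: HV.2.
by rewrite (si_lin H)// (si_sym H Vw Vu) (si_sym H Vw Vv).
Qed.

Lemma si_sqr c u v : V u -> V v ->
  B (c *: u + v) (c *: u + v) = c ^+ 2 * B u u + 2 * c * B u v + B v v.
Proof.
move=> Vu Vv; rewrite (si_lin H)//; last exact: HV.2.
rewrite (si_linear_onr Vu)// (si_linear_onr Vv)// (si_sym H Vv Vu).
by rewrite mulrDr mulrA -expr2; ring.
Qed.

Lemma si_CS u v : V u -> V v -> B u v ^+ 2 <= B u u * B v v.
Proof.
move=> Vu Vv.
have K c : 0 <= c ^+ 2 * B u u + 2 * c * B u v + B v v.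
  by rewrite -si_sqr//; apply: (si_ge0 H); apply: HV.2.
have := si_ge0 H Vu; have := si_ge0 H Vv.
move: (B u u) (B u v) (B v v) K => a b d K d0 a0.
have [a_eq|a_neq] := eqVneq a 0.
  have [->|b_neq] := eqVneq b 0; first by rewrite a_eq; lra.
  (* With [a = 0] the quadratic is affine in its parameter, and this value makes it equal to -1. *)
  have := K (- (d + 1) / (2 * b)); rewrite a_eq.
  have -> : 2 * (- (d + 1) / (2 * b)) * b = - (d + 1) by field.
  by rewrite mulr0; lra.
(* The minimiser of the quadratic. *)
have := K (- b / a).
have -> : (- b / a) ^+ 2 * a + 2 * (- b / a) * b + d = (a * d - b ^+ 2) / a.
  by field.
have a1 : 0 < a by rewrite lt_neqAle eq_sym a_neq.
by rewrite pmulr_lge0 ?invr_gt0// subr_ge0.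
Qed.

Lemma seminorm_ge0 u : 0 <= nrm u. Proof. exact: sqrtr_ge0. Qed.
Lemma seminorm_sqr u : V u -> nrm u ^+ 2 = B u u.
Proof. by move=> Vu; rewrite sqr_sqrtr// (si_ge0 H). Qed.

Lemma si_CS_norm u v : V u -> V v -> `|B u v| <= nrm u * nrm v.
Proof.
move=> Vu Vv; rewrite -ler_sqr ?nnegrE ?mulr_ge0 ?seminorm_ge0//.
by rewrite exprMn !seminorm_sqr// real_normK ?num_real// si_CS.
Qed.

Lemma seminormD u v : V u -> V v -> nrm (u + v) <= nrm u + nrm v.
Proof.
move=> Vu Vv; rewrite -ler_sqr ?nnegrE ?addr_ge0 ?seminorm_ge0//.
rewrite seminorm_sqr; last exact: lsD HV _ _ Vu Vv.
rewrite -[u in B (u + _)]scale1r -[u in B _ (u + _)]scale1r si_sqr//.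
have := si_CS_norm Vu Vv; have := ler_norm (B u v).
rewrite sqrrD -[B u u]seminorm_sqr// -[B v v]seminorm_sqr//.
by rewrite mulr2n; lra.
Qed.

Lemma seminormZ c u : V u -> nrm (c *: u) = `|c| * nrm u.
Proof.
move=> Vu; rewrite /seminorm -[c *: u]addr0 si_sqr//; last exact: ls0 HV.
rewrite (linear_on0 HV (si_linear_onr Vu)).
rewrite (linear_on0 HV (si_linear_onr (ls0 HV))) mulr0 !addr0.
by rewrite sqrtrM ?sqr_ge0// sqrtr_sqr.
Qed.

Lemma seminormN u : V u -> nrm (- u) = nrm u.
Proof. by move=> Vu; rewrite -scaleN1r seminormZ// normrN normr1 mul1r. Qed.

Lemma seminormB u v : V u -> V v -> nrm (u - v) <= nrm u + nrm v.
Proof.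
move=> Vu Vv; rewrite -(seminormN Vv); apply: seminormD => //.
exact: lsN HV _ Vv.
Qed.

Lemma seminorm_dist u v w : V u -> V v -> V w ->
  nrm (u - w) <= nrm (u - v) + nrm (v - w).
Proof.
move=> Vu Vv Vw; have -> : u - w = (u - v) + (v - w) by rewrite addrA subrK.
by apply: seminormD; apply: (lsB HV).
Qed.

Lemma seminorm_distC u v : V u -> V v -> nrm (u - v) = nrm (v - u).
Proof. by move=> Vu Vv; rewrite -opprB seminormN//; apply: (lsB HV). Qed.

Lemma cvg_seminorm (u : nat -> X) w : (forall n, V (u n)) -> V w ->
  B (u n - w) (u n - w) @[n --> \oo] --> (0 : R) ->
  nrm (u n - w) @[n --> \oo] --> (0 : R).
Proof.
move=> Vu Vw uw; rewrite -[X in _ --> X](@sqrtr0 R).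
by apply: continuous_cvg => //; exact: sqrt_continuous.
Qed.

Lemma cvg_si (u : nat -> X) w v : (forall n, V (u n)) -> V w -> V v ->
  B (u n - w) (u n - w) @[n --> \oo] --> (0 : R) ->
  B (u n) v @[n --> \oo] --> B w v.
Proof.
move=> Vu Vw Vv /(cvg_seminorm Vu Vw) uw.
apply: near_cvg => e e0.
have : \forall n \near \oo, `|nrm (u n - w) - 0| < e / (nrm v + 1).
  by apply: cvg_near uw _; rewrite divr_gt0// ltr_wpDl// seminorm_ge0.
apply: filterS => n; rewrite subr0 ger0_norm ?seminorm_ge0// => un.
rewrite -(linear_onB HV (si_linear_on Vv))//.
rewrite (le_trans (si_CS_norm _ _))//; first exact: lsB HV _ _ (Vu n) Vw.
have v0 : 0 < nrm v + 1 by rewrite ltr_wpDl// seminorm_ge0.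
have : nrm (u n - w) * (nrm v + 1) < e by rewrite -ltr_pdivlMr.
rewrite mulrDr mulr1; have := seminorm_ge0 (u n - w).
by move: (nrm (u n - w)) (_ * _) => s t; lra.
Qed.

Lemma sup_bound_seq (f : nat -> R) : (forall C, exists n, C < f n) ->
  exists g : nat -> nat, forall k, 4 ^+ k < f (g k).
Proof.
move=> fub; have /choice[g Hg] : forall k, exists n, 4 ^+ k < f n by move=> k.
by exists g.
Qed.

(* Minimise B u u - 2 L u over V0. *)
Lemma riesz (V0 : X -> Prop) L C : complete_on V B ->
  linear_set V0 -> (forall u, V0 u -> V u) -> linear_on V0 L ->
  (forall u, V0 u -> `|L u| <= C * nrm u) ->
  exists w, [/\ V w, forall v, V0 v -> B w v = L v &
    exists2 u : nat -> X, forall n, V0 (u n) &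
      nrm (u n - w) @[n --> \oo] --> (0 : R)].
Proof.
move=> cV HV0 sV lL bL; pose J u := B u u - 2 * L u.
pose E := [set J u | u in V0].
have Jlb u : V0 u -> - C ^+ 2 <= J u.
  move=> Vu; rewrite /J -seminorm_sqr; last exact: sV.
  have := bL _ Vu; have := ler_norm (L u); move: (L u) (`|L u|) (nrm u) => a b c ab.
  by move=> bc; have := sqr_ge0 (c - C); rewrite sqrrB !mulr2n mulrC; lra.
have hE : has_inf E.
  split; first by exists (J 0), 0 => //; exact: ls0 HV0.
  by exists (- C ^+ 2) => _ [u Vu <-]; exact: Jlb.
have infJ u : V0 u -> inf E <= J u by move=> Vu; apply: ge_inf; [exact: hE.2|exists u].
have /choice[u Hu] : forall n, exists u, V0 u /\ J u < inf E + n.+1%:R^-1.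
  move=> n; have n0 : 0 < n.+1%:R^-1 :> R by rewrite invr_gt0.
  by have [_ [u Vu <-] ?] := inf_adherent n0 hE; exists u.
have JD t a v : V0 a -> V0 v ->
    J (t *: v + a) = J a + 2 * t * (B a v - L v) + t ^+ 2 * B v v.
  move=> Va Vv; rewrite /J si_sqr ?lL//; [|exact: sV..].
  by rewrite (si_sym H (sV _ Vv) (sV _ Va)); ring.
have Vu n : V (u n) by apply: sV; exact: (Hu n).1.
(* Parallelogram argument: [JD] with parameters 1 and 1/2 gives [J] at [u n] and at the midpoint of
   [u n] and [u k], and the latter is at least the infimum. *)
have uB n k : B (u n - u k) (u n - u k) <= 2 * (n.+1%:R^-1 + k.+1%:R^-1).
  have [V0n Jn] := Hu n; have [V0k Jk] := Hu k.
  have Vd : V0 (u n - u k) by exact: lsB HV0 _ _ V0n V0k.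
  have := JD 2^-1 _ _ V0k Vd.
  have := JD 1 _ _ V0k Vd; rewrite scale1r subrK => E1 E2.
  have := infJ (2^-1 *: (u n - u k) + u k) (HV0.2 _ _ _ Vd V0k).
  rewrite E2; move: E1 Jn Jk.
  move: (B (u n - u k) _) (B (u k) _ - _) (J (u n)) (J (u k)) (inf E) => b c x y z.
  move: (n.+1%:R^-1) (k.+1%:R^-1) => p q; lra.
have [|w Vw uw] := cV u Vu.
  move=> e e0; have e40 : 0 < e / 4 by rewrite divr_gt0.
  have [N _ HN] := near_infty_natSinv_lt (PosNum e40).
  exists N => n k /HN /= ln /HN /= lk; apply: le_lt_trans (uB n k) _.
  by move: ln lk; move: (n.+1%:R^-1) (k.+1%:R^-1) => p q; lra.
exists w; split=> //; last by exists u; [move=> n; exact: (Hu n).1|exact: cvg_seminorm].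
move=> v V0v; have Vv := sV _ V0v.
(* The variational inequality at [w] is the limit of [J (u n) - n.+1%:R^-1 < inf E <= J (t *: v + u
   n)]; [w] itself need not lie in [V0]. *)
have K t : 0 <= 2 * t * (B w v - L v) + t ^+ 2 * B v v.
  have c1 : (2 * t * (B (u n) v - L v) + t ^+ 2 * B v v) @[n --> \oo] -->
     2 * t * (B w v - L v) + t ^+ 2 * B v v.
    apply: cvgD; last exact: cvg_cst.
    apply: cvgMr; apply: cvgB; last exact: cvg_cst.
    exact: cvg_si.
  have c2 : - (n.+1%:R^-1 : R) @[n --> \oo] --> 0.
    by rewrite -oppr0; apply: cvgN; exact: cvg_harmonic.
  apply: (@ler_cvg_to _ _ _ _ _ _ _ _ c2 c1); near=> n.
  have [V0n Jn] := Hu n.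
  have := infJ _ (HV0.2 t _ _ V0v V0n); rewrite JD//; move: Jn.
  by move: (J _) (inf E) (_ * (B (u n) v - _)) (t ^+ 2 * _) (_^-1) => *; lra.
have := K; move: (B w v) (L v) (B v v) (si_ge0 H Vv) => a b d d0 K'.
apply/eqP; rewrite -subr_eq0; apply/eqP; move: (a - b) K' => c K'.
(* The optimal parameter would be [- c / d]; the added 1 covers [d = 0]. *)
have := K' (- c / (d + 1)).
have -> : 2 * (- c / (d + 1)) * c + (- c / (d + 1)) ^+ 2 * d =
   - (c ^+ 2 * (d + 2)) / (d + 1) ^+ 2.
  by field; rewrite lt0r_neq0//; lra.
rewrite pmulr_lge0; last by rewrite invr_gt0 exprn_gt0//; lra.
rewrite oppr_ge0 pmulr_lle0; last by lra.
by move=> c2; apply/eqP; rewrite -sqrf_eq0 eq_le c2 sqr_ge0.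
Unshelve. all: by end_near. Qed.

(* Sokal's gliding hump. *)
Fixpoint hump (y : nat -> X) n : X :=
  if n is k.+1 then
    hump y k + ((if 0 <= B (hump y k) (y k) then 1 else -1) * 3^-1 ^+ k.+1
               / nrm (y k)) *: y k
  else 0.

(** If the norms were unbounded, some [y k] would have norm above [4 ^+ k]. The vectors [hump y k]
    receive increments of norm at most [3^-1 ^+ k.+1], so they converge, and the increments after
    the one along [y k] add up to at most half of its norm. Hence the limit pairs with [y k] to at
    least [3^-1 ^+ k.+1 * nrm (y k) / 2], which grows like (4/3)^k, against the pointwise bound. No
    category argument is involved. *)
Lemma unif_bounded (x : nat -> X) : complete_on V B -> (forall n, V (x n)) ->
  (forall w, V w -> exists C : R, forall n, `|B w (x n)| <= C) ->
  exists C : R, forall n, nrm (x n) <= C.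
Proof.
move=> cV Vx bx; apply: contrapT => nb.
have [C|g Hg] := @sup_bound_seq (fun n => nrm (x n)).
  apply: contrapT => nC; apply: nb; exists C => n; rewrite leNgt.
  by apply/negP => Cn; apply: nC; exists n.
pose y k := x (g k); pose w := hump y; pose r : R := 3^-1.
have Vy k : V (y k) by exact: Vx.
have y0 k : 0 < nrm (y k) by apply: lt_trans (Hg k); rewrite exprn_gt0.
have r0 n : 0 < r ^+ n by rewrite exprn_gt0// invr_gt0.
have Vw n : V (w n).
  by elim: n => [|n IH]; [exact: ls0 HV|apply: lsD HV _ _ IH _; exact: lsZ HV _ _ (Vy n)].
have wS n : nrm (w n.+1 - w n) <= r ^+ n.+1.
  rewrite /w /= addrAC subrr add0r seminormZ// 2!normrM normfV.
  rewrite (ger0_norm (seminorm_ge0 _)) divfK ?gt_eqF//.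
  rewrite [`| _ ^+ _|]gtr0_norm ?r0//.
  by case: ifP; rewrite ?normrN normr1 mul1r.
(* The right-hand side is the exact sum of the powers of 1/3 with exponents from [n + 1] to
   [n + p]. *)
have wp n p : nrm (w (n + p)%N - w n) <= (r ^+ n - r ^+ (n + p)) / 2.
  elim: p => [|p IH]; first by rewrite addn0 !subrr mul0r /seminorm
    (linear_on0 HV (si_linear_onr (ls0 HV))) sqrtr0.
  apply: le_trans (seminorm_dist (Vw _) (Vw (n + p)%N) (Vw _)) _.
  rewrite addnS; have := wS (n + p)%N; move: IH; rewrite exprS.
  move: (nrm _) (nrm _) (r ^+ n) (r ^+ (n + p)%N) => a b c d; rewrite /r; lra.
have wnk n k : (n <= k)%N -> nrm (w k - w n) <= r ^+ n / 2.
  move=> nk; rewrite -(subnKC nk); apply: le_trans (wp _ _) _.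
  by rewrite ler_pM2r ?invr_gt0// lerBlDr lerDl ltW.
have rcvg : r ^+ n @[n --> \oo] --> 0.
  by apply: cvg_expr; rewrite gtr0_norm /r ?invr_gt0// invf_lt1// ltr1n.
have [|w0 Vw0 cw0] := cV w Vw.
  move=> e e0; have : \forall n \near \oo, `|r ^+ n - 0| < Num.sqrt e.
    by apply: cvg_near rcvg _; rewrite sqrtr_gt0.
  case=> N _ HN; exists N => n k Nn Nk.
  rewrite -seminorm_sqr; last exact: lsB HV _ _ (Vw n) (Vw k).
  rewrite -[e]sqr_sqrtr ?ltW// ltr_sqr ?nnegrE ?sqrtr_ge0//.
  apply: le_lt_trans (seminorm_dist (Vw n) (Vw N) (Vw k)) _.
  rewrite (seminorm_distC (Vw N) (Vw k)).
  have := HN N (leqnn _); rewrite /= subr0 gtr0_norm ?r0//.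
  have := wnk _ _ Nn; have := wnk _ _ Nk.
  by move: (nrm _) (nrm _) (r ^+ N) (Num.sqrt e) => *; lra.
have lim k : nrm (w0 - w k) <= r ^+ k / 2.
  have c1 : nrm (w0 - w n) + r ^+ k / 2 @[n --> \oo] --> 0 + r ^+ k / 2.
    apply: cvgD; last exact: cvg_cst.
    have := cvg_seminorm Vw Vw0 cw0.
    by under eq_fun do rewrite seminorm_distC//.
  rewrite -[leRHS]add0r.
  apply: cvg_lower c1 _.
  near=> n; apply: le_trans (seminorm_dist Vw0 (Vw n) (Vw k)) _.
  by rewrite lerD2l wnk//; near: n; exact: nbhs_infty_ge.
have [C HC] := bx _ Vw0.
have big k : r ^+ k.+1 * nrm (y k) / 2 <= C.
  have := HC (g k); rewrite -/(y k).
  have -> : w0 = (w0 - w k.+1) + w k.+1 by rewrite subrK.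
  rewrite (linear_onD (si_linear_on (Vy k)))//; last exact: lsB HV _ _ Vw0 (Vw _).
  have := si_CS_norm (lsB HV Vw0 (Vw k.+1)) (Vy k).
  have := ler_wpM2r (ltW (y0 k)) (lim k.+1).
  (* The sign in [hump] agrees with that of [B (w k) (y k)], so the new increment cannot cancel what
     was there. *)
  have : r ^+ k.+1 * nrm (y k) <= `|B (w k.+1) (y k)|.
    have -> : w k.+1 = w k + ((if 0 <= B (w k) (y k) then 1 else -1) *
        r ^+ k.+1 / nrm (y k)) *: y k by [].
    rewrite (linear_onD (si_linear_on (Vy k)))//; last first.
      exact: lsZ HV _ _ (Vy k).
    rewrite (linear_onZ HV _ (si_linear_on (Vy k)))// -seminorm_sqr//.
    have nz : nrm (y k) != 0 by rewrite gt_eqF.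
    have ry : 0 <= r ^+ k.+1 * nrm (y k) by rewrite mulr_ge0 ?ltW// r0.
    case: ifPn => [p|].
      have -> : 1 * r ^+ k.+1 / nrm (y k) * nrm (y k) ^+ 2 = r ^+ k.+1 * nrm (y k).
        by field.
      by rewrite ger0_norm ?addr_ge0// lerDr.
    rewrite -ltNge => p.
    have -> : -1 * r ^+ k.+1 / nrm (y k) * nrm (y k) ^+ 2 = - (r ^+ k.+1 * nrm (y k)).
      by field.
    by move: p ry; move: (B _ _) (_ * _) => ? ? ? ?; rewrite ler0_norm; lra.
  move: (B _ _) (B (w _) _) (nrm (_ - _)) (nrm _) (r ^+ _) => a b c d e.
  have : `|b| <= `|a + b| + `|a|.
    by rewrite -{1}[b](addrK a) [b + a]addrC ler_normB.
  have -> : e / 2 * d = e * d / 2 by ring.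
  by move: (`|a|) (`|b|) (`|a + b|) (e * d) (c * d) => *; lra.
(* The 6 is the product of the 3 in [3^-1 ^+ k.+1] and the 2 lost to the later increments. *)
have [k Hk] : exists k, 6 * C < (4 / 3) ^+ k.
  have : (3 / 4 : R) ^+ n @[n --> \oo] --> 0.
    by apply: cvg_expr; rewrite gtr0_norm; lra.
  move/cvg_near => /(_ (6 * `|C| + 1)^-1).
  have C0 : 0 < 6 * `|C| + 1 by rewrite ltr_wpDl// mulr_ge0.
  rewrite invr_gt0 => /(_ C0)[N _ HN]; exists N.
  have := HN N (leqnn _); rewrite /= subr0 gtr0_norm; last first.
    by rewrite exprn_gt0//; lra.
  have -> : (3 / 4 : R) = (4 / 3)^-1 by field.
  have q0 : 0 < (4 / 3 : R) ^+ N by rewrite exprn_gt0//; lra.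
  rewrite exprVn ltf_pV2 ?posrE// {q0}.
  have := ler_norm C; move: (_ ^+ N) => *; lra.
have := big k; rewrite exprS => h2; have := ltr_pM2r (r0 k) (4 ^+ k) (nrm (y k)).
rewrite (Hg k) => h3.
move: Hk; have -> : (4 / 3 : R) ^+ k = 4 ^+ k * r ^+ k by rewrite exprMn.
move: h2 h3; rewrite [in r * _]/r; move: (4 ^+ k) (r ^+ k) (nrm (y k)) => a b c.
have -> : 3^-1 * b * c / 2 = c * b / 6 by field.
move=> h2 h3 h4; have h5 : a * b < c * b by rewrite h3.
by move: h2 h4 h5 {h3}; move: (a * b) (c * b) => *; lra.
Unshelve. all: by end_near. Qed.
End Theory.
End SemiInner.

(** * Square-integrable functions on a set of finite measure *)

Section Integration.
Context {d : measure_display} {T : measurableType d} {R : realType}.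
Variables (mu : {measure set T -> \bar R}) (D : set T).
Hypotheses (mD : measurable D) (finD : (mu D < +oo)%E).
Implicit Types (u v w f g : T -> R).

Local Notation rint u := (mu.-integrable D (EFin \o u)).

(** For the plane measure this unfolds to [L2], so facts about either apply to the other. *)
Definition sq_integrable u := measurable_fun D u /\ rint (fun x => u x ^+ 2).

Definition ip u v := \int[mu]_(x in D) (u x * v x).

Lemma rint_measurable u : rint u -> measurable_fun D u.
Proof. by move=> /measurable_int/measurable_EFinP. Qed.

Lemma rint_le u v : measurable_fun D u -> (forall x, D x -> `|u x| <= v x) ->
  rint v -> rint u.
Proof.
move=> mu_ uv iv; apply: le_integrable iv => //; first exact/measurable_EFinP.
by move=> x Dx; rewrite /= lee_fin (le_trans (uv _ Dx))// ler_norm.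
Qed.

Lemma rintD u v : rint u -> rint v -> rint (fun x => u x + v x).
Proof. by move=> iu iv; exact: (integrableD mD iu iv). Qed.
Lemma rintB u v : rint u -> rint v -> rint (fun x => u x - v x).
Proof. by move=> iu iv; exact: (integrableB mD iu iv). Qed.
Lemma rintZ (c : R) u : rint u -> rint (fun x => c * u x).
Proof. by move=> iu; exact: (integrableZl mD _ iu). Qed.

Lemma rint_bounded u (C : R) : measurable_fun D u ->
  (forall x, D x -> `|u x| <= C) -> rint u.
Proof.
move=> mu_ uC; apply: measurable_bounded_integrable => //.
exists C; split; first exact: num_real.
by move=> M CM x Dx; apply: le_trans (uC _ Dx) (ltW CM).
Qed.

Lemma rint_bounded_mul u v (C : R) : measurable_fun D u ->
  (forall x, D x -> `|u x| <= C) -> rint v -> rint (fun x => u x * v x).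
Proof.
move=> mu_ uC iv; apply: (@rint_le _ (fun x => C * `|v x|)).
- by apply: measurable_funM => //; exact: rint_measurable.
- by move=> x Dx; rewrite normrM ler_wpM2r// uC.
- by apply: rintZ; exact: (integrable_norm iv).
Qed.

Lemma rint_ae u v : rint u -> measurable_fun D v ->
  {ae mu, forall x, D x -> u x = v x} -> rint v.
Proof.
move=> iu mv uv; apply/integrableP; split; first exact/measurable_EFinP.
have mu_ := rint_measurable iu.
rewrite (@ae_eq_integral _ _ _ mu D (fun x => `|(EFin \o u) x|)%E)//.
- by case/integrableP : iu.
- by do 2 apply: measurableT_comp => //.
- by do 2 apply: measurableT_comp => //.
- by apply: filterS uv => x uv Dx /=; rewrite uv.
Qed.

Lemma Rintegral_ae u v : measurable_fun D u -> measurable_fun D v ->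
  {ae mu, forall x, D x -> u x = v x} ->
  \int[mu]_(x in D) u x = \int[mu]_(x in D) v x.
Proof.
move=> mu_ mv uv; congr fine; apply: ae_eq_integral => //; try exact/measurable_EFinP.
by apply: filterS uv => x uv Dx /=; rewrite uv.
Qed.

Lemma Rintegral_eq0_ae u : rint u -> (forall x, D x -> 0 <= u x) ->
  \int[mu]_(x in D) u x = 0 -> {ae mu, forall x, D x -> u x = 0}.
Proof.
move=> iu u0 I0.
have mu_ := rint_measurable iu.
have : (\int[mu]_(x in D) `|(u x)%:E|)%E = 0%E.
  rewrite (@eq_integral _ _ _ _ _ (EFin \o u)).
    by rewrite -[LHS]fineK ?integrable_fin_num//; congr EFin.
  by move=> x /set_mem Dx /=; rewrite ger0_norm// u0.
move/(ae_eq_integral_abs mu mD (f := EFin \o u)).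
move=> /(_ (proj2 (measurable_EFinP _ _) mu_)); apply: filterS => x /[apply] /=.
by case.
Qed.

Lemma Rintegral_dominated (f : nat -> T -> R) g h :
  (forall n, measurable_fun D (f n)) -> measurable_fun D g ->
  {ae mu, forall x, D x -> f n x @[n --> \oo] --> g x} ->
  rint h -> (forall n x, D x -> `|f n x| <= h x) ->
  \int[mu]_(x in D) f n x @[n --> \oo] --> \int[mu]_(x in D) g x.
Proof.
move=> mf mg fg ih fh.
have [|||||ig _ cvI] := @dominated_convergence _ _ _ mu D mD (fun n => EFin \o f n)
  (EFin \o g) (EFin \o h).
- by move=> n; exact/measurable_EFinP.
- exact/measurable_EFinP.
- by apply: filterS fg => x fg Dx; apply: cvg_EFin; [exact: nearW|exact: fg].
- exact: ih.
- by apply: aeW => x n Dx /=; rewrite lee_fin fh.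
have ifn n : rint (f n) by apply: rint_le ih => //; exact: fh.
apply: fine_cvg; rewrite fineK ?integrable_fin_num//; exact: cvI.
Qed.

Lemma sq_measurable u : sq_integrable u -> measurable_fun D u.
Proof. by case. Qed.

Lemma sq_bounded u (C : R) : measurable_fun D u ->
  (forall x, D x -> `|u x| <= C) -> sq_integrable u.
Proof.
move=> mu_ uC; split=> //; apply: (@rint_bounded _ (C ^+ 2)).
  exact: measurable_funX.
move=> x Dx; rewrite normrX; apply: lerXn2r => //; rewrite ?nnegrE ?uC//.
exact: le_trans (uC _ Dx).
Qed.

Lemma sq_ae u v : sq_integrable u -> measurable_fun D v ->
  {ae mu, forall x, D x -> u x = v x} -> sq_integrable v.
Proof.
move=> [mu_ iu] mv uv; split=> //; apply: (rint_ae iu); first exact: measurable_funX.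
by apply: filterS uv => x uv Dx; rewrite uv.
Qed.

Lemma sq_linear_set : linear_set sq_integrable.
Proof.
split; first by apply: (@sq_bounded _ 0) => [|x _ /=]; rewrite ?normr0//; exact: measurable_cst.
move=> c u v [mu_ iu] [mv iv]; have m : measurable_fun D (c *: u + v).
  by apply: measurable_funD => //; apply: measurable_funM.
split=> //; apply: (@rint_le _ (fun x => (2 * c ^+ 2) * u x ^+ 2 + 2 * v x ^+ 2)).
- exact: measurable_funX.
- move=> x Dx; rewrite ger0_norm ?sqr_ge0//.
  have -> : (c *: u + v) x = c * u x + v x by [].
  have := sqr_ge0 (c * u x - v x); move: (u x) (v x) => a b.
  by rewrite -subr_ge0 subr0 sqrrB sqrrD exprMn !mulr2n; move: (a ^+ 2) => *; lra.
- by apply: rintD; apply: rintZ.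
Qed.

Lemma sq_mul u v : sq_integrable u -> sq_integrable v -> rint (fun x => u x * v x).
Proof.
move=> [mu_ iu] [mv iv]; apply: (@rint_le _ (fun x => u x ^+ 2 + v x ^+ 2)).
- exact: measurable_funM.
- move=> x Dx; rewrite normrM -[u x ^+ 2]real_normK ?num_real//.
  rewrite -[v x ^+ 2]real_normK ?num_real//.
  by move: (`|u x|) (`|v x|) (normr_ge0 (u x)) (normr_ge0 (v x)) => *; nra.
- exact: rintD.
Qed.

Lemma sq_bounded_mul u v (C : R) : measurable_fun D u ->
  (forall x, D x -> `|u x| <= C) -> sq_integrable v ->
  sq_integrable (fun x => u x * v x).
Proof.
move=> mu_ uC [mv iv]; split; first exact: measurable_funM.
under [fun x => _]eq_fun do rewrite exprMn.
apply: (@rint_bounded_mul _ _ (C ^+ 2)) iv; first exact: measurable_funX.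
move=> x Dx; rewrite normrX; apply: lerXn2r => //; rewrite ?nnegrE ?uC//.
exact: le_trans (uC _ Dx).
Qed.

Lemma sq_rint u : sq_integrable u -> rint u.
Proof.
move=> su; have s1 : sq_integrable (fun=> 1).
  by apply: (@sq_bounded _ 1) => [|x _]; rewrite ?normr1//; exact: measurable_cst.
by have := sq_mul su s1; under [fun x => _]eq_fun do rewrite mulr1.
Qed.

Lemma ip_semi_inner : semi_inner sq_integrable ip.
Proof.
split; first exact: sq_linear_set.
- move=> c u v w su sv sw; rewrite /ip -RintegralZl//; last exact: sq_mul.
  rewrite -RintegralD//; [|by apply: rintZ; exact: sq_mul|exact: sq_mul].
  by apply: eq_Rintegral => x _; rewrite mulrA -mulrDl.
- by move=> u v _ _; apply: eq_Rintegral => x _; rewrite mulrC.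
- by move=> u _; apply: Rintegral_ge0 => x _; rewrite -expr2 sqr_ge0.
Qed.

Lemma ip_ae u v w : sq_integrable u -> sq_integrable v -> sq_integrable w ->
  {ae mu, forall x, D x -> u x = v x} -> ip u w = ip v w.
Proof.
move=> su sv sw uv; apply: Rintegral_ae.
- by apply: rint_measurable; exact: sq_mul.
- by apply: rint_measurable; exact: sq_mul.
- by apply: filterS uv => x uv Dx; rewrite uv.
Qed.

Lemma ip_eq0_ae u : sq_integrable u -> ip u u = 0 ->
  {ae mu, forall x, D x -> u x = 0}.
Proof.
move=> su u0; have := Rintegral_eq0_ae (sq_mul su su).
have p x : D x -> 0 <= u x * u x by rewrite -expr2 sqr_ge0.
move=> /(_ p u0); apply: filterS => x h /h /eqP.
by rewrite -expr2 sqrf_eq0 => /eqP.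
Qed.

Lemma ip_normr u : ip (fun x => `|u x|) (fun x => `|u x|) = ip u u.
Proof.
by apply: eq_Rintegral => x _; rewrite -!expr2 real_normK ?num_real.
Qed.

Lemma ip_bounded u (C : R) : measurable_fun D u -> (forall x, D x -> `|u x| <= C) ->
  ip u u <= C ^+ 2 * fine (mu D).
Proof.
move=> mu_ uC; rewrite -Rintegral_cst//; apply: le_Rintegral => //.
- by apply: sq_mul; exact: sq_bounded uC.
- by apply: (@rint_bounded _ `|C ^+ 2|) => //; exact: measurable_cst.
- move=> x Dx; rewrite -expr2 -[leLHS]ger0_norm ?sqr_ge0// normrX.
  by apply: lerXn2r; rewrite ?nnegrE ?uC//; exact: le_trans (uC _ Dx).
Qed.

Lemma ip_dominated (f : nat -> T -> R) g (C : R) :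
  (forall n, measurable_fun D (f n)) -> measurable_fun D g ->
  {ae mu, forall x, D x -> f n x @[n --> \oo] --> g x} ->
  (forall n x, D x -> `|f n x| <= C) -> (forall x, D x -> `|g x| <= C) ->
  ip (f n - g) (f n - g) @[n --> \oo] --> (0 : R).
Proof.
move=> mf mg fg fC gC.
have <- : \int[mu]_(x in D) (fun=> 0 : R) x = 0.
  by rewrite Rintegral_cst// mul0r.
apply: (@Rintegral_dominated _ _ (fun=> (C + C) ^+ 2)).
- move=> n; apply: measurable_funM; exact: measurable_funB.
- exact: measurable_cst.
- apply: filterS fg => x fg Dx; rewrite -(mul0r 0) -(subrr (g x)).
  by apply: cvgM; (apply: cvgB; [exact: fg|exact: cvg_cst]).
- by apply: (@rint_bounded _ `|(C + C) ^+ 2|) => //; exact: measurable_cst.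
- move=> n x Dx; rewrite -expr2 normrX; apply: lerXn2r; rewrite ?nnegrE//.
    by rewrite addr_ge0// (le_trans _ (gC _ Dx)).
  by rewrite (le_trans (ler_normB _ _))// lerD// ?fC ?gC.
Qed.

Lemma limn_einf_le (f : nat -> \bar R) (c : \bar R) K :
  (forall k, (K <= k)%N -> (f k <= c)%E) -> (limn_einf f <= c)%E.
Proof.
move=> fc; rewrite limn_einf_lim; apply: lime_le; first exact: is_cvg_einfs.
apply: nearW => n; apply: le_trans (fc (maxn n K) (leq_maxr _ _)).
by apply: ereal_inf_lbound; exists (maxn n K) => //=; exact: leq_maxl.
Qed.

Lemma geometric_half_le n : \sum_(0 <= k < n) (2^-1 : R) ^+ k <= 2.
Proof.
suff -> : \sum_(0 <= k < n) (2^-1 : R) ^+ k = 2 - 2 * 2^-1 ^+ n.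
  by rewrite gerBl mulr_ge0// exprn_ge0// invr_ge0.
elim: n => [|n IH]; first by rewrite big_geq// expr0 mulr1 subrr.
by rewrite big_nat_recr//= IH exprS; field.
Qed.

(* Riesz-Fischer: a subsequence with summable increments converges almost
   everywhere, and Fatou's lemma gives the convergence in mean. *)
Lemma sq_complete : complete_on sq_integrable ip.
Proof.
move=> u su Cu; have H := ip_semi_inner; have HV := si_set H.
have s1 : sq_integrable (cst 1).
  by apply: (@sq_bounded _ 1) => [|x _]; rewrite ?normr1//; exact: measurable_cst.
pose r : R := 2^-1; have r0 k : 0 < r ^+ k by rewrite exprn_gt0// invr_gt0.
have /choice[N HN] : forall k, exists N, forall n m, (N <= n)%N -> (N <= m)%N ->
    ip (u n - u m) (u n - u m) < (r ^+ k) ^+ 2.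
  by move=> k; apply: Cu; rewrite exprn_gt0.
(* Taking maxima makes [g k] admissible for every tolerance up to the k-th at once. *)
pose g k := (\max_(j < k.+1) N j)%N.
have gN k j : (j <= k)%N -> (N j <= g k)%N.
  by move=> jk; exact: (@leq_bigmax _ (fun j : 'I_k.+1 => N j) (Ordinal (jk : (j < k.+1)%N))).
pose v k := u (g k); pose w k := v k.+1 - v k.
have sv k : sq_integrable (v k) by exact: su.
have sw k : sq_integrable (w k) by exact: lsB HV _ _ (sv _) (sv _).
have swn k : sq_integrable (fun x => `|w k x|).
  split; first by apply: measurableT_comp => //; case: (sw k).
  by under [fun x => _]eq_fun do rewrite real_normK ?num_real//; exact: (sw k).2.
pose c := seminorm ip (cst 1).
have wk k : \int[mu]_(x in D) `|w k x| <= c * r ^+ k.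
  have := si_CS_norm H (swn k) s1.
  rewrite {1}/ip; under eq_Rintegral do rewrite mulr1.
  move/(le_trans (ler_norm _)) => h; apply: le_trans h _.
  rewrite mulrC ler_wpM2l ?seminorm_ge0// /seminorm ip_normr.
  rewrite -[leRHS](ger0_norm (ltW (r0 k))) -sqrtr_sqr ler_wsqrtr// ltW// HN// gN//.
pose S x := (\sum_(0 <= k <oo) `|w k x|%:E)%E.
have mw k : measurable_fun D (fun x => (`|w k x|%:E)%E).
  by apply/measurable_EFinP; exact: sq_measurable (swn k).
have mS : measurable_fun D S by apply: ge0_emeasurable_sum => // k x Dx _; rewrite lee_fin.
have iS : mu.-integrable D S.
  apply/integrableP; split => //.
  rewrite (@eq_integral _ _ _ _ _ S); last first.
    by move=> x _; rewrite gee0_abs// nneseries_ge0// => k _ _; rewrite lee_fin.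
  rewrite integral_nneseries//.
  apply: (@le_lt_trans _ _ (c * 2)%:E); last exact: ltry.
  apply: lime_le.
    by apply: is_cvg_nneseries => k _ _; apply: integral_ge0 => x _; rewrite lee_fin.
  apply: nearW => n.
  have fw k : (\int[mu]_(x in D) `|w k x|%:E)%E = (\int[mu]_(x in D) `|w k x|)%:E.
    by rewrite fineK//; apply: integrable_fin_num => //; exact: sq_rint (swn k).
  under eq_bigr do rewrite fw.
  rewrite sumEFin lee_fin.
  apply: (@le_trans _ _ (\sum_(0 <= k < n) c * r ^+ k)).
    by apply: ler_sum => k _; exact: wk.
  by rewrite -mulr_sumr ler_wpM2l ?geometric_half_le// seminorm_ge0.
(* The sum of the increments is integrable, hence finite off a null set. Setting the sequence to 0
   outside [E] makes it converge everywhere, which gives a measurable limit. *)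
pose E := D `&` [set x | (S x < +oo)%E].
have mE : measurable E by exact: emeasurable_fun_infty_o.
have aeE : {ae mu, forall x, D x -> E x}.
  apply: filterS (integrable_ae mD iS) => x h Dx; split => //=.
  by move: (h Dx); rewrite fin_numE => /andP[_]; rewrite -ltey.
pose z k := (v k \* \1_E : T -> R).
have mz k : measurable_fun D (z k).
  by apply: measurable_funM; [exact: sq_measurable|exact: measurable_indic].
have cz x : cvgn (z ^~ x).
  have [Ex|nEx] := pselect (E x); last first.
    have -> : z ^~ x = cst 0 by apply/funext => k; rewrite /z /= indicE memNset// mulr0.
    exact: is_cvg_cst.
  have -> : z ^~ x = v ^~ x by apply/funext => k; rewrite /z /= indicE mem_set// mulr1.
  have Sx : S x \is a fin_num.
    rewrite ge0_fin_numE; first exact: Ex.2.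
    by apply: nneseries_ge0 => k _ _; rewrite lee_fin.
  have cs : cvgn (series (fun k => `|w k x|)).
    apply: nondecreasing_is_cvgn; first exact: nondecreasing_series.
    exists (fine (S x)) => _ [n _ <-]; rewrite -lee_fin fineK//.
    apply: le_trans (nneseries_lim_ge n _); last by move=> k _ _; rewrite lee_fin.
    by rewrite /series /= sumEFin.
  have cs' : cvgn (series (w ^~ x)) by exact: normed_cvg.
  have -> : v ^~ x = (fun n => series (w ^~ x) n + v 0%N x).
    apply/funext => n; rewrite /series /=.
    by rewrite (telescope_sumr (fun k => v k x))// subrK.
  by apply: is_cvgD => //; exact: is_cvg_cst.
pose l x := limn (z ^~ x).
have zl x : z n x @[n --> \oo] --> l x by exact: cz.
have ml : measurable_fun D l by apply: measurable_fun_cvg => // x _; exact: zl.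
have zv k : {ae mu, forall x, D x -> z k x = v k x}.
  by apply: filterS aeE => x h /h Ex; rewrite /z /= indicE mem_set// mulr1.
have sz k : sq_integrable (z k).
  by apply: (sq_ae (sv k)) => //; apply: filterS (zv k) => x h /h.
(* Fatou's lemma in the second index, with [n] kept fixed, turns the Cauchy estimate into an
   estimate of the distance to the limit. *)
have fat n k : (forall m, (N k <= m)%N -> ip (u n - u m) (u n - u m) <= (r ^+ k) ^+ 2) ->
    rint (fun x => (u n x - l x) ^+ 2) /\ ip (u n - l) (u n - l) <= (r ^+ k) ^+ 2.
  move=> hk.
  have mul_ : measurable_fun D (fun x => (u n x - l x) ^+ 2).
    by apply: measurable_funX; apply: measurable_funB => //; exact: sq_measurable.
  have fe : (\int[mu]_(x in D) ((u n x - l x) ^+ 2)%:E <= ((r ^+ k) ^+ 2)%:E)%E.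
    have := @fatou _ _ _ mu D mD (fun m x => ((u n x - z m x) ^+ 2)%:E).
    have h1 m : measurable_fun D (fun x => ((u n x - z m x) ^+ 2)%:E).
      apply/measurable_EFinP; apply: measurable_funX; apply: measurable_funB => //.
      exact: sq_measurable.
    have h2 m x : D x -> (0 <= ((u n x - z m x) ^+ 2)%:E)%E by rewrite lee_fin sqr_ge0.
    move=> /(_ h1 h2); rewrite (@eq_integral _ _ _ _ _ (fun x => ((u n x - l x) ^+ 2)%:E)); last first.
      move=> x _; rewrite is_cvg_limn_einfE; last first.
        by apply: cvgP; apply: cvg_EFin; [exact: nearW|apply: cvgM; (apply: cvgB; [exact: cvg_cst|exact: zl])].
      apply: cvg_lim => //; apply: cvg_EFin; first exact: nearW.
      by rewrite expr2; apply: cvgM; (apply: cvgB; [exact: cvg_cst|exact: zl]).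
    move/le_trans; apply; apply: (@limn_einf_le _ _ k) => m km.
    have sd : sq_integrable (u n - z m) by exact: lsB HV _ _ (su n) (sz m).
    rewrite -[X in (X <= _)%E]fineK; last first.
      by apply: integrable_fin_num => //; exact: sd.2.
    rewrite lee_fin; apply: le_trans (hk (g m) (gN _ _ km)).
    have sd' : sq_integrable (u n - v m) by exact: lsB HV _ _ (su n) (sv m).
    rewrite le_eqVlt; apply/orP; left; apply/eqP; apply: Rintegral_ae.
    - exact: rint_measurable sd.2.
    - exact: rint_measurable (sq_mul sd' sd').
    - by apply: filterS (zv m) => x h Dx; rewrite expr2 (h Dx).
  have ir : rint (fun x => (u n x - l x) ^+ 2).
    apply/integrableP; split; first exact/measurable_EFinP.
    rewrite (@eq_integral _ _ _ _ _ (fun x => ((u n x - l x) ^+ 2)%:E)).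
      by apply: le_lt_trans fe _; exact: ltry.
    by move=> x _; rewrite gee0_abs// lee_fin sqr_ge0.
  split=> //; have -> : ip (u n - l) (u n - l) = \int[mu]_(x in D) ((u n x - l x) ^+ 2).
    by apply: eq_Rintegral => x _; rewrite expr2.
  by rewrite -lee_fin fineK//; exact: integrable_fin_num.
have sl : sq_integrable l.
  have := fat (N 0%N) 0%N; case=> [m Nm|ir _].
    by apply/ltW/HN.
  have sd : sq_integrable (u (N 0%N) - l).
    by split=> //; apply: measurable_funB => //; exact: sq_measurable.
  by rewrite -[l](subKr (u (N 0%N))); exact: lsB HV _ _ (su _) sd.
exists l => //; apply: near_cvg => e e0.
have rc : r ^+ n @[n --> \oo] --> 0.
  by apply: cvg_expr; rewrite gtr0_norm /r ?invr_gt0// invf_lt1// ltr1n.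
(* Below both 1 and [e], the power [r ^+ k] has a square below [e]. *)
have [|k _ Hk] := cvg_near rc (e := Num.min 1 e); first by rewrite lt_min ltr01.
exists (N k) => // n Nn; rewrite /= subr0 ger0_norm; last by apply: (si_ge0 H); exact: lsB HV _ _ (su n) sl.
have [//|_ h] := fat n k; first by move=> m Nm; apply/ltW/HN.
apply: le_trans h _; have := Hk k (leqnn _); rewrite /= subr0 gtr0_norm// lt_min => /andP[h1 h2].
by rewrite expr2 (le_trans _ (ltW h2))// ger_pMl// ltW.
Qed.
End Integration.

(** * Directional derivatives *)

Section Derivatives.
Context {R : realType}.

Lemma is_derive_cvg (V : normedModType R) (f : V -> R) (a v : V) (l : R) :
  (h^-1 * (f (h *: v + a) - f a)) @[h --> (0 : R)^'] --> l <->
  is_derive a v f l.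
Proof.
split=> [fl|[df <-]].
  by split; [apply: cvgP fl|exact: cvg_lim fl].
exact: df.
Qed.

Lemma is_derive_line (V : normedModType R) (f : V -> R) (a v : V) (l : R) :
  is_derive a v f l <-> is_derive (0 : R) 1 (fun t => f (t *: v + a)) l.
Proof.
rewrite -!is_derive_cvg.
rewrite scale0r add0r.
by under [in X in _ <-> X]eq_fun do rewrite addr0 [_%:A]mulr1.
Qed.

Lemma is_derive_ext (V : normedModType R) (f g : V -> R) (a v : V) (k l : R) :
  is_derive a v f k -> (forall x, f x = g x) -> k = l -> is_derive a v g l.
Proof. by move=> fk fg <-; have <- : f = g by exact/funext. Qed.

Lemma is_derive_unique (V : normedModType R) (f : V -> R) (a v : V) (k l : R) :
  is_derive a v f k -> is_derive a v f l -> k = l.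
Proof. by move=> [_ <-] [_ <-]. Qed.

(** Restriction to the line through [a] in direction [v] reduces this to the one-variable chain
    rule, so that differentiability of [u] in the other directions is never at stake. *)
Lemma is_derive_comp (V : normedModType R) (f : R -> R) (u : V -> R) (a v : V)
    (k l : R) :
  is_derive (u a) 1 f k -> is_derive a v u l ->
  is_derive a v (fun x => f (u x)) (k * l).
Proof.
move=> fk /is_derive_line ul; apply/is_derive_line.
apply: (@is_derive1_comp _ f (fun t => u (t *: v + a)) 0 k l) => //.
by rewrite scale0r add0r.
Qed.

Lemma is_derive_quad0 (f : R -> R) (C : R) :
  (forall h : R, h <= 1 -> `|f h| <= C * h ^+ 2) -> is_derive (0 : R) 1 f 0.
Proof.
move=> fC; apply/is_derive_cvg.
have f0 : f 0 = 0 by apply/normr0_eq0/le_anti; rewrite normr_ge0 (le_trans (fC _ _))// expr0n mulr0.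
apply: near_cvg => e e0; rewrite f0.
have C0 : 0 < C + 1 by have := fC 1 (lexx _); rewrite expr1n mulr1; have := normr_ge0 (f 1); lra.
near=> h; rewrite subr0 subr0 addr0 [h *: 1]mulr1 normrM normfV.
have h0 : h != 0 by near: h; exact: nbhs_dnbhs_neq.
rewrite ler_pdivrMl ?normr_gt0//.
have h1 : `|h| < Num.min 1 (e / (C + 1)).
  near: h; apply: dnbhs0_lt; rewrite lt_min ltr01 divr_gt0//.
move: h1; rewrite lt_min => /andP[h1 h2].
apply: le_trans (fC _ (le_trans (ler_norm _) (ltW h1))) _.
rewrite -real_normK ?num_real// expr2 mulrA mulrC ler_wpM2l//.
have : `|h| * (C + 1) <= e by rewrite -ler_pdivlMr// ltW.
by rewrite mulrDr mulr1 [C * _]mulrC; have := normr_ge0 h; move: (`|h| * C) => *; lra.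
Unshelve. all: by end_near. Qed.

Lemma is_derive1_continuous (f : R -> R) (x l : R) : is_derive x 1 f l ->
  {for x, continuous f}.
Proof. by move=> [df _]; apply: differentiable_continuous; apply/derivable1_diffP. Qed.
End Derivatives.

(** * Smooth transition functions built from exp(-1/x) *)

Section FlatFunctions.
Context {R : realType}.
Implicit Types (P : {poly R}) (x t d : R).

(** Admitting a polynomial factor in 1/x makes the family closed under differentiation, which is
    what smoothness of all orders needs. *)
Definition flat P x : R := if 0 < x then P.[x^-1] * expR (- x^-1) else 0.

Lemma flat_le0 P x : x <= 0 -> flat P x = 0.
Proof. by move=> x0; rewrite /flat ltNge x0. Qed.

Lemma poly_bound P : exists C : R, 0 <= C /\
  forall y, 1 <= y -> `|P.[y]| <= C * y ^+ size P.
Proof.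
exists (\sum_(i < size P) `|P`_i|); split; first exact: sumr_ge0.
move=> y y1; rewrite horner_coef (le_trans (ler_norm_sum _ _ _))// mulr_suml.
apply: ler_sum => i _; rewrite normrM ler_wpM2l// normrX ger0_norm; last lra.
by apply: ler_weXn2l => //; exact: ltnW.
Qed.

(** With N = n + 1, exp(y) is the N-th power of exp(y/N), which exceeds y/N. *)
Lemma expRN_le n (y : R) : 0 < y -> expR (- y : R) <= n.+1%:R ^+ n.+1 / y ^+ n.+1.
Proof.
move=> y0; have n0 : 0 < n.+1%:R :> R by [].
have h : (y / n.+1%:R) ^+ n.+1 <= expR y.
  have -> : expR y = expR (y / n.+1%:R) ^+ n.+1.
    by rewrite -expRM_natl; congr expR; rewrite mulrC divfK// gt_eqF.
  apply: lerXn2r; rewrite ?nnegrE ?expR_ge0 ?divr_ge0 ?ltW//.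
  by apply: le_lt_trans (expR_gt1Dx _); rewrite ?lerDr// gt_eqF ?divr_gt0.
rewrite expRN -[leRHS]invrK lef_pV2 ?posrE ?expR_gt0//; last first.
  by rewrite invr_gt0 divr_gt0// exprn_gt0.
by rewrite invf_div -expr_div_n.
Qed.

Lemma flat_bound P : exists C : R, forall x, x <= 1 -> `|flat P x| <= C * x ^+ 2.
Proof.
(* The exponent [n.+1] is two more than [size P]: the powers of x left over after the polynomial is
   absorbed form the required square. *)
have [C [C0 HC]] := poly_bound P; pose n := (size P).+1.
exists (C * n.+1%:R ^+ n.+1) => x x1; rewrite /flat; case: ifPn => [x0|_]; last first.
  by rewrite normr0 mulr_ge0 ?sqr_ge0// mulr_ge0// exprn_ge0.
have y1 : 1 <= x^-1 by rewrite invf_ge1.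
have y0 : 0 < x^-1 by rewrite invr_gt0.
rewrite normrM [`|expR _|]ger0_norm ?expR_ge0//.
apply: le_trans (ler_pM _ _ (HC _ y1) (expRN_le n y0)) _ => //; rewrite ?expR_ge0//.
rewrite /n exprS [x^-1 ^+ _.+1]exprS [x^-1 ^+ (size P).+1]exprS !exprVn.
rewrite le_eqVlt; apply/orP; left; apply/eqP.
have : x ^+ size P != 0 by rewrite expf_neq0// gt_eqF.
have : x != 0 by rewrite gt_eqF.
move: (x ^+ size P) (_ ^+ _) (_%:R) => a b c xn an; field.
by rewrite xn an.
Qed.

(** Differentiating P(1/x) exp(-1/x) gives the factor 1/x^2 from both inner derivatives, times P -
    P' at 1/x. *)
Definition dflat P := 'X^2 * (P - P^`()).

Lemma is_derive_flat P x : is_derive x 1 (flat P) (flat (dflat P) x).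
Proof.
have [x0|x0|->] := ltgtP x 0.
- rewrite [X in is_derive _ _ _ X]flat_le0 ?ltW//.
  refine (near_eq_is_derive (f := cst 0) _ (is_derive_cst _ _ _)).
  by near=> t; rewrite flat_le0// ltW//; near: t; exact: lt_nbhsl.
- refine (near_eq_is_derive (f := fun y : R => P.[y^-1] * expR (- y^-1)) _ _).
    by near=> t; rewrite /flat ifT//; near: t; exact: lt_nbhsr.
  have xn : x != 0 by rewrite gt_eqF.
  have dV : is_derive x 1 (fun y : R => y^-1) (- x ^- 2).
    apply: (is_derive_ext (@is_deriveV R id x 1 1 xn (is_derive_id _ _))) => //.
    by rewrite [_ *: 1]mulr1.
  have dP := is_derive_comp (is_derive_poly P x^-1) dV.
  have dE := is_derive_comp (u := fun y : R => - y^-1) (is_derive_expR (- x^-1))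
    (is_deriveN dV).
  apply: (is_derive_ext (is_deriveM dP dE)) => //.
  rewrite /flat x0 /dflat !hornerE !scalerAl /= -!mulrA.
  move: (expR _) (P.[_]) (P^`().[_]) => a b c; by field.
rewrite flat_le0//; have [C HC] := flat_bound P; exact: is_derive_quad0 HC.
Unshelve. all: by end_near. Qed.

Lemma flat_continuous P : continuous (flat P).
Proof. by move=> x; exact: is_derive1_continuous (is_derive_flat P x). Qed.

Let E := flat 1.

Lemma flat1E x : 0 < x -> E x = expR (- x^-1).
Proof. by move=> x0; rewrite /E /flat x0 hornerC mul1r. Qed.

Lemma flat1_gt0 x : 0 < x -> 0 < E x.
Proof. by move=> x0; rewrite flat1E// expR_gt0. Qed.

Lemma flat1_ge0 x : 0 <= E x.
Proof. by have [x0|x0] := lerP x 0; [rewrite /E flat_le0|exact: ltW (flat1_gt0 x0)]. Qed.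

Lemma flat1_homo : {homo E : x y / x <= y}.
Proof.
move=> x y xy; have [x0|x0] := lerP x 0; first by rewrite {1}/E flat_le0// flat1_ge0.
rewrite !flat1E//; last exact: lt_le_trans xy.
by rewrite ler_expR lerN2 lef_pV2// posrE//; exact: lt_le_trans xy.
Qed.

(* A smooth transition with no quotient of functions: E (1 - .) vanishes on
   [1, +oo[ and exceeds E 1 on ]-oo, 0], so E (E 1 - E (1 - .)) is E (E 1)
   on the former and 0 on the latter. *)
Definition transition t := E (E 1 - E (1 - t)) / E (E 1).
Definition dtransition t :=
  flat (dflat 1) (E 1 - E (1 - t)) * flat (dflat 1) (1 - t) / E (E 1).

Let E1 : 0 < E 1. Proof. exact: flat1_gt0. Qed.
Let EE1 : 0 < E (E 1). Proof. exact: flat1_gt0. Qed.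

Lemma transition_le0 t : t <= 0 -> transition t = 0.
Proof.
move=> t0; rewrite /transition {1}/E flat_le0 ?mul0r// subr_le0.
by apply: flat1_homo; lra.
Qed.
Lemma transition_ge1 t : 1 <= t -> transition t = 1.
Proof.
move=> t0; rewrite /transition [E (1 - t)]flat_le0; last by lra.
by rewrite subr0 divff// gt_eqF.
Qed.
Lemma transition_itv t : 0 <= transition t <= 1.
Proof.
apply/andP; split; first by apply: divr_ge0; exact: flat1_ge0.
rewrite /transition ler_pdivrMr// mul1r.
by apply: flat1_homo; rewrite gerBl flat1_ge0.
Qed.
Lemma is_derive_transition t : is_derive t 1 transition (dtransition t).
Proof.
have d1 : is_derive t 1 (fun x => E (1 - x)) (- flat (dflat 1) (1 - t)).
  apply: (is_derive_ext (is_derive_comp (u := fun x : R => 1 - x)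
    (is_derive_flat 1 (1 - t)) (is_deriveB (is_derive_cst (1 : R) t 1) (is_derive_id t 1)))) => //.
  by rewrite sub0r mulrN1.
apply: (is_derive_ext (is_deriveZ (E (E 1))^-1 (is_derive_comp
  (u := fun x : R => E 1 - E (1 - x)) (is_derive_flat 1 (E 1 - E (1 - t)))
  (is_deriveB (is_derive_cst (E 1) t 1) d1)))).
  by move=> x; rewrite /transition mulrC.
by rewrite sub0r opprK [_ *: _]mulrC.
Qed.
Lemma dtransition_out t : t <= 0 \/ 1 <= t -> dtransition t = 0.
Proof.
case=> t0; rewrite /dtransition.
  by rewrite flat_le0 ?mul0r// subr_le0; apply: flat1_homo; lra.
by rewrite [flat _ (1 - t)]flat_le0 ?mulr0 ?mul0r//; lra.
Qed.
Lemma dtransition_bounded : exists C : R, 0 <= C /\ forall t, `|dtransition t| <= C.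
Proof.
have c : {within `[0, 1], continuous (fun t => `|dtransition t|)}.
  apply: continuous_subspaceT => t; apply: cvg_norm; rewrite /dtransition.
  have c1 : {for t, continuous (fun t => 1 - t)}.
    by apply: cvgB; [exact: cvg_cst|exact: cvg_id].
  apply: cvgMl; apply: cvgM.
    apply: (continuous_comp (f := fun t => E 1 - E (1 - t))); last exact: flat_continuous.
    apply: cvgB; first exact: cvg_cst.
    by apply: (continuous_comp (f := fun t => 1 - t)) => //; exact: flat_continuous.
  by apply: (continuous_comp (f := fun t => 1 - t)) => //; exact: flat_continuous.
have [x _ Hx] := EVT_max ler01 c.
exists (`|dtransition x|); split=> // t.
have [t0|t0] := lerP t 0; first by rewrite dtransition_out ?normr0//; left.
have [t1|t1] := lerP 1 t; first by rewrite dtransition_out ?normr0//; right.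
by apply: Hx; rewrite in_itv /= !ltW.
Qed.
End FlatFunctions.

Section DerivativeRules.
Context {R : realType}.

Lemma is_derive_mul (V : normedModType R) (f g : V -> R) (a v : V) (k l : R) :
  is_derive a v f k -> is_derive a v g l ->
  is_derive a v (fun x => f x * g x) (k * g a + f a * l).
Proof.
move=> fk gl; apply: (is_derive_ext (is_deriveM fk gl)) => //.
by rewrite -[LHS]/(f a * l + g a * k); ring.
Qed.
Lemma is_derive_add (V : normedModType R) (f g : V -> R) (a v : V) (k l : R) :
  is_derive a v f k -> is_derive a v g l ->
  is_derive a v (fun x => f x + g x) (k + l).
Proof. by move=> fk gl; apply: (is_derive_ext (is_deriveD fk gl)). Qed.
Lemma is_derive_scale (V : normedModType R) (f : V -> R) (c : R) (a v : V) (k : R) :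
  is_derive a v f k -> is_derive a v (fun x => c * f x) (c * k).
Proof. by move=> fk; apply: (is_derive_ext (is_deriveZ c fk)). Qed.

Lemma is_derive_sub (V : normedModType R) (f g : V -> R) (a v : V) (k l : R) :
  is_derive a v f k -> is_derive a v g l ->
  is_derive a v (fun x => f x - g x) (k - l).
Proof. by move=> fk gl; apply: (is_derive_ext (is_deriveB fk gl)). Qed.
End DerivativeRules.

(** * The plateau function [step] and the bent ramp *)

Section Ramp.
Context {R : realType}.
Implicit Types (t d : R).

(** The dead zone reaching up to 1/2 instead of 0 is what later yields compact supports: [step] of a
    multiple of the distance to a side, or of the level-set function, vanishes on a whole
    neighbourhood of the zero set of its argument. *)
Definition step t := transition (2 * t - 1).
Definition dstep t := 2 * dtransition (2 * t - 1).

Lemma step0 t : t <= 2^-1 -> step t = 0.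
Proof. by move=> h; rewrite /step transition_le0//; lra. Qed.
Lemma step1 t : 1 <= t -> step t = 1.
Proof. by move=> h; rewrite /step transition_ge1//; lra. Qed.
Lemma step_itv t : 0 <= step t <= 1.
Proof. exact: transition_itv. Qed.
Lemma dstep_out t : t <= 2^-1 \/ 1 <= t -> dstep t = 0.
Proof. by move=> h; rewrite /dstep dtransition_out ?mulr0//; lra. Qed.

Lemma is_derive_affine (c e t : R) : is_derive t 1 (fun x => c * x + e) c.
Proof.
apply: (is_derive_ext (is_deriveD (is_deriveZ c (is_derive_id t (1 : R)))
  (is_derive_cst e t 1))) => //.
by rewrite [_ *: _]mulr1 addr0.
Qed.

Lemma is_derive_step t : is_derive t 1 step (dstep t).
Proof.
apply: (is_derive_ext (is_derive_comp (u := fun x : R => 2 * x - 1)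
  (is_derive_transition (2 * t - 1)) (is_derive_affine 2 (- 1) t))) => //.
by rewrite mulrC.
Qed.

(* The identity, bent to be constant near 0 and near 1. *)
Definition ramp d t := t * step (d^-1 * t) + (1 - t) * (1 - step (d^-1 * (1 - t))).
Definition dramp d t := step (d^-1 * t) + d^-1 * t * dstep (d^-1 * t)
  - (1 - step (d^-1 * (1 - t))) + d^-1 * (1 - t) * dstep (d^-1 * (1 - t)).

Lemma is_derive_ramp d t : is_derive t 1 (ramp d) (dramp d t).
Proof.
have l1 : is_derive t 1 (fun x : R => d^-1 * x) (d^-1 * 1).
  by apply: is_derive_scale.
have l2 : is_derive t 1 (fun x : R => 1 - x) (0 - 1).
  by apply: is_derive_sub.
have l3 : is_derive t 1 (fun x : R => d^-1 * (1 - x)) (d^-1 * (0 - 1)).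
  exact: is_derive_scale.
have a1 := is_derive_comp (u := fun x : R => d^-1 * x) (is_derive_step _) l1.
have a2 := is_derive_comp (u := fun x : R => d^-1 * (1 - x)) (is_derive_step _) l3.
have a3 := is_derive_mul (f := fun x : R => x) (is_derive_id t (1 : R)) a1.
have a4 := is_derive_mul l2 (is_derive_sub (f := fun=> 1) (is_derive_cst (1 : R) t 1) a2).
apply: (is_derive_ext (is_derive_add a3 a4)) => [//|].
by rewrite /dramp; move: (step _) (step _) (dstep _) (dstep _) => *; ring.
Qed.

Section Small.
Variable d : R.
Hypotheses (d0 : 0 < d) (d4 : d <= 4^-1).

Let ge1 t : d <= t -> 1 <= d^-1 * t.
Proof. by move=> h; rewrite mulrC ler_pdivlMr// mul1r. Qed.
Let le2 t : t <= d / 2 -> d^-1 * t <= 2^-1.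
Proof. by move=> h; rewrite mulrC ler_pdivrMr// mulrC. Qed.

Lemma ramp0 t : t <= d / 2 -> ramp d t = 0.
Proof.
move=> h; rewrite /ramp step0 ?le2// step1 ?ge1//; first by ring.
by move: d0 d4 h; lra.
Qed.
Lemma ramp1 t : 1 - d / 2 <= t -> ramp d t = 1.
Proof.
move=> h; rewrite /ramp step1 ?ge1//; last by move: d0 d4 h; lra.
by rewrite step0 ?le2//; [ring|move: h; lra].
Qed.
Lemma ramp_id t : d <= t <= 1 - d -> ramp d t = t.
Proof.
move=> /andP[h1 h2]; rewrite /ramp !step1 ?ge1//; first by ring.
by move: h2; lra.
Qed.
Lemma dramp_out t : t <= d / 2 \/ 1 - d / 2 <= t -> dramp d t = 0.
Proof.
move=> [h|h]; rewrite /dramp.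
  have g : 1 <= d^-1 * (1 - t) by rewrite ge1//; move: d0 d4 h; lra.
  by rewrite step0 ?le2// step1// !dstep_out; [ring|right|left; exact: le2].
have g : 1 <= d^-1 * t by rewrite ge1//; move: d0 d4 h; lra.
have g' : d^-1 * (1 - t) <= 2^-1 by rewrite le2//; move: h; lra.
by rewrite (step1 g) (step0 g') !dstep_out; [ring|left|right].
Qed.
Lemma dramp_id t : d <= t <= 1 - d -> dramp d t = 1.
Proof.
move=> /andP[h1 h2]; have g : d <= 1 - t by move: h2; lra.
rewrite /dramp !step1 ?ge1// !dstep_out; [ring|right; exact: ge1..].
Qed.
Lemma ramp_itv t : 0 <= t <= 1 -> 0 <= ramp d t <= 1.
Proof.
move=> /andP[t0 t1]; have [t2|t2] := lerP t 2^-1.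
  rewrite /ramp [step (d^-1 * (1 - t))]step1 ?ge1//; last by move: t2 d4; lra.
  rewrite subrr mulr0 addr0; have /andP[s0 s1] := step_itv (d^-1 * t).
  by rewrite mulr_ge0//= mulr_ile1.
rewrite /ramp step1 ?ge1//; last by move: t2 d4; lra.
have := step_itv (d^-1 * (1 - t)); move: (step _) => s /andP[s0 s1].
by apply/andP; split; nra.
Qed.
End Small.

(** Uniformity in [d] is the point: the slope of [step (d^-1 * t)] is of order 1/d, but it comes
    with a factor [t] and is nonzero only for [t] below [d], so that only products [u * dstep u]
    occur. *)
Lemma dramp_bounded : exists C : R, 0 <= C /\
  forall d t, 0 < d -> d <= 4^-1 -> `|dramp d t| <= C.
Proof.
have [K [K0 HK]] := @dtransition_bounded R.
have b u : `|u * dstep u| <= 2 * K.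
  have [u1|u1] := lerP 1 u; first by rewrite dstep_out ?mulr0 ?normr0 ?mulr_ge0//; right.
  have [u0|u0] := lerP u 2^-1; first by rewrite dstep_out ?mulr0 ?normr0 ?mulr_ge0//; left.
  rewrite normrM -[leRHS]mul1r ler_pM//; first by rewrite ger0_norm; lra.
  by rewrite /dstep normrM ger0_norm// ler_wpM2l.
exists (2 + 4 * K); split; first by rewrite addr_ge0// mulr_ge0.
move=> d t d0 d4; rewrite /dramp.
have := b (d^-1 * t); have := b (d^-1 * (1 - t)).
have := step_itv (d^-1 * t); have := step_itv (d^-1 * (1 - t)).
move: (step _) (step _) (_ * dstep _) (_ * dstep _) => a e x y.
move=> /andP[? ?] /andP[? ?] /ler_normlP[? ?] /ler_normlP[? ?].
by apply/ler_normlP; split; lra.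
Qed.
End Ramp.

(** * Algebra and composition rules for [Ck] *)

Section CkCalculus.
Context {R : realType}.
Implicit Types (D : set (R * R)) (u v : R * R -> R) (p e : R * R).

Lemma is_derive_fst1 p : is_derive p e1 (fst : R * R -> R) 1.
Proof.
apply/is_derive_line.
by apply: (is_derive_ext (is_derive_affine 1 p.1 0)) => // t /=; rewrite [_ *: _]mulr1 mul1r.
Qed.
Lemma is_derive_fst2 p : is_derive p e2 (fst : R * R -> R) 0.
Proof.
apply/is_derive_line.
by apply: (is_derive_ext (is_derive_affine 0 p.1 0)) => // t /=; rewrite [_ *: _]mulr0 mul0r.
Qed.
Lemma is_derive_snd1 p : is_derive p e1 (snd : R * R -> R) 0.
Proof.
apply/is_derive_line.
by apply: (is_derive_ext (is_derive_affine 0 p.2 0)) => // t /=; rewrite [_ *: _]mulr0 mul0r.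
Qed.
Lemma is_derive_snd2 p : is_derive p e2 (snd : R * R -> R) 1.
Proof.
apply/is_derive_line.
by apply: (is_derive_ext (is_derive_affine 1 p.2 0)) => // t /=; rewrite [_ *: _]mulr1 mul1r.
Qed.

Lemma Ck_continuous k D u : Ck k D u -> {within closure D, continuous u}.
Proof. by case: k => [|k] []. Qed.

Lemma Ck_le k D u : Ck k.+1 D u -> Ck k D u.
Proof.
elim: k u => [|k IH] u [cu [u1 [u2 [du h1 h2]]]]; split=> //.
by exists u1, u2; split=> //; exact: IH.
Qed.

Lemma Ck_cst k D (c : R) : Ck k D (fun=> c).
Proof.
elim: k c => [|k IH] c; split=> //; try exact: cst_continuous.
by exists (fun=> 0), (fun=> 0); split=> // p _; split; exact: is_derive_cst.
Qed.

Lemma Ck_fst k D : Ck k D fst.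
Proof.
have c : {within closure D, continuous (fst : R * R -> R)}.
  by apply: continuous_subspaceT => p; exact: cvg_fst.
case: k => [|k]; split=> //.
exists (fun=> 1), (fun=> 0); split; [|exact: Ck_cst..].
by move=> p _; split; [exact: is_derive_fst1|exact: is_derive_fst2].
Qed.

Lemma Ck_snd k D : Ck k D snd.
Proof.
have c : {within closure D, continuous (snd : R * R -> R)}.
  by apply: continuous_subspaceT => p; exact: cvg_snd.
case: k => [|k]; split=> //.
exists (fun=> 0), (fun=> 1); split; [|exact: Ck_cst..].
by move=> p _; split; [exact: is_derive_snd1|exact: is_derive_snd2].
Qed.

Lemma Ck_add k D u v : Ck k D u -> Ck k D v -> Ck k D (fun p => u p + v p).
Proof.
elim: k u v => [|k IH] u v [cu hu] [cv hv]; split=> //;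
  try by move=> p; apply: cvgD; [exact: cu|exact: cv].
have [u1 [u2 [du hu1 hu2]]] := hu; have [v1 [v2 [dv hv1 hv2]]] := hv.
exists (fun p => u1 p + v1 p), (fun p => u2 p + v2 p); split; [|exact: IH..].
by move=> p Dp; have [? ?] := du p Dp; have [? ?] := dv p Dp; split; exact: is_derive_add.
Qed.

Lemma Ck_mul k D u v : Ck k D u -> Ck k D v -> Ck k D (fun p => u p * v p).
Proof.
elim: k u v => [|k IH] u v hu hv.
  by split=> // p; apply: cvgM; [exact: hu.1|exact: hv.1].
have lu := Ck_le hu; have lv := Ck_le hv.
have [cu [u1 [u2 [du hu1 hu2]]]] := hu; have [cv [v1 [v2 [dv hv1 hv2]]]] := hv.
split; first by move=> p; apply: cvgM; [exact: cu|exact: cv].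
exists (fun p => u1 p * v p + u p * v1 p), (fun p => u2 p * v p + u p * v2 p).
split; [|by apply: Ck_add; apply: IH..].
by move=> p Dp; have [? ?] := du p Dp; have [? ?] := dv p Dp; split; exact: is_derive_mul.
Qed.

Lemma Ck_scale k D (c : R) u : Ck k D u -> Ck k D (fun p => c * u p).
Proof. by move=> hu; apply: Ck_mul hu; exact: Ck_cst. Qed.

Lemma Ck_opp k D u : Ck k D u -> Ck k D (fun p => - u p).
Proof.
move=> /(Ck_scale (- 1)); have -> // : (fun p => -1 * u p) = (fun p => - u p).
by apply/funext => p; rewrite mulN1r.
Qed.

Lemma Ck_sub k D u v : Ck k D u -> Ck k D v -> Ck k D (fun p => u p - v p).
Proof. by move=> hu /Ck_opp hv; exact: Ck_add. Qed.

Lemma Ck_sum k D (I : Type) (r : seq I) (F : I -> R * R -> R) :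
  (forall i, Ck k D (F i)) -> Ck k D (fun p => \sum_(i <- r) F i p).
Proof.
move=> h; elim: r => [|i r IH].
  by under eq_fun do rewrite big_nil; exact: Ck_cst.
by under eq_fun do rewrite big_cons; exact: Ck_add.
Qed.

(** The induction on [k] works because [P] is quantified inside it: the derivative is again of this
    form, with [dflat P]. *)
Lemma Ck_flat k D P u : Ck k D u -> Ck k D (fun p => flat P (u p)).
Proof.
have cf v : {within closure D, continuous v} ->
    forall P, {within closure D, continuous (fun p => flat P (v p))}.
  move=> cv Q p; apply: (continuous_comp (f := v : subspace (closure D) -> R)).
    exact: cv.
  exact: flat_continuous.
elim: k u P => [|k IH] u P hu; first by split=> //; apply: cf; exact: hu.1.
have lu := Ck_le hu; have [cu [u1 [u2 [du h1 h2]]]] := hu.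
split; first exact: cf.
exists (fun p => flat (dflat P) (u p) * u1 p), (fun p => flat (dflat P) (u p) * u2 p).
split; [|by apply: Ck_mul => //; exact: IH..].
by move=> p /du[d1 d2]; split; apply: is_derive_comp => //; exact: is_derive_flat.
Qed.

Lemma Ck_step k D u : Ck k D u -> Ck k D (fun p => step (u p)).
Proof.
move=> hu; rewrite /step /transition.
have h : Ck k D (fun p => 1 - (2 * u p - 1)).
  by apply: Ck_sub; [exact: Ck_cst|apply: Ck_sub; [exact: Ck_scale|exact: Ck_cst]].
under eq_fun do rewrite mulrC; apply/Ck_scale/Ck_flat/Ck_sub; first exact: Ck_cst.
exact: Ck_flat.
Qed.

Lemma Ck_ramp k D (d : R) u : Ck k D u -> Ck k D (fun p => ramp d (u p)).
Proof.
move=> hu; rewrite /ramp; have h1 : Ck k D (fun p => 1 - u p).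
  by apply: Ck_sub => //; exact: Ck_cst.
apply: Ck_add; apply: Ck_mul => //; first by apply/Ck_step/Ck_scale.
by apply: Ck_sub; [exact: Ck_cst|apply/Ck_step/Ck_scale].
Qed.

End CkCalculus.

(** * Topology, measurability and extension by zero in the plane *)

Section PlaneTopology.
Context {R : realType}.
Implicit Types (D U K A : set (R * R)) (u v : R * R -> R) (p q e : R * R).

Local Notation MP := (measurableTypeR R * measurableTypeR R)%type.

Lemma nbhs_box p U : nbhs p U <-> exists2 e : R, 0 < e &
  forall q, `|q.1 - p.1| < e -> `|q.2 - p.2| < e -> U q.
Proof.
split=> [/nbhs_ballP[e e0 H]|[e e0 H]]; last apply/nbhs_ballP; exists e => // q.
  by move=> h1 h2; apply: H; split; rewrite /ball /= distrC.
by move=> [h1 h2]; apply: H; rewrite distrC.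
Qed.

Lemma open_box U p : open U -> U p -> exists2 e : R, 0 < e &
  forall q, `|q.1 - p.1| < e -> `|q.2 - p.2| < e -> U q.
Proof. by move=> oU Up; apply/nbhs_box; exact: open_nbhs_nbhs. Qed.

Lemma cvg_box (T : Type) (F : set_system T) (FF : Filter F) (f : T -> R * R) p :
  (forall e : R, 0 < e -> \forall x \near F, `|(f x).1 - p.1| < e /\ `|(f x).2 - p.2| < e) ->
  f x @[x --> F] --> p.
Proof.
move=> H U /nbhs_box[e e0 HU]; apply: filterS (H _ e0) => x [h1 h2].
exact: HU.
Qed.

(** The sigma-algebra is a product one, so openness has to be traced back to rectangles: the open
    set is the union of the countably many rational boxes inside it. *)
Lemma open_measurable_plane U : open U -> measurable (U : set MP).
Proof.
move=> oU.
pose rct (q : rat * rat * rat * rat) : set (R * R) :=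
  `]ratr q.1.1.1, ratr q.1.1.2[%classic `*` `]ratr q.1.2, ratr q.2[%classic.
have -> : U = \bigcup_q (if pselect (rct q `<=` U) then rct q else set0).
  apply/seteqP; split=> p.
    move=> /(open_box oU)[e e0 H].
    have /rat_in_itvoo[a] : p.1 - e < p.1 by rewrite ltrBlDr ltrDl.
    have /rat_in_itvoo[b] : p.1 < p.1 + e by rewrite ltrDl.
    have /rat_in_itvoo[c] : p.2 - e < p.2 by rewrite ltrBlDr ltrDl.
    have /rat_in_itvoo[d] : p.2 < p.2 + e by rewrite ltrDl.
    rewrite !in_itv /= => /andP[d1 d2] /andP[c1 c2] /andP[b1 b2] /andP[a1 a2].
    exists (a, b, c, d) => //; case: pselect => /= [_|n].
      by split; rewrite /= in_itv /= ?a2 ?b1 ?c2 ?d1.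
    exfalso; apply: n => q [/=]; rewrite !in_itv /= => /andP[q1 q2] /andP[q3 q4].
    by apply: H; apply/ltr_normlP; split; lra.
  by move=> [q _]; case: pselect => //= h /h.
apply: countable_bigcupT_measurable; first exact: countableP.
move=> q; case: pselect => //= _.
by apply: measurableX; exact: measurable_itv.
Qed.

Lemma closed_measurable_plane A : closed A -> measurable (A : set MP).
Proof.
by move=> /closed_openC/open_measurable_plane/measurableC; rewrite setCK.
Qed.

Lemma within_measurable A u : measurable (A : set MP) ->
  {within A, continuous u} -> measurable_fun (A : set MP) (u : MP -> R).
Proof.
move=> mA /continuousP cu; apply: (measurability _ (RGenOpens.measurableE R)).
move=> _ [_ [a [b ->] <-]].
have /cu/open_subspaceP[V oV VD] : open `]a, b[%classic by exact: interval_open.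
have -> : A `&` u @^-1` `]a, b[ = V `&` A by rewrite setIC -VD.
by apply: measurableI => //; exact: open_measurable_plane.
Qed.

Lemma within_continuous_at D u p : open D -> D p ->
  {within closure D, continuous u} -> {for p, continuous u}.
Proof.
move=> oD Dp /(continuous_subspaceW (@subset_closure _ D)).
by rewrite continuous_open_subspace// => /(_ p); apply; rewrite inE.
Qed.

Lemma Ck_continuous_at k D u p : open D -> D p -> Ck k D u -> {for p, continuous u}.
Proof. by move=> oD Dp /Ck_continuous; exact: within_continuous_at. Qed.

Lemma Ck_measurable k D u : open D -> Ck k D u -> measurable_fun (D : set MP) (u : MP -> R).
Proof.
move=> oD /Ck_continuous cu; apply: within_measurable.
  exact: open_measurable_plane.
exact: continuous_subspaceW (@subset_closure _ D) cu.
Qed.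

Lemma compact_bound K u : compact K -> {within K, continuous u} ->
  exists C : R, 0 <= C /\ forall p, K p -> `|u p| <= C.
Proof.
move=> cK cu; have [->|K0] := eqVneq K set0; first by exists 0.
have cn : {within K, continuous (fun p => `|u p|)} by move=> p; apply: cvg_norm; exact: cu.
have [c _ Hc] := compact_EVT_max (proj1 (set0P _) K0) cK cn.
by exists `|u c|; split=> // p Kp; apply: Hc; rewrite inE.
Qed.

Lemma is_derive_near_eq (f g : R * R -> R) (p e : R * R) (l : R) U :
  open U -> U p -> (forall q, U q -> f q = g q) ->
  is_derive p e f l -> is_derive p e g l.
Proof.
move=> oU Up fg; apply: near_eq_is_derive.
by apply: filterS (open_nbhs_nbhs (conj oU Up)) => q /fg.
Qed.

Lemma eq_continuous_at U u v p : open U -> U p -> (forall q, U q -> v q = u q) ->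
  {for p, continuous u} -> {for p, continuous v}.
Proof.
move=> oU Up vu cu; rewrite /prop_for /continuous_at vu//.
apply: cvg_trans cu; apply: near_eq_cvg.
by apply: filterS (open_nbhs_nbhs (conj oU Up)) => q /vu.
Qed.

(** The open sets [D] and the complement of [K] cover the plane, and [v] is [u] on one and 0 on the
    other. *)
Lemma glue_continuous D K u v : open D -> closed K ->
  {within closure D, continuous u} -> K `<=` D ->
  (forall p, D p -> v p = u p) -> (forall p, ~ K p -> v p = 0) -> continuous v.
Proof.
move=> oD cK cu KD vu v0 p; have oK : open (~` K) by exact: closed_openC.
have [Dp|nDp] := pselect (D p).
  exact: eq_continuous_at oD Dp vu (within_continuous_at oD Dp cu).
apply: (eq_continuous_at (u := fun=> 0) oK _ v0); last exact: cvg_cst.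
by move=> /KD.
Qed.

(** On [D] outside [K] both 0 and the derivative of [u] are derivatives of [v]; uniqueness
    reconciles them, so the extended derivative has the same shape as [v] and the construction can
    be iterated. *)
Lemma glue_derive D K e u u1 v : open D -> closed K -> K `<=` D ->
  (forall p, D p -> is_derive p e u (u1 p)) ->
  (forall p, D p -> v p = u p) -> (forall p, ~ K p -> v p = 0) ->
  exists v1, [/\ forall p, D p -> v1 p = u1 p, forall p, ~ K p -> v1 p = 0 &
    forall p, is_derive p e v (v1 p)].
Proof.
move=> oD cK KD du vu v0; have oK : open (~` K) by exact: closed_openC.
pose v1 p := if pselect (D p) then u1 p else 0.
have dD p : D p -> is_derive p e v (u1 p).
  by move=> Dp; apply: is_derive_near_eq oD Dp _ (du _ Dp) => q /vu.
have dK p : ~ K p -> is_derive p e v 0.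
  by move=> Kp; apply: (is_derive_near_eq (f := fun=> 0) oK Kp) => q /v0 ->.
exists v1; split=> p; rewrite /v1; case: pselect => //= Dp.
- by move=> Kp; exact: is_derive_unique (dD _ Dp) (dK _ Kp).
- exact: dD.
- by apply: dK => /KD.
Qed.

Lemma Ck_glue k D K u v : open D -> closed K -> K `<=` D -> Ck k D u ->
  (forall p, D p -> v p = u p) -> (forall p, ~ K p -> v p = 0) -> Ck k setT v.
Proof.
move=> oD cK KD; elim: k u v => [|k IH] u v hu vu v0.
  split=> //; apply: continuous_subspaceT.
  exact: glue_continuous oD cK hu.1 KD vu v0.
have [cu [u1 [u2 [du h1 h2]]]] := hu.
have [v1 [v1u v10 dv1]] := glue_derive oD cK KD (fun p Dp => (du p Dp).1) vu v0.
have [v2 [v2u v20 dv2]] := glue_derive oD cK KD (fun p Dp => (du p Dp).2) vu v0.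
split; first by apply: continuous_subspaceT; exact: glue_continuous oD cK cu KD vu v0.
exists v1, v2; split; [by []|exact: IH h1 v1u v10|exact: IH h2 v2u v20].
Qed.

Lemma test_glue D u v K : open D -> compact K -> K `<=` D -> smooth D u ->
  (forall p, D p -> v p = u p) -> (forall p, ~ K p -> v p = 0) -> test_function D v.
Proof.
move=> oD cK KD su vu v0; split; last by exists K.
move=> k; apply: Ck_glue (su k) vu v0 => //.
by apply: compact_closed cK; exact: norm_hausdorff.
Qed.

Lemma Ck_restrict k D A u : closure D `<=` closure A -> D `<=` A -> Ck k A u -> Ck k D u.
Proof.
move=> cDA DA; elim: k u => [|k IH] u [cu hu]; split=> //;
  try exact: continuous_subspaceW cu.
by have [u1 [u2 [du h1 h2]]] := hu; exists u1, u2; split; [move=> p /DA/du|exact: IH..].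
Qed.

Lemma smooth_derive k u : Ck k.+1 setT u ->
  exists u1 u2, [/\ forall p, is_derive p e1 u (u1 p), forall p, is_derive p e2 u (u2 p),
    Ck k setT u1 & Ck k setT u2].
Proof.
move=> [_ [u1 [u2 [du h1 h2]]]]; exists u1, u2; split=> //.
  by move=> p; exact: (du p I).1.
by move=> p; exact: (du p I).2.
Qed.

Lemma is_derive_e1 u p (l : R) :
  is_derive p e1 u l <-> is_derive p.1 (1 : R) (fun x => u (x, p.2)) l.
Proof.
rewrite is_derive_line [in X in _ <-> X]is_derive_line.
have -> // : (fun t : R => u (t *: e1 + p)) = (fun t : R => u (t *: 1 + p.1, p.2)).
by apply/funext => t; congr (u (_, _)) => /=; rewrite [_ *: 0]mulr0 add0r.
Qed.

Lemma is_derive_e2 u p (l : R) :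
  is_derive p e2 u l <-> is_derive p.2 (1 : R) (fun y => u (p.1, y)) l.
Proof.
rewrite is_derive_line [in X in _ <-> X]is_derive_line.
have -> // : (fun t : R => u (t *: e2 + p)) = (fun t : R => u (p.1, t *: 1 + p.2)).
by apply/funext => t; congr (u (_, _)) => /=; rewrite [_ *: 0]mulr0 add0r.
Qed.

Lemma is_derive_val p e u (l : R) : is_derive p e u l -> 'D_e u p = l.
Proof. by case. Qed.
End PlaneTopology.

(** * The rectangle: closure, slices, mean value theorems *)

Section Rectangle.
Context {R : realType}.
Variable Q : rectangle R.
Hypotheses (HW : xW Q < xE Q) (HS : yS Q < yN Q).
Local Notation Om := (Omega Q).
Implicit Types (p q : R * R) (u v : R * R -> R).

Lemma itv_dist (a b x y : R) : `|y - x| < x - a -> `|y - x| < b - x -> a < y < b.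
Proof. by move=> /ltr_normlP[? ?] /ltr_normlP[? ?]; apply/andP; split; lra. Qed.

Definition Omega_bar : set (R * R) :=
  [set p | xW Q <= p.1 <= xE Q /\ yS Q <= p.2 <= yN Q].

Lemma open_Omega : open Om.
Proof.
rewrite openE => p [/andP[a1 a2] /andP[b1 b2]]; apply/nbhs_box.
pose e := Num.min (Num.min (p.1 - xW Q) (xE Q - p.1)) (Num.min (p.2 - yS Q) (yN Q - p.2)).
exists e; first by rewrite !lt_min !subr_gt0 a1 a2 b1 b2.
move=> q; rewrite !lt_min => /andP[/andP[h1 h2] _] /andP[_ /andP[h3 h4]].
by split; [exact: itv_dist h1 h2|exact: itv_dist h3 h4].
Qed.

Lemma compact_Omega_bar : compact Omega_bar.
Proof.
have -> : Omega_bar = `[xW Q, xE Q]%classic `*` `[yS Q, yN Q]%classic.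
  by apply/seteqP; split => p /=; rewrite /Omega_bar /= !in_itv.
by apply: compact_setX; exact: segment_compact.
Qed.

Lemma closed_Omega_bar : closed Omega_bar.
Proof. by apply: compact_closed compact_Omega_bar; exact: norm_hausdorff. Qed.

Lemma closure_Omega : closure Om = Omega_bar.
Proof.
apply/seteqP; split.
  move=> p cp; apply: closed_Omega_bar => U /cp[q [[/andP[? ?] /andP[? ?]] Uq]].
  by exists q; split=> //; split; apply/andP; split; exact: ltW.
move=> p [/andP[a1 a2] /andP[b1 b2]] U /nbhs_box[e e0 H].
pose c := ((xW Q + xE Q) / 2, (yS Q + yN Q) / 2) : R * R.
(* [L] exceeds both coordinates of the displacement from [p] to the centre [c], so moving by the
   fraction [e / L] of it stays within [e], and any positive fraction enters the open rectangle. *)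
pose L := 1 + (xE Q - xW Q) + (yN Q - yS Q).
have L0 : 0 < L by rewrite /L; move: HW HS; lra.
pose t := Num.min 2^-1 (e / L).
have t0 : 0 < t by rewrite lt_min invr_gt0 ltr0n/= divr_gt0.
have t1 : t <= 2^-1 by rewrite ge_min lexx.
have t2 : t * L <= e by rewrite -ler_pdivlMr// ge_min lexx orbT.
pose q := (p.1 + t * (c.1 - p.1), p.2 + t * (c.2 - p.2)) : R * R.
have bt x : `|x| < L -> `|t * x| < e.
  move=> h; rewrite normrM gtr0_norm//; apply: lt_le_trans t2.
  by rewrite ltr_pM2l.
exists q; split; last first.
  have cs (x y : R) : x + y - x = y by rewrite addrAC subrr add0r.
  apply: H; rewrite /q /= cs; apply: bt; apply/ltr_normlP; rewrite /L /c /=; clear -HW HS a1 a2 b1 b2.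
    by split; move: HW HS a1 a2; lra.
  by split; move: HW HS b1 b2; lra.
have mid a b x : a <= x -> x <= b -> a < b -> a < x + t * ((a + b) / 2 - x) < b.
  move=> h1 h2 h3.
  have := mulr_gt0 t0 (_ : 0 < b - a); rewrite subr_gt0 => /(_ h3) => h4.
  have h5 : 0 <= (1 - t) * (x - a) by apply: mulr_ge0; lra.
  have h6 : 0 <= (1 - t) * (b - x) by apply: mulr_ge0; lra.
  by apply/andP; split; nra.
by split; apply: mid.
Qed.

Lemma Omega_sub_bar : Om `<=` Omega_bar.
Proof. by rewrite -closure_Omega; exact: subset_closure. Qed.

Lemma Ck_bounded k u : Ck k Om u -> exists C : R, 0 <= C /\
  forall p, Omega_bar p -> `|u p| <= C.
Proof.
move=> /Ck_continuous; rewrite closure_Omega; apply: compact_bound.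
exact: compact_Omega_bar.
Qed.

Lemma slice_continuous1 u y (a b : R) : {within Omega_bar, continuous u} ->
  yS Q <= y <= yN Q -> xW Q <= a -> b <= xE Q ->
  {within `[a, b], continuous (fun x => u (x, y))}.
Proof.
move=> /subspace_continuousP cu Hy Ha Hb; apply/subspace_continuousP => x.
rewrite /= in_itv /= => /andP[ax xb].
have Bx : Omega_bar (x, y) by split=> //=; apply/andP; split; lra.
move=> U nU.
have /nbhs_box[e e0 H] : nbhs (x, y) (fun q => Omega_bar q -> U (u q)) := cu _ Bx U nU.
suff : nbhs x (fun x' => `[a, b]%classic x' -> U (u (x', y))) by [].
apply/nbhs_ballP; exists e => // x'.
rewrite /ball /= => h; rewrite /= in_itv /= => /andP[ax' x'b].
apply: H => /=; [by rewrite distrC|by rewrite subrr normr0|].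
by split=> //=; apply/andP; split; lra.
Qed.

Lemma slice_continuous2 u x (a b : R) : {within Omega_bar, continuous u} ->
  xW Q <= x <= xE Q -> yS Q <= a -> b <= yN Q ->
  {within `[a, b], continuous (fun y => u (x, y))}.
Proof.
move=> /subspace_continuousP cu Hx Ha Hb; apply/subspace_continuousP => y.
rewrite /= in_itv /= => /andP[ay yb].
have Bx : Omega_bar (x, y) by split=> //=; apply/andP; split; lra.
move=> U nU.
have /nbhs_box[e e0 H] : nbhs (x, y) (fun q => Omega_bar q -> U (u q)) := cu _ Bx U nU.
suff : nbhs y (fun y' => `[a, b]%classic y' -> U (u (x, y'))) by [].
apply/nbhs_ballP; exists e => // y'.
rewrite /ball /= => h; rewrite /= in_itv /= => /andP[ay' y'b].
apply: H => /=; [by rewrite subrr normr0|by rewrite distrC|].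
by split=> //=; apply/andP; split; lra.
Qed.

(** Only continuity is required at the ends of the segment, which may therefore lie on the boundary;
    the first and the last cell of a row need this. *)
Lemma MVT_e1 u u1 y (a b : R) : {within Omega_bar, continuous u} ->
  (forall p, Om p -> is_derive p e1 u (u1 p)) ->
  yS Q < y < yN Q -> xW Q <= a -> a < b -> b <= xE Q ->
  exists2 c, a < c < b & u (b, y) - u (a, y) = u1 (c, y) * (b - a).
Proof.
move=> cu du /andP[y1 y2] Ha ab Hb.
have [x||c] := @MVT R (fun x => u (x, y)) (fun x => u1 (x, y)) a b ab.
- rewrite in_itv /= => /andP[h1 h2]; apply/(is_derive_e1 u (x, y))/du.
  by split=> /=; apply/andP; split; lra.
- by apply: slice_continuous1 => //; rewrite !ltW.
by rewrite in_itv /= => h1 h2; exists c.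
Qed.

Lemma MVT_e2 u u2 x (a b : R) : {within Omega_bar, continuous u} ->
  (forall p, Om p -> is_derive p e2 u (u2 p)) ->
  xW Q < x < xE Q -> yS Q <= a -> a < b -> b <= yN Q ->
  exists2 c, a < c < b & u (x, b) - u (x, a) = u2 (x, c) * (b - a).
Proof.
move=> cu du /andP[y1 y2] Ha ab Hb.
have [y0||c] := @MVT R (fun y => u (x, y)) (fun y => u2 (x, y)) a b ab.
- rewrite in_itv /= => /andP[h1 h2]; apply/(is_derive_e2 u (x, y0))/du.
  by split=> /=; apply/andP; split; lra.
- by apply: slice_continuous2 => //; rewrite !ltW.
by rewrite in_itv /= => h1 h2; exists c.
Qed.
End Rectangle.

(** * Integrals of derivatives with compact support *)

Section PlaneIntegrals.
Context {R : realType}.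
Variable Q : rectangle R.
Hypotheses (HW : xW Q < xE Q) (HS : yS Q < yN Q).
Local Notation Om := (Omega Q).
Local Notation MP := (measurableTypeR R * measurableTypeR R)%type.
Local Notation mu := (@plane_measure R).
Local Notation rint D u := (mu.-integrable D (EFin \o u)).
Implicit Types (p q e : R * R) (u v w z g : R * R -> R).

Lemma plane_measure_rect (A B : set R) : measurable A -> measurable B ->
  mu (A `*` B) = (lebesgue_measure A * lebesgue_measure B)%E.
Proof. by move=> mA mB; exact: product_measure1E. Qed.

Lemma OmegaX : Om = `]xW Q, xE Q[%classic `*` `]yS Q, yN Q[%classic.
Proof. by apply/seteqP; split => p /=; rewrite !in_itv. Qed.

Lemma measurable_Omega : measurable (Om : set MP).
Proof. by apply: open_measurable_plane; exact: open_Omega. Qed.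

Lemma finite_Omega : (mu Om < +oo)%E.
Proof.
rewrite OmegaX plane_measure_rect; [|exact: measurable_itv..].
by rewrite !lebesgue_measure_itv /= !lte_fin HW HS -!EFinB -EFinM ltry.
Qed.

Lemma integral_Omega_mkcond w : (forall p, ~ Om p -> w p = 0) ->
  (\int[mu]_(p in Om) (w p)%:E = \int[mu]_p (w p)%:E)%E.
Proof.
move=> w0; rewrite integral_mkcond; apply: eq_integral => p _.
by rewrite patchE; case: ifPn => // /negP; rewrite inE => /w0 ->.
Qed.

Lemma integrable_Omega_mkcond w : (forall p, ~ Om p -> w p = 0) ->
  rint Om w -> rint setT w.
Proof.
move=> w0 /(integrable_mkcond _ measurable_Omega).
have -> // : (EFin \o w) \_ Om = EFin \o w.
by apply/funext => p; rewrite patchE; case: ifPn => // /negP; rewrite inE /= => /w0 ->.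
Qed.

Lemma FTC_segment (f F : R -> R) (a b : R) : a < b -> continuous f ->
  (forall x : R, is_derive x 1 F (f x)) ->
  (\int[lebesgue_measure]_(x in `[a, b]) (f x)%:E = (F b - F a)%:E)%E.
Proof.
move=> ab cf dF; have cF x : {for x, continuous F} by exact: is_derive1_continuous (dF x).
rewrite (@continuous_FTC2 _ f F)//.
- exact: continuous_subspaceT.
- split; [by move=> x _; case: (dF x)|exact: cvg_at_right_filter (cF a)|].
  exact: cvg_at_left_filter (cF b).
- by move=> x _; rewrite derive1E; case: (dF x).
Qed.

Lemma integral_line (f F : R -> R) (a b : R) : a < b -> continuous f ->
  (forall x : R, is_derive x 1 F (f x)) -> (forall x, ~ a < x < b -> f x = 0) ->
  F a = 0 -> F b = 0 -> (\int[lebesgue_measure]_x (f x)%:E = 0)%E.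
Proof.
move=> ab cf dF f0 Fa Fb; rewrite -[RHS](_ : (F b - F a)%:E = 0%E); last by rewrite Fa Fb subr0.
rewrite -(FTC_segment ab cf dF) [RHS]integral_mkcond; apply: eq_integral => x _.
rewrite patchE; case: ifPn => // /negP; rewrite inE /= in_itv /= => h.
by rewrite f0// => /andP[? ?]; apply: h; rewrite !ltW.
Qed.

Lemma slice_cont1 v y : continuous v -> continuous (fun x : R => v (x, y)).
Proof.
move=> cv x; apply: (continuous_comp (f := fun x => (x, y))); last exact: cv.
apply: cvg_box => e e0; apply/nbhs_ballP; exists e => // t.
by rewrite /ball /= distrC subrr normr0.
Qed.
Lemma slice_cont2 v x : continuous v -> continuous (fun y : R => v (x, y)).
Proof.
move=> cv y; apply: (continuous_comp (f := fun y => (x, y))); last exact: cv.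
apply: cvg_box => e e0; apply/nbhs_ballP; exists e => // t.
by rewrite /ball /= distrC subrr normr0.
Qed.

Lemma continuous_rint u (C : R) : {in Om, continuous u} ->
  (forall p, Om p -> `|u p| <= C) -> rint Om u.
Proof.
move=> cu uC; apply (rint_bounded measurable_Omega finite_Omega (C := C)) => //.
apply: within_measurable; first exact: measurable_Omega.
by rewrite continuous_open_subspace//; exact: open_Omega.
Qed.

(** Fubini in the order that integrates first along the direction of differentiation: each slice
    integral is a difference of two boundary values, both 0. *)
Lemma integral_derive_e1 v v1 : (forall p, is_derive p e1 v (v1 p)) ->
  continuous v1 -> (forall p, ~ Om p -> v p = 0) -> (forall p, ~ Om p -> v1 p = 0) ->
  \int[mu]_(p in Om) v1 p = 0.
Proof.
move=> dv cv1 v0 v10; rewrite /Rintegral integral_Omega_mkcond//.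
have [C [_ HC]] : exists C : R, 0 <= C /\ forall p, Omega_bar Q p -> `|v1 p| <= C.
  by apply: compact_bound; [exact: compact_Omega_bar|exact: continuous_subspaceT].
have iv : rint setT v1.
  apply: integrable_Omega_mkcond => //; apply: (@continuous_rint _ C).
    by move=> p _; exact: cv1.
  by move=> p /(Omega_sub_bar HW HS)/HC.
rewrite -[X in fine X](integral21_prod_meas1 iv) (_ : (\int[_]_x _)%E = 0%E)//.
rewrite -[RHS](integral0 lebesgue_measure setT); apply: eq_integral => y _.
rewrite /fubini_G /=; apply: (integral_line (F := fun x => v (x, y)) HW).
- exact: slice_cont1.
- by move=> x; apply/(is_derive_e1 v (x, y)).
- by move=> x h; apply: v10 => -[].
- by rewrite v0// => -[/=]; rewrite ltxx.
- by rewrite v0// => -[/=]; rewrite ltxx andbF.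
Qed.

Lemma integral_derive_e2 v v1 : (forall p, is_derive p e2 v (v1 p)) ->
  continuous v1 -> (forall p, ~ Om p -> v p = 0) -> (forall p, ~ Om p -> v1 p = 0) ->
  \int[mu]_(p in Om) v1 p = 0.
Proof.
move=> dv cv1 v0 v10; rewrite /Rintegral integral_Omega_mkcond//.
have [C [_ HC]] : exists C : R, 0 <= C /\ forall p, Omega_bar Q p -> `|v1 p| <= C.
  by apply: compact_bound; [exact: compact_Omega_bar|exact: continuous_subspaceT].
have iv : rint setT v1.
  apply: integrable_Omega_mkcond => //; apply: (@continuous_rint _ C).
    by move=> p _; exact: cv1.
  by move=> p /(Omega_sub_bar HW HS)/HC.
rewrite -[X in fine X](integral12_prod_meas1 iv) (_ : (\int[_]_x _)%E = 0%E)//.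
rewrite -[RHS](integral0 lebesgue_measure setT); apply: eq_integral => x _.
rewrite /fubini_F /=; apply: (integral_line (F := fun y => v (x, y)) HS).
- exact: slice_cont2.
- by move=> y; apply/(is_derive_e2 v (x, y)).
- by move=> y h; apply: v10 => -[].
- by rewrite v0// => -[_ /=]; rewrite ltxx.
- by rewrite v0// => -[_ /=]; rewrite ltxx andbF.
Qed.

(** Here [w] is only known inside the rectangle; since it vanishes off a compact subset, its
    extension by 0 is differentiable on the whole plane. *)
Lemma integral_compact_derive e w w1 K : e = e1 \/ e = e2 ->
  compact K -> K `<=` Om ->
  (forall p, Om p -> is_derive p e w (w1 p)) -> {in Om, continuous w1} ->
  (forall p, Om p -> ~ K p -> w p = 0) ->
  \int[mu]_(p in Om) w1 p = 0.
Proof.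
move=> he cK KO dw cw w0; pose v p := if pselect (Om p) then w p else 0.
have clK : closed K by apply: compact_closed cK; exact: norm_hausdorff.
have oK : open (~` K) by exact: closed_openC.
have vw p : Om p -> v p = w p by rewrite /v; case: pselect.
have v0 p : ~ K p -> v p = 0 by rewrite /v; case: pselect => // Op; exact: w0.
have [v1 [v1w v10 dv]] := glue_derive (@open_Omega R Q) clK KO dw vw v0.
have cv : continuous v1.
  move=> p; have [Op|nOp] := pselect (Om p).
    apply: (eq_continuous_at (@open_Omega R Q) Op v1w).
    by apply: cw; rewrite inE.
  apply: (eq_continuous_at (u := fun=> 0) oK _ v10); last exact: cvg_cst.
  by move=> /KO.
have nK p : ~ Om p -> ~ K p by move=> + /KO.
rewrite (@eq_Rintegral _ _ _ mu Om v1); last by move=> p /set_mem /v1w.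
by case: he dv => -> dv; [apply: (integral_derive_e1 dv cv)|
  apply: (integral_derive_e2 dv cv)] => p /nK; [exact: v0|exact: v10|exact: v0|exact: v10].
Qed.

Lemma test_Ck z D : test_function D z -> forall k, Ck k setT z.
Proof. by case. Qed.

Lemma Ck_setT_continuous k z : Ck k setT z -> continuous z.
Proof. by move=> hz p; apply: Ck_continuous_at hz => //; exact: openT. Qed.

(* A tensor product of plateaus converging to the indicator of the box. *)
Lemma box_test (a b c d : R) (n : nat) : xW Q <= a -> b <= xE Q -> yS Q <= c -> d <= yN Q ->
  test_function Om (fun p => step (n.+1%:R * (p.1 - a)) * step (n.+1%:R * (b - p.1)) *
    (step (n.+1%:R * (p.2 - c)) * step (n.+1%:R * (d - p.2)))).
Proof.
move=> Ha Hb Hc Hd; split.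
  move=> k; apply: Ck_mul; apply: Ck_mul; apply/Ck_step/Ck_scale/Ck_sub;
    by [exact: Ck_fst|exact: Ck_snd|exact: Ck_cst].
pose r : R := n.+1%:R^-1 / 2; have r0 : 0 < r by rewrite divr_gt0// invr_gt0.
have st x : x < r -> step (n.+1%:R * x) = 0.
  move=> xr; apply: step0; apply: ltW; rewrite -ltr_pdivlMl//.
clearbody r; exists (`[a + r, b - r]%classic `*` `[c + r, d - r]%classic); split.
- by apply: compact_setX; exact: segment_compact.
- move=> p [/=]; rewrite !in_itv /= => /andP[h1 h2] /andP[h3 h4].
  by clear st; split; apply/andP; split; lra.
- move=> p np; have [h1|h1] := ltP (p.1 - a) r; first by rewrite st// !mul0r.
  have [h2|h2] := ltP (b - p.1) r; first by rewrite [X in _ * X * _]st// mulr0 mul0r.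
  have [h3|h3] := ltP (p.2 - c) r; first by rewrite [X in _ * (X * _)]st// mul0r mulr0.
  have [h4|h4] := ltP (d - p.2) r; first by rewrite [X in _ * (_ * X)]st// !mulr0.
  by exfalso; clear st; apply: np; split; rewrite /= in_itv /=; apply/andP; split; lra.
Qed.
End PlaneIntegrals.

(** * The fundamental lemma of the calculus of variations *)

Section FundamentalLemma.
Context {R : realType}.
Variable Q : rectangle R.
Hypotheses (HW : xW Q < xE Q) (HS : yS Q < yN Q).
Local Notation Om := (Omega Q).
Local Notation MP := (measurableTypeR R * measurableTypeR R)%type.
Local Notation mu := (@plane_measure R).
Local Notation rint D u := (mu.-integrable D (EFin \o u)).
Local Notation mOm := (measurable_Omega Q).
Implicit Types (p q e : R * R) (u v w z g : R * R -> R).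

Lemma step_cvg (s : R) : step (n.+1%:R * s) @[n --> \oo] --> ((0 < s)%R%:R : R).
Proof.
have [s0|s0] := ltP 0 s; last first.
  have -> : (fun n => step (n.+1%:R * s)) = cst 0; last exact: cvg_cst.
  by apply/funext => n; rewrite step0// (@le_trans _ _ 0)// ?invr_ge0// mulr_ge0_le0.
apply: near_cvg => e e0.
have [N _ HN] := near_infty_natSinv_lt (PosNum s0).
exists N => // n /HN /= h; rewrite step1 ?subrr ?normr0 ?ltW//.
by rewrite -ltr_pdivrMl// mulr1.
Qed.

Variable g : R * R -> R.
Hypotheses (ig : rint Om g)
  (g0 : forall z, test_function Om z -> \int[mu]_(p in Om) (g p * z p) = 0).

Let rint_indic (A : set MP) : measurable A -> rint Om (fun p => g p * \1_A p).
Proof.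
move=> mA.
apply: (rint_le mOm (v := fun p => `|g p|)).
- apply: measurable_funM; first exact: rint_measurable ig.
  exact: measurable_indic.
- move=> p _; rewrite normrM ler_piMr// indicE; case: (_ \in _); rewrite ?normr1 ?normr0//.
- exact: (integrable_norm ig).
Qed.

Lemma integral_box0 (a b c d : R) :
  \int[mu]_(p in Om) (g p * \1_(`]a, b[ `*` `]c, d[) p) = 0.
Proof.
(* Clamping the box to the rectangle makes its smooth plateaus test functions and does not change
   the indicator inside the rectangle. *)
pose a' := Num.max a (xW Q); pose b' := Num.min b (xE Q).
pose c' := Num.max c (yS Q); pose d' := Num.min d (yN Q).
pose z n p := step (n.+1%:R * (p.1 - a')) * step (n.+1%:R * (b' - p.1)) *
    (step (n.+1%:R * (p.2 - c')) * step (n.+1%:R * (d' - p.2))).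
have tz n : test_function Om (z n).
  by apply: box_test; rewrite ?le_max ?ge_min ?lexx ?orbT.
have cz : \int[mu]_(p in Om) (g p * z n p) @[n --> \oo] -->
    \int[mu]_(p in Om) (g p * \1_(`]a, b[ `*` `]c, d[) p).
  apply: (Rintegral_dominated mOm (h := fun p => `|g p|)).
  - move=> n; apply: measurable_funM; first exact: rint_measurable ig.
    by apply: (Ck_measurable (k := 0) (@open_Omega R Q)); apply: Ck_restrict (test_Ck (tz n) 0) => //; rewrite closureT.
  - by apply: rint_measurable; apply: rint_indic; apply: measurableX; exact: measurable_itv.
  - apply: aeW => p [/andP[x1 x2] /andP[y1 y2]]; apply: cvgM; first exact: cvg_cst.
    have -> : \1_(`]a, b[ `*` `]c, d[) p = (0 < p.1 - a')%R%:R * (0 < b' - p.1)%R%:R *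
       ((0 < p.2 - c')%R%:R * (0 < d' - p.2)%R%:R) :> R.
      rewrite indicE !subr_gt0 !gt_max !lt_min x1 x2 y1 y2 !andbT -!natrM !mulnb; congr ((nat_of_bool _)%:R).
      by apply/idP/idP; rewrite ?inE => h; [case: h; rewrite /= !in_itv /= => -> ->|
        by split; rewrite /= in_itv /=; case/andP: h].
    by apply: cvgM; apply: cvgM; exact: step_cvg.
  - exact: (integrable_norm ig).
  - move=> n p _; rewrite normrM ler_piMr//.
    have m1 (x y : R) : `|x| <= 1 -> `|y| <= 1 -> `|x * y| <= 1.
      by move=> ? ?; rewrite normrM mulr_ile1.
    have s1 x : `|step x| <= 1 :> R.
      by have /andP[h1 h2] := step_itv x; rewrite ger0_norm.
    exact: (m1 _ _ (m1 _ _ (s1 _) (s1 _)) (m1 _ _ (s1 _) (s1 _))).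
have : (fun n => \int[mu]_(p in Om) (g p * z n p)) = cst 0.
  by apply/funext => n; exact: g0.
by move=> E; rewrite E in cz; apply: (cvg_unique _ cz); [exact: norm_hausdorff|exact: cvg_cst].
Qed.

(** A pi-lambda argument for the signed integrable density [g]: complements are differences with the
    integral over [E], and countable unions pass by dominated convergence with [|g|]. The map [f]
    and the set [E] allow one coordinate to be treated while the other is held in a fixed set. *)
Lemma dynkin_integral (dT : measure_display) (T : measurableType dT)
    (G : set (set T)) (f : MP -> T) (E : set MP) :
  @measurable _ T = <<s G >> -> setI_closed G -> measurable E ->
  measurable_fun setT f -> \int[mu]_(p in Om) (g p * \1_E p) = 0 ->
  (forall A, G A -> \int[mu]_(p in Om) (g p * \1_(E `&` f @^-1` A) p) = 0) ->
  forall A, measurable A -> \int[mu]_(p in Om) (g p * \1_(E `&` f @^-1` A) p) = 0.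
Proof.
move=> GE GI mE mf E0 G0 A; rewrite GE.
have mfA B : measurable B -> measurable (E `&` f @^-1` B).
  by move=> mB; apply: measurableI => //; rewrite -[X in measurable X]setTI; exact: mf.
apply: (dynkin_induction (P := fun A => \int[mu]_(p in Om) (g p * \1_(E `&` f @^-1` A) p) = 0) GE GI).
- by rewrite preimage_setT setIT.
- by move=> B /G0.
- move=> B mB B0; rewrite -[RHS]subr0 -{1}E0 -B0 -RintegralB//; [|exact: mOm|exact: rint_indic|apply: rint_indic; exact: mfA].
  apply: eq_Rintegral => p _; rewrite -mulrBr; congr (_ * _).
  rewrite !indicE !in_setI preimage_setC in_setC.
  by case: (_ \in E) => /=; rewrite ?subr0//; case: (_ \in _); rewrite ?subrr ?subr0.
- move=> F mF tF F0.
  pose S n := \bigcup_(i < n) F i.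
  have mS n : measurable (S n) by apply: bigcup_measurable.
  have SS n : S n.+1 = S n `|` F n by rewrite /S bigcup_mkord big_ord_recr -bigcup_mkord.
  have In n : \int[mu]_(p in Om) (g p * \1_(E `&` f @^-1` S n) p) = 0.
    elim: n => [|n IH].
      rewrite (@eq_Rintegral _ _ _ mu Om (fun=> 0)) ?Rintegral_cst ?mul0r//; first exact: mOm.
      by move=> p _; rewrite /S bigcup_mkord big_ord0 preimage_set0 setI0 indic0 mulr0.
    rewrite -[RHS]addr0 -{1}IH -{1}(F0 n) -RintegralD//; [|exact: mOm|by apply: rint_indic; exact: mfA..].
    apply: eq_Rintegral => p _; rewrite -mulrDr; congr (_ * _).
    rewrite SS preimage_setU setIUr !indicE in_setU.
    case/boolP : (p \in E `&` f @^-1` S n) => h1; case/boolP : (p \in E `&` f @^-1` F n) => h2 //=; rewrite ?addr0 ?add0r//.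
    exfalso; move: h1 h2; rewrite !inE => -[_ [i /= ni Fi]] [_ Fn].
    have h : i = n by apply: (tF i n I I); exists (f p).
    by move: ni; rewrite h ltnn.
  have cv : \int[mu]_(p in Om) (g p * \1_(E `&` f @^-1` S n) p) @[n --> \oo] -->
      \int[mu]_(p in Om) (g p * \1_(E `&` f @^-1` (\bigcup_k F k)) p).
    apply: (Rintegral_dominated mOm (h := fun p => `|g p|)).
    + by move=> n; apply: rint_measurable; apply: rint_indic; exact: mfA.
    + by apply: rint_measurable; apply: rint_indic; apply: mfA; exact: bigcup_measurable.
    + apply: aeW => p _; apply: cvgM; first exact: cvg_cst.
      have [[k _ Fk]|nF] := pselect ((\bigcup_k F k) (f p)); last first.
        have -> : (fun n => \1_(E `&` f @^-1` S n) p) = (fun=> \1_(E `&` f @^-1` (\bigcup_k F k)) p : R).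
          apply/funext => n; rewrite !indicE !memNset// => -[_]; first exact: nF.
          by move=> [i _ Fi]; apply: nF; exists i.
        exact: cvg_cst.
      apply: near_cvg => e e0; exists k.+1 => // n /= kn.
      rewrite !indicE !in_setI.
      have -> : p \in f @^-1` S n by apply/mem_set; exists k.
      have -> : p \in f @^-1` (\bigcup_k F k) by apply/mem_set; exists k.
      by rewrite subrr normr0 ltW.
    + exact: (integrable_norm ig).
    + move=> n p _; rewrite normrM ler_piMr// indicE; case: (_ \in _); rewrite ?normr1 ?normr0//.
  have E1 : (fun n => \int[mu]_(p in Om) (g p * \1_(E `&` f @^-1` S n) p)) = cst 0.
    by apply/funext => n; exact: In.
  by rewrite E1 in cv; apply: (cvg_unique _ cv); [exact: norm_hausdorff|exact: cvg_cst].
Qed.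

Let oint := [set A : set R | exists x y, A = `]x, y[%classic].
Let measurable_oint : @measurable _ (measurableTypeR R) = <<s oint >>.
Proof. exact: RGenOpens.measurableE. Qed.
Let oint_setI : setI_closed oint.
Proof.
move=> _ _ [a [b ->]] [c [d ->]]; exists (Num.max a c), (Num.min b d).
apply/seteqP; split => x /=; rewrite !in_itv /= gt_max lt_min.
  by move=> [/andP[-> ->] /andP[-> ->]].
by move=> /andP[/andP[-> ->] /andP[-> ->]].
Qed.

Let whole (u : R * R -> R) : (forall p, Om p -> u p = 1) ->
  \int[mu]_(p in Om) (g p * u p) = 0.
Proof.
move=> u1; rewrite -(integral_box0 (xW Q) (xE Q) (yS Q) (yN Q)).
apply: eq_Rintegral => p /set_mem Op; by rewrite u1// indicE mem_set.
Qed.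

(** Vanishing on open boxes is extended to an arbitrary Borel set in the first coordinate, then in
    the second, and finally from measurable rectangles to all measurable sets. The set where [g] is
    nonnegative and its complement then show that the integral of [|g|] is 0. *)
Lemma fundamental_lemma : {ae mu, forall p, Om p -> g p = 0}.
Proof.
have mfst : measurable_fun setT (fst : MP -> measurableTypeR R) by exact: measurable_fst.
have msnd : measurable_fun setT (snd : MP -> measurableTypeR R) by exact: measurable_snd.
have s1 (c d : R) (A : set (measurableTypeR R)) : measurable A ->
    \int[mu]_(p in Om) (g p * \1_((snd @^-1` `]c, d[%classic : set MP) `&` fst @^-1` A) p) = 0.
  apply: (dynkin_integral measurable_oint oint_setI) => //.
  - by rewrite -[X in measurable X]setTI; apply: msnd => //; exact: measurable_itv.
  - rewrite -(integral_box0 (xW Q) (xE Q) c d); apply: eq_Rintegral => p /set_mem Op.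
    congr (_ * _); rewrite !indicE; congr ((nat_of_bool _)%:R); apply/idP/idP; rewrite !inE /=.
      by move=> h; split => //=; rewrite in_itv /=; exact: Op.1.
    by case.
  - move=> _ [a [b ->]]; rewrite -(integral_box0 a b c d); apply: eq_Rintegral => p _.
    congr (_ * _); rewrite !indicE; congr ((nat_of_bool _)%:R).
    by apply/idP/idP; rewrite !inE /= => -[].
have s2 (A B : set (measurableTypeR R)) : measurable A -> measurable B ->
    \int[mu]_(p in Om) (g p * \1_((fst @^-1` A : set MP) `&` snd @^-1` B) p) = 0.
  move=> mA; move: B; apply: (dynkin_integral measurable_oint oint_setI) => //.
  - by rewrite -[X in measurable X]setTI; exact: mfst.
  - rewrite -(s1 (yS Q) (yN Q) A mA); apply: eq_Rintegral => p /set_mem Op.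
    congr (_ * _); rewrite !indicE; congr ((nat_of_bool _)%:R); apply/idP/idP; rewrite !inE /=.
      by move=> h; split => //=; rewrite in_itv /=; exact: Op.2.
    by case.
  - by move=> _ [c [d ->]]; rewrite -[RHS](s1 c d A mA) setIC.
have s3 (A : set MP) : measurable A ->
    \int[mu]_(p in Om) (g p * \1_(setT `&` id @^-1` A) p) = 0.
  apply: (dynkin_integral (measurable_prod_measurableType _ _)) => //.
  - move=> _ _ [A1 mA1 [B1 mB1 <-]] [A2 mA2 [B2 mB2 <-]].
    exists (A1 `&` A2); first exact: measurableI.
    by exists (B1 `&` B2); [exact: measurableI|rewrite setXI].
  - by apply: whole => p _; rewrite indicT.
  - move=> _ [A1 mA1 [B1 mB1 <-]]; rewrite setTI -[RHS](s2 _ _ mA1 mB1).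
    by apply: eq_Rintegral => p _; congr (_ * _); rewrite !indicE; congr ((nat_of_bool _)%:R); apply/idP/idP; rewrite !inE /=.
have mg := rint_measurable ig.
pose P := Om `&` [set p | 0 <= g p].
have mP : measurable (P : set MP).
  have -> : P = Om `&` g @^-1` `[0, +oo[.
    by apply/seteqP; split => p [h1 h2]; split=> //; move: h2; rewrite /= in_itv /= andbT.
  by apply: mg; [exact: mOm|exact: measurable_itv].
have := s3 P mP; have := s3 _ (measurableC mP); rewrite !setTI => I1 I2.
have I3 : \int[mu]_(p in Om) `|g p| = 0.
  rewrite -(subrr (0 : R)) -{1}I2 -{1}I1 -RintegralB//; [|exact: mOm|by apply: rint_indic|by apply: rint_indic; exact: measurableC].
  apply: eq_Rintegral => p /set_mem Op; rewrite !indicE.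
  have [gp|gp] := boolP (0 <= g p).
    have Pp : P p by [].
    have e1 : (p \in id @^-1` P) = true by apply/mem_set.
    have e2 : (p \in id @^-1` (~` P)) = false by apply/memNset.
    by rewrite e1 e2 /= mulr1 mulr0 subr0 ger0_norm.
  have Pp : ~ P p by move=> [_] /=; exact/negP.
  have e1 : (p \in id @^-1` P) = false by apply/memNset.
  have e2 : (p \in id @^-1` (~` P)) = true by apply/mem_set.
  by rewrite e1 e2 /= mulr1 mulr0 sub0r ler0_norm// ltW// ltNge.
have := Rintegral_eq0_ae mOm (integrable_norm ig) (fun p _ => normr_ge0 (g p)) I3.
by apply: filterS => p h /h /normr0_eq0.
Qed.
End FundamentalLemma.

Section AlmostEverywhere.
Context {d : measure_display} {T : measurableType d} {R : realType}.
Variable mu : {measure set T -> \bar R}.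

Lemma ae_sub (P P' : T -> Prop) : (forall x, P x -> P' x) ->
  {ae mu, forall x, P x} -> {ae mu, forall x, P' x}.
Proof. by move=> H; apply: filterS. Qed.

Lemma ae_sub2 (P1 P2 P : T -> Prop) : (forall x, P1 x -> P2 x -> P x) ->
  {ae mu, forall x, P1 x} -> {ae mu, forall x, P2 x} -> {ae mu, forall x, P x}.
Proof. by move=> H; apply: filterS2. Qed.
End AlmostEverywhere.

Section SemiInnerSums.
Context {R : realType} {X : lmodType R}.
Implicit Types (V : X -> Prop) (B : X -> X -> R).

Lemma semi_inner_add V B1 B2 : semi_inner V B1 -> semi_inner V B2 ->
  semi_inner V (fun u v => B1 u v + B2 u v).
Proof.
move=> h1 h2; split; first exact: si_set h1.
- by move=> c u v w Vu Vv Vw; rewrite (si_lin h1)// (si_lin h2)//; ring.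
- by move=> u v Vu Vv; rewrite (si_sym h1)// (si_sym h2).
- by move=> u Vu; rewrite addr_ge0 ?(si_ge0 h1) ?(si_ge0 h2).
Qed.

Lemma semi_inner_sub V W B : linear_set W -> (forall u, W u -> V u) ->
  semi_inner V B -> semi_inner W B.
Proof.
move=> hW WV h; split=> //.
- by move=> c u v w /WV ? /WV ? /WV ?; exact: (si_lin h).
- by move=> u v /WV ? /WV ?; exact: (si_sym h).
- by move=> u /WV ?; exact: (si_ge0 h).
Qed.
End SemiInnerSums.

(** * Weak derivatives and the energy form on H^1 *)

Section Sobolev.
Context {R : realType}.
Variable Q : rectangle R.
Hypotheses (HW : xW Q < xE Q) (HS : yS Q < yN Q).
Local Notation Om := (Omega Q).
Local Notation MP := (measurableTypeR R * measurableTypeR R)%type.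
Local Notation mu := (@plane_measure R).
Local Notation mOm := (measurable_Omega Q).
Local Notation fOm := (finite_Omega HW HS).
Local Notation l2 := (@sq_integrable _ MP R mu Om).
Local Notation ipO := (@ip _ MP R mu Om).
Local Notation wd := (weak_derivative Om).
Local Notation isw := (is_weak_derivative Om).
Local Notation test := (test_function Om).
Implicit Types (p q e : R * R) (u v w z g h : R * R -> R).

Definition axis e := e = e1 \/ e = e2 :> R * R.

Lemma test_derive e z : axis e -> test z ->
  test (fun p => 'D_e z p) /\ forall p, is_derive p e z ('D_e z p).
Proof.
move=> he [sz [K [cK KO z0]]].
have clK : closed K by apply: compact_closed cK; exact: norm_hausdorff.
have oK : open (~` K) by exact: closed_openC.
have dz k : exists2 u, forall p, is_derive p e z (u p) & Ck k setT u.
  have [u1 [u2 [d1 d2 h1 h2]]] := smooth_derive (sz k.+1).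
  by case: he => ->; [exists u1|exists u2].
have dD p : is_derive p e z ('D_e z p).
  by have [u du _] := dz 0%N; rewrite (is_derive_val (du p)).
split=> //; split.
  move=> k; have [u du hu] := dz k; have -> // : (fun p => 'D_e z p) = u.
  by apply/funext => p; exact: is_derive_val (du p).
exists K; split=> // p nK; apply: is_derive_unique (dD p) _.
by apply: (is_derive_near_eq (f := fun=> 0) oK nK) => q /z0 ->.
Qed.

Lemma test_continuous z : test z -> continuous z.
Proof. by move=> [sz _]; exact: Ck_setT_continuous (sz 0%N). Qed.

Lemma test_bounded z : test z -> exists C : R, 0 <= C /\ forall p, `|z p| <= C.
Proof.
move=> tz; have [_ [K [cK _ z0]]] := tz.
have [|C [C0 HC]] := compact_bound (u := z) cK.
  by apply: continuous_subspaceT; exact: test_continuous.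
exists C; split=> // p; have [Kp|nK] := pselect (K p); first exact: HC.
by rewrite z0// normr0.
Qed.

Lemma Omega_measurable u : {in Om, continuous u} -> measurable_fun (Om : set MP) (u : MP -> R).
Proof.
move=> cu; apply: within_measurable; first exact: mOm.
by rewrite continuous_open_subspace//; exact: open_Omega.
Qed.

Lemma test_measurable z : test z -> measurable_fun (Om : set MP) (z : MP -> R).
Proof. by move=> tz; apply: Omega_measurable => p _; exact: test_continuous. Qed.

Lemma test_l2 z : test z -> l2 z.
Proof.
move=> tz; have [C [_ HC]] := test_bounded tz.
by apply: (sq_bounded mOm fOm (C := C)) => //; exact: test_measurable.
Qed.

Lemma test_linear (c : R) z y : test z -> test y -> test (c *: z + y).
Proof.
move=> [sz [K [cK KO z0]]] [sy [L [cL LO y0]]]; split.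
  by move=> k; apply: Ck_add => //; exact: Ck_scale.
exists (K `|` L); split; first exact: compactU.
- by move=> p [/KO|/LO].
- move=> p nKL; have -> : (c *: z + y) p = c * z p + y p by [].
  rewrite z0; last by move=> h; apply: nKL; left.
  by rewrite y0 ?mulr0 ?addr0// => h; apply: nKL; right.
Qed.

Lemma test0 : test (0 : R * R -> R).
Proof.
split; first by move=> k; exact: Ck_cst.
by exists set0; split=> //; exact: compact0.
Qed.

Lemma test_set : linear_set test.
Proof. by split; [exact: test0|move=> c u v; exact: test_linear]. Qed.

(** The integrand is the derivative of [u * z], which inherits the compact support of [z]. *)
Lemma ibp e u u1 z : axis e -> (forall p, Om p -> is_derive p e u (u1 p)) ->
  {in Om, continuous u} -> {in Om, continuous u1} -> test z ->
  \int[mu]_(p in Om) (u1 p * z p + u p * 'D_e z p) = 0.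
Proof.
move=> he du cu cu1 tz; have [tDz dz] := test_derive he tz.
have [_ [K [cK KO z0]]] := tz.
apply: (integral_compact_derive HW HS (w := fun p => u p * z p) he cK KO).
- by move=> p Op; exact: (is_derive_mul (du _ Op) (dz p)).
- move=> p Op; apply: cvgD; apply: cvgM; [exact: cu1|exact: (test_continuous tz)|exact: cu|exact: (test_continuous tDz)].
- by move=> p _ nK; rewrite z0// mulr0.
Qed.

Lemma ibp_test e z y : axis e -> test z -> test y ->
  ipO z (fun p => 'D_e y p) = - ipO (fun p => 'D_e z p) y.
Proof.
move=> he tz ty; have [tD dz] := test_derive he tz; have [tDy _] := test_derive he ty.
have := ibp he (fun p _ => dz p) (fun p _ => @test_continuous z tz p)
  (fun p _ => @test_continuous _ tD p) ty.
rewrite RintegralD//; [|exact: mOm|by apply: (sq_mul mOm); exact: test_l2..].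
by rewrite addrC => /eqP; rewrite addr_eq0 => /eqP.
Qed.

Lemma isw_test e z : axis e -> test z -> isw e z (fun p => 'D_e z p).
Proof.
move=> he tz; have [tD _] := test_derive he tz.
by split=> [|y ty]; [exact: test_l2|exact: ibp_test].
Qed.

(** The difference of two weak derivatives is orthogonal to all test functions. *)
Lemma isw_unique e u g h : isw e u g -> isw e u h ->
  {ae mu, forall p, Om p -> g p = h p}.
Proof.
move=> [lg Hg] [lh Hh].
have ld : l2 (g - h) by exact: (lsB (sq_linear_set mOm fOm)).
have e0 z : test z -> \int[mu]_(p in Om) ((g - h) p * z p) = 0.
  move=> tz; have := linear_onB (sq_linear_set mOm fOm)
    (si_linear_on (ip_semi_inner mOm fOm) (test_l2 tz)) lg lh.
  rewrite /= {1}/ip => ->; apply/eqP; rewrite subr_eq0 -eqr_opp; apply/eqP.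
  by rewrite -[LHS]Hg// -[RHS]Hh.
apply: ae_sub (fundamental_lemma (sq_rint mOm fOm ld) e0) => p hp Op.
by apply/eqP; rewrite -subr_eq0; apply/eqP; exact: hp.
Qed.

Lemma isw_ex e u : (exists g, isw e u g) -> isw e u (wd e u).
Proof. by move=> h; rewrite /weak_derivative; exact: (xgetPex (fun=> 0) h). Qed.

Local Opaque weak_derivative e1 e2.

Lemma isw_linear e (c : R) u v g h : axis e -> l2 u -> l2 v -> isw e u g -> isw e v h ->
  isw e (c *: u + v) (c *: g + h).
Proof.
move=> he lu lv [lg Hg] [lh Hh]; have S := ip_semi_inner mOm fOm.
split; first exact: (si_set S).2.
move=> z tz; have [tD _] := test_derive he tz.
have := si_lin S c lu lv (test_l2 tD); rewrite {1}/ip => ->.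
have := si_lin S c lg lh (test_l2 tz); rewrite {1}/ip => ->.
have := Hg z tz; have := Hh z tz; rewrite -!/(ip _ _ _ _) => -> ->; ring.
Qed.

Lemma H1_isw u : H1 Om u -> [/\ l2 u, isw e1 u (wd e1 u) & isw e2 u (wd e2 u)].
Proof. by move=> [lu h1 h2]; split=> //; exact: isw_ex. Qed.

Lemma H1_wd e u : axis e -> H1 Om u -> isw e u (wd e u).
Proof. by move=> he /H1_isw[_ h1 h2]; case: he => ->. Qed.

Lemma H1_l2 u : H1 Om u -> l2 u. Proof. by case. Qed.
Lemma wd_l2 e u : axis e -> H1 Om u -> l2 (wd e u).
Proof. by move=> he /(H1_wd he)[]. Qed.

Lemma wd_eq e u g : axis e -> H1 Om u -> isw e u g ->
  {ae mu, forall p, Om p -> wd e u p = g p}.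
Proof. by move=> he /(H1_wd he); exact: isw_unique. Qed.

Lemma H1_set : linear_set (H1 Om).
Proof.
have h0 e : axis e -> exists g, isw e (0 : R * R -> R) g.
  by move=> he; exists (fun p => 'D_e (0 : R * R -> R) p); apply: isw_test test0.
split; first by split; [exact: test_l2 test0|apply: h0; left|apply: h0; right].
move=> c u v Hu Hv; have lu := H1_l2 Hu; have lv := H1_l2 Hv.
split; first exact: (sq_linear_set mOm fOm).2.
- exists (c *: wd e1 u + wd e1 v).
  by apply: isw_linear => //; [left|apply: H1_wd => //; left..].
- exists (c *: wd e2 u + wd e2 v).
  by apply: isw_linear => //; [right|apply: H1_wd => //; right..].
Qed.

(** [weak_derivative] picks a representative for each function separately, so linearity can hold no
    better than almost everywhere. *)
Lemma wd_linear e (c : R) u v : axis e -> H1 Om u -> H1 Om v ->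
  {ae mu, forall p, Om p -> wd e (c *: u + v) p = c * wd e u p + wd e v p}.
Proof.
move=> he Hu Hv; apply: (wd_eq he (g := c *: wd e u + wd e v)).
  exact: H1_set.2.
by apply: isw_linear => //; [exact: H1_l2|exact: H1_l2|exact: H1_wd|exact: H1_wd].
Qed.

Lemma test_H1 z : test z -> H1 Om z.
Proof.
move=> tz; split; first exact: test_l2.
  by exists (fun p => 'D_e1 z p); apply: isw_test => //; left.
by exists (fun p => 'D_e2 z p); apply: isw_test => //; right.
Qed.

Lemma wd_test e z : axis e -> test z ->
  {ae mu, forall p, Om p -> wd e z p = 'D_e z p}.
Proof. by move=> he tz; apply: wd_eq => //; [exact: test_H1|exact: isw_test]. Qed.

Section Energy.
Variables (beta : R * R -> R) (m M : R).
Hypotheses (mb : measurable_fun (Om : set MP) (beta : MP -> R)) (m0 : 0 <= m)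
  (bb : forall p, Om p -> m <= beta p <= M).

Let bM p : Om p -> `|beta p| <= M.
Proof. by move=> /bb/andP[h1 h2]; rewrite ger0_norm// (le_trans m0). Qed.

Let bl2 g : l2 g -> l2 (fun p => beta p * g p).
Proof. by move=> lg; exact: (sq_bounded_mul mOm mb bM lg). Qed.

Lemma energyE u v : H1 Om u -> H1 Om v ->
  energy Om beta u v = ipO (fun p => beta p * wd e1 u p) (wd e1 v)
                     + ipO (fun p => beta p * wd e2 u p) (wd e2 v).
Proof.
move=> Hu Hv; rewrite /energy /ip -RintegralD//; first last.
- by apply: (sq_mul mOm); [apply: bl2|]; apply: wd_l2 => //; right.
- by apply: (sq_mul mOm); [apply: bl2|]; apply: wd_l2 => //; left.
- exact: mOm.
by apply: eq_Rintegral => p _; rewrite mulrDr; congr (_ + _); rewrite mulrA.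
Qed.

Lemma dirichlet_si e : axis e ->
  semi_inner (H1 Om) (fun u v => ipO (fun p => beta p * wd e u p) (wd e v)).
Proof.
move=> he; have S := ip_semi_inner mOm fOm; split; first exact: H1_set.
- move=> c u v w Hu Hv Hw; rewrite -(si_lin S); try by [apply: bl2; exact: wd_l2|exact: wd_l2].
  apply: (ip_ae mOm); [by apply: bl2; apply: wd_l2 => //; exact: H1_set.2| |exact: wd_l2|].
    by apply: (si_set S).2; apply: bl2; exact: wd_l2.
  apply: ae_sub (wd_linear c he Hu Hv) => p hp Op; rewrite hp//.
  by rewrite mulrDr mulrCA.
- by move=> u v Hu Hv; apply: eq_Rintegral => p _; rewrite mulrAC.
- move=> u Hu; apply: Rintegral_ge0 => p Op; rewrite -mulrA -expr2 mulr_ge0 ?sqr_ge0//.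
  by have /andP[h _] := bb Op; exact: le_trans h.
Qed.

Lemma energy_si : semi_inner (H1 Om) (energy Om beta).
Proof.
have h := semi_inner_add (dirichlet_si (or_introl erefl)) (dirichlet_si (or_intror erefl)).
have E := energyE; split; first exact: H1_set.
- move=> c u v w Hu Hv Hw; have Huv := H1_set.2 c u v Hu Hv.
  rewrite (E _ _ Huv Hw) (E _ _ Hu Hw) (E _ _ Hv Hw); exact: (si_lin h c Hu Hv Hw).
- move=> u v Hu Hv; rewrite (E _ _ Hu Hv) (E _ _ Hv Hu); exact: (si_sym h Hu Hv).
- move=> u Hu; rewrite (E _ _ Hu Hu); exact: (si_ge0 h Hu).
Qed.

Lemma energy_bounds u : H1 Om u ->
  m * (ipO (wd e1 u) (wd e1 u) + ipO (wd e2 u) (wd e2 u)) <= energy Om beta u u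
  <= M * (ipO (wd e1 u) (wd e1 u) + ipO (wd e2 u) (wd e2 u)).
Proof.
move=> Hu; rewrite energyE// !mulrDr.
have K e : axis e -> m * ipO (wd e u) (wd e u) <= ipO (fun p => beta p * wd e u p) (wd e u)
    <= M * ipO (wd e u) (wd e u).
  move=> he; have lw := wd_l2 he Hu; have lww := sq_mul mOm lw lw.
  rewrite /ip -!RintegralZl//; [|exact: mOm..].
  have i1 := sq_mul mOm (bl2 lw) lw.
  apply/andP; split; apply: le_Rintegral => //; try exact: mOm.
  - exact: (rintZ mOm).
  - move=> p /bb/andP[h1 h2]; rewrite -mulrA ler_wpM2r// -expr2 sqr_ge0//.
  - exact: (rintZ mOm).
  - move=> p /bb/andP[h1 h2]; rewrite -mulrA ler_wpM2r// -expr2 sqr_ge0//.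
have /andP[a1 b1] := K e1 (or_introl erefl); have /andP[a2 b2] := K e2 (or_intror erefl).
by apply/andP; split; [exact: lerD a1 a2|exact: lerD b1 b2].
Qed.
End Energy.
End Sobolev.

Lemma poincare_arith (R : realType) (K eps a b c d x w n : R) : 0 <= K ->
  a <= b + c -> c <= K * d -> b <= n -> d <= x + w -> x <= n -> n * (1 + K) <= eps ->
  a <= K * w + eps.
Proof.
move=> K0 k1 k2 k3 k4 k5 k6; have := ler_wpM2l K0 k4; have := ler_wpM2l K0 k5.
move: k1 k2 k3 k6; rewrite !mulrDr !mulr1 [K * n]mulrC.
by move: (K * d) (K * x) (K * w) (n * K) => *; lra.
Qed.

(** * H^1_0: Poincare inequality and completeness *)

Section SobolevZero.
Local Opaque weak_derivative e1 e2.
Context {R : realType}.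
Variable Q : rectangle R.
Hypotheses (HW : xW Q < xE Q) (HS : yS Q < yN Q).
Local Notation Om := (Omega Q).
Local Notation MP := (measurableTypeR R * measurableTypeR R)%type.
Local Notation mu := (@plane_measure R).
Local Notation mOm := (measurable_Omega Q).
Local Notation fOm := (finite_Omega HW HS).
Local Notation l2 := (@sq_integrable _ MP R mu Om).
Local Notation ipO := (@ip _ MP R mu Om).
Local Notation wd := (weak_derivative Om).
Local Notation isw := (is_weak_derivative Om).
Local Notation test := (test_function Om).
Implicit Types (p q e : R * R) (u v w z g h : R * R -> R).

Local Notation S := (ip_semi_inner mOm fOm).
Local Notation l2B := (lsB (sq_linear_set mOm fOm)).
Local Notation nrm := (seminorm ipO).

(** The energy with coefficient 1. It serves as the reference norm, comparable to the energy of any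
    admissible coefficient, and keeps estimates on interpolants free of [beta]. *)
Definition gradsq u := ipO (wd e1 u) (wd e1 u) + ipO (wd e2 u) (wd e2 u).

Let m1 : measurable_fun (Om : set MP) ((fun=> 1 : R) : MP -> R).
Proof. exact: measurable_cst. Qed.

Let b1 p : Om p -> (1 : R) <= (fun=> 1 : R) p <= 1.
Proof. by rewrite lexx. Qed.

Lemma energy1E u : H1 Om u -> energy Om (fun=> 1) u u = gradsq u.
Proof.
move=> Hu; have /andP[h1 h2] := energy_bounds m1 ler01 b1 Hu.
by apply/eqP; rewrite eq_le; move: h1 h2; rewrite !mul1r => -> ->.
Qed.

Lemma H1_normsqE u : H1 Om u -> H1_normsq Om u = ipO u u + gradsq u.
Proof.
move=> Hu; have lu := H1_l2 Hu.
have l1 := wd_l2 (or_introl erefl) Hu; have l2' := wd_l2 (or_intror erefl) Hu.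
rewrite /H1_normsq /gradsq /ip -(RintegralD mOm (sq_mul mOm l1 l1) (sq_mul mOm l2' l2')).
rewrite -(RintegralD mOm (sq_mul mOm lu lu)); last first.
  by apply: (rintD mOm); [exact: (sq_mul mOm l1 l1)|exact: (sq_mul mOm l2' l2')].
have E (a b c : R) : a ^+ 2 + b ^+ 2 + c ^+ 2 = a * a + (b * b + c * c) by rewrite !expr2 addrA.
by apply: eq_Rintegral => p _; exact: E.
Qed.

Lemma normsq_si : semi_inner (H1 Om) (fun u v => ipO u v + energy Om (fun=> 1) u v).
Proof.
apply: semi_inner_add; last exact: (energy_si HW HS m1 ler01 b1).
apply: semi_inner_sub S; [exact: H1_set|exact: H1_l2].
Qed.

Let N := (fun u v => ipO u v + energy Om (fun=> 1) u v).

Let si_N : semi_inner (H1 Om) N. Proof. exact: normsq_si. Qed.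

Let NE u : H1 Om u -> N u u = H1_normsq Om u.
Proof. by move=> Hu; rewrite /N energy1E// H1_normsqE. Qed.

Lemma H10_H1 u : H10 Om u -> H1 Om u. Proof. by case. Qed.

Lemma wdB e u v : axis e -> H1 Om u -> H1 Om v ->
  {ae mu, forall p, Om p -> wd e (u - v) p = (wd e u - wd e v) p}.
Proof.
move=> he Hu Hv; have := wd_linear HW HS (- 1) he Hv Hu.
rewrite scaleN1r [- v + u]addrC; apply: ae_sub => p h /h ->.
by rewrite mulN1r addrC.
Qed.

Lemma ipO_ae u v : l2 u -> l2 v -> {ae mu, forall p, Om p -> u p = v p} ->
  ipO u u = ipO v v.
Proof.
move=> lu lv uv; rewrite (ip_ae mOm lu lv lu uv) (si_sym S)//.
by rewrite (ip_ae mOm lu lv lv uv).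
Qed.

Lemma gradsqB u v : H1 Om u -> H1 Om v -> gradsq (u - v) =
  ipO (wd e1 u - wd e1 v) (wd e1 u - wd e1 v) + ipO (wd e2 u - wd e2 v) (wd e2 u - wd e2 v).
Proof.
move=> Hu Hv; have Hd : H1 Om (u - v) by exact: (lsB (H1_set HW HS)).
have K e : axis e -> ipO (wd e (u - v)) (wd e (u - v)) =
    ipO (wd e u - wd e v) (wd e u - wd e v).
  move=> he; apply: ipO_ae; [exact: wd_l2| |exact: wdB].
  by apply: l2B; exact: wd_l2.
rewrite /gradsq; congr (_ + _); first exact: (K _ (or_introl erefl)).
exact: (K _ (or_intror erefl)).
Qed.

Local Notation nN := (seminorm N).

Let nNE u : H1 Om u -> nN u ^+ 2 = H1_normsq Om u.
Proof. by move=> Hu; rewrite (seminorm_sqr si_N Hu); exact: NE. Qed.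

Lemma H10P u : H10 Om u <-> H1 Om u /\
  forall eps : R, 0 < eps -> exists z, test z /\ nN (u - z) < eps.
Proof.
have Hd z : H1 Om u -> test z -> H1 Om (u - z).
  by move=> Hu /(test_H1 HW HS); exact: (lsB (H1_set HW HS)).
split=> -[Hu H]; split=> // eps e0.
  have e2 : 0 < eps ^+ 2 by rewrite exprn_gt0.
  have [z [tz Hz]] := H _ e2; exists z; split=> //.
  have Huz := Hd z Hu tz.
  rewrite -ltr_sqr; [|by rewrite nnegrE seminorm_ge0|by rewrite nnegrE ltW].
  by rewrite (nNE Huz).
have e2 : 0 < Num.sqrt eps by rewrite sqrtr_gt0.
have [z [tz Hz]] := H _ e2; exists z; split=> //.
have Huz := Hd z Hu tz.
have := Hz; rewrite -ltr_sqr; [|by rewrite nnegrE seminorm_ge0|by rewrite nnegrE sqrtr_ge0].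
by rewrite (nNE Huz) sqr_sqrtr// ltW.
Qed.

Lemma test_H10 z : test z -> H10 Om z.
Proof.
move=> tz; have Hz := test_H1 HW HS tz; apply/H10P; split=> // eps e0.
exists z; split=> //; rewrite subrr /seminorm.
by rewrite (linear_on0 (H1_set HW HS) (si_linear_on si_N (ls0 (H1_set HW HS)))) sqrtr0.
Qed.

Lemma H10_set : linear_set (H10 Om).
Proof.
split; first exact: test_H10 (test0 Q).
move=> c u v /H10P[Hu au] /H10P[Hv av]; apply/H10P; split; first exact: (H1_set HW HS).2.
move=> eps e0; pose d := eps / (2 * (`|c| + 1)).
have c0 : 0 < `|c| + 1 by rewrite ltr_wpDl.
have d0 : 0 < d by rewrite divr_gt0// mulr_gt0.
have [z [tz zu]] := au _ d0; have e2 : 0 < eps / 2 by rewrite divr_gt0.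
have [y [ty yv]] := av _ e2; exists (c *: z + y); split; first exact: test_linear.
have Hz := test_H1 HW HS tz; have Hy := test_H1 HW HS ty.
have Huz := lsB (H1_set HW HS) Hu Hz; have Hvy := lsB (H1_set HW HS) Hv Hy.
have -> : c *: u + v - (c *: z + y) = c *: (u - z) + (v - y).
  by rewrite scalerBr opprD addrACA.
apply: le_lt_trans (seminormD si_N (lsZ (H1_set HW HS) c Huz) Hvy) _.
rewrite (seminormZ si_N)// (_ : eps = eps / 2 + eps / 2); last by field.
apply: (ler_ltD _ yv); apply: (@le_trans _ _ (`|c| * d)); first by rewrite ler_wpM2l// ltW.
have -> : `|c| * d = (eps / 2) * (`|c| / (`|c| + 1)) by rewrite /d; field; rewrite gt_eqF.
by rewrite ger_pMr// ler_pdivrMr// mul1r lerDl.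
Qed.

Lemma nrm_le_nN u : H1 Om u -> nrm u <= nN u.
Proof.
move=> Hu; apply: ler_wsqrtr; rewrite lerDl.
exact: (si_ge0 (energy_si HW HS m1 ler01 b1)).
Qed.

Lemma ge0_ip e u : axis e -> H1 Om u -> 0 <= ipO (wd e u) (wd e u).
Proof. by move=> he Hu; apply: (si_ge0 S); exact: wd_l2. Qed.

Lemma wd_le_nN e u : axis e -> H1 Om u -> nrm (wd e u) <= nN u.
Proof.
move=> he Hu; apply: ler_wsqrtr; rewrite /N energy1E// /gradsq.
have E (a b c : R) : 0 <= a -> 0 <= b -> 0 <= c -> b <= a + (b + c) /\ c <= a + (b + c).
  by move=> *; split; lra.
have [k1 k2] := E _ _ _ (si_ge0 S (H1_l2 Hu)) (ge0_ip (or_introl erefl) Hu)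
  (ge0_ip (or_intror erefl) Hu).
by case: he => ->; [exact: k1|exact: k2].
Qed.

Lemma wd_le_gradsq e u : axis e -> H1 Om u -> ipO (wd e u) (wd e u) <= gradsq u.
Proof.
move=> he Hu; rewrite /gradsq; case: he => ->.
  by rewrite lerDl; exact: (ge0_ip (or_intror erefl) Hu).
by rewrite lerDr; exact: (ge0_ip (or_introl erefl) Hu).
Qed.

Lemma nrm_ae u v : l2 u -> l2 v -> {ae mu, forall p, Om p -> u p = v p} -> nrm u = nrm v.
Proof. by move=> lu lv uv; rewrite /seminorm (ipO_ae lu lv uv). Qed.

Lemma nrm_bounded_mul (f g : R * R -> R) (C : R) : 0 <= C ->
  measurable_fun (Om : set MP) (f : MP -> R) -> (forall p, Om p -> `|f p| <= C) -> l2 g ->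
  nrm (fun p => f p * g p) <= C * nrm g.
Proof.
move=> C0 mf fC lg; have lfg := sq_bounded_mul mOm mf fC lg.
rewrite -ler_sqr ?nnegrE ?mulr_ge0 ?seminorm_ge0// exprMn !(seminorm_sqr S)//.
rewrite /ip -(RintegralZl _ mOm (sq_mul mOm lg lg)) //; apply: le_Rintegral.
- exact: mOm.
- exact: (sq_mul mOm lfg lfg).
- exact: (rintZ mOm _ (sq_mul mOm lg lg)).
- move=> p Op; rewrite -!expr2 exprMn ler_wpM2r ?sqr_ge0//.
  by rewrite -[leLHS]real_normK ?num_real// lerXn2r ?nnegrE ?fC.
Qed.

Lemma l2_bounded_mul (f g : R * R -> R) (C : R) :
  measurable_fun (Om : set MP) (f : MP -> R) -> (forall p, Om p -> `|f p| <= C) -> l2 g ->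
  l2 (fun p => f p * g p).
Proof. by move=> mf fC lg; exact: (sq_bounded_mul mOm mf fC lg). Qed.

(** The derivative of (x - xW) z^2 in x has integral 0, so the squared norm of [z] is -2 times the
    pairing of (x - xW) z_x with [z]; Cauchy-Schwarz and |x - xW| <= xE - xW conclude. *)
Lemma poincare_test z : test z -> nrm z <= 2 * (xE Q - xW Q) * nrm (fun p => 'D_e1 z p).
Proof.
move=> tz; have [tD dz] := test_derive (or_introl erefl) tz.
pose x p := p.1 - xW Q; pose L := xE Q - xW Q.
have L0 : 0 <= L by rewrite /L subr_ge0 ltW.
have cx : continuous x by move=> p; apply: cvgB; [exact: cvg_fst|exact: cvg_cst].
have xL p : Om p -> `|x p| <= L.
  by move=> [/andP[h1 h2] _]; rewrite /x /L ger0_norm; lra.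
have mx : measurable_fun (Om : set MP) (x : MP -> R) by apply: Omega_measurable => p _; exact: cx.
have lz := test_l2 HW HS tz; have lD := test_l2 HW HS tD.
have dx p : Om p -> is_derive p e1 x 1.
  move=> _; have := is_derive_sub (is_derive_fst1 p) (is_derive_cst (xW Q) p e1).
  by rewrite subr0.
have cz := test_continuous tz; have cD := test_continuous tD.
have cxz : {in Om, continuous (fun p => x p * z p)}.
  by move=> p _; apply: cvgM; [exact: cx|exact: cz].
have cxD : {in Om, continuous (fun p => 1 * z p + x p * 'D_e1 z p)}.
  move=> p _; apply: cvgD; apply: cvgM; [exact: cvg_cst|exact: cz|exact: cx|exact: cD].
have := ibp HW HS (or_introl erefl) (fun p Op => is_derive_mul (dx p Op) (dz p)) cxz cxD tz.
have lxD := l2_bounded_mul mx xL lD; have lxz := l2_bounded_mul mx xL lz.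
have -> : \int[mu]_(p in Om) ((1 * z p + x p * 'D_e1 z p) * z p + x p * z p * 'D_e1 z p) =
    ipO z z + 2 * ipO (fun p => x p * 'D_e1 z p) z.
  rewrite /ip -(RintegralZl _ mOm (sq_mul mOm lxD lz)).
  rewrite -(RintegralD mOm (sq_mul mOm lz lz) (rintZ mOm 2 (sq_mul mOm lxD lz))).
  apply: eq_Rintegral => p _; move: (z p) (x p) ('D_e1 z p) => a b c; ring.
move=> E; have := si_CS_norm S lxD lz; have := nrm_bounded_mul L0 mx xL lD.
move: E; rewrite -(seminorm_sqr S lz) -/L.
have F (a b c y : R) : 0 <= c -> 0 <= a -> a ^+ 2 + 2 * y = 0 -> c <= L * b ->
    `|y| <= c * a -> a <= 2 * L * b.
  move=> c0 a0 E cL /ler_normlP[h1 h2].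
  have [->|an] := eqVneq a 0; first by move: cL c0; rewrite -mulrA; move: (L * b) => *; lra.
  have a1 : 0 < a by rewrite lt_neqAle eq_sym an.
  have : a * a <= (2 * c) * a by rewrite -expr2 -mulrA; move: (a ^+ 2) (c * a) h1 h2 E => *; lra.
  by rewrite ler_pM2r// -mulrA; move: cL; move: (L * b) => *; lra.
by move=> E cL h; exact: F (seminorm_ge0 _ _) (seminorm_ge0 _ _) E cL h.
Qed.

Lemma poincare u : H10 Om u -> nrm u <= 2 * (xE Q - xW Q) * nrm (wd e1 u).
Proof.
move=> Hu; have [H au] := (H10P u).1 Hu.
pose K := 2 * (xE Q - xW Q); have K0 : 0 <= K by rewrite mulr_ge0// subr_ge0 ltW.
apply/ler_addgt0Pr => eps e0; pose d := eps / (1 + K).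
have K1 : 0 < 1 + K by rewrite ltr_pwDl.
have [z [tz zu]] := au d (divr_gt0 e0 K1).
have Hz := test_H1 HW HS tz; have Hd := lsB (H1_set HW HS) H Hz.
have lu := H1_l2 H; have lz := H1_l2 Hz.
have h1 : nrm u <= nrm (u - z) + nrm z.
  by rewrite -{1}(subrK z u); apply: (seminormD S) => //; exact: l2B.
have h2 := poincare_test tz.
have [tD _] := test_derive (or_introl erefl) tz.
have e2 : nrm (fun p => 'D_e1 z p) = nrm (wd e1 z).
  apply: nrm_ae; [exact: test_l2|apply: wd_l2 => //; by left|].
  by apply: ae_sub (wd_test HW HS (or_introl erefl) tz) => p h /h.
have lwu := wd_l2 (or_introl erefl) H; have lwz := wd_l2 (or_introl erefl) Hz.
have h3 : nrm (wd e1 z) <= nrm (wd e1 (u - z)) + nrm (wd e1 u).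
  have -> : nrm (wd e1 (u - z)) = nrm (wd e1 u - wd e1 z).
    by apply: nrm_ae; [apply: wd_l2 => //; left|exact: l2B|apply: wdB => //; left].
  rewrite addrC -(seminormN S (l2B lwu lwz)).
  rewrite -{1}[wd e1 z](subKr (wd e1 u)); apply: (seminormD S) => //.
  by apply: (lsN (sq_linear_set mOm fOm)); exact: l2B.
have h4 := nrm_le_nN Hd; have h5 := wd_le_nN (or_introl erefl) Hd.
have h6 : nN (u - z) * (1 + K) <= eps by rewrite -ler_pdivlMr// ltW.
move: h2; rewrite e2 -/K => h2.
exact: poincare_arith K0 h1 h2 h4 h3 h5 h6.
Qed.

Lemma poincare_gradsq u : H10 Om u -> ipO u u <= (2 * (xE Q - xW Q)) ^+ 2 * gradsq u.
Proof.
move=> Hu; have H := H10_H1 Hu; have K0 : 0 <= 2 * (xE Q - xW Q) by rewrite mulr_ge0// subr_ge0 ltW.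
rewrite -(seminorm_sqr S (H1_l2 H)).
apply: (@le_trans _ _ ((2 * (xE Q - xW Q) * nrm (wd e1 u)) ^+ 2)).
  apply: lerXn2r; [exact: seminorm_ge0| |exact: poincare].
  exact: mulr_ge0 K0 (seminorm_ge0 _ _).
rewrite exprMn ler_wpM2l ?sqr_ge0// (seminorm_sqr S (wd_l2 (or_introl erefl) H)).
exact: wd_le_gradsq (or_introl erefl) H.
Qed.

(** The weak derivative is a closed operator: its defining identity passes to the limit for each
    test function. *)
Lemma isw_lim e (u g : nat -> R * R -> R) u0 g0 : axis e ->
  (forall n, l2 (u n)) -> (forall n, isw e (u n) (g n)) -> l2 u0 -> l2 g0 ->
  ipO (u n - u0) (u n - u0) @[n --> \oo] --> (0 : R) ->
  ipO (g n - g0) (g n - g0) @[n --> \oo] --> (0 : R) -> isw e u0 g0.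
Proof.
move=> he lu ig lu0 lg0 uu0 gg0; split=> // z tz; have [tD _] := test_derive he tz.
have c1 := cvg_si S lu lu0 (test_l2 HW HS tD) uu0.
have c2 : - ipO (g n) z @[n --> \oo] --> - ipO g0 z.
  by apply: cvgN; exact: (cvg_si S (fun n => (ig n).1) lg0 (test_l2 HW HS tz) gg0).
have E : (fun n => ipO (u n) ('D_e z)) = (fun n => - ipO (g n) z).
  by apply/funext => n; exact: (ig n).2.
by rewrite E in c1; apply: (cvg_unique (@Rhausdorff R) c1 c2).
Qed.

Section Complete.
Variables (beta : R * R -> R) (m M : R).
Hypotheses (mb : measurable_fun (Om : set MP) (beta : MP -> R)) (m0 : 0 < m)
  (bb : forall p, Om p -> m <= beta p <= M).

Lemma H10_energy_si : semi_inner (H10 Om) (energy Om beta).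
Proof.
apply: semi_inner_sub (energy_si HW HS mb (ltW m0) bb); [exact: H10_set|exact: H10_H1].
Qed.

Lemma wd_le_energy e u : axis e -> H1 Om u ->
  ipO (wd e u) (wd e u) <= m^-1 * energy Om beta u u.
Proof.
move=> he Hu; have /andP[h _] := energy_bounds mb (ltW m0) bb Hu.
rewrite ler_pdivlMl//; apply: le_trans h; rewrite ler_pM2l//.
exact: wd_le_gradsq.
Qed.

(** The lower bound on the coefficient makes the weak derivatives Cauchy in L^2, and Poincare does
    the same for the functions; [isw_lim] matches the two limits. The limit stays in H^1_0 because a
    test function close to some [u k] is close to it. *)
Lemma H10_complete : complete_on (H10 Om) (energy Om beta).
Proof.
move=> u Hu Cu; have H n := H10_H1 (Hu n).
have HB n k := lsB H10_set (Hu n) (Hu k).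
have cw e : axis e -> exists2 g, l2 g & ipO (wd e (u n) - g) (wd e (u n) - g) @[n --> \oo] --> (0 : R).
  move=> he; apply: (sq_complete mOm fOm) => [n|eps e0]; first exact: wd_l2.
  have em : 0 < m * eps by rewrite mulr_gt0.
  have [K HK] := Cu _ em; exists K => n k Kn Kk.
  have -> : ipO (wd e (u n) - wd e (u k)) (wd e (u n) - wd e (u k)) =
      ipO (wd e (u n - u k)) (wd e (u n - u k)).
    apply: ipO_ae; [by apply: l2B; exact: wd_l2|by apply: wd_l2 => //; exact: H10_H1|].
    by apply: ae_sub (wdB he (H n) (H k)) => p h /h.
  apply: le_lt_trans (wd_le_energy he (H10_H1 (HB n k))) _.
  by rewrite ltr_pdivrMl// HK.
have [g1 lg1 c1] := cw _ (or_introl erefl); have [g2 lg2 c2] := cw _ (or_intror erefl).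
pose K := (2 * (xE Q - xW Q)) ^+ 2.
have gm v : H1 Om v -> gradsq v <= m^-1 * energy Om beta v v.
  move=> Hv; have /andP[h _] := energy_bounds mb (ltW m0) bb Hv.
  by rewrite ler_pdivlMl.
have [u0 lu0 c0] : exists2 u0, l2 u0 & ipO (u n - u0) (u n - u0) @[n --> \oo] --> (0 : R).
  apply: (sq_complete mOm fOm) => [n|eps e0]; first exact: H1_l2.
  have K0 : 0 < K + 1 by rewrite ltr_wpDl// sqr_ge0.
  have em : 0 < m * (eps / (K + 1)) by rewrite mulr_gt0// divr_gt0.
  have [k0 HK] := Cu _ em; exists k0 => n k Kn Kk.
  apply: le_lt_trans (poincare_gradsq (HB n k)) _; rewrite -/K.
  have e1 := HK n k Kn Kk; have e2 := gm _ (H10_H1 (HB n k)).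
  have e3 : gradsq (u n - u k) < eps / (K + 1).
    by apply: le_lt_trans e2 _; rewrite ltr_pdivrMl.
  have g0 : 0 <= gradsq (u n - u k).
    by apply: addr_ge0; apply: ge0_ip => //; [left|exact: H10_H1|right|exact: H10_H1].
  apply: (@le_lt_trans _ _ ((K + 1) * gradsq (u n - u k))).
    by rewrite ler_wpM2r// lerDl.
  by rewrite -ltr_pdivlMl// mulrC.
have w1 : isw e1 u0 g1.
  by apply: (isw_lim (or_introl erefl) (fun n => H1_l2 (H n)) _ lu0 lg1 c0 c1) => n; apply: H1_wd => //; left.
have w2 : isw e2 u0 g2.
  by apply: (isw_lim (or_intror erefl) (fun n => H1_l2 (H n)) _ lu0 lg2 c0 c2) => n; apply: H1_wd => //; right.
have H0 : H1 Om u0 by split=> //; [exists g1|exists g2].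
have cg e g : axis e -> l2 g -> isw e u0 g ->
    ipO (wd e (u n) - g) (wd e (u n) - g) @[n --> \oo] --> (0 : R) ->
    ipO (wd e (u n - u0)) (wd e (u n - u0)) @[n --> \oo] --> (0 : R).
  move=> he lg wg; have -> // : (fun n => ipO (wd e (u n) - g) (wd e (u n) - g)) =
    (fun n => ipO (wd e (u n - u0)) (wd e (u n - u0))).
  apply/funext => n; apply: ipO_ae.
  - by apply: l2B => //; exact: wd_l2.
  - by apply: wd_l2 => //; exact: (lsB (H1_set HW HS)).
  - apply: ae_sub2 (wdB he (H n) H0) (wd_eq HW HS he H0 wg) => p h1 h2 Op.
    rewrite (h1 Op); have -> : (wd e (u n) - g) p = wd e (u n) p - g p by [].
    by rewrite -(h2 Op).
have cG : gradsq (u n - u0) @[n --> \oo] --> (0 : R).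
  rewrite -(addr0 0); apply: cvgD; [exact: (cg _ _ (or_introl erefl) lg1)|exact: (cg _ _ (or_intror erefl) lg2)].
have HBd n := lsB (H1_set HW HS) (H n) H0.
exists u0.
  apply/H10P; split=> // eps e0; have e2 : 0 < (eps / 2) ^+ 2 by rewrite exprn_gt0// divr_gt0.
  have cN : N (u n - u0) (u n - u0) @[n --> \oo] --> (0 : R).
    rewrite -(addr0 0); apply: cvgD => //.
    by under eq_fun do rewrite energy1E//; exact: cG.
  have [k _ Hk] := cvg_near cN e2; have := Hk k (leqnn _); rewrite /= subr0 => Nk.
  have [_ au] := (H10P (u k)).1 (Hu k); have e4 : 0 < eps / 2 by rewrite divr_gt0.
  have [z [tz zu]] := au _ e4; exists z; split=> //.
  have Hz := test_H1 HW HS tz.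
  apply: le_lt_trans (seminorm_dist si_N H0 (H k) Hz) _.
  rewrite (_ : eps = eps / 2 + eps / 2); last by field.
  apply: (ltrD _ zu); rewrite (seminorm_distC si_N H0 (H k)).
  rewrite -ltr_sqr; [|by rewrite nnegrE seminorm_ge0|by rewrite nnegrE ltW].
  rewrite (seminorm_sqr si_N (HBd k)).
  exact: le_lt_trans (ler_norm _) Nk.
have M0 : 0 <= `|M| := normr_ge0 M.
apply: (@squeeze_cvgr _ _ _ _ (fun=> 0) (fun n => M * gradsq (u n - u0))).
- apply: nearW => n; rewrite (si_ge0 (energy_si HW HS mb (ltW m0) bb))//=.
  by have /andP[_ h] := energy_bounds mb (ltW m0) bb (HBd n).
- exact: cvg_cst.
- by rewrite -(mulr0 M); apply: cvgMr.
Qed.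
End Complete.
End SobolevZero.

(** * Density of test functions and its consequences *)

Section Approximation.
Local Opaque weak_derivative e1 e2.
Context {R : realType}.
Variable Q : rectangle R.
Hypotheses (HW : xW Q < xE Q) (HS : yS Q < yN Q).
Local Notation Om := (Omega Q).
Local Notation MP := (measurableTypeR R * measurableTypeR R)%type.
Local Notation mu := (@plane_measure R).
Local Notation mOm := (measurable_Omega Q).
Local Notation fOm := (finite_Omega HW HS).
Local Notation l2 := (@sq_integrable _ MP R mu Om).
Local Notation ipO := (@ip _ MP R mu Om).
Local Notation wd := (weak_derivative Om).
Local Notation test := (test_function Om).
Local Notation S := (ip_semi_inner mOm fOm).
Local Notation l2B := (lsB (sq_linear_set mOm fOm)).
Local Notation nrm := (seminorm ipO).
Implicit Types (p q e : R * R) (u v w z g h : R * R -> R).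

(** Riesz representation on the non-closed subspace of test functions: the representative of the
    pairing with [X0] is a limit of test functions, and its difference to [X0] is orthogonal to all
    of them, hence null. *)
Lemma l2_density X0 : l2 X0 -> exists2 z : nat -> R * R -> R,
  forall n, test (z n) & nrm (z n - X0) @[n --> \oo] --> (0 : R).
Proof.
move=> lX.
have lin : linear_on test (ipO X0).
  by move=> c u v tu tv; apply: (si_linear_onr S lX); exact: test_l2.
have bd u : test u -> `|ipO X0 u| <= nrm X0 * nrm u.
  by move=> tu; apply: (si_CS_norm S lX); exact: test_l2.
have [w [lw Hw [z tz cz]]] := riesz S (sq_complete mOm fOm) (test_set Q)
  (fun u => @test_l2 R Q HW HS u) lin bd.
exists z => //.
have ld : l2 (w - X0) by exact: l2B.
have e0 y : test y -> \int[mu]_(p in Om) ((w - X0) p * y p) = 0.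
  move=> ty; have := linear_onB (sq_linear_set mOm fOm)
    (si_linear_on S (test_l2 HW HS ty)) lw lX.
  by rewrite /= (Hw _ ty) subrr.
have wX : {ae mu, forall p, Om p -> w p = X0 p}.
  apply: ae_sub (fundamental_lemma (sq_rint mOm fOm ld) e0) => p hp Op.
  by apply/eqP; rewrite -subr_eq0; apply/eqP; exact: hp.
have E n : nrm (z n - w) = nrm (z n - X0).
  have lz := test_l2 HW HS (tz n).
  apply: (nrm_ae HW HS); [exact: l2B|exact: l2B|].
  apply: ae_sub wX => p h Op.
  by have -> : (z n - w) p = z n p - w p by []; rewrite (h Op).
by under eq_fun do rewrite -E.
Qed.

(** The uniform bound allows [X0] to be replaced by a nearby test function. Consistency of the
    scheme thus has to be checked against smooth functions only. *)
Lemma weak_l2 (f : nat -> R * R -> R) (C : R) X0 :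
  (forall n, l2 (f n)) -> (forall n, nrm (f n) <= C) ->
  (forall z, test z -> ipO z (f n) @[n --> \oo] --> (0 : R)) -> l2 X0 ->
  ipO X0 (f n) @[n --> \oo] --> (0 : R).
Proof.
move=> lf fC ft lX; have [z tz cz] := l2_density lX.
have C0 : 0 <= C by apply: le_trans (fC 0%N); exact: seminorm_ge0.
apply: near_cvg => e e0.
have d0 : 0 < e / (2 * (C + 1)) by rewrite divr_gt0// mulr_gt0// ltr_wpDl.
have [k _ Hk] := cvg_near cz d0; have := Hk k (leqnn _).
rewrite /= subr0 (ger0_norm (seminorm_ge0 _ _)) => zk.
have e2 : 0 < e / 2 by rewrite divr_gt0.
have [K0 _ HK0] := cvg_near (ft _ (tz k)) e2; exists K0 => // n /HK0 /=; rewrite !subr0 => h.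
have lz := test_l2 HW HS (tz k); have ld := l2B lX lz.
have -> : X0 = (X0 - z k) + z k by rewrite subrK.
rewrite (linear_onD (si_linear_on S (lf n)) ld lz).
apply: le_trans (ler_normD _ _) _.
have h2 : `|ipO (X0 - z k) (f n)| <= e / (2 * (C + 1)) * C.
  apply: le_trans (si_CS_norm S ld (lf n)) _; apply: ler_pM => //; rewrite ?seminorm_ge0//.
  by rewrite (seminorm_distC S lX lz) ltW.
have h3 : e / (2 * (C + 1)) * C <= e / 2.
  have -> : e / (2 * (C + 1)) * C = e / 2 * (C / (C + 1)).
    by field; rewrite gt_eqF// ltr_wpDl.
  by rewrite ger_pMr// ler_pdivrMr ?ltr_wpDl// mul1r lerDl.
rewrite (_ : e = e / 2 + e / 2); last by field.
exact: lerD (le_trans h2 h3) (ltW h).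
Qed.

Lemma cvg_sqr0 (u : nat -> R * R -> R) : (forall n, l2 (u n)) ->
  nrm (u n) @[n --> \oo] --> (0 : R) -> ipO (u n) (u n) @[n --> \oo] --> (0 : R).
Proof.
move=> lu c; have -> : (fun n => ipO (u n) (u n)) = (fun n => nrm (u n) * nrm (u n)).
  by apply/funext => n; rewrite -expr2 (seminorm_sqr S).
by rewrite -(mul0r 0); apply: cvgM.
Qed.

Lemma H10_approx u : H10 Om u -> exists z : nat -> R * R -> R,
  [/\ forall n, test (z n), ipO (z n - u) (z n - u) @[n --> \oo] --> (0 : R) &
  forall e, axis e ->
    ipO ((fun p => 'D_e (z n) p) - wd e u) ((fun p => 'D_e (z n) p) - wd e u)
      @[n --> \oo] --> (0 : R)].
Proof.
move=> Hu0; have [Hu au] := (H10P HW HS u).1 Hu0.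
pose N := (fun u v => ipO u v + energy Om (fun=> 1) u v).
have /choice[z Hz] : forall n, exists z, test z /\ seminorm N (u - z) < n.+1%:R^-1.
  by move=> n; apply: au; rewrite invr_gt0.
exists z.
have tz n : test (z n) := (Hz n).1.
have HH n := test_H1 HW HS (tz n).
have Hd n := lsB (H1_set HW HS) Hu (HH n).
have sq (f : nat -> R * R -> R) : (forall n, l2 (f n)) ->
    (forall n, nrm (f n) <= seminorm N (u - z n)) ->
    ipO (f n) (f n) @[n --> \oo] --> (0 : R).
  move=> lf fN; apply: cvg_sqr0 => //.
  apply: (@squeeze_cvgr _ _ _ _ (fun=> 0) (fun n => n.+1%:R^-1)).
  - apply: nearW => n; rewrite seminorm_ge0 /=.
    by apply: le_trans (fN n) _; apply: ltW; exact: (Hz n).2.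
  - exact: cvg_cst.
  - exact: cvg_harmonic.
split=> //.
- apply: sq => n; first by apply: l2B; [exact: test_l2|exact: H1_l2].
  rewrite (seminorm_distC S (H1_l2 (HH n)) (H1_l2 Hu)).
  exact: nrm_le_nN.
- move=> e he; have [tD _] : (forall n, test (fun p => 'D_e (z n) p)) /\ True.
    by split=> // n; have [] := test_derive he (tz n).
  have lw := wd_l2 he Hu.
  apply: sq => n; first by apply: l2B => //; exact: test_l2.
  rewrite (seminorm_distC S (test_l2 HW HS (tD n)) lw).
  have -> : nrm (wd e u - (fun p => 'D_e (z n) p)) = nrm (wd e (u - z n)).
    apply: (nrm_ae HW HS); [by apply: l2B => //; exact: test_l2|exact: wd_l2|].
    apply: ae_sub2 (wdB HW HS he Hu (HH n)) (wd_test HW HS he (tz n)) => p h1 h2 Op.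
    rewrite (h1 Op); have -> : (wd e u - wd e (z n)) p = wd e u p - wd e (z n) p by [].
    by rewrite (h2 Op).
  exact: wd_le_nN.
Qed.

(** For a test function in place of [psi] this is [ibp] applied to its product with [G]; both sides
    are continuous for the convergence in [H10_approx]. *)
Lemma ibp_H10 e psi (G G1 : R * R -> R) zeta (C : R) : axis e -> H10 Om psi ->
  (forall p, Om p -> is_derive p e G (G1 p)) ->
  {in Om, continuous G} -> {in Om, continuous G1} ->
  (forall p, Om p -> `|G p| <= C) -> (forall p, Om p -> `|G1 p| <= C) ->
  test zeta ->
  ipO psi (fun p => G p * 'D_e zeta p) =
    - (ipO (wd e psi) (fun p => G p * zeta p) + ipO psi (fun p => G1 p * zeta p)).
Proof.
move=> he Hpsi dG cG cG1 GC G1C tzeta.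
have H := H10_H1 Hpsi; have lp := H1_l2 H; have lw := wd_l2 he H.
have [tDz dzeta] := test_derive he tzeta.
have mG := Omega_measurable cG; have mG1 := Omega_measurable cG1.
have l1 := l2_bounded_mul mG GC (test_l2 HW HS tDz).
have l2' := l2_bounded_mul mG GC (test_l2 HW HS tzeta).
have l3 := l2_bounded_mul mG1 G1C (test_l2 HW HS tzeta).
have [z [tz cz cD]] := H10_approx Hpsi.
have lz n := test_l2 HW HS (tz n).
have tD n : test (fun p => 'D_e (z n) p) by have [] := test_derive he (tz n).
have lD n := test_l2 HW HS (tD n).
have c1 := cvg_si S lz lp l1 cz.
have c2 : - (ipO (fun p => 'D_e (z n) p) (fun p => G p * zeta p) +
     ipO (z n) (fun p => G1 p * zeta p)) @[n --> \oo] -->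
   - (ipO (wd e psi) (fun p => G p * zeta p) + ipO psi (fun p => G1 p * zeta p)).
  apply: cvgN; apply: cvgD; first exact: (cvg_si S lD lw l2' (cD e he)).
  exact: (cvg_si S lz lp l3 cz).
have E : (fun n => ipO (z n) (fun p => G p * 'D_e zeta p)) =
   (fun n => - (ipO (fun p => 'D_e (z n) p) (fun p => G p * zeta p) +
     ipO (z n) (fun p => G1 p * zeta p))).
  apply/funext => n; apply/eqP; rewrite -addr_eq0; apply/eqP.
  have [_ dz] := test_derive he (tz n).
  have cu : {in Om, continuous (fun p => z n p * G p)}.
    by move=> p Op; apply: cvgM; [exact: (test_continuous (tz n))|exact: cG].
  have cu1 : {in Om, continuous (fun p => 'D_e (z n) p * G p + z n p * G1 p)}.
    move=> p Op; apply: cvgD; apply: cvgM; [exact: (test_continuous (tD n))|exact: cG|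
      exact: (test_continuous (tz n))|exact: cG1].
  rewrite -[RHS](ibp HW HS he (fun p Op => is_derive_mul (dz p) (dG p Op)) cu cu1 tzeta).
  have i1 := sq_mul mOm (lz n) l1; have i2 := sq_mul mOm (lD n) l2'; have i3 := sq_mul mOm (lz n) l3.
  rewrite /ip -(RintegralD mOm i2 i3) -(RintegralD mOm i1 (rintD mOm i2 i3)).
  have F (a b c d x y : R) : a * (b * c) + (d * (b * x) + a * (y * x)) =
     (d * b + a * y) * x + a * b * c by ring.
  by apply: eq_Rintegral => p _; exact: F.
by rewrite E in c1; exact: (cvg_unique (@Rhausdorff R) c1 c2).
Qed.
End Approximation.

Section RintegralSum.
Context {d : measure_display} {T : measurableType d} {R : realType}.
Variables (mu : {measure set T -> \bar R}) (D : set T).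
Hypothesis mD : measurable D.

Lemma Rintegral_sum (I : Type) (r : seq I) (f : I -> T -> R) :
  (forall i, mu.-integrable D (EFin \o f i)) ->
  mu.-integrable D (EFin \o (fun x => \sum_(i <- r) f i x)) /\
  \int[mu]_(x in D) (\sum_(i <- r) f i x) = \sum_(i <- r) \int[mu]_(x in D) f i x.
Proof.
move=> hf; elim: r => [|i r [IH1 IH2]].
  under [X in EFin \o X]eq_fun do rewrite big_nil.
  rewrite big_nil; split; first exact: integrable0.
  by under eq_Rintegral do rewrite big_nil; rewrite Rintegral_cst// mul0r.
under [X in EFin \o X]eq_fun do rewrite big_cons.
split; first exact: (rintD mD).
by under eq_Rintegral do rewrite big_cons; rewrite big_cons RintegralD// IH2.
Qed.
End RintegralSum.

(** * Cells of a uniform subdivision of an interval *)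

Section Line.
Context {R : realType}.
Variables (a b : R) (n : nat).
Hypothesis ab : a < b.

Definition step_size : R := (b - a) / n.+1%:R.
Local Notation h := step_size.
Definition cell_index (x : R) : nat := Num.truncn ((x - a) / h).
Definition cell_frac (x : R) : R := (x - a) / h - (cell_index x)%:R.

Lemma step_size_gt0 : 0 < h.
Proof. by rewrite divr_gt0// subr_gt0. Qed.
Local Notation h0 := step_size_gt0.

Lemma step_sizeE : h * n.+1%:R = b - a.
Proof. by rewrite divfK// pnatr_eq0. Qed.

Lemma cell_itv x : a < x < b -> (cell_index x < n.+1)%N /\ 0 <= cell_frac x < 1.
Proof.
move=> /andP[ax xb].
have q0 : 0 <= (x - a) / h by rewrite divr_ge0 ?ltW ?h0// subr_gt0.
have /andP[t1 t2] := truncn_itv q0; split.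
  rewrite truncn_lt_nat// ltr_pdivrMr ?h0// mulrC step_sizeE.
  by rewrite ltrD2r.
by rewrite /cell_frac subr_ge0 t1 /= ltrBlDl -natr1 in t2 *.
Qed.

Lemma cell_decomp x : x = a + ((cell_index x)%:R + cell_frac x) * h.
Proof.
have E (k q : R) : k + (q - k) = q by ring.
by rewrite /cell_frac E divfK ?gt_eqF ?h0// addrC subrK.
Qed.

Lemma cell_index_eq k x (s : R) : 0 <= s < 1 -> x = a + (k%:R + s) * h ->
  cell_index x = k /\ cell_frac x = s.
Proof.
move=> /andP[s0 s1] ->.
have E : (a + (k%:R + s) * h - a) / h = k%:R + s.
  by rewrite addrAC subrr add0r mulfK// gt_eqF ?h0.
have ik : cell_index (a + (k%:R + s) * h) = k.
  by rewrite /cell_index E; apply: truncn_def; rewrite lerDl s0 -natr1 ltrD2l.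
by split=> //; rewrite /cell_frac ik E addrAC subrr add0r.
Qed.

(** Half-open in the fraction, as the integer part dictates, so that the whole cell is the case 0,
    1. *)
Definition subcell (k : nat) (al be : R) : set R :=
  [set x | [/\ a < x < b, cell_index x = k & al <= cell_frac x < be]].

Lemma subcellE k (al be : R) : 0 <= al -> be <= 1 ->
  subcell k al be = `]a, b[ `&` `[a + (k%:R + al) * h, a + (k%:R + be) * h[.
Proof.
move=> al0 be1; apply/seteqP; split => x /=; rewrite !in_itv /=.
  move=> [xab ik fr]; split=> //; have := cell_decomp x; rewrite ik.
  move: (cell_frac x) fr => f /andP[f1 f2] ->.
  by rewrite lerD2l ltrD2l ler_pM2r ?h0// ltr_pM2r ?h0// lerD2l ltrD2l f1 f2.
move=> [xab /andP[x1 x2]]; pose s := (x - a) / h - k%:R.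
have xE : x = a + (k%:R + s) * h.
  have E (q r : R) : q + (r - q) = r by ring.
  by rewrite /s E divfK ?gt_eqF ?h0// E.
move: x1 x2; rewrite {1 2}xE lerD2l ltrD2l ler_pM2r ?h0// ltr_pM2r ?h0// lerD2l ltrD2l => x1 x2.
have s01 : 0 <= s < 1 by rewrite (le_trans al0)//= (lt_le_trans x2).
by have [e1 e2] := cell_index_eq s01 xE; split=> //; rewrite e2 x1 x2.
Qed.

Lemma measurable_subcell k (al be : R) : 0 <= al -> be <= 1 ->
  measurable (subcell k al be).
Proof. by move=> ? ?; rewrite subcellE//; apply: measurableI; exact: measurable_itv. Qed.

Lemma subcell_measure k (al be : R) : (k < n.+1)%N -> 0 <= al -> al <= be -> be <= 1 ->
  lebesgue_measure (subcell k al be) = ((be - al) * h)%:E.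
Proof.
move=> kn al0 albe be1; rewrite subcellE//.
pose u := a + (k%:R + al) * h; pose w := a + (k%:R + be) * h; rewrite -/u -/w.
have wu : w - u = (be - al) * h by rewrite /w /u; ring.
have au : a <= u by rewrite lerDl mulr_ge0 ?addr_ge0 ?ler0n ?(ltW h0).
have uw : u <= w by rewrite -subr_ge0 wu mulr_ge0 ?subr_ge0 ?(ltW h0).
have wb : w <= b.
  rewrite /w -lerBrDl -step_sizeE [leRHS]mulrC ler_pM2r ?h0//.
  by rewrite -natr1; apply: lerD => //; rewrite ler_nat.
(* In the first cell the left end may be [a], which the open interval excludes; the measure is the
   same but the set is an open interval there. *)
have [au'|au'] := ltP a u.
  have -> : `]a, b[ `&` `[u, w[ = `[u, w[%classic.
    apply/seteqP; split => x /=; rewrite !in_itv /=; first by case.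
    by move=> /andP[x1 x2]; rewrite x1 x2 (lt_le_trans au')// (lt_le_trans x2).
  rewrite lebesgue_measure_itv /= lte_fin; case: ltP => [_|wu'].
    by rewrite -EFinB wu.
  by rewrite -wu (_ : w - u = 0)//; apply/eqP; rewrite subr_eq0 eq_le uw wu'.
have ua : u = a by apply/le_anti; rewrite au au'.
have -> : `]a, b[ `&` `[u, w[ = `]a, w[%classic.
  apply/seteqP; split => x /=; rewrite !in_itv /= ua; first by case=> /andP[-> _] /andP[].
  by move=> /andP[x1 x2]; rewrite x1 x2 (ltW x1) (lt_le_trans x2).
rewrite lebesgue_measure_itv /= lte_fin; case: ltP => [_|wu'].
  by rewrite -EFinB -wu ua.
by rewrite -wu (_ : w - u = 0)//; apply/eqP; rewrite subr_eq0 eq_le uw ua wu'.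
Qed.
End Line.

(** * Arrays as piecewise constant functions *)

Section GridIntegral.
Context {R : realType}.
Variable Q : rectangle R.
Hypotheses (HW : xW Q < xE Q) (HS : yS Q < yN Q).
Variables I J : nat.
Local Notation Om := (Omega Q).
Local Notation MP := (measurableTypeR R * measurableTypeR R)%type.
Local Notation mu := (@plane_measure R).
Local Notation mOm := (measurable_Omega Q).
Local Notation fOm := (finite_Omega HW HS).
Local Notation rint u := (mu.-integrable Om (EFin \o u)).
Implicit Types (p : R * R) (c : nat -> nat -> R).

Definition ix p := cell_index (xW Q) (xE Q) I p.1.
Definition iy p := cell_index (yS Q) (yN Q) J p.2.
Definition fx p := cell_frac (xW Q) (xE Q) I p.1.
Definition fy p := cell_frac (yS Q) (yN Q) J p.2.

(** Each cell carries the entry of its lower left corner. Sums over cells become integrals over the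
    rectangle, which puts arrays of all grids into one L^2 space. *)
Definition pc c p := c (ix p) (iy p).
Definition cellsum c : R := \sum_(0 <= i < I.+1) \sum_(0 <= j < J.+1) c i j * dx Q I * dy Q J.

(** Indicator of the same proportion of every cell at once; it allows estimates that are valid on
    only a part of each cell. *)
Definition subcells (al1 be1 al2 be2 : R) p : R :=
  ((al1 <= fx p < be1) && (al2 <= fy p < be2))%R%:R.

Lemma pc_subcellsE c (al1 be1 al2 be2 : R) p : Om p ->
  pc c p * subcells al1 be1 al2 be2 p =
  \sum_(0 <= i < I.+1) \sum_(0 <= j < J.+1)
    c i j * \1_(subcell (xW Q) (xE Q) I i al1 be1 `*` subcell (yS Q) (yN Q) J j al2 be2) p.
Proof.
move=> [p1 p2]; have [iI _] := cell_itv I HW p1; have [jJ _] := cell_itv J HS p2.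
rewrite !big_mkord (bigD1 (Ordinal iI))//= [X in _ + X]big1 ?addr0; last first.
  move=> i /eqP ni; rewrite big_mkord big1// => j _.
  rewrite indicE memNset ?mulr0// => -[[_ /= E _] _]; apply: ni.
  by apply/val_inj; rewrite /= -E.
rewrite big_mkord (bigD1 (Ordinal jJ))//= [X in _ + X]big1 ?addr0; last first.
  move=> j /eqP nj; rewrite indicE memNset ?mulr0// => -[_ [_ /= E _]]; apply: nj.
  by apply/val_inj; rewrite /= -E.
congr (_ * _); rewrite /subcells indicE; congr ((nat_of_bool _)%:R).
apply/idP/idP; last by move=> /set_mem[[_ _ /= h1] [_ _ /= h2]]; rewrite /fx /fy h1 h2.
by move=> /andP[h1 h2]; apply/mem_set; split; split.
Qed.

Lemma pc_subcells_integral c (al1 be1 al2 be2 : R) :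
  0 <= al1 -> al1 <= be1 -> be1 <= 1 -> 0 <= al2 -> al2 <= be2 -> be2 <= 1 ->
  let F := fun p => pc c p * subcells al1 be1 al2 be2 p in
  measurable_fun (Om : set MP) (F : MP -> R) /\
  \int[mu]_(p in Om) F p = (be1 - al1) * (be2 - al2) * cellsum c.
Proof.
move=> a10 ab1 b11 a20 ab2 b21 F.
pose X i : set (measurableTypeR R) := subcell (xW Q) (xE Q) I i al1 be1.
pose Y j : set (measurableTypeR R) := subcell (yS Q) (yN Q) J j al2 be2.
pose G i j p : R := c i j * \1_(X i `*` Y j) p.
have mXY i j : measurable (X i `*` Y j).
  by apply: measurableX; exact: measurable_subcell.
have iG i j : rint (G i j).
  apply: (rintZ mOm); apply: (rint_bounded mOm fOm (C := 1)).
    by apply: measurable_indic.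
  by move=> p _; rewrite indicE; case: (_ \in _); rewrite ?normr1 ?normr0.
have IG i j : (i < I.+1)%N -> (j < J.+1)%N ->
    \int[mu]_(p in Om) G i j p = c i j * ((be1 - al1) * dx Q I * ((be2 - al2) * dy Q J)).
  move=> iI jJ; rewrite /G RintegralZl//; [|exact: mOm|].
    congr (_ * _); rewrite /Rintegral integral_indic//; last exact: mOm.
    rewrite setIidl; last first.
      by move=> p [[h1 _ _] [h2 _ _]].
    rewrite plane_measure_rect; [|exact: measurable_subcell..].
    by rewrite !subcell_measure.
  apply: (rint_bounded mOm fOm (C := 1)); first exact: measurable_indic.
  by move=> p _; rewrite indicE; case: (_ \in _); rewrite ?normr1 ?normr0.
have S1 i := Rintegral_sum mOm (index_iota 0 J.+1) (iG i).
have S2 := Rintegral_sum mOm (index_iota 0 I.+1) (fun i => (S1 i).1).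
have FE p : Om p -> F p = \sum_(0 <= i < I.+1) \sum_(0 <= j < J.+1) G i j p.
  exact: pc_subcellsE.
split.
  apply: (eq_measurable_fun (fun p => \sum_(0 <= i < I.+1) \sum_(0 <= j < J.+1) G i j p)).
    by move=> p /set_mem /FE.
  exact: (rint_measurable S2.1).
rewrite (@eq_Rintegral _ _ _ mu Om (fun p => \sum_(0 <= i < I.+1) \sum_(0 <= j < J.+1) G i j p)); last first.
  by move=> p /set_mem /FE.
rewrite S2.2 /cellsum mulr_sumr !big_mkord; apply: eq_bigr => i _.
rewrite (S1 i).2 mulr_sumr !big_mkord; apply: eq_bigr => j _.
by rewrite IG//; ring.
Qed.

Lemma subcells01 p : Om p -> subcells 0 1 0 1 p = 1.
Proof.
move=> [p1 p2]; have [_ h1] := cell_itv I HW p1; have [_ h2] := cell_itv J HS p2.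
by rewrite /subcells /fx /fy h1 h2.
Qed.

Lemma pc_measurable c : measurable_fun (Om : set MP) (pc c : MP -> R).
Proof.
have [m _] := @pc_subcells_integral c 0 1 0 1 (lexx _) ler01 (lexx _) (lexx _) ler01 (lexx _).
apply: eq_measurable_fun m => p /set_mem Op.
by rewrite subcells01// mulr1.
Qed.

Lemma pc_integral c : \int[mu]_(p in Om) pc c p = cellsum c.
Proof.
have [_ E] := @pc_subcells_integral c 0 1 0 1 (lexx _) ler01 (lexx _) (lexx _) ler01 (lexx _).
have -> : cellsum c = (1 - 0) * (1 - 0) * cellsum c by rewrite subr0 !mul1r.
by rewrite -E; apply: eq_Rintegral => p /set_mem Op; rewrite subcells01// mulr1.
Qed.

Lemma pc_bounded c : exists C : R, forall p, Om p -> `|pc c p| <= C.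
Proof.
exists (\sum_(i < I.+1) \sum_(j < J.+1) `|c i j|) => p [p1 p2].
have [iI _] := cell_itv I HW p1; have [jJ _] := cell_itv J HS p2.
rewrite (bigD1 (Ordinal iI))//= (bigD1 (Ordinal jJ))//= -addrA lerDl.
by rewrite addr_ge0// sumr_ge0// => i _; rewrite sumr_ge0.
Qed.

Lemma pc_l2 c : @sq_integrable _ MP R mu Om (pc c).
Proof.
have [C HC] := pc_bounded c.
by apply: (sq_bounded mOm fOm (C := C)) => //; exact: pc_measurable.
Qed.

Lemma pc_index p : Om p -> (ix p <= I)%N /\ (iy p <= J)%N.
Proof.
by move=> [p1 p2]; have [iI _] := cell_itv I HW p1; have [jJ _] := cell_itv J HS p2.
Qed.

Lemma cellsum_le c c' : (forall i j, (i <= I)%N -> (j <= J)%N -> c i j <= c' i j) ->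
  cellsum c <= cellsum c'.
Proof.
move=> h; have d1 : 0 <= dx Q I by apply: ltW; exact: step_size_gt0.
have d2 : 0 <= dy Q J by apply: ltW; exact: step_size_gt0.
apply: ler_sum_nat => i /andP[_ iI]; apply: ler_sum_nat => j /andP[_ jJ].
by rewrite ler_wpM2r// ler_wpM2r// h.
Qed.
End GridIntegral.

(** * The mollified interpolant *)

Section Interpolation.
Context {R : realType}.
Variable Q : rectangle R.
Hypotheses (HW : xW Q < xE Q) (HS : yS Q < yN Q).
Local Notation Om := (Omega Q).
Implicit Types (p q : R * R) (d s t : R).

Lemma is_derive_bigsum (V : normedModType R) (K : Type) (r : seq K) (f : K -> V -> R)
    (k : K -> R) (x e : V) : (forall i, is_derive x e (f i) (k i)) ->
  is_derive x e (fun y => \sum_(i <- r) f i y) (\sum_(i <- r) k i).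
Proof.
move=> h; elim: r => [|i r IH].
  rewrite big_nil (_ : (fun y => _) = fun=> 0); first exact: is_derive_cst.
  by apply/funext => y; rewrite big_nil.
apply: (is_derive_ext (is_derive_add (h i) IH)) => [y|]; by rewrite big_cons.
Qed.

(** With the unbent ramp, clamped to [0, 1], this is the usual tent function on [-1, 1]. Writing it
    as a difference of ramps makes consecutive hats add up to 1 on a cell whatever the bending. *)
Definition hat d s := ramp d (1 + s) - ramp d s.
Definition dhat d s := dramp d (1 + s) - dramp d s.

Lemma is_derive_hat d (u : R * R -> R) p e (l : R) : is_derive p e u l ->
  is_derive p e (fun q => hat d (u q)) (dhat d (u p) * l).
Proof.
move=> hu; have h1 : is_derive p e (fun q => 1 + u q) (0 + l).
  by apply: (is_derive_add (f := fun=> 1)); exact: is_derive_cst.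
have a1 := is_derive_comp (u := fun q => 1 + u q) (is_derive_ramp d _) h1.
have a2 := is_derive_comp (u := u) (is_derive_ramp d _) hu.
apply: (is_derive_ext (is_derive_sub a1 a2)) => [//|].
by rewrite add0r /dhat mulrBl.
Qed.

Section Width.
Variable d : R.
Hypotheses (d0 : 0 < d) (d4 : d <= 4^-1).

Lemma hat_out s : s <= -1 + d / 2 \/ 1 - d / 2 <= s -> hat d s = 0.
Proof.
have d2 : 0 < d / 2 by rewrite divr_gt0.
have d8 : d / 2 <= 8^-1 by rewrite ler_pdivrMr// (le_trans d4)//; lra.
rewrite /hat; case=> h.
  by rewrite !(ramp0 d0 d4) ?subrr//; lra.
by rewrite !(ramp1 d0 d4) ?subrr//; lra.
Qed.

Lemma dhat_out s : s <= -1 \/ 1 <= s -> dhat d s = 0.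
Proof.
have d2 : 0 < d / 2 by rewrite divr_gt0.
rewrite /dhat; case=> h.
  by rewrite !(dramp_out d0 d4) ?subrr//; left; lra.
by rewrite !(dramp_out d0 d4) ?subrr//; right; lra.
Qed.

Lemma hat_itv s : 0 <= s < 1 ->
  [/\ hat d s = 1 - ramp d s, hat d (s - 1) = ramp d s,
      dhat d s = - dramp d s & dhat d (s - 1) = dramp d s].
Proof.
move=> /andP[s0 s1]; have d2 : 0 < d / 2 by rewrite divr_gt0.
have E : 1 + (s - 1) = s by ring.
rewrite /hat /dhat E; split.
- by rewrite (ramp1 d0 d4)//; lra.
- by rewrite (ramp0 d0 d4 (t := s - 1)) ?subr0//; lra.
- by rewrite (dramp_out d0 d4 (t := 1 + s)) ?sub0r//; right; lra.
- by rewrite (dramp_out d0 d4 (t := s - 1)) ?subr0//; left; lra.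
Qed.
End Width.

(** Only the hats of the two nodes bounding the cell are nonzero at a point of it. *)
Lemma local_sum (w : R -> R) (c : nat -> R) n i s :
  (forall t, t <= -1 \/ 1 <= t -> w t = 0) -> (i <= n)%N -> 0 <= s < 1 ->
  \sum_(0 <= k < n.+2) c k * w (i%:R + s - k%:R) = c i * w s + c i.+1 * w (s - 1).
Proof.
move=> w0 iN /andP[s0 s1].
rewrite (big_cat_nat (n := i)) ?(leq_trans iN)//=; last by rewrite ltnW.
rewrite big_nat_cond big1 ?add0r; last first.
  move=> k; rewrite andbT => /andP[_ ki]; rewrite w0 ?mulr0//; right.
  by rewrite addrAC -[leLHS]addr0 lerD// -natrB ?(ltnW ki)// ler1n subn_gt0.
rewrite big_nat_recl ?(leq_trans iN)//.
rewrite big_ltn; last by rewrite ltnS.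
rewrite big_nat_cond big1 ?addr0; last first.
  move=> k; rewrite andbT => /andP[ik _]; rewrite w0 ?mulr0//; left.
  have : (i.+1%:R + 1 <= k.+1%:R :> R) by rewrite natr1 ler_nat.
  by move: s1; rewrite -(natr1 i); move: (i%:R) (k.+1%:R) => x y; lra.
have E : i%:R + s - i%:R = s by rewrite addrAC subrr add0r.
have E' : i%:R + s - i.+1%:R = s - 1 by rewrite -natr1; ring.
by rewrite E E'.
Qed.

Section OneGrid.
Variables I J : nat.
Implicit Types (v w psi : @gridfun R I J) (i j : nat).
Local Notation DX := (dx Q I).
Local Notation DY := (dy Q J).

(** At most 1/8, so the fractions between 1/8 and 7/8 are not bent, and tending to 0 under
    refinement, so the bent part is negligible in the limit. *)
Definition smoothing : R := (I + J + 8)%:R^-1.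
Local Notation d := smoothing.

Lemma smoothing_gt0 : 0 < d.
Proof. by rewrite invr_gt0 ltr0n addn_gt0 orbT. Qed.
Lemma smoothing_le : d <= 8^-1.
Proof. by rewrite lef_pV2 ?posrE ?ltr0n ?addn_gt0 ?orbT// ler_nat leq_addl. Qed.
Lemma smoothing_le4 : d <= 4^-1.
Proof. by apply: le_trans smoothing_le _; lra. Qed.
Local Notation d0 := smoothing_gt0.
Local Notation d4 := smoothing_le4.

Definition sx p := (p.1 - xW Q) / DX.
Definition sy p := (p.2 - yS Q) / DY.

Lemma dx_gt0 : 0 < DX. Proof. exact: step_size_gt0. Qed.
Lemma dy_gt0 : 0 < DY. Proof. exact: step_size_gt0. Qed.

(* Bilinear interpolation with the hat functions mollified at scale [d], so
   that the interpolant of a grid function in H10h is a test function. *)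
Definition interpolant v p :=
  \sum_(0 <= j < J.+2) (\sum_(0 <= i < I.+2) at_ v i j * hat d (sx p - i%:R))
    * hat d (sy p - j%:R).
Definition interpolant_x v p :=
  \sum_(0 <= j < J.+2) (\sum_(0 <= i < I.+2) at_ v i j * dhat d (sx p - i%:R)) / DX
    * hat d (sy p - j%:R).
Definition interpolant_y v p :=
  \sum_(0 <= j < J.+2) (\sum_(0 <= i < I.+2) at_ v i j * hat d (sx p - i%:R))
    * (dhat d (sy p - j%:R) / DY).

Lemma is_derive_sx p : is_derive p e1 sx DX^-1 /\ is_derive p e2 sx 0.
Proof.
split.
  have h := is_derive_sub (is_derive_fst1 p) (is_derive_cst (xW Q) p e1).
  apply: (is_derive_ext (is_derive_scale DX^-1 h)) => [x|]; last by rewrite subr0 mulr1.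
  by rewrite mulrC.
have h := is_derive_sub (is_derive_fst2 p) (is_derive_cst (xW Q) p e2).
apply: (is_derive_ext (is_derive_scale DX^-1 h)) => [x|]; last by rewrite subr0 mulr0.
by rewrite mulrC.
Qed.

Lemma is_derive_sy p : is_derive p e1 sy 0 /\ is_derive p e2 sy DY^-1.
Proof.
split.
  have h := is_derive_sub (is_derive_snd1 p) (is_derive_cst (yS Q) p e1).
  apply: (is_derive_ext (is_derive_scale DY^-1 h)) => [x|]; last by rewrite subr0 mulr0.
  by rewrite mulrC.
have h := is_derive_sub (is_derive_snd2 p) (is_derive_cst (yS Q) p e2).
apply: (is_derive_ext (is_derive_scale DY^-1 h)) => [x|]; last by rewrite subr0 mulr1.
by rewrite mulrC.
Qed.

Lemma is_derive_hats p e (k l : R) i j (u1 u2 : R * R -> R) :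
  is_derive p e u1 k -> is_derive p e u2 l ->
  is_derive p e (fun q => hat d (u1 q - i%:R)) (dhat d (u1 p - i%:R) * k) /\
  is_derive p e (fun q => hat d (u2 q - j%:R)) (dhat d (u2 p - j%:R) * l).
Proof.
move=> h1 h2; split.
  apply: (@is_derive_hat d (fun q => u1 q - i%:R)).
  apply: (is_derive_ext (is_derive_sub h1 (is_derive_cst (i%:R : R) p e))) => //.
  by rewrite subr0.
apply: (@is_derive_hat d (fun q => u2 q - j%:R)).
apply: (is_derive_ext (is_derive_sub h2 (is_derive_cst (j%:R : R) p e))) => //.
by rewrite subr0.
Qed.

Lemma is_derive_interpolant v p :
  is_derive p e1 (interpolant v) (interpolant_x v p) /\
  is_derive p e2 (interpolant v) (interpolant_y v p).
Proof.
have [x1 x2] := is_derive_sx p; have [y1 y2] := is_derive_sy p.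
split; apply: is_derive_bigsum => j.
  have [_ hy] := is_derive_hats 0 j x1 y1.
  have hx : is_derive p e1 (fun q => \sum_(0 <= i < I.+2) at_ v i j * hat d (sx q - i%:R))
      (\sum_(0 <= i < I.+2) at_ v i j * (dhat d (sx p - i%:R) * DX^-1)).
    by apply: is_derive_bigsum => i; apply: is_derive_scale; exact: (is_derive_hats i 0 x1 y1).1.
  apply: (is_derive_ext (is_derive_mul hx hy)) => //.
  rewrite !mulr0 addr0; congr (_ * _); rewrite mulr_suml.
  by apply: eq_bigr => i _; rewrite mulrA.
have [_ hy] := is_derive_hats 0 j x2 y2.
have hx : is_derive p e2 (fun q => \sum_(0 <= i < I.+2) at_ v i j * hat d (sx q - i%:R))
    (\sum_(0 <= i < I.+2) at_ v i j * (dhat d (sx p - i%:R) * 0)).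
  by apply: is_derive_bigsum => i; apply: is_derive_scale; exact: (is_derive_hats i 0 x2 y2).1.
apply: (is_derive_ext (is_derive_mul hx hy)) => //.
by rewrite [X in X * _ + _]big1 ?mul0r ?add0r// => i _; rewrite !mulr0.
Qed.

Lemma interpolant_smooth v : smooth setT (interpolant v).
Proof.
have Chat k (u : R * R -> R) : Ck k setT u -> Ck k setT (fun p => hat d (u p)).
  move=> hu; apply: Ck_sub; apply: Ck_ramp => //.
  by apply: Ck_add => //; exact: Ck_cst.
have Csx k : Ck k setT sx.
  by apply: Ck_mul; [apply: Ck_sub; [exact: Ck_fst|exact: Ck_cst]|exact: Ck_cst].
have Csy k : Ck k setT sy.
  by apply: Ck_mul; [apply: Ck_sub; [exact: Ck_snd|exact: Ck_cst]|exact: Ck_cst].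
move=> k; apply: Ck_sum => j; apply: Ck_mul.
  apply: Ck_sum => i; apply: Ck_scale; apply: Chat; apply: Ck_sub => //; exact: Ck_cst.
by apply: Chat; apply: Ck_sub => //; exact: Ck_cst.
Qed.

Lemma interpolant_linear (c : R) v w :
  interpolant (c *: v + w) = c *: interpolant v + interpolant w.
Proof.
apply/funext => p; rewrite !fctE /interpolant scaler_sumr -big_split /=.
apply: eq_bigr => j _.
have sE (x y : R) : x *: y = x * y by [].
rewrite sE mulrA -mulrDl mulr_sumr -big_split /=; congr (_ * _).
by apply: eq_bigr => i _; rewrite /at_ !mxE mulrA -mulrDl.
Qed.

Lemma grid_size : DX * I.+1%:R = xE Q - xW Q /\ DY * J.+1%:R = yN Q - yS Q.
Proof. by split; exact: step_sizeE. Qed.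

Lemma hat_sx_out p i : (1 <= i <= I)%N ->
  ~ (xW Q + d / 2 * DX <= p.1 <= xE Q - d / 2 * DX) -> hat d (sx p - i%:R) = 0.
Proof.
move=> /andP[i1 iI] h; apply: (hat_out d0 d4).
have [h1|h1] := ltP p.1 (xW Q + d / 2 * DX).
  left; have : sx p <= d / 2.
    by rewrite /sx ler_pdivrMr ?dx_gt0// lerBlDl; exact: ltW.
  have : 1 <= i%:R :> R by rewrite ler1n.
  by move: (sx p) (i%:R) (d) => x y z; lra.
right; have h2 : xE Q - d / 2 * DX < p.1.
  by rewrite ltNge; apply/negP => h2; apply: h; rewrite h1.
have : I.+1%:R - d / 2 <= sx p.
  rewrite /sx ler_pdivlMr ?dx_gt0// mulrBl [X in X - _]mulrC grid_size.1.
  by move: h2; move: (d / 2 * DX) => z; lra.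
have : i%:R + 1 <= I.+1%:R :> R by rewrite natr1 ler_nat.
by move: (sx p) (i%:R) (d) (I.+1%:R) => x y z w; lra.
Qed.

Lemma hat_sy_out p j : (1 <= j <= J)%N ->
  ~ (yS Q + d / 2 * DY <= p.2 <= yN Q - d / 2 * DY) -> hat d (sy p - j%:R) = 0.
Proof.
move=> /andP[i1 iI] h; apply: (hat_out d0 d4).
have [h1|h1] := ltP p.2 (yS Q + d / 2 * DY).
  left; have : sy p <= d / 2.
    by rewrite /sy ler_pdivrMr ?dy_gt0// lerBlDl; exact: ltW.
  have : 1 <= j%:R :> R by rewrite ler1n.
  by move: (sy p) (j%:R) (d) => x y z; lra.
right; have h2 : yN Q - d / 2 * DY < p.2.
  by rewrite ltNge; apply/negP => h2; apply: h; rewrite h1.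
have : J.+1%:R - d / 2 <= sy p.
  rewrite /sy ler_pdivlMr ?dy_gt0// mulrBl [X in X - _]mulrC grid_size.2.
  by move: h2; move: (d / 2 * DY) => z; lra.
have : j%:R + 1 <= J.+1%:R :> R by rewrite natr1 ler_nat.
by move: (sy p) (j%:R) (d) (J.+1%:R) => x y z w; lra.
Qed.

Lemma H10h_at v i j : H10h v -> (i <= I.+1)%N -> (j <= J.+1)%N ->
  (i = 0%N \/ i = I.+1 \/ j = 0%N \/ j = J.+1) -> at_ v i j = 0.
Proof.
move=> hv iI jJ h; apply: hv => //; rewrite /interior_point.
case: h => [->//|[->|[->|->]]]; first by rewrite ltnn andbF.
  by rewrite andbF.
by rewrite ltnn !andbF.
Qed.

(** Boundary nodes carry the value 0, and the hats of interior nodes end [d / 2] of a cell before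
    the boundary. The support therefore lies in a slightly smaller closed rectangle. *)
Lemma interpolant_test v : H10h v -> test_function Om (interpolant v).
Proof.
move=> hv; split; first exact: interpolant_smooth.
pose Q' := Rectangle (xW Q + d / 2 * DX) (xE Q - d / 2 * DX)
  (yS Q + d / 2 * DY) (yN Q - d / 2 * DY).
have dX : 0 < d / 2 * DX by rewrite mulr_gt0 ?dx_gt0// divr_gt0// d0.
have dY : 0 < d / 2 * DY by rewrite mulr_gt0 ?dy_gt0// divr_gt0// d0.
exists (Omega_bar Q'); split.
- exact: compact_Omega_bar.
- move=> p [/= /andP[h1 h2] /andP[h3 h4]]; split.
    by move: dX h1 h2; move: (d / 2 * DX) => z; lra.
  by move: dY h3 h4; move: (d / 2 * DY) => z; lra.
move=> p np; rewrite /interpolant big_nat_cond big1// => j; rewrite andbT => /andP[_ jJ].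
case jj : (1 <= j <= J)%N; last first.
  rewrite big_nat_cond big1 ?mul0r// => i; rewrite andbT => /andP[_ iI].
  by rewrite hv ?mul0r// /interior_point jj andbF.
have [h2|h2] := pselect (yS Q + d / 2 * DY <= p.2 <= yN Q - d / 2 * DY); last first.
  by rewrite (hat_sy_out jj h2) mulr0.
have h1 : ~ (xW Q + d / 2 * DX <= p.1 <= xE Q - d / 2 * DX) by move=> h1; apply: np.
rewrite big_nat_cond big1 ?mul0r// => i; rewrite andbT => /andP[_ iI].
case ii : (1 <= i <= I)%N; first by rewrite (hat_sx_out ii h1) mulr0.
by rewrite hv ?mul0r// /interior_point ii.
Qed.

Local Notation ix := (ix Q I).
Local Notation iy := (iy Q J).
Local Notation fx := (fx Q I).
Local Notation fy := (fy Q J).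
Local Notation rx p := (ramp d (fx p)).
Local Notation ry p := (ramp d (fy p)).

Lemma sxE p : sx p = (ix p)%:R + fx p /\ sy p = (iy p)%:R + fy p.
Proof. by split; rewrite addrC subrK. Qed.
Lemma frac_itv p : Om p -> 0 <= fx p < 1 /\ 0 <= fy p < 1.
Proof.
by move=> [p1 p2]; have [_ h1] := cell_itv I HW p1; have [_ h2] := cell_itv J HS p2.
Qed.

Lemma ramp_frac p : Om p -> 0 <= rx p <= 1 /\ 0 <= ry p <= 1.
Proof.
move=> /frac_itv[/andP[h1 h2] /andP[h3 h4]].
by split; apply: (ramp_itv d0 d4); rewrite ?h1 ?h3 ltW.
Qed.

Lemma row_sum v j p : Om p ->
  \sum_(0 <= i < I.+2) at_ v i j * hat d (sx p - i%:R) =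
    at_ v (ix p) j * (1 - rx p) + at_ v (ix p).+1 j * rx p /\
  (\sum_(0 <= i < I.+2) at_ v i j * dhat d (sx p - i%:R)) / DX =
    nabla_x Q v (ix p) j * dramp d (fx p).
Proof.
move=> Op; have [iI _] := pc_index HW HS I J Op; have [f1 _] := frac_itv Op.
have [E1 E2 E3 E4] := hat_itv d0 d4 f1.
have hd2 : 0 < d / 2 by rewrite divr_gt0// d0.
have hat1 t : t <= -1 \/ 1 <= t -> hat d t = 0.
  move=> ht; apply: (hat_out d0 d4); case: ht => ht; [left|right].
    by apply: (le_trans ht); rewrite lerDl ltW.
  by apply: le_trans ht; rewrite gerBl ltW.
split.
  rewrite -E1 -[X in _ + _ * X]E2 -(local_sum (fun i => at_ v i j) hat1 iI f1).
  by apply: eq_bigr => i _; rewrite (sxE p).1.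
have -> : \sum_(0 <= i < I.+2) at_ v i j * dhat d (sx p - i%:R) =
    \sum_(0 <= i < I.+2) at_ v i j * dhat d ((ix p)%:R + fx p - i%:R).
  by apply: eq_bigr => i _; rewrite (sxE p).1.
rewrite (@local_sum (dhat d) (fun i => at_ v i j) I)//; last exact: (dhat_out d0 d4).
rewrite E3 E4 /nabla_x; move: (dramp _ _) (_^-1) => x y; ring.
Qed.

(** Within a cell the mollification is a mere reparametrisation: ordinary bilinear interpolation
    evaluated at the bent fractions. *)
Lemma interpolantE v p : Om p ->
  [/\ interpolant v p =
        (at_ v (ix p) (iy p) * (1 - rx p) + at_ v (ix p).+1 (iy p) * rx p) * (1 - ry p)
        + (at_ v (ix p) (iy p).+1 * (1 - rx p) + at_ v (ix p).+1 (iy p).+1 * rx p) * ry p,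
      interpolant_x v p = dramp d (fx p) *
        ((1 - ry p) * nabla_x Q v (ix p) (iy p) + ry p * nabla_x Q v (ix p) (iy p).+1)
    & interpolant_y v p = dramp d (fy p) *
        ((1 - rx p) * nabla_y Q v (ix p) (iy p) + rx p * nabla_y Q v (ix p).+1 (iy p))].
Proof.
move=> Op; have [_ jJ] := pc_index HW HS I J Op; have [_ f2] := frac_itv Op.
have [E1 E2 E3 E4] := hat_itv d0 d4 f2.
have hd2 : 0 < d / 2 by rewrite divr_gt0// d0.
have hat1 t : t <= -1 \/ 1 <= t -> hat d t = 0.
  move=> ht; apply: (hat_out d0 d4); case: ht => ht; [left|right].
    by apply: (le_trans ht); rewrite lerDl ltW.
  by apply: le_trans ht; rewrite gerBl ltW.
have ys j : sy p - j%:R = (iy p)%:R + fy p - j%:R by rewrite (sxE p).2.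
split.
- rewrite /interpolant; under eq_bigr do rewrite ys.
  rewrite (local_sum _ hat1 jJ f2) !(row_sum v _ Op).1 E1 E2.
  by move: (rx p) (ry p) => x y; ring.
- rewrite /interpolant_x; under eq_bigr do rewrite ys.
  rewrite (local_sum _ hat1 jJ f2) !(row_sum v _ Op).2 E1 E2.
  by move: (dramp _ _) (ry p) => x y; ring.
rewrite /interpolant_y; under eq_bigr do rewrite ys mulrA.
rewrite -mulr_suml (local_sum _ (dhat_out d0 d4) jJ f2) !(row_sum v _ Op).1 E3 E4 /nabla_y.
by move: (dramp _ _) (rx p) (_^-1) => x y z; ring.
Qed.

Lemma interpolant_err v p : Om p ->
  `|interpolant v p - at_ v (ix p) (iy p)| <=
    DX * (`|nabla_x Q v (ix p) (iy p)| + `|nabla_x Q v (ix p) (iy p).+1|)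
    + DY * `|nabla_y Q v (ix p) (iy p)|.
Proof.
move=> Op; have [-> _ _] := interpolantE v Op; have [hx hy] := ramp_frac Op.
have nx i j : at_ v i.+1 j = at_ v i j + DX * nabla_x Q v i j.
  by rewrite /nabla_x mulrC divfK ?gt_eqF ?dx_gt0//; ring.
have ny i j : at_ v i j.+1 = at_ v i j + DY * nabla_y Q v i j.
  by rewrite /nabla_y mulrC divfK ?gt_eqF ?dy_gt0//; ring.
rewrite !nx ny; move: (rx p) (ry p) hx hy (at_ v _ _) => x y hx hy v0.
move: (nabla_x _ _ _ _) (nabla_x _ _ _ _) (nabla_y _ _ _ _) => a' a c.
(* Expanding around the corner value leaves the increments with the weights x (1 - y), x y and y,
   all between 0 and 1. *)
have -> : (v0 * (1 - x) + (v0 + DX * a) * x) * (1 - y)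
    + ((v0 + DY * c) * (1 - x) + (v0 + DY * c + DX * a') * x) * y - v0
  = x * (1 - y) * (DX * a) + x * y * (DX * a') + y * (DY * c) by ring.
have n1 t : 0 <= t <= 1 -> `|t| <= 1 by move=> /andP[t0 t1]; rewrite ger0_norm.
have n2 s t u : `|s| <= 1 -> `|t| <= 1 -> `|s * t * u| <= `|u|.
  by move=> hs ht; rewrite !normrM ler_piMl// mulr_ile1.
have hx1 := n1 _ hx; have hy1 := n1 _ hy.
have hy2 : `|1 - y| <= 1.
  by move: hy => /andP[? ?]; rewrite n1// subr_ge0 lerBlDr lerDl; apply/andP.
have P1 := n2 x (1 - y) (DX * a) hx1 hy2.
have P2 := n2 x y (DX * a') hx1 hy1.
have P3 : `|y * (DY * c)| <= `|DY * c| by rewrite normrM ler_piMl.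
apply: (le_trans (ler_normD _ _)); apply: lerD.
  rewrite [leRHS]mulrDr; apply: (le_trans (ler_normD _ _)); apply: lerD.
    by apply: (le_trans P1); rewrite normrM (gtr0_norm dx_gt0).
  by apply: (le_trans P2); rewrite normrM (gtr0_norm dx_gt0).
by apply: (le_trans P3); rewrite normrM (gtr0_norm dy_gt0).
Qed.

Lemma nabla_x_boundary v i j : H10h v -> (i <= I)%N -> (j = 0%N \/ j = J.+1) ->
  nabla_x Q v i j = 0.
Proof.
move=> hv iI h; rewrite /nabla_x !(H10h_at hv) ?subrr ?mul0r//; try by case: h => ->.
- exact: leqW.
- by case: h => ->; auto.
- by case: h => ->; auto.
Qed.

Lemma nabla_y_boundary v i j : H10h v -> (j <= J)%N -> (i = 0%N \/ i = I.+1) ->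
  nabla_y Q v i j = 0.
Proof.
move=> hv iI h; rewrite /nabla_y !(H10h_at hv) ?subrr ?mul0r//; try by case: h => ->.
- exact: leqW.
- by case: h => ->; auto.
- by case: h => ->; auto.
Qed.

(** Shifting an array by one row exchanges the bottom row for the top one, and both vanish. *)
Lemma cellsum_shift_y (c : nat -> nat -> R) :
  (forall i, (i <= I)%N -> c i 0%N = 0 /\ c i J.+1 = 0) ->
  cellsum Q I J (fun i j => c i j.+1) = cellsum Q I J c.
Proof.
move=> h; apply: eq_big_nat => i /andP[_ iI]; have [h0 h1] := h i iI.
rewrite big_nat_recr//= [RHS]big_nat_recl//= h0 h1 !mul0r addr0 add0r.
by [].
Qed.

Lemma cellsum_shift_x (c : nat -> nat -> R) :
  (forall j, (j <= J)%N -> c 0%N j = 0 /\ c I.+1 j = 0) ->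
  cellsum Q I J (fun i j => c i.+1 j) = cellsum Q I J c.
Proof.
move=> h; rewrite /cellsum big_nat_recr//= [RHS]big_nat_recl//=.
rewrite [X in _ + X]big_nat_cond [X in _ + X]big1 ?addr0; last first.
  by move=> j; rewrite andbT => /andP[_ jJ]; rewrite (h j jJ).2 !mul0r.
rewrite [X in _ = X + _]big_nat_cond [X in _ = X + _]big1 ?add0r// => j.
by rewrite andbT => /andP[_ jJ]; rewrite (h j jJ).1 !mul0r.
Qed.

End OneGrid.
End Interpolation.

(** From (u + w)^2 >= u^2 / 2 - w^2 with weights at least 3/4 and at most 1/4: the constants are
    (3/4)^2 / 2 and (1/4)^2. *)
Lemma bilinear_lower (R : realType) (t a a' : R) : 0 <= t <= 4^-1 ->
  9 / 32 * a ^+ 2 - 16^-1 * a' ^+ 2 <= ((1 - t) * a + t * a') ^+ 2.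
Proof.
move=> /andP[t0 t4]; set u := (1 - t) * a; set w := t * a'.
have h1 : u ^+ 2 / 2 - w ^+ 2 <= (u + w) ^+ 2.
  by have := sqr_ge0 (u / 2 + w); lra.
have h2 : 9 / 16 * a ^+ 2 <= u ^+ 2.
  rewrite /u exprMn ler_wpM2r ?sqr_ge0//.
  have -> : (9 / 16 : R) = (3 / 4) ^+ 2 by rewrite expr_div_n; congr (_ / _); ring.
  by rewrite ler_sqr ?nnegrE; lra.
have h3 : w ^+ 2 <= 16^-1 * a' ^+ 2.
  rewrite /w exprMn ler_wpM2r ?sqr_ge0//.
  have -> : (16^-1 : R) = (4^-1) ^+ 2 by rewrite exprVn; congr (_^-1); ring.
  by rewrite ler_sqr ?nnegrE; lra.
by move: h1 h2 h3; move: (_ ^+ 2) (u ^+ 2) (w ^+ 2) (a ^+ 2) (a' ^+ 2) => *; lra.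
Qed.

(** Convexity of the square. *)
Lemma bilinear_upper (R : realType) (C g t a a' : R) : 0 <= t <= 1 -> `|g| <= C ->
  (g * ((1 - t) * a + t * a')) ^+ 2 <= C ^+ 2 * (a ^+ 2 + a' ^+ 2).
Proof.
move=> /andP[t0 t1] hg; rewrite exprMn; apply: ler_pM; rewrite ?sqr_ge0//.
  by rewrite -real_normK ?num_real// ler_sqr ?nnegrE//; exact: le_trans hg.
have : ((1 - t) * a + t * a') ^+ 2 <= (1 - t) * a ^+ 2 + t * a' ^+ 2.
  rewrite -subr_ge0 (_ : _ - _ = t * (1 - t) * (a - a') ^+ 2); last by ring.
  by rewrite mulr_ge0 ?sqr_ge0// mulr_ge0// subr_ge0.
move/le_trans; apply; apply: lerD; rewrite ler_piMl ?sqr_ge0//.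
by rewrite gerBl.
Qed.

(** * Energy of the interpolant against the discrete energy *)

Section GridBounds.
Context {R : realType}.
Variable Q : rectangle R.
Hypotheses (HW : xW Q < xE Q) (HS : yS Q < yN Q).
Local Notation Om := (Omega Q).
Local Notation MP := (measurableTypeR R * measurableTypeR R)%type.
Local Notation mu := (@plane_measure R).
Local Notation mOm := (measurable_Omega Q).
Local Notation fOm := (finite_Omega HW HS).
Local Notation l2 := (@sq_integrable _ MP R mu Om).
Local Notation ipO := (@ip _ MP R mu Om).
Local Notation rint u := (mu.-integrable Om (EFin \o u)).
Local Notation wd := (weak_derivative Om).
Implicit Types (p q : R * R).
Local Opaque weak_derivative e1 e2.

Section OneGrid.
Variables I J : nat.
Implicit Types (v w psi : @gridfun R I J) (i j : nat) (c : nat -> nat -> R).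
Local Notation DX := (dx Q I).
Local Notation DY := (dy Q J).
Local Notation d := (@smoothing R I J).
Local Notation cellsum := (cellsum Q I J).
Local Notation pc := (pc Q I J).
Local Notation ax := (nabla_x Q).
Local Notation ay := (nabla_y Q).

Lemma cellsumD c c' : cellsum (fun i j => c i j + c' i j) = cellsum c + cellsum c'.
Proof.
rewrite /cellsum -big_split /=; apply: eq_bigr => i _; rewrite -big_split /=.
by apply: eq_bigr => j _; rewrite -!mulrDl.
Qed.

Lemma cellsumZ (k : R) c : cellsum (fun i j => k * c i j) = k * cellsum c.
Proof.
rewrite /cellsum mulr_sumr; apply: eq_bigr => i _; rewrite mulr_sumr.
by apply: eq_bigr => j _; rewrite !mulrA.
Qed.

Lemma eq_cellsum c c' : (forall i j, (i <= I)%N -> (j <= J)%N -> c i j = c' i j) ->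
  cellsum c = cellsum c'.
Proof.
move=> h; apply: eq_big_nat => i /andP[_ iI]; apply: eq_big_nat => j /andP[_ jJ].
by rewrite h.
Qed.

Lemma cellsum_ge0 c : (forall i j, 0 <= c i j) -> 0 <= cellsum c.
Proof.
move=> h; rewrite sumr_ge0// => i _; rewrite sumr_ge0// => j _.
by rewrite (mulr_ge0 (mulr_ge0 (h _ _) (ltW (dx_gt0 HW I))) (ltW (dy_gt0 HS J))).
Qed.

Lemma pc_ip c c' : ipO (pc c) (pc c') = cellsum (fun i j => c i j * c' i j).
Proof. by rewrite -(pc_integral HW HS). Qed.

Lemma pc_rint c : rint (pc c).
Proof.
have [C hC] := pc_bounded HW HS I J c.
by apply: (rint_bounded mOm fOm (C := C)) => //; exact: (pc_measurable HW HS).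
Qed.

(** Two parts of each cell, of relative area 1/16 each, are enough: [c] dominates in one and its
    neighbour [c'] in the other. Since both arrays have the same sum of squares, the negative terms
    are absorbed, and 2 (9/32 - 1/16) / 16 = 7/256 remains. *)
Lemma core_lower (D : R * R -> R) c c' (x1 x2 y1 y2 x1' x2' y1' y2' : R) :
  [/\ 0 <= x1, x1 <= x2, x2 <= 1, 0 <= y1 & y1 <= y2 <= 1] ->
  [/\ 0 <= x1', x1' <= x2', x2' <= 1, 0 <= y1' & y1' <= y2' <= 1] ->
  (x2 - x1) * (y2 - y1) = 16^-1 -> (x2' - x1') * (y2' - y1') = 16^-1 ->
  l2 D -> cellsum (fun i j => c' i j ^+ 2) = cellsum (fun i j => c i j ^+ 2) ->
  (forall p, Om p -> let A := pc c p ^+ 2 in let A' := pc c' p ^+ 2 in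
    (9 / 32 * A - 16^-1 * A') * subcells Q I J x1 x2 y1 y2 p
    + (9 / 32 * A' - 16^-1 * A) * subcells Q I J x1' x2' y1' y2' p <= D p ^+ 2) ->
  7 / 256 * cellsum (fun i j => c i j ^+ 2) <= ipO D D.
Proof.
move=> [a1 a2 a3 a4 /andP[a5 a6]] [b1 b2 b3 b4 /andP[b5 b6]] ar1 ar2 lD cc hD.
pose k i j := 9 / 32 * c i j ^+ 2 - 16^-1 * c' i j ^+ 2.
pose k' i j := 9 / 32 * c' i j ^+ 2 - 16^-1 * c i j ^+ 2.
have sub1 x y z t p : `|subcells Q I J x y z t p| <= 1.
  by rewrite /subcells; case: (_ && _); rewrite ?normr1 ?normr0.
have [m1 i1] := pc_subcells_integral HW HS I J k a1 a2 a3 a4 a5 a6.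
have [m2 i2] := pc_subcells_integral HW HS I J k' b1 b2 b3 b4 b5 b6.
have bnd f x y z t p C : (forall p, Om p -> `|pc f p| <= C) -> Om p ->
    `|pc f p * subcells Q I J x y z t p| <= C.
  by move=> h Op; rewrite normrM (le_trans (ler_piMr _ (sub1 _ _ _ _ _)))// h.
have [C1 h1] := pc_bounded HW HS I J k.
have [C2 h2] := pc_bounded HW HS I J k'.
have r1 := rint_bounded mOm fOm m1 (fun p Op => bnd _ _ _ _ _ p _ h1 Op).
have r2 := rint_bounded mOm fOm m2 (fun p Op => bnd _ _ _ _ _ p _ h2 Op).
have E : cellsum k + cellsum k' = 7 / 16 * cellsum (fun i j => c i j ^+ 2).
  have e1 : cellsum k = 9 / 32 * cellsum (fun i j => c i j ^+ 2)
      + (- 16^-1) * cellsum (fun i j => c' i j ^+ 2).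
    by rewrite -!cellsumZ -cellsumD; apply: eq_cellsum => i j _ _; rewrite /k mulNr.
  have e2 : cellsum k' = 9 / 32 * cellsum (fun i j => c' i j ^+ 2)
      + (- 16^-1) * cellsum (fun i j => c i j ^+ 2).
    by rewrite -!cellsumZ -cellsumD; apply: eq_cellsum => i j _ _; rewrite /k' mulNr.
  by rewrite e1 e2 cc; move: (cellsum _) => s; field.
have -> : 7 / 256 * cellsum (fun i j => c i j ^+ 2) =
    \int[mu]_(p in Om) (pc k p * subcells Q I J x1 x2 y1 y2 p
      + pc k' p * subcells Q I J x1' x2' y1' y2' p).
  rewrite RintegralD//; last exact: mOm.
  rewrite [X in _ = X + _]i1 [X in _ = _ + X]i2 ar1 ar2 -mulrDr E.
  by move: (cellsum _) => s; field.
apply: (le_Rintegral mOm); [exact: (rintD mOm r1 r2)|exact: (sq_mul mOm lD lD)|].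
by move=> p Op; exact: hD.
Qed.

Lemma interpolant_l2 v : H10h v ->
  [/\ l2 (interpolant_x Q v), l2 (interpolant_y Q v), H10 Om (interpolant Q v) &
   {ae mu, forall p, Om p -> wd e1 (interpolant Q v) p = interpolant_x Q v p} /\
   {ae mu, forall p, Om p -> wd e2 (interpolant Q v) p = interpolant_y Q v p}].
Proof.
move=> hv; have tv := interpolant_test HW HS hv.
have E1 : (fun p : R * R => 'D_e1 (interpolant Q v) p) = interpolant_x Q v.
  by apply/funext => p; have h := is_derive_interpolant Q v p; exact: (is_derive_val h.1).
have E2 : (fun p => 'D_e2 (interpolant Q v) p) = interpolant_y Q v.
  by apply/funext => p; have h := is_derive_interpolant Q v p; exact: (is_derive_val h.2).
have a1 : axis (e1 : R * R) by left.
have a2 : axis (e2 : R * R) by right.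
have t1 := (test_derive a1 tv).1; have t2 := (test_derive a2 tv).1.
rewrite E1 in t1; rewrite E2 in t2; split.
- exact: (test_l2 HW HS t1).
- exact: (test_l2 HW HS t2).
- exact: (test_H10 HW HS tv).
split.
  by apply: ae_sub (wd_test HW HS a1 tv) => p h Op; rewrite (h Op) -E1.
by apply: ae_sub (wd_test HW HS a2 tv) => p h Op; rewrite (h Op) -E2.
Qed.

Lemma nabla_x_shift v : H10h v ->
  cellsum (fun i j => ax v i j.+1 ^+ 2) = cellsum (fun i j => ax v i j ^+ 2).
Proof.
move=> hv; apply: (@cellsum_shift_y R Q I J (fun i j => ax v i j ^+ 2)) => i iI.
by rewrite !(nabla_x_boundary Q hv iI) ?expr0n//; auto.
Qed.

Lemma nabla_y_shift v : H10h v ->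
  cellsum (fun i j => ay v i.+1 j ^+ 2) = cellsum (fun i j => ay v i j ^+ 2).
Proof.
move=> hv; apply: (@cellsum_shift_x R Q I J (fun i j => ay v i j ^+ 2)) => j jJ.
by rewrite !(nabla_y_boundary Q hv jJ) ?expr0n//; auto.
Qed.

Local Notation d0 := (@smoothing_gt0 R I J).

Lemma ramp_core t : 8^-1 <= t <= 7 / 8 -> ramp d t = t /\ dramp d t = 1.
Proof.
move=> /andP[t1 t2]; have d8 := @smoothing_le R I J.
have h : d <= t <= 1 - d by apply/andP; split; move: d8 t1 t2; move: (smoothing _ _) => x; lra.
by rewrite (ramp_id d0 h) (dramp_id d0 h).
Qed.

(** With the x-fraction in [1/4, 3/4) the slope of the ramp is 1. The strip of y-fractions [1/8,
    1/4) gives the lower edge a weight of at least 3/4, and [3/4, 7/8) does so for the upper edge;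
    both strips lie in the unbent core. *)
Lemma interpolant_x_lower v : H10h v ->
  7 / 256 * cellsum (fun i j => ax v i j ^+ 2) <=
  ipO (interpolant_x Q v) (interpolant_x Q v).
Proof.
move=> hv; have [lx _ _ _] := interpolant_l2 hv.
apply: (@core_lower _ (ax v) (fun i j => ax v i j.+1)
   (4^-1) (3 / 4) (8^-1) (4^-1) (4^-1) (3 / 4) (3 / 4) (7 / 8)) => //.
- by split; lra.
- by split; lra.
- by field.
- by field.
- exact: nabla_x_shift.
move=> p Op; rewrite /= /subcells; have [_ -> _] := interpolantE HW HS v Op.
rewrite -/(pc (ax v) p) -/(pc (fun i j => ax v i j.+1) p).
move: (pc _ p) (pc _ p) (fx Q I p) (fy Q J p) => a a' x y.
case h1 : (4^-1 <= x < 3 / 4); rewrite /= ?mulr0 ?addr0 ?sqr_ge0//.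
have [_ ->] : ramp d x = x /\ dramp d x = 1 by apply: ramp_core; move: h1; lra.
rewrite mul1r; case h2 : (8^-1 <= y < 4^-1).
  have -> : (3 / 4 <= y < 7 / 8) = false by apply/negP; move: h2; lra.
  have [-> _] : ramp d y = y /\ dramp d y = 1 by apply: ramp_core; move: h2; lra.
  by rewrite mulr0 addr0 mulr1; apply: bilinear_lower; move: h2; lra.
rewrite mulr0 add0r; case h3 : (3 / 4 <= y < 7 / 8); last by rewrite mulr0 sqr_ge0.
have [-> _] : ramp d y = y /\ dramp d y = 1 by apply: ramp_core; move: h3; lra.
rewrite mulr1 [X in _ <= X ^+ 2]addrC; have := @bilinear_lower R (1 - y) a a'.
by rewrite subKr; apply; move: h3; lra.
Qed.

Lemma interpolant_y_lower v : H10h v ->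
  7 / 256 * cellsum (fun i j => ay v i j ^+ 2) <=
  ipO (interpolant_y Q v) (interpolant_y Q v).
Proof.
move=> hv; have [_ lx _ _] := interpolant_l2 hv.
apply: (@core_lower _ (ay v) (fun i j => ay v i.+1 j)
   (8^-1) (4^-1) (4^-1) (3 / 4) (3 / 4) (7 / 8) (4^-1) (3 / 4)) => //.
- by split; lra.
- by split; lra.
- by field.
- by field.
- exact: nabla_y_shift.
move=> p Op; rewrite /= /subcells; have [_ _ ->] := interpolantE HW HS v Op.
rewrite -/(pc (ay v) p) -/(pc (fun i j => ay v i.+1 j) p).
move: (pc _ p) (pc _ p) (fx Q I p) (fy Q J p) => a a' y x.
case h1 : (4^-1 <= x < 3 / 4); rewrite /= ?andbF ?mulr0 ?addr0 ?sqr_ge0// !andbT.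
have [_ ->] : ramp d x = x /\ dramp d x = 1 by apply: ramp_core; move: h1; lra.
rewrite mul1r; case h2 : (8^-1 <= y < 4^-1).
  have -> : (3 / 4 <= y < 7 / 8) = false by apply/negP; move: h2; lra.
  have [-> _] : ramp d y = y /\ dramp d y = 1 by apply: ramp_core; move: h2; lra.
  by rewrite mulr0 addr0 mulr1; apply: bilinear_lower; move: h2; lra.
rewrite mulr0 add0r; case h3 : (3 / 4 <= y < 7 / 8); last by rewrite mulr0 sqr_ge0.
have [-> _] : ramp d y = y /\ dramp d y = 1 by apply: ramp_core; move: h3; lra.
rewrite mulr1 [X in _ <= X ^+ 2]addrC; have := @bilinear_lower R (1 - y) a a'.
by rewrite subKr; apply; move: h3; lra.
Qed.

Lemma interpolant_x_upper v (C : R) : (forall t, `|dramp d t| <= C) -> H10h v ->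
  ipO (interpolant_x Q v) (interpolant_x Q v) <=
  2 * C ^+ 2 * cellsum (fun i j => ax v i j ^+ 2).
Proof.
move=> hC hv; have [lx _ _ _] := interpolant_l2 hv.
have -> : 2 * C ^+ 2 * cellsum (fun i j => ax v i j ^+ 2) =
    cellsum (fun i j => C ^+ 2 * (ax v i j ^+ 2 + ax v i j.+1 ^+ 2)).
  by rewrite cellsumZ cellsumD nabla_x_shift//; move: (cellsum _) => t; ring.
rewrite -(pc_integral HW HS); apply: (le_Rintegral mOm).
- exact: (sq_mul mOm lx lx).
- exact: pc_rint.
move=> p Op; have [_ -> _] := interpolantE HW HS v Op; rewrite -expr2.
by apply: bilinear_upper => //; exact: (ramp_frac HW HS I J Op).2.
Qed.

Lemma interpolant_y_upper v (C : R) : (forall t, `|dramp d t| <= C) -> H10h v ->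
  ipO (interpolant_y Q v) (interpolant_y Q v) <=
  2 * C ^+ 2 * cellsum (fun i j => ay v i j ^+ 2).
Proof.
move=> hC hv; have [_ lx _ _] := interpolant_l2 hv.
have -> : 2 * C ^+ 2 * cellsum (fun i j => ay v i j ^+ 2) =
    cellsum (fun i j => C ^+ 2 * (ay v i j ^+ 2 + ay v i.+1 j ^+ 2)).
  by rewrite cellsumZ cellsumD nabla_y_shift//; move: (cellsum _) => t; ring.
rewrite -(pc_integral HW HS); apply: (le_Rintegral mOm).
- exact: (sq_mul mOm lx lx).
- exact: pc_rint.
move=> p Op; have [_ _ ->] := interpolantE HW HS v Op; rewrite -expr2.
by apply: bilinear_upper => //; exact: (ramp_frac HW HS I J Op).1.
Qed.

Definition dirichlet v :=
  cellsum (fun i j => ax v i j ^+ 2) + cellsum (fun i j => ay v i j ^+ 2).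

Lemma interpolant_pc v : H10h v ->
  ipO (interpolant Q v - pc (at_ v)) (interpolant Q v - pc (at_ v)) <=
  6 * (DX ^+ 2 + DY ^+ 2) * dirichlet v.
Proof.
move=> hv; have [_ _ h _] := interpolant_l2 hv; have lT := H1_l2 (H10_H1 h).
have lB : l2 (interpolant Q v - pc (at_ v)).
  exact: (lsB (sq_linear_set mOm fOm) lT (pc_l2 HW HS I J (at_ v))).
(* The 3 comes from squaring a sum of three terms; a further factor 2 arises because each horizontal
   edge is counted from the cell above and the cell below. *)
set c := fun i j => 3 * (DX ^+ 2 * (ax v i j ^+ 2 + ax v i j.+1 ^+ 2) + DY ^+ 2 * ay v i j ^+ 2).
apply: (@le_trans _ _ (cellsum c)); last first.
  rewrite /c cellsumZ cellsumD !cellsumZ cellsumD nabla_x_shift// /dirichlet.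
  have : 0 <= cellsum (fun i j => ax v i j ^+ 2) by apply: cellsum_ge0 => *; exact: sqr_ge0.
  have : 0 <= cellsum (fun i j => ay v i j ^+ 2) by apply: cellsum_ge0 => *; exact: sqr_ge0.
  move: (cellsum _) (cellsum _) (DX ^+ 2) (DY ^+ 2) (sqr_ge0 DX) (sqr_ge0 DY).
  move=> s t x y x0 y0 s0 t0; rewrite -subr_ge0.
  rewrite (_ : _ - _ = 6 * (x * t) + 6 * (y * s) + 3 * (y * t)); last by ring.
  by rewrite !addr_ge0// mulr_ge0// mulr_ge0.
rewrite -(pc_integral HW HS); apply: (le_Rintegral mOm).
- exact: (sq_mul mOm lB lB).
- exact: pc_rint.
move=> p Op; rewrite -expr2 -real_normK ?num_real//.
have h1 : `|(interpolant Q v - pc (at_ v)) p| <= _ := interpolant_err HW HS v Op.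
apply: (le_trans (_ : _ <= (DX * (`|ax v (ix Q I p) (iy Q J p)|
   + `|ax v (ix Q I p) (iy Q J p).+1|) + DY * `|ay v (ix Q I p) (iy Q J p)|) ^+ 2)).
  by rewrite ler_sqr ?nnegrE// (le_trans _ h1).
have -> : pc c p = 3 * (DX ^+ 2 * (`|ax v (ix Q I p) (iy Q J p)| ^+ 2
    + `|ax v (ix Q I p) (iy Q J p).+1| ^+ 2) + DY ^+ 2 * `|ay v (ix Q I p) (iy Q J p)| ^+ 2).
  by rewrite !real_normK ?num_real.
move: `|ax v _ (iy Q J p)| `|ax v _ _.+1| `|ay v _ _| (DX) (DY) => a b e x y.
rewrite -subr_ge0.
rewrite (_ : _ - _ = (x * (a - b)) ^+ 2 + (x * a - y * e) ^+ 2 + (x * b - y * e) ^+ 2);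
  last by ring.
by rewrite !addr_ge0 ?sqr_ge0.
Qed.

Lemma gradsq_interpolant v : H10h v -> gradsq Q (interpolant Q v) =
  ipO (interpolant_x Q v) (interpolant_x Q v) + ipO (interpolant_y Q v) (interpolant_y Q v).
Proof.
move=> hv; have [lx ly h [a1 a2]] := interpolant_l2 hv; have h1 := H10_H1 h.
have x1 : axis (e1 : R * R) by left.
have x2 : axis (e2 : R * R) by right.
congr (_ + _).
  exact: (ipO_ae HW HS (wd_l2 x1 h1) lx a1).
exact: (ipO_ae HW HS (wd_l2 x2 h1) ly a2).
Qed.

Lemma gradsq_lower v : H10h v -> 7 / 256 * dirichlet v <= gradsq Q (interpolant Q v).
Proof.
move=> hv; rewrite gradsq_interpolant// mulrDr; apply: lerD.
  exact: interpolant_x_lower.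
exact: interpolant_y_lower.
Qed.

Lemma gradsq_upper v (C : R) : (forall t, `|dramp d t| <= C) -> H10h v ->
  gradsq Q (interpolant Q v) <= 2 * C ^+ 2 * dirichlet v.
Proof.
move=> hC hv; rewrite gradsq_interpolant// mulrDr; apply: lerD.
  exact: interpolant_x_upper.
exact: interpolant_y_upper.
Qed.

End OneGrid.
End GridBounds.

(** * The discrete forms as sums over cells *)

Section DiscreteForms.
Context {R : realType}.
Variable Q : rectangle R.
Hypotheses (HW : xW Q < xE Q) (HS : yS Q < yN Q).
Variables I J : nat.
Implicit Types (v w psi : @gridfun R I J) (i j : nat) (c : nat -> nat -> R) (u : R * R -> R).
Local Notation Om := (Omega Q).
Local Notation DX := (dx Q I).
Local Notation DY := (dy Q J).
Local Notation cellsum := (cellsum Q I J).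
Local Notation ax := (nabla_x Q).
Local Notation ay := (nabla_y Q).
Local Notation grid u := (@on_grid R Q I J u).

(** The double sums of the scheme omit the row or column of index 0, on which every summand
    containing a grid function with zero boundary values vanishes. *)
Lemma cellsum_rows c : (forall i, (i <= I)%N -> c i 0%N = 0) ->
  \sum_(1 <= j < J.+1) \sum_(0 <= i < I.+1) c i j * DX * DY = cellsum c.
Proof.
move=> h; rewrite exchange_big /=; apply: eq_big_nat => i /andP[_ iI].
by rewrite [RHS]big_ltn//= h ?mul0r ?add0r.
Qed.

Lemma cellsum_cols c : (forall j, (j <= J)%N -> c 0%N j = 0) ->
  \sum_(1 <= i < I.+1) \sum_(0 <= j < J.+1) c i j * DX * DY = cellsum c.
Proof.
move=> h; rewrite /cellsum [RHS]big_ltn//=.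
rewrite [X in _ = X + _]big_nat_cond [X in _ = X + _]big1 ?add0r// => i.
by rewrite andbT => /andP[_ iI]; rewrite h ?mul0r.
Qed.

Lemma cellsum_inner c : (forall i, (i <= I)%N -> c i 0%N = 0) ->
  (forall j, (j <= J)%N -> c 0%N j = 0) ->
  \sum_(1 <= i < I.+1) \sum_(1 <= j < J.+1) c i j * DX * DY = cellsum c.
Proof.
move=> h h'; rewrite -cellsum_cols//; apply: eq_big_nat => i /andP[_ iI].
by rewrite [RHS]big_ltn//= h ?mul0r ?add0r.
Qed.

(* The discrete forms only see the nodes with positive indices; masking the
   others avoids evaluating the data on the boundary. *)
Definition mask (k : nat) (x : R) : R := if (0 < k)%N then x else 0.

Lemma mask_x c psi : H10h psi ->
  cellsum (fun i j => c i j * ax psi i j) = cellsum (fun i j => mask j (c i j) * ax psi i j).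
Proof.
move=> hp; apply: eq_cellsum => i [|j] iI jJ //=.
by rewrite (nabla_x_boundary Q hp iI) ?mulr0//; left.
Qed.

Lemma mask_y c psi : H10h psi ->
  cellsum (fun i j => c i j * ay psi i j) = cellsum (fun i j => mask i (c i j) * ay psi i j).
Proof.
move=> hp; apply: eq_cellsum => [[|i]] j iI jJ //=.
by rewrite (nabla_y_boundary Q hp jJ) ?mulr0//; left.
Qed.

Lemma H10h_at0 psi i : H10h psi -> (i <= I)%N -> at_ psi i 0%N = 0.
Proof. by move=> hp iI; rewrite (H10h_at hp) ?leqW//; auto. Qed.

Lemma H10h_at0' psi j : H10h psi -> (j <= J)%N -> at_ psi 0%N j = 0.
Proof. by move=> hp iI; rewrite (H10h_at hp) ?leqW//; auto. Qed.

Lemma mask_0 c psi : H10h psi ->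
  cellsum (fun i j => c i j * at_ psi i j) =
  cellsum (fun i j => mask i (mask j (c i j)) * at_ psi i j).
Proof.
move=> hp; apply: eq_cellsum => [[|i] [|j]] iI jJ //=;
  by rewrite ?(H10h_at0 hp iI) ?(H10h_at0' hp jJ) ?mulr0 ?mul0r.
Qed.

Definition bx (beta : R * R -> R) i j := mask j (beta_x Q I J beta i j).
Definition by_ (beta : R * R -> R) i j := mask i (beta_y Q I J beta i j).

Lemma BhE beta w psi : H10h psi -> Bh Q beta w psi =
  cellsum (fun i j => bx beta i j * ax w i j * ax psi i j)
  + cellsum (fun i j => by_ beta i j * ay w i j * ay psi i j).
Proof.
move=> hp; congr (_ + _).
  rewrite (cellsum_rows (c := fun i j => beta_x Q I J beta i j * ax w i j * ax psi i j)).
    apply: eq_cellsum => i [|j] iI jJ //=.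
    by rewrite (nabla_x_boundary Q hp iI) ?mulr0//; left.
  by move=> i iI; rewrite (nabla_x_boundary Q hp iI) ?mulr0//; left.
rewrite (cellsum_cols (c := fun i j => beta_y Q I J beta i j * ay w i j * ay psi i j)).
  apply: eq_cellsum => [[|i]] j iI jJ //=.
  by rewrite (nabla_y_boundary Q hp jJ) ?mulr0//; left.
by move=> i iI; rewrite (nabla_y_boundary Q hp iI) ?mulr0//; left.
Qed.

Lemma gxB i : gx Q I i.+1%:R - gx Q I i%:R = DX.
Proof. by rewrite /gx -natr1; ring. Qed.

Lemma grid_at u i j : (i <= I.+1)%N -> (j <= J.+1)%N ->
  at_ (grid u) i j = u (gx Q I i%:R, gy Q J j%:R).
Proof. by move=> iI jJ; rewrite /at_ mxE !inordK. Qed.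

Lemma gx_le (s : R) : 0 <= s <= I.+1%:R -> xW Q <= gx Q I s <= xE Q.
Proof.
move=> /andP[s0 s1]; rewrite /gx lerDl mulr_ge0 ?(ltW (dx_gt0 HW I))//=.
rewrite -lerBrDl -(grid_size Q I 0).1 mulrC.
by rewrite ler_pM2l ?(dx_gt0 HW I).
Qed.

Lemma gy_le (s : R) : 0 <= s <= J.+1%:R -> yS Q <= gy Q J s <= yN Q.
Proof.
move=> /andP[s0 s1]; rewrite /gy lerDl mulr_ge0 ?(ltW (dy_gt0 HS J))//=.
rewrite -lerBrDl -(grid_size Q 0 J).2 mulrC.
by rewrite ler_pM2l ?(dy_gt0 HS J).
Qed.

Lemma gx_lt (s : R) : 0 < s < I.+1%:R -> xW Q < gx Q I s < xE Q.
Proof.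
move=> /andP[s0 s1]; rewrite /gx ltrDl mulr_gt0 ?(dx_gt0 HW I)//=.
rewrite -ltrBrDl -(grid_size Q I 0).1 mulrC.
by rewrite ltr_pM2l ?(dx_gt0 HW I).
Qed.

Lemma gy_lt (s : R) : 0 < s < J.+1%:R -> yS Q < gy Q J s < yN Q.
Proof.
move=> /andP[s0 s1]; rewrite /gy ltrDl mulr_gt0 ?(dy_gt0 HS J)//=.
rewrite -ltrBrDl -(grid_size Q 0 J).2 mulrC.
by rewrite ltr_pM2l ?(dy_gt0 HS J).
Qed.

Lemma half_itv (k n : nat) : (k <= n)%N -> 0 < (k%:R + 2^-1 : R) < n.+1%:R.
Proof.
move=> kn; have h : (k%:R : R) <= n%:R by rewrite ler_nat.
have k0 : (0 : R) <= k%:R by [].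
have -> : (n.+1%:R : R) = n%:R + 1 by rewrite natr1.
by move: (k%:R : R) (n%:R : R) h k0 => x y h k0; lra.
Qed.

Lemma node_itv (k n : nat) : (0 < k <= n)%N -> 0 < (k%:R : R) < n.+1%:R.
Proof. by move=> /andP[k0 kn]; rewrite ltr0n k0 ltr_nat. Qed.

Lemma bx_itv beta (m M : R) i j : (forall p, Om p -> m <= beta p <= M) ->
  (i <= I)%N -> (0 < j <= J)%N -> m <= bx beta i j <= M.
Proof.
move=> h iI /andP[j0 jJ]; rewrite /bx /mask j0; apply: h; split => /=.
  by apply: gx_lt; exact: half_itv.
by apply: gy_lt; apply: node_itv; rewrite j0.
Qed.

Lemma by_itv beta (m M : R) i j : (forall p, Om p -> m <= beta p <= M) ->
  (0 < i <= I)%N -> (j <= J)%N -> m <= by_ beta i j <= M.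
Proof.
move=> h /andP[i0 iI] jJ; rewrite /by_ /mask i0; apply: h; split => /=.
  by apply: gx_lt; apply: node_itv; rewrite i0.
by apply: gy_lt; exact: half_itv.
Qed.

Lemma Bh_bounds beta (m M : R) psi : (forall p, Om p -> m <= beta p <= M) -> H10h psi ->
  m * dirichlet Q psi <= Bh Q beta psi psi <= M * dirichlet Q psi.
Proof.
move=> hb hp; rewrite BhE// /dirichlet !mulrDr -!cellsumZ.
have hx i j : (i <= I)%N -> (j <= J)%N ->
    m * ax psi i j ^+ 2 <= bx beta i j * ax psi i j * ax psi i j <= M * ax psi i j ^+ 2.
  case: j => [|j] iI jJ.
    by rewrite (nabla_x_boundary Q hp iI) ?expr0n ?mulr0 ?lexx//; left.
  have /andP[h1 h2] : m <= bx beta i j.+1 <= M by exact: bx_itv.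
  by rewrite -mulrA -expr2 !ler_wpM2r ?sqr_ge0.
have hy i j : (i <= I)%N -> (j <= J)%N ->
    m * ay psi i j ^+ 2 <= by_ beta i j * ay psi i j * ay psi i j <= M * ay psi i j ^+ 2.
  case: i => [|i] iI jJ.
    by rewrite (nabla_y_boundary Q hp jJ) ?expr0n ?mulr0 ?lexx//; left.
  have /andP[h1 h2] : m <= by_ beta i.+1 j <= M by exact: by_itv.
  by rewrite -mulrA -expr2 !ler_wpM2r ?sqr_ge0.
apply/andP; split; apply: lerD; apply: (cellsum_le HW HS) => i j iI jJ.
- by case/andP: (hx i j iI jJ).
- by case/andP: (hy i j iI jJ).
- by case/andP: (hx i j iI jJ).
- by case/andP: (hy i j iI jJ).
Qed.

Lemma H10h_set : linear_set (@H10h R I J).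
Proof.
split=> [i j iI jJ _|c u v hu hv i j iI jJ ij]; first by rewrite /at_ mxE.
by rewrite /at_ !mxE -!/(at_ _ i j) hu// hv// mulr0 addr0.
Qed.

Lemma Bh_linear beta (c : R) (u v psi : @gridfun R I J) :
  Bh Q beta (c *: u + v) psi = c * Bh Q beta u psi + Bh Q beta v psi.
Proof.
have nx (w w' : @gridfun R I J) i j : ax (c *: w + w' : @gridfun R I J) i j = c * ax w i j + ax w' i j.
  by rewrite /nabla_x /at_ !mxE; move: (_^-1) => k; ring.
have ny (w w' : @gridfun R I J) i j : ay (c *: w + w' : @gridfun R I J) i j = c * ay w i j + ay w' i j.
  by rewrite /nabla_y /at_ !mxE; move: (_^-1) => k; ring.
rewrite /Bh mulrDr addrACA; congr (_ + _).
  rewrite mulr_sumr -big_split /=; apply: eq_bigr => j _.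
  rewrite mulr_sumr -big_split /=; apply: eq_bigr => i _.
  by rewrite nx; ring.
rewrite mulr_sumr -big_split /=; apply: eq_bigr => j _.
rewrite mulr_sumr -big_split /=; apply: eq_bigr => i _.
by rewrite ny; ring.
Qed.

Lemma Bh_sym beta (u v : @gridfun R I J) : Bh Q beta u v = Bh Q beta v u.
Proof.
congr (_ + _); apply: eq_bigr => j _; apply: eq_bigr => i _.
  congr (_ * _ * _); exact: mulrAC.
by congr (_ * _ * _); exact: mulrAC.
Qed.

Lemma Bh_si beta (m M : R) : 0 < m -> (forall p, Om p -> m <= beta p <= M) ->
  semi_inner (@H10h R I J) (Bh Q beta).
Proof.
move=> m0 hb; split.
- exact: H10h_set.
- by move=> c u v w _ _ _; exact: Bh_linear.
- by move=> u v _ _; exact: Bh_sym.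
move=> u hu; have /andP[h _] := Bh_bounds hb hu; apply: le_trans h.
apply: mulr_ge0; first exact: ltW.
by apply: addr_ge0; apply: (cellsum_ge0 HW HS) => i j; exact: sqr_ge0.
Qed.

(** Summation by parts. At [i = 0] the truncated predecessor [i.-1] is again 0, which is harmless
    because [q] vanishes there. *)
Lemma abel_x (q c : nat -> nat -> R) :
  (forall j, (j <= J)%N -> q 0%N j = 0 /\ q I.+1 j = 0) ->
  cellsum (fun i j => (q i.+1 j - q i j) * c i j) =
  cellsum (fun i j => q i j * (c i.-1 j - c i j)).
Proof.
move=> h; have := @cellsum_shift_x R Q I J (fun i j => q i j * c i.-1 j).
move=> E; have {}E : cellsum (fun i j => q i.+1 j * c i j) = cellsum (fun i j => q i j * c i.-1 j).
  by rewrite -E// => j jJ; have [-> ->] := h j jJ; rewrite !mul0r.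
have -> : cellsum (fun i j => (q i.+1 j - q i j) * c i j) =
    cellsum (fun i j => q i.+1 j * c i j) + cellsum (fun i j => - 1 * (q i j * c i j)).
  by rewrite -cellsumD; apply: eq_cellsum => i j _ _; ring.
by rewrite E -cellsumD; apply: eq_cellsum => i j _ _; ring.
Qed.

Lemma abel_y (q c : nat -> nat -> R) :
  (forall i, (i <= I)%N -> q i 0%N = 0 /\ q i J.+1 = 0) ->
  cellsum (fun i j => (q i j.+1 - q i j) * c i j) =
  cellsum (fun i j => q i j * (c i j.-1 - c i j)).
Proof.
move=> h; have := @cellsum_shift_y R Q I J (fun i j => q i j * c i j.-1).
move=> E; have {}E : cellsum (fun i j => q i j.+1 * c i j) = cellsum (fun i j => q i j * c i j.-1).
  by rewrite -E// => j jJ; have [-> ->] := h j jJ; rewrite !mul0r.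
have -> : cellsum (fun i j => (q i j.+1 - q i j) * c i j) =
    cellsum (fun i j => q i j.+1 * c i j) + cellsum (fun i j => - 1 * (q i j * c i j)).
  by rewrite -cellsumD; apply: eq_cellsum => i j _ _; ring.
by rewrite E -cellsumD; apply: eq_cellsum => i j _ _; ring.
Qed.

Section Functional.
Variables (phi beta a b g f G1 G2 : R * R -> R).

(** [G1] and [G2] stand for the components of b grad phi; this is the error made in replacing the
    discrete normal by the smooth gradient. *)
Definition normal_err_x i j : R := if interior_point I J i j then
  at_ (grid b) i j * normal_x Q I J phi i j - at_ (grid G1) i j else 0.
Definition normal_err_y i j : R := if interior_point I J i j then
  at_ (grid b) i j * normal_y Q I J phi i j - at_ (grid G2) i j else 0.

Definition load_x i j : R := mask j (beta_x Q I J beta i j * ax (grid g) i j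
  - beta_x Q I J beta i j * ax (grid a) i j * chi_x Q I J phi i j
  + at_ (grid G1) i.+1 j * chi_x Q I J phi i j).
Definition load_y i j : R := mask i (beta_y Q I J beta i j * ay (grid g) i j
  - beta_y Q I J beta i j * ay (grid a) i j * chi_y Q I J phi i j
  + at_ (grid G2) i j.+1 * chi_y Q I J phi i j).
(** The quotients of differences of chi by the mesh width are not bounded as h tends to 0; their
    products with the normal error are, because the latter is O(h) wherever chi changes. *)
Definition load_0 i j : R := mask i (mask j (at_ (grid f) i j
  + (ax (grid G1) i j * chi_x Q I J phi i j
     + normal_err_x i j * ((chi_x Q I J phi i.-1 j - chi_x Q I J phi i j) / DX))
  + (ay (grid G2) i j * chi_y Q I J phi i j
     + normal_err_y i j * ((chi_y Q I J phi i j.-1 - chi_y Q I J phi i j) / DY)))).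

(** The smooth part is expanded by the discrete product rule, in which [G1] appears at the right end
    of the edge and [psi] at the left one. Only the error part is summed by parts: it has no
    difference quotient worth keeping, whereas chi is constant away from the interface. *)
Lemma Fh4E psi : H10h psi -> Fh4 Q phi b psi =
  cellsum (fun i j => at_ (grid G1) i.+1 j * chi_x Q I J phi i j * ax psi i j)
  + cellsum (fun i j => at_ (grid G2) i j.+1 * chi_y Q I J phi i j * ay psi i j)
  + cellsum (fun i j => (ax (grid G1) i j * chi_x Q I J phi i j
     + normal_err_x i j * ((chi_x Q I J phi i.-1 j - chi_x Q I J phi i j) / DX)
     + (ay (grid G2) i j * chi_y Q I J phi i j
     + normal_err_y i j * ((chi_y Q I J phi i j.-1 - chi_y Q I J phi i j) / DY)))
     * at_ psi i j).
Proof.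
move=> hp.
have Px i j : (i <= I.+1)%N -> (j <= J.+1)%N -> at_ (b_normal_x Q phi b psi) i j =
    (at_ (grid G1) i j + normal_err_x i j) * at_ psi i j.
  move=> iI jJ; rewrite {1}/at_ /b_normal_x mxE !inordK// /normal_err_x; case: ifP => ij.
    by ring.
  by rewrite [at_ psi i j]hp ?mulr0 ?ij.
have Py i j : (i <= I.+1)%N -> (j <= J.+1)%N -> at_ (b_normal_y Q phi b psi) i j =
    (at_ (grid G2) i j + normal_err_y i j) * at_ psi i j.
  move=> iI jJ; rewrite {1}/at_ /b_normal_y mxE !inordK// /normal_err_y; case: ifP => ij.
    by ring.
  by rewrite [at_ psi i j]hp ?mulr0 ?ij.
have DX0 : DX != 0 by rewrite gt_eqF ?(dx_gt0 HW).
have DY0 : DY != 0 by rewrite gt_eqF ?(dy_gt0 HS).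
have nx i j : (i <= I)%N -> (j <= J)%N ->
    nabla_x Q (b_normal_x Q phi b psi) i j * chi_x Q I J phi i j =
    at_ (grid G1) i.+1 j * chi_x Q I J phi i j * ax psi i j
    + ax (grid G1) i j * chi_x Q I J phi i j * at_ psi i j
    + (normal_err_x i.+1 j * at_ psi i.+1 j - normal_err_x i j * at_ psi i j)
       * (chi_x Q I J phi i j / DX).
  move=> iI jJ; rewrite /nabla_x !Px ?(leqW iI) ?(leqW jJ)//.
  move: (at_ _ _ _) (at_ _ _ _) (at_ _ _ _) (at_ _ _ _) (normal_err_x _ _) (normal_err_x _ _).
  by move: (chi_x _ _ _ _ _ _) (DX^-1) => *; ring.
have ny i j : (i <= I)%N -> (j <= J)%N ->
    nabla_y Q (b_normal_y Q phi b psi) i j * chi_y Q I J phi i j =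
    at_ (grid G2) i j.+1 * chi_y Q I J phi i j * ay psi i j
    + ay (grid G2) i j * chi_y Q I J phi i j * at_ psi i j
    + (normal_err_y i j.+1 * at_ psi i j.+1 - normal_err_y i j * at_ psi i j)
       * (chi_y Q I J phi i j / DY).
  move=> iI jJ; rewrite /nabla_y !Py ?(leqW iI) ?(leqW jJ)//.
  move: (at_ _ _ _) (at_ _ _ _) (at_ _ _ _) (at_ _ _ _) (normal_err_y _ _) (normal_err_y _ _).
  by move: (chi_y _ _ _ _ _ _) (DY^-1) => *; ring.
rewrite /Fh4.
rewrite (cellsum_rows (c := fun i j => nabla_x Q (b_normal_x Q phi b psi) i j * chi_x Q I J phi i j)); last first.
  move=> i iI; rewrite /nabla_x !Px ?(leqW iI)//.
  by rewrite !(H10h_at hp) ?(leqW iI) ?mulr0 ?subrr ?mul0r//; auto.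
rewrite (cellsum_cols (c := fun i j => nabla_y Q (b_normal_y Q phi b psi) i j * chi_y Q I J phi i j)); last first.
  move=> i iI; rewrite /nabla_y !Py ?(leqW iI)//.
  by rewrite !(H10h_at hp) ?(leqW iI) ?mulr0 ?subrr ?mul0r//; auto.
rewrite (eq_cellsum Q nx) (eq_cellsum Q ny) !cellsumD.
rewrite (abel_x (q := fun i j => normal_err_x i j * at_ psi i j)
                (fun i j => chi_x Q I J phi i j / DX)); last first.
  by move=> j jJ; rewrite !(H10h_at hp) ?(leqW jJ) ?mulr0//; auto.
rewrite (abel_y (q := fun i j => normal_err_y i j * at_ psi i j)
                (fun i j => chi_y Q I J phi i j / DY)); last first.
  by move=> j jJ; rewrite !(H10h_at hp) ?(leqW jJ) ?mulr0//; auto.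
set X := (X in _ = _ + _ + X).
have -> : X =
    cellsum (fun i j => ax (grid G1) i j * chi_x Q I J phi i j * at_ psi i j)
    + cellsum (fun i j => normal_err_x i j * at_ psi i j
        * (chi_x Q I J phi i.-1 j / DX - chi_x Q I J phi i j / DX))
    + (cellsum (fun i j => ay (grid G2) i j * chi_y Q I J phi i j * at_ psi i j)
    + cellsum (fun i j => normal_err_y i j * at_ psi i j
        * (chi_y Q I J phi i j.-1 / DY - chi_y Q I J phi i j / DY))).
  rewrite /X -!cellsumD; apply: eq_cellsum => i j _ _.
  move: (at_ _ _ _) (ax _ _ _) (ay _ _ _) (normal_err_x _ _) (normal_err_y _ _).
  by move: (chi_x _ _ _ _ _ _) (chi_x _ _ _ _ _ _) (chi_y _ _ _ _ _ _) (chi_y _ _ _ _ _ _)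
    (DX^-1) (DY^-1) => *; ring.
clear X; do 6!move: (cellsum _); clear; move=> *; ring.
Qed.

Lemma FhE psi : H10h psi -> Fh Q phi beta a b g f psi =
  cellsum (fun i j => load_x i j * ax psi i j)
  + cellsum (fun i j => load_y i j * ay psi i j)
  + cellsum (fun i j => load_0 i j * at_ psi i j).
Proof.
move=> hp; rewrite /Fh Fh4E// /Fh2 /Fh1 /Fh3.
rewrite -mask_x// -mask_y// -mask_0//.
rewrite (cellsum_inner (c := fun i j => at_ (grid f) i j * at_ psi i j)); last 2 first.
- by move=> i iI; rewrite (H10h_at0 hp iI) mulr0.
- by move=> i iI; rewrite (H10h_at0' hp iI) mulr0.
rewrite (cellsum_rows (c := fun i j => beta_x Q I J beta i j * ax (grid a) i j * ax psi i j
  * chi_x Q I J phi i j)); last first.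
  by move=> i iI; rewrite (nabla_x_boundary Q hp iI) ?mulr0 ?mul0r//; left.
rewrite (cellsum_cols (c := fun i j => beta_y Q I J beta i j * ay (grid a) i j * ay psi i j
  * chi_y Q I J phi i j)); last first.
  by move=> i iI; rewrite (nabla_y_boundary Q hp iI) ?mulr0 ?mul0r//; left.
rewrite /Bh (cellsum_rows (c := fun i j => beta_x Q I J beta i j * ax (grid g) i j * ax psi i j));
  last first.
  by move=> i iI; rewrite (nabla_x_boundary Q hp iI) ?mulr0 ?mul0r//; left.
rewrite (cellsum_cols (c := fun i j => beta_y Q I J beta i j * ay (grid g) i j * ay psi i j));
  last first.
  by move=> i iI; rewrite (nabla_y_boundary Q hp iI) ?mulr0 ?mul0r//; left.
have EN (c c' c1 c2 c3 : nat -> nat -> R) :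
    cellsum (fun i j => (c i j - c1 i j * c2 i j + c3 i j) * c' i j) =
    cellsum (fun i j => c i j * c' i j) - cellsum (fun i j => c1 i j * c' i j * c2 i j)
    + cellsum (fun i j => c3 i j * c' i j).
  rewrite -[- cellsum _]mulN1r -cellsumZ -!cellsumD; apply: eq_cellsum => i j _ _; ring.
under [X in _ = _ + X]eq_cellsum => i j _ _ do rewrite -addrA mulrDl.
rewrite !EN [X in _ = _ + X]cellsumD.
do 8!move: (cellsum _); clear; move=> *; ring.
Qed.
End Functional.

End DiscreteForms.

(** * Consistency on smooth functions *)

Section Consistency.
Context {R : realType}.
Variable Q : rectangle R.
Hypotheses (HW : xW Q < xE Q) (HS : yS Q < yN Q).
Local Notation Om := (Omega Q).
Local Notation MP := (measurableTypeR R * measurableTypeR R)%type.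
Local Notation mu := (@plane_measure R).
Local Notation mOm := (measurable_Omega Q).
Local Notation fOm := (finite_Omega HW HS).
Local Notation l2 := (@sq_integrable _ MP R mu Om).
Local Notation ipO := (@ip _ MP R mu Om).
Local Notation rint u := (mu.-integrable Om (EFin \o u)).
Local Notation nrm := (seminorm ipO).
Local Notation S := (ip_semi_inner mOm fOm).
Local Notation l2B := (lsB (sq_linear_set mOm fOm)).
Local Notation test := (test_function Om).
Implicit Types (p q : R * R) (u z : R * R -> R).
Local Opaque weak_derivative e1 e2.

Lemma node_dist I J p (al be : R) : Om p -> 0 <= al <= 1 -> 0 <= be <= 1 ->
  `|gx Q I ((ix Q I p)%:R + al) - p.1| <= dx Q I /\
  `|gy Q J ((iy Q J p)%:R + be) - p.2| <= dy Q J.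
Proof.
move=> Op ha hb; have [hx hy] := frac_itv HW HS I J Op.
have E1 : p.1 = xW Q + ((ix Q I p)%:R + fx Q I p) * dx Q I := cell_decomp I HW p.1.
have E2 : p.2 = yS Q + ((iy Q J p)%:R + fy Q J p) * dy Q J := cell_decomp J HS p.2.
have key (k s t h a : R) : 0 < h -> 0 <= s <= 1 -> 0 <= t < 1 ->
    `|a + (k + s) * h - (a + (k + t) * h)| <= h.
  move=> h0 /andP[s0 s1] /andP[t0 t1].
  rewrite (_ : _ - _ = (s - t) * h); last by ring.
  rewrite normrM (gtr0_norm h0) ler_piMl ?(ltW h0)// ler_norml; apply/andP; split; lra.
split; [rewrite E1|rewrite E2]; apply: key => //; [exact: dx_gt0|exact: dy_gt0].
Qed.

Lemma nabla_x_bound I J u u1 (C : R) i j : {within Omega_bar Q, continuous u} ->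
  (forall p, Om p -> is_derive p e1 u (u1 p)) -> (forall p, Om p -> `|u1 p| <= C) ->
  (i <= I)%N -> (0 < j <= J)%N ->
  exists2 c, gx Q I i%:R < c < gx Q I i.+1%:R &
    nabla_x Q (@on_grid R Q I J u) i j = u1 (c, gy Q J j%:R) /\
    `|u1 (c, gy Q J j%:R)| <= C.
Proof.
move=> cu du bu iI hj; have dX := dx_gt0 HW I.
have hy : yS Q < gy Q J j%:R < yN Q by apply: (gy_lt HS); exact: node_itv.
have /andP[x0 _] : xW Q <= gx Q I i%:R <= xE Q.
  by apply: (gx_le HW); rewrite ler0n ler_nat leqW.
have /andP[_ x1] : xW Q <= gx Q I i.+1%:R <= xE Q.
  by apply: (gx_le HW); rewrite ler0n ler_nat.
have x01 : gx Q I i%:R < gx Q I i.+1%:R by rewrite -subr_gt0 gxB.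
have [c cc E] := MVT_e1 cu du hy x0 x01 x1.
exists c => //; have Oc : Om (c, gy Q J j%:R).
  case/andP: cc => c0 c1; split=> //=.
  by rewrite (le_lt_trans x0 c0) (lt_le_trans c1 x1).
split; last exact: bu.
case/andP: hj => j0 jJ.
rewrite /nabla_x !grid_at ?(leqW iI) ?(leqW jJ)// E gxB mulfK// gt_eqF//.
Qed.

Lemma nabla_y_bound I J u u1 (C : R) i j : {within Omega_bar Q, continuous u} ->
  (forall p, Om p -> is_derive p e2 u (u1 p)) -> (forall p, Om p -> `|u1 p| <= C) ->
  (0 < i <= I)%N -> (j <= J)%N ->
  exists2 c, gy Q J j%:R < c < gy Q J j.+1%:R &
    nabla_y Q (@on_grid R Q I J u) i j = u1 (gx Q I i%:R, c) /\
    `|u1 (gx Q I i%:R, c)| <= C.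
Proof.
move=> cu du bu hi jJ; have dY := dy_gt0 HS J.
have hx : xW Q < gx Q I i%:R < xE Q by apply: (gx_lt HW); exact: node_itv.
have /andP[y0 _] : yS Q <= gy Q J j%:R <= yN Q.
  by apply: (gy_le HS); rewrite ler0n ler_nat leqW.
have /andP[_ y1] : yS Q <= gy Q J j.+1%:R <= yN Q.
  by apply: (gy_le HS); rewrite ler0n ler_nat.
have gyB : gy Q J j.+1%:R - gy Q J j%:R = dy Q J by rewrite /gy -natr1; ring.
have y01 : gy Q J j%:R < gy Q J j.+1%:R by rewrite -subr_gt0 gyB.
have [c cc E] := MVT_e2 cu du hx y0 y01 y1.
exists c => //; have Oc : Om (gx Q I i%:R, c).
  case/andP: cc => c0 c1; split=> //=.
  by rewrite (le_lt_trans y0 c0) (lt_le_trans c1 y1).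
split; last exact: bu.
case/andP: hi => i0 iI.
rewrite /nabla_y !grid_at ?(leqW iI) ?(leqW jJ)// E gyB mulfK// gt_eqF//.
Qed.

Section Sequence.
Variables (I J : nat -> nat).
Hypotheses (hx : dx Q (I n) @[n --> \oo] --> (0 : R))
  (hy : dy Q (J n) @[n --> \oo] --> (0 : R)).

Lemma mesh_small (e : R) : 0 < e -> \forall n \near \oo, dx Q (I n) < e /\ dy Q (J n) < e.
Proof.
move=> e0; have [N _ hN] := cvg_near hx e0; have [N' _ hN'] := cvg_near hy e0.
exists (maxn N N') => // n /=; rewrite geq_max => /andP[n1 n2].
have := hN n n1; have := hN' n n2; rewrite /= !subr0.
by rewrite !gtr0_norm ?(dx_gt0 HW) ?(dy_gt0 HS).
Qed.

(** Three mesh widths allow for a node at distance two from [p] and a mean value point one further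
    cell away. *)
Lemma cvg_mesh_point u p (X Y : nat -> R) : {for p, continuous u} ->
  (forall n, `|X n - p.1| <= 3 * dx Q (I n)) -> (forall n, `|Y n - p.2| <= 3 * dy Q (J n)) ->
  u (X n, Y n) @[n --> \oo] --> u p.
Proof.
move=> cu hX hY; apply: (cvg_comp (fun n => (X n, Y n)) u); last exact: cu.
apply: cvg_box => e e0.
have e2 : 0 < e / 3 by rewrite divr_gt0.
have [N _ hN] := mesh_small e2; exists N => // n /= Nn; have [h1 h2] := hN n Nn.
split; [apply: le_lt_trans (hX n) _|apply: le_lt_trans (hY n) _];
  by rewrite mulrC -ltr_pdivlMr.
Qed.

Lemma cell_interior p : Om p -> \forall n \near \oo,
  (0 < ix Q (I n) p)%N /\ (0 < iy Q (J n) p)%N.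
Proof.
move=> Op; have [/= /andP[p1 _] /andP[p2 _]] := Op.
have e0 : 0 < Num.min (p.1 - xW Q) (p.2 - yS Q) by rewrite lt_min !subr_gt0 p1.
have [N _ hN] := mesh_small e0; exists N => // n /= Nn; have [] := hN n Nn.
rewrite !lt_min => /andP[h1 _] /andP[_ h2].
have [hfx hfy] := frac_itv HW HS (I n) (J n) Op.
have E1 : p.1 = xW Q + ((ix Q (I n) p)%:R + fx Q (I n) p) * dx Q (I n) := cell_decomp (I n) HW p.1.
have E2 : p.2 = yS Q + ((iy Q (J n) p)%:R + fy Q (J n) p) * dy Q (J n) := cell_decomp (J n) HS p.2.
split; rewrite lt0n; apply/eqP => k0.
  move: h1; rewrite E1 k0 add0r [xW Q + _]addrC addrK => h1.
  have : fx Q (I n) p * dx Q (I n) <= dx Q (I n).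
    by rewrite ler_piMl ?(ltW (dx_gt0 HW _))//; case/andP: hfx => _ /ltW.
  by rewrite leNgt h1.
move: h2; rewrite E2 k0 add0r [yS Q + _]addrC addrK => h2.
have : fy Q (J n) p * dy Q (J n) <= dy Q (J n).
  by rewrite ler_piMl ?(ltW (dy_gt0 HS _))//; case/andP: hfy => _ /ltW.
by rewrite leNgt h2.
Qed.

Lemma cvg_eventually (v w : nat -> R) (l : R) : (\forall n \near \oo, v n = w n) ->
  v n @[n --> \oo] --> l -> w n @[n --> \oo] --> l.
Proof.
move=> [N _ hN] hv; apply: near_cvg => e e0; have [N' _ hN'] := cvg_near hv e0.
exists (maxn N N') => // n /=; rewrite geq_max => /andP[n1 n2].
by rewrite -(hN n n1) ltW// hN'.
Qed.

Lemma cvg_node u p (al be : R) : Om p -> {for p, continuous u} ->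
  0 <= al <= 1 -> 0 <= be <= 1 ->
  u (gx Q (I n) ((ix Q (I n) p)%:R + al), gy Q (J n) ((iy Q (J n) p)%:R + be))
    @[n --> \oo] --> u p.
Proof.
move=> Op cu ha hb; apply: cvg_mesh_point => // n; have [h1 h2] := node_dist (I n) (J n) Op ha hb.
  by apply: (le_trans h1); rewrite ler_peMl ?ler1n// ltW// (dx_gt0 HW).
by apply: (le_trans h2); rewrite ler_peMl ?ler1n// ltW// (dy_gt0 HS).
Qed.

(** The indices are arbitrary sequences near [p], since summation by parts and interpolation shift
    them by one in either direction. *)
Lemma cvg_nabla_x u u1 p (i j : nat -> nat) : Om p -> {within Omega_bar Q, continuous u} ->
  (forall q, Om q -> is_derive q e1 u (u1 q)) -> {for p, continuous u1} ->
  (forall n, (i n <= I n)%N) ->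
  (forall n, `|gx Q (I n) (i n)%:R - p.1| <= 2 * dx Q (I n)) ->
  (forall n, `|gy Q (J n) (j n)%:R - p.2| <= 2 * dy Q (J n)) ->
  nabla_x Q (@on_grid R Q (I n) (J n) u) (i n) (j n) @[n --> \oo] --> u1 p.
Proof.
move=> Op cu du cu1 iI hi hj.
(* The mean value theorem needs an interior row. Coarse grids may fail this; there the evaluation
   point is replaced by [p] itself. *)
pose P n := (0 < j n <= J n)%N.
have hP : \forall n \near \oo, P n.
  have [_ /= /andP[p1 p2]] := Op.
  have e0 : 0 < Num.min (p.2 - yS Q) (yN Q - p.2) / 2 by rewrite divr_gt0// lt_min !subr_gt0 p1.
  have [N _ hN] := mesh_small e0; exists N => // n /= Nn; have [_ h] := hN n Nn.
  have {h} : 2 * dy Q (J n) < Num.min (p.2 - yS Q) (yN Q - p.2) by rewrite mulrC -ltr_pdivlMr.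
  move=> /(le_lt_trans (hj n)); rewrite lt_min /P lt0n => /andP[h1 h2]; apply/andP; split.
    apply/eqP => j0; move: h1; rewrite j0 /gy mul0r addr0 ltNge => /negP; apply.
    by rewrite distrC ler_norm.
  rewrite leqNgt; apply/negP => Jj; move: h2; rewrite ltNge => /negP; apply.
  apply: le_trans (ler_norm _); rewrite lerB// /gy -lerBlDl -(grid_size Q (I n) (J n)).2 mulrC.
  by rewrite ler_pM2r ?(dy_gt0 HS)// ler_nat.
have /choice[c hc] : forall n, exists c : R, P n ->
    gx Q (I n) (i n)%:R < c < gx Q (I n) (i n).+1%:R /\
    nabla_x Q (@on_grid R Q (I n) (J n) u) (i n) (j n) = u1 (c, gy Q (J n) (j n)%:R).
  move=> n; have [Pn|nP] := pselect (P n); last by exists 0.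
  have dX := dx_gt0 HW (I n); case/andP: (Pn) => j0 jJ.
  have hy' : yS Q < gy Q (J n) (j n)%:R < yN Q by apply: (gy_lt HS); exact: node_itv.
  have /andP[x0 _] : xW Q <= gx Q (I n) (i n)%:R <= xE Q.
    by apply: (gx_le HW); rewrite ler0n ler_nat leqW.
  have /andP[_ x1] : xW Q <= gx Q (I n) (i n).+1%:R <= xE Q.
    by apply: (gx_le HW); rewrite ler0n ler_nat; exact: iI.
  have x01 : gx Q (I n) (i n)%:R < gx Q (I n) (i n).+1%:R by rewrite -subr_gt0 gxB.
  have [c cc E] := MVT_e1 cu du hy' x0 x01 x1.
  have i1 : ((i n).+1 <= (I n).+1)%N := iI n.
  by exists c => _; split=> //; rewrite /nabla_x !grid_at ?(leqW (iI n)) ?(leqW jJ)// E gxB mulfK// gt_eqF.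
pose X n := if P n then c n else p.1.
pose Y n := if P n then gy Q (J n) (j n)%:R else p.2.
apply: (@cvg_eventually (fun n => u1 (X n, Y n))).
  case: hP => N _ hN; exists N => // n /= Nn; have Pn := hN n Nn.
  by rewrite /X /Y Pn; have [_ ->] := hc n Pn.
apply: cvg_mesh_point => // n; rewrite /X /Y; case: ifP => Pn.
- have [/andP[c0 c1] _] := hc n Pn; have := gxB Q (I n) (i n); have := hi n.
  rewrite !ler_norml; move: (gx _ _ _) (gx _ _ _) (dx _ _) (c n) (p.1) c0 c1.
  by move=> a a' h s t h1 h2 /andP[h3 h4] h5; apply/andP; split; lra.
- by rewrite subrr normr0 mulr_ge0// ltW// (dx_gt0 HW).
- by apply: (le_trans (hj n)); rewrite ler_pM2r ?(dy_gt0 HS)// ler_nat.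
- by rewrite subrr normr0 mulr_ge0// ltW// (dy_gt0 HS).
Qed.

Lemma gyB J' (j : nat) : gy Q J' j.+1%:R - gy Q J' j%:R = dy Q J'.
Proof. by rewrite /gy -natr1; ring. Qed.

Lemma cvg_nabla_y u u1 p (i j : nat -> nat) : Om p -> {within Omega_bar Q, continuous u} ->
  (forall q, Om q -> is_derive q e2 u (u1 q)) -> {for p, continuous u1} ->
  (forall n, (j n <= J n)%N) ->
  (forall n, `|gx Q (I n) (i n)%:R - p.1| <= 2 * dx Q (I n)) ->
  (forall n, `|gy Q (J n) (j n)%:R - p.2| <= 2 * dy Q (J n)) ->
  nabla_y Q (@on_grid R Q (I n) (J n) u) (i n) (j n) @[n --> \oo] --> u1 p.
Proof.
move=> Op cu du cu1 jJ hi hj.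
pose P n := (0 < i n <= I n)%N.
have hP : \forall n \near \oo, P n.
  have [/= /andP[p1 p2] _] := Op.
  have e0 : 0 < Num.min (p.1 - xW Q) (xE Q - p.1) / 2 by rewrite divr_gt0// lt_min !subr_gt0 p1.
  have [N _ hN] := mesh_small e0; exists N => // n /= Nn; have [h _] := hN n Nn.
  have {h} : 2 * dx Q (I n) < Num.min (p.1 - xW Q) (xE Q - p.1) by rewrite mulrC -ltr_pdivlMr.
  move=> /(le_lt_trans (hi n)); rewrite lt_min /P lt0n => /andP[h1 h2]; apply/andP; split.
    apply/eqP => j0; move: h1; rewrite j0 /gx mul0r addr0 ltNge => /negP; apply.
    by rewrite distrC ler_norm.
  rewrite leqNgt; apply/negP => Jj; move: h2; rewrite ltNge => /negP; apply.
  apply: le_trans (ler_norm _); rewrite lerB// /gx -lerBlDl -(grid_size Q (I n) (J n)).1 mulrC.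
  by rewrite ler_pM2r ?(dx_gt0 HW)// ler_nat.
have /choice[c hc] : forall n, exists c : R, P n ->
    gy Q (J n) (j n)%:R < c < gy Q (J n) (j n).+1%:R /\
    nabla_y Q (@on_grid R Q (I n) (J n) u) (i n) (j n) = u1 (gx Q (I n) (i n)%:R, c).
  move=> n; have [Pn|nP] := pselect (P n); last by exists 0.
  have dY := dy_gt0 HS (J n); case/andP: (Pn) => i0 iI.
  have hx' : xW Q < gx Q (I n) (i n)%:R < xE Q by apply: (gx_lt HW); exact: node_itv.
  have /andP[y0 _] : yS Q <= gy Q (J n) (j n)%:R <= yN Q.
    by apply: (gy_le HS); rewrite ler0n ler_nat leqW.
  have /andP[_ y1] : yS Q <= gy Q (J n) (j n).+1%:R <= yN Q.
    by apply: (gy_le HS); rewrite ler0n ler_nat; exact: jJ.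
  have y01 : gy Q (J n) (j n)%:R < gy Q (J n) (j n).+1%:R by rewrite -subr_gt0 gyB.
  have [c cc E] := MVT_e2 cu du hx' y0 y01 y1.
  have j1 : ((j n).+1 <= (J n).+1)%N := jJ n.
  by exists c => _; split=> //; rewrite /nabla_y !grid_at ?(leqW (jJ n)) ?(leqW iI)// E gyB mulfK// gt_eqF.
pose X n := if P n then gx Q (I n) (i n)%:R else p.1.
pose Y n := if P n then c n else p.2.
apply: (@cvg_eventually (fun n => u1 (X n, Y n))).
  case: hP => N _ hN; exists N => // n /= Nn; have Pn := hN n Nn.
  by rewrite /X /Y Pn; have [_ ->] := hc n Pn.
apply: cvg_mesh_point => // n; rewrite /X /Y; case: ifP => Pn.
- by apply: (le_trans (hi n)); rewrite ler_pM2r ?(dx_gt0 HW)// ler_nat.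
- by rewrite subrr normr0 mulr_ge0// ltW// (dx_gt0 HW).
- have [/andP[c0 c1] _] := hc n Pn; have := gyB (J n) (j n); have := hj n.
  rewrite !ler_norml; move: (gy _ _ _) (gy _ _ _) (dy _ _) (c n) (p.2) c0 c1.
  by move=> a a' h s t h1 h2 /andP[h3 h4] h5; apply/andP; split; lra.
- by rewrite subrr normr0 mulr_ge0// ltW// (dy_gt0 HS).
Qed.

(** Dominated convergence on a set of finite measure, with a constant as dominating function. *)
Lemma array_l2 (c : nat -> nat -> nat -> R) (c0 : R * R -> R) (C : R) :
  (forall n i j, (i <= I n)%N -> (j <= J n)%N -> `|c n i j| <= C) ->
  {ae mu, forall p, Om p -> pc Q (I n) (J n) (c n) p @[n --> \oo] --> c0 p} ->
  measurable_fun (Om : set MP) (c0 : MP -> R) -> (forall p, Om p -> `|c0 p| <= C) ->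
  nrm (pc Q (I n) (J n) (c n) - c0) @[n --> \oo] --> (0 : R).
Proof.
move=> cC hc mc0 c0C; have l0 : l2 c0 := sq_bounded mOm fOm mc0 c0C.
have lc n : l2 (pc Q (I n) (J n) (c n)) := pc_l2 HW HS (I n) (J n) (c n).
have mc n := sq_measurable (lc n).
have bc n (p : MP) : Om p -> `|pc Q (I n) (J n) (c n) p| <= C.
  by move=> Op; have [iI jJ] := pc_index HW HS (I n) (J n) Op; exact: cC.
exact: (cvg_seminorm lc l0 (ip_dominated mOm fOm mc mc0 hc bc c0C)).
Qed.

Lemma cell_point p k n : Om p -> (k <= 1)%N ->
  `|gx Q (I n) (ix Q (I n) p)%:R - p.1| <= dx Q (I n) /\
  `|gy Q (J n) (iy Q (J n) p)%:R - p.2| <= dy Q (J n) /\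
  `|gx Q (I n) (ix Q (I n) p + k)%:R - p.1| <= 2 * dx Q (I n) /\
  `|gy Q (J n) (iy Q (J n) p + k)%:R - p.2| <= 2 * dy Q (J n).
Proof.
move=> Op k1; have z1 : 0 <= (0 : R) <= 1 by rewrite lexx ler01.
have kk : 0 <= (k%:R : R) <= 1 by rewrite ler0n lern1.
have [h1 h2] := node_dist (I n) (J n) Op z1 z1; rewrite !addr0 in h1 h2.
have [h3 h4] := node_dist (I n) (J n) Op kk kk.
rewrite !natrD; split=> //; split=> //; split.
  by apply: (le_trans h3); rewrite ler_peMl ?ler1n// ltW// (dx_gt0 HW).
by apply: (le_trans h4); rewrite ler_peMl ?ler1n// ltW// (dy_gt0 HS).
Qed.

Lemma cell_point_pred p n : Om p ->
  `|gx Q (I n) (ix Q (I n) p).-1%:R - p.1| <= 2 * dx Q (I n) /\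
  `|gy Q (J n) (iy Q (J n) p).-1%:R - p.2| <= 2 * dy Q (J n).
Proof.
move=> Op; have [h1 [h2 _]] := cell_point n Op (leq0n 1).
have dX := dx_gt0 HW (I n); have dY := dy_gt0 HS (J n).
split.
  case: (ix Q (I n) p) h1 => [|k] /= h1; first by rewrite mulr2n mulrDl mul1r (le_trans h1)// lerDr ltW.
  have := gxB Q (I n) k; move: h1; rewrite !ler_norml.
  by move: (gx _ _ _) (gx _ _ _) (dx _ _) (p.1) => *; lra.
case: (iy Q (J n) p) h2 => [|k] /= h2; first by rewrite mulr2n mulrDl mul1r (le_trans h2)// lerDr ltW.
have := gyB (J n) k; move: h2; rewrite !ler_norml.
by move: (gy _ _ _) (gy _ _ _) (dy _ _) (p.2) => *; lra.
Qed.

Lemma H10h_grid z n : (forall p, ~ Om p -> z p = 0) -> H10h (@on_grid R Q (I n) (J n) z).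
Proof.
move=> z0 i j iI jJ nij; rewrite grid_at//; apply: z0 => -[/= /andP[x1 x2] /andP[y1 y2]].
move/negP: nij; apply; apply/andP; split; apply/andP; split.
- by rewrite lt0n; apply/eqP => i0; move: x1; rewrite i0 /gx mul0r addr0 ltxx.
- rewrite leqNgt; apply/negP => Ii; move: x2; rewrite ltNge => /negP; apply.
  rewrite /gx -lerBlDl -(grid_size Q (I n) 0).1 mulrC ler_pM2r ?(dx_gt0 HW)//.
  by rewrite ler_nat.
- by rewrite lt0n; apply/eqP => i0; move: y1; rewrite i0 /gy mul0r addr0 ltxx.
rewrite leqNgt; apply/negP => Ii; move: y2; rewrite ltNge => /negP; apply.
rewrite /gy -lerBlDl -(grid_size Q 0 (J n)).2 mulrC ler_pM2r ?(dy_gt0 HS)//.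
by rewrite ler_nat.
Qed.

Lemma test_out z : test z -> forall p, ~ Om p -> z p = 0.
Proof. by move=> [_ [K [_ KO z0]]] p np; apply: z0 => Kp; apply: np; exact: KO. Qed.

Lemma test_bar z : test z -> {within Omega_bar Q, continuous z}.
Proof. by move=> tz; apply: continuous_subspaceT; exact: (test_continuous tz). Qed.

Lemma smoothing_cvg0 : @smoothing R (I n) (J n) @[n --> \oo] --> (0 : R).
Proof.
apply: near_cvg => e e0.
have w0 : 0 < xE Q - xW Q by rewrite subr_gt0.
have [N _ hN] := mesh_small (mulr_gt0 e0 w0); exists N => // n /= Nn; have [h _] := hN n Nn.
rewrite subr0 gtr0_norm ?smoothing_gt0//; apply: (@le_trans _ _ ((I n).+1%:R^-1)).
  by rewrite lef_pV2 ?posrE ?ltr0n ?addn_gt0 ?orbT// ler_nat -addn1 -addnA leq_add2l addnS.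
move: h; rewrite /dx mulrC ltr_pM2r// => /ltW.
by [].
Qed.

(** The crude bound [K] applies only to the bent part, whose area is a controlled share of the
    rectangle. The factor 3 is for the square of three terms, and (1 - t)^2 <= 1 - t for [t] in
    [0, 1]. *)
Lemma smoothing_err n (D A A' z0 : R * R -> R) (x1 x2 y1 y2 C K : R) :
  [/\ 0 <= x1, x1 <= x2, x2 <= 1, 0 <= y1 & y1 <= y2 <= 1] ->
  l2 D -> l2 A -> l2 A' -> l2 z0 ->
  (forall p, Om p -> `|D p - z0 p| <= C * `|A p - z0 p| + C * `|A' p - z0 p|
    + K * (1 - subcells Q (I n) (J n) x1 x2 y1 y2 p)) ->
  ipO (D - z0) (D - z0) <= 3 * (C ^+ 2 * ipO (A - z0) (A - z0) + C ^+ 2 * ipO (A' - z0) (A' - z0)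
    + K ^+ 2 * ((1 - (x2 - x1) * (y2 - y1)) * fine (mu Om))).
Proof.
move=> [a1 a2 a3 a4 /andP[a5 a6]] lD lA lA' lz h.
have lDz := l2B lD lz; have lAz := l2B lA lz; have lAz' := l2B lA' lz.
have [ms is_] := pc_subcells_integral HW HS (I n) (J n) (fun _ _ => 1) a1 a2 a3 a4 a5 a6.
pose s p := pc Q (I n) (J n) (fun _ _ => 1) p * subcells Q (I n) (J n) x1 x2 y1 y2 p.
have sE p : s p = subcells Q (I n) (J n) x1 x2 y1 y2 p by rewrite /s mul1r.
have s01 p : 0 <= s p <= 1 by rewrite sE /subcells ler0n lern1 leq_b1.
have rs : rint s.
  by apply: (rint_bounded mOm fOm (C := 1)) => // p _; case/andP: (s01 p) => s0 s1; rewrite ger0_norm.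
have r1 : rint (fun=> 1).
  by apply: (rint_bounded mOm fOm (C := 1)) => // p _; rewrite normr1.
have c1 : cellsum Q (I n) (J n) (fun _ _ => 1) = fine (mu Om).
  rewrite -(pc_integral HW HS); have -> : pc Q (I n) (J n) (fun _ _ => 1) = fun=> 1 by [].
  by rewrite (Rintegral_cst _ mOm) mul1r.
have i1 : \int[mu]_(p in Om) (1 - s p) = (1 - (x2 - x1) * (y2 - y1)) * fine (mu Om).
  rewrite (RintegralB mOm r1 rs) [X in _ - X]is_ c1 (Rintegral_cst _ mOm) mul1r.
  by rewrite [RHS]mulrBl mul1r.
have rA := rintZ mOm (C ^+ 2) (sq_mul mOm lAz lAz).
have rA' := rintZ mOm (C ^+ 2) (sq_mul mOm lAz' lAz').
have rK := rintZ mOm (K ^+ 2) (rintB mOm r1 rs).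
have -> : 3 * (C ^+ 2 * ipO (A - z0) (A - z0) + C ^+ 2 * ipO (A' - z0) (A' - z0)
    + K ^+ 2 * ((1 - (x2 - x1) * (y2 - y1)) * fine (mu Om))) =
  \int[mu]_(p in Om) (3 * (C ^+ 2 * ((A - z0) p * (A - z0) p) + C ^+ 2 * ((A' - z0) p * (A' - z0) p)
    + K ^+ 2 * (1 - s p))).
  rewrite (RintegralZl _ mOm (rintD mOm (rintD mOm rA rA') rK)).
  rewrite (RintegralD mOm (rintD mOm rA rA') rK) (RintegralD mOm rA rA').
  rewrite (RintegralZl _ mOm (sq_mul mOm lAz lAz)) (RintegralZl _ mOm (sq_mul mOm lAz' lAz')).
  by rewrite (RintegralZl _ mOm (rintB mOm r1 rs)) i1.
apply: (le_Rintegral mOm (sq_mul mOm lDz lDz)).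
  exact: (rintZ mOm 3 (rintD mOm (rintD mOm rA rA') rK)).
move=> p Op; have := h p Op; rewrite -sE; case/andP: (s01 p) => s0 s1.
rewrite -!expr2 -(real_normK (num_real ((D - z0) p))).
rewrite -(real_normK (num_real ((A - z0) p))) -(real_normK (num_real ((A' - z0) p))).
change (D p - z0 p) with ((D - z0) p); change (A p - z0 p) with ((A - z0) p).
change (A' p - z0 p) with ((A' - z0) p).
move: `|(D - z0) p| (normr_ge0 ((D - z0) p)) `|(A - z0) p| `|(A' - z0) p| (s p) s0 s1.
move=> x x0 y y' t t0 t1 hle.
have h1 : x ^+ 2 <= (C * y + C * y' + K * (1 - t)) ^+ 2.
  by rewrite ler_sqr ?nnegrE// (le_trans x0).
apply: (le_trans h1); rewrite -subr_ge0.
rewrite (_ : _ - _ = (C * y - C * y') ^+ 2 + (C * y - K * (1 - t)) ^+ 2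
  + (C * y' - K * (1 - t)) ^+ 2 + 3 * (K ^+ 2 * (t * (1 - t)))); last by ring.
by rewrite !addr_ge0 ?sqr_ge0// mulr_ge0// mulr_ge0 ?sqr_ge0// mulr_ge0// subr_ge0.
Qed.

Lemma cvg0_squeeze (u v : nat -> R) : (forall n, 0 <= u n <= v n) ->
  v n @[n --> \oo] --> (0 : R) -> u n @[n --> \oo] --> (0 : R).
Proof.
move=> uv hv; apply: near_cvg => e e0; have [N _ hN] := cvg_near hv e0.
exists N => // n /= Nn; have := hN n Nn; have /andP[u0 u1] := uv n.
rewrite /= !subr0 !ger0_norm ?(le_trans u0)// => h.
exact: (le_trans u1 (ltW h)).
Qed.

Lemma cvg0_scale (c : R) (u : nat -> R) : u n @[n --> \oo] --> (0 : R) ->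
  (c * u n) @[n --> \oo] --> (0 : R).
Proof. by move=> h; rewrite -(mulr0 c); apply: cvgM => //; exact: cvg_cst. Qed.

Lemma cvg0_add (u v : nat -> R) : u n @[n --> \oo] --> (0 : R) ->
  v n @[n --> \oo] --> (0 : R) -> (u n + v n) @[n --> \oo] --> (0 : R).
Proof. by move=> h h'; rewrite -(addr0 0); exact: cvgD. Qed.

(** [g] is the slope of the ramp, [t] the weight of the other edge, and [s] says whether the slope
    is exactly 1; the last term is (g - 1) z0. *)
Lemma mollified_err (C K g t a a' z0 : R) (s : bool) : `|g| <= C -> 0 <= t <= 1 ->
  (s -> g = 1) -> `|z0| <= K ->
  `|g * ((1 - t) * a + t * a') - z0| <=
    C * `|a - z0| + C * `|a' - z0| + (C + 1) * K * (1 - s%:R).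
Proof.
move=> hg /andP[t0 t1] hs hz; have C0 : 0 <= C by apply: le_trans hg.
rewrite (_ : _ - z0 = g * (1 - t) * (a - z0) + g * t * (a' - z0) + (g - 1) * z0); last by ring.
apply: (le_trans (ler_normD _ _)); apply: lerD.
  apply: (le_trans (ler_normD _ _)); apply: lerD; rewrite normrM ler_wpM2r// normrM.
    by apply: (le_trans _ hg); rewrite ler_piMr// ger0_norm ?subr_ge0// gerBl.
  by apply: (le_trans _ hg); rewrite ler_piMr// ger0_norm.
case: s hs => [/(_ isT) ->|_] /=; first by rewrite !subrr mul0r normr0 mulr0.
rewrite subr0 mulr1 normrM ler_pM//.
by apply: (le_trans (ler_normB _ _)); rewrite normr1 lerD2r.
Qed.

Section TestFunction.
Variable z : R * R -> R.
Hypothesis tz : test z.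
Local Notation Z n := (@on_grid R Q (I n) (J n) z).
Local Notation z1 := (fun p : R * R => 'D_e1 z p).
Local Notation z2 := (fun p : R * R => 'D_e2 z p).
Let ax1 : axis (e1 : R * R) := or_introl erefl.
Let ax2 : axis (e2 : R * R) := or_intror erefl.

Lemma cvg_test_x p k : Om p -> (k <= 1)%N ->
  nabla_x Q (Z n) (ix Q (I n) p) (iy Q (J n) p + k) @[n --> \oo] --> z1 p.
Proof.
move=> Op k1; have [t1 d1] := test_derive ax1 tz.
apply: (cvg_nabla_x (u1 := z1)) => //.
- exact: test_bar.
- by have /(_ p) := test_continuous t1.
- by move=> n; have [] := pc_index HW HS (I n) (J n) Op.
- by move=> n; have [_ [_ []]] := cell_point n Op (leq0n 1); rewrite addn0.
- by move=> n; have [_ [_ []]] := cell_point n Op k1.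
Qed.

Lemma cvg_test_y p k : Om p -> (k <= 1)%N ->
  nabla_y Q (Z n) (ix Q (I n) p + k) (iy Q (J n) p) @[n --> \oo] --> z2 p.
Proof.
move=> Op k1; have [t1 d1] := test_derive ax2 tz.
apply: (cvg_nabla_y (u1 := z2)) => //.
- exact: test_bar.
- by have /(_ p) := test_continuous t1.
- by move=> n; have [] := pc_index HW HS (I n) (J n) Op.
- by move=> n; have [_ [_ []]] := cell_point n Op k1.
- by move=> n; have [_ [_ [_]]] := cell_point n Op (leq0n 1); rewrite addn0.
Qed.

Lemma test_nabla_bounded : exists C : R, [/\ 0 <= C,
  forall n i j, (i <= I n)%N -> (j <= (J n).+1)%N -> `|nabla_x Q (Z n) i j| <= C,
  forall n i j, (i <= (I n).+1)%N -> (j <= J n)%N -> `|nabla_y Q (Z n) i j| <= C,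
  forall p, `|z1 p| <= C & forall p, `|z2 p| <= C].
Proof.
have [t1 d1] := test_derive ax1 tz; have [t2 d2] := test_derive ax2 tz.
have [C1 [C10 hC1]] := test_bounded t1; have [C2 [C20 hC2]] := test_bounded t2.
have hZ n : H10h (Z n) := H10h_grid (test_out tz).
exists (C1 + C2); split.
- exact: addr_ge0.
- move=> n i j iI jJ; case j0 : ((0 < j <= J n)%N).
    have [c _ [-> h]] := nabla_x_bound (u1 := z1) (C := C1) (test_bar tz)
      (fun p _ => d1 p) (fun p _ => hC1 p) iI j0.
    by apply: (le_trans h); rewrite lerDl.
  rewrite (nabla_x_boundary Q (hZ n) iI) ?normr0 ?addr_ge0//.
  by move: j0; case: j jJ => [|j] jJ /= h; [left|right; apply/eqP; rewrite eqn_leq jJ ltnNge h].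
- move=> n i j iI jJ; case j0 : ((0 < i <= I n)%N).
    have [c _ [-> h]] := nabla_y_bound (u1 := z2) (C := C2) (test_bar tz)
      (fun p _ => d2 p) (fun p _ => hC2 p) j0 jJ.
    by apply: (le_trans h); rewrite lerDr.
  rewrite (nabla_y_boundary Q (hZ n) jJ) ?normr0 ?addr_ge0//.
  by move: j0; case: i iI => [|i] iI /= h; [left|right; apply/eqP; rewrite eqn_leq iI ltnNge h].
- by move=> p; apply: (le_trans (hC1 p)); rewrite lerDl.
- by move=> p; apply: (le_trans (hC2 p)); rewrite lerDr.
Qed.

(** On the unbent part the gradient of the interpolant is a convex combination of difference
    quotients of [z], which converge; the bent strips have relative area 2 d and everything on them
    is bounded. *)
Lemma interpolant_strong :
  gradsq Q (interpolant Q (Z n) - z) @[n --> \oo] --> (0 : R).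
Proof.
have [t1 d1] := test_derive ax1 tz; have [t2 d2] := test_derive ax2 tz.
have hZ n : H10h (Z n) := H10h_grid (test_out tz).
have [C [C0 b1 b2 b3 b4]] := test_nabla_bounded.
have [Cd [Cd0 hCd]] := @dramp_bounded R.
have l1 := test_l2 HW HS t1; have l2' := test_l2 HW HS t2.
pose d n := @smoothing R (I n) (J n).
have dd n : 0 < d n /\ d n <= 8^-1 by split; [exact: smoothing_gt0|exact: smoothing_le].
have hg n t : `|dramp (d n) t| <= Cd.
  by apply: hCd; [exact: smoothing_gt0|exact: smoothing_le4].
have A1 k : (k <= 1)%N -> nrm (pc Q (I n) (J n) (fun i j => nabla_x Q (Z n) i (j + k)) - z1)
    @[n --> \oo] --> (0 : R).
  move=> k1; apply: (array_l2 (c := fun n i j => nabla_x Q (Z n) i (j + k)) (C := C)).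
  - move=> n i j iI jJ; apply: b1 => //.
    by rewrite -addn1 leq_add.
  - by apply: aeW => p Op; exact: cvg_test_x.
  - exact: sq_measurable l1.
  - by move=> p _; exact: b3.
have A2 k : (k <= 1)%N -> nrm (pc Q (I n) (J n) (fun i j => nabla_y Q (Z n) (i + k) j) - z2)
    @[n --> \oo] --> (0 : R).
  move=> k1; apply: (array_l2 (c := fun n i j => nabla_y Q (Z n) (i + k) j) (C := C)).
  - move=> n i j iI jJ; apply: b2 => //.
    by rewrite -addn1 leq_add.
  - by apply: aeW => p Op; exact: cvg_test_y.
  - exact: sq_measurable l2'.
  - by move=> p _; exact: b4.
have B1 k k1 := cvg_sqr0 HW HS (fun n => l2B (pc_l2 HW HS (I n) (J n)
  (fun i j => nabla_x Q (Z n) i (j + k))) l1) (A1 k k1).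
have B2 k k1 := cvg_sqr0 HW HS (fun n => l2B (pc_l2 HW HS (I n) (J n)
  (fun i j => nabla_y Q (Z n) (i + k) j)) l2') (A2 k k1).
pose V n := (Cd + 1) * C * ((Cd + 1) * C) * (2 * fine (mu Om) * d n).
have cV : V n @[n --> \oo] --> (0 : R).
  apply: cvg0_scale; apply: cvg0_scale; exact: smoothing_cvg0.
have E n : gradsq Q (interpolant Q (Z n) - z) =
    ipO (interpolant_x Q (Z n) - z1) (interpolant_x Q (Z n) - z1) +
    ipO (interpolant_y Q (Z n) - z2) (interpolant_y Q (Z n) - z2).
  have [lx ly h [a1 a2]] := interpolant_l2 HW HS (hZ n).
  have hT := H10_H1 h; have Hz := test_H1 HW HS tz.
  rewrite (gradsqB HW HS hT Hz); congr (_ + _).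
    apply: (ipO_ae HW HS (l2B (wd_l2 ax1 hT) (wd_l2 ax1 Hz)) (l2B lx l1)).
    apply: (ae_sub2 _ a1 (wd_test HW HS ax1 tz)) => p h1 h2 Op.
    exact: (congr2 (fun x y => x - y) (h1 Op) (h2 Op)).
  apply: (ipO_ae HW HS (l2B (wd_l2 ax2 hT) (wd_l2 ax2 Hz)) (l2B ly l2')).
  apply: (ae_sub2 _ a2 (wd_test HW HS ax2 tz)) => p h1 h2 Op.
  exact: (congr2 (fun x y => x - y) (h1 Op) (h2 Op)).
have core n t : d n <= t < 1 - d n -> dramp (d n) t = 1.
  by move=> /andP[t1' t2']; apply: (dramp_id (dd n).1); rewrite t1' ltW.
(* For the x-derivative only the x-fraction has to avoid the bends; the ramp of the y-fraction is
   just a convex weight. *)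
have box n : [/\ 0 <= d n, d n <= 1 - d n, 1 - d n <= 1, (0 : R) <= 0 & 0 <= (1 : R) <= 1].
  by have [] := dd n; move: (d n) => x h1 h2; split=> //; rewrite ?ler01 ?lexx //; lra.
have box' n : [/\ (0 : R) <= 0, 0 <= (1 : R), (1 : R) <= 1, 0 <= d n & d n <= 1 - d n <= 1].
  by have [] := dd n; move: (d n) => x h1 h2; split=> //; rewrite ?ler01 ?lexx //; lra.
have X1 n : ipO (interpolant_x Q (Z n) - z1) (interpolant_x Q (Z n) - z1) <=
  3 * (Cd ^+ 2 * ipO (pc Q (I n) (J n) (fun i j => nabla_x Q (Z n) i (j + 0)) - z1)
                     (pc Q (I n) (J n) (fun i j => nabla_x Q (Z n) i (j + 0)) - z1)
    + Cd ^+ 2 * ipO (pc Q (I n) (J n) (fun i j => nabla_x Q (Z n) i (j + 1)) - z1)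
                     (pc Q (I n) (J n) (fun i j => nabla_x Q (Z n) i (j + 1)) - z1) + V n).
  have -> : V n = ((Cd + 1) * C) ^+ 2 * ((1 - (1 - d n - d n) * (1 - 0)) * fine (mu Om)).
    by rewrite /V; move: (fine _) (d n) => x y; ring.
  have [lx _ _ _] := interpolant_l2 HW HS (hZ n).
  apply: (@smoothing_err n _ _ _ _ _ _ _ _ _ _ (box n) lx (pc_l2 HW HS _ _ _) (pc_l2 HW HS _ _ _) l1) => p Op.
  have [_ -> _] := interpolantE HW HS (Z n) Op.
  have -> : nabla_x Q (Z n) (ix Q (I n) p) (iy Q (J n) p).+1 =
    pc Q (I n) (J n) (fun i j => nabla_x Q (Z n) i (j + 1)) p by rewrite -addn1.
  have -> : nabla_x Q (Z n) (ix Q (I n) p) (iy Q (J n) p) =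
    pc Q (I n) (J n) (fun i j => nabla_x Q (Z n) i (j + 0)) p.
    by rewrite -[in LHS](addn0 (iy Q (J n) p)).
  apply: mollified_err.
  - exact: hg.
  - exact: (ramp_frac HW HS (I n) (J n) Op).2.
  - by move=> /andP[h _]; exact: core.
  - exact: b3.
have X2 n : ipO (interpolant_y Q (Z n) - z2) (interpolant_y Q (Z n) - z2) <=
  3 * (Cd ^+ 2 * ipO (pc Q (I n) (J n) (fun i j => nabla_y Q (Z n) (i + 0) j) - z2)
                     (pc Q (I n) (J n) (fun i j => nabla_y Q (Z n) (i + 0) j) - z2)
    + Cd ^+ 2 * ipO (pc Q (I n) (J n) (fun i j => nabla_y Q (Z n) (i + 1) j) - z2)
                     (pc Q (I n) (J n) (fun i j => nabla_y Q (Z n) (i + 1) j) - z2) + V n).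
  have -> : V n = ((Cd + 1) * C) ^+ 2 * ((1 - (1 - 0) * (1 - d n - d n)) * fine (mu Om)).
    by rewrite /V; move: (fine _) (d n) => x y; ring.
  have [_ lx _ _] := interpolant_l2 HW HS (hZ n).
  apply: (@smoothing_err n _ _ _ _ _ _ _ _ _ _ (box' n) lx (pc_l2 HW HS _ _ _) (pc_l2 HW HS _ _ _) l2') => p Op.
  have [_ _ ->] := interpolantE HW HS (Z n) Op.
  have -> : nabla_y Q (Z n) (ix Q (I n) p).+1 (iy Q (J n) p) =
    pc Q (I n) (J n) (fun i j => nabla_y Q (Z n) (i + 1) j) p by rewrite -addn1.
  have -> : nabla_y Q (Z n) (ix Q (I n) p) (iy Q (J n) p) =
    pc Q (I n) (J n) (fun i j => nabla_y Q (Z n) (i + 0) j) p.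
    by rewrite -[in LHS](addn0 (ix Q (I n) p)).
  apply: mollified_err.
  - exact: hg.
  - exact: (ramp_frac HW HS (I n) (J n) Op).1.
  - by move=> /andP[_ h]; exact: core.
  - exact: b4.
pose a k n := let r := pc Q (I n) (J n) (fun i j => nabla_x Q (Z n) i (j + k)) - z1 in ipO r r.
pose b k n := let r := pc Q (I n) (J n) (fun i j => nabla_y Q (Z n) (i + k) j) - z2 in ipO r r.
apply: (cvg0_squeeze (v := fun n => 3 * (Cd ^+ 2 * a 0%N n + Cd ^+ 2 * a 1%N n + V n)
  + 3 * (Cd ^+ 2 * b 0%N n + Cd ^+ 2 * b 1%N n + V n))).
  move=> n; rewrite E; apply/andP; split; last by apply: lerD; [exact: X1|exact: X2].
  have [lx ly _ _] := interpolant_l2 HW HS (hZ n).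
  by apply: addr_ge0; [exact: (si_ge0 S (l2B lx l1))|exact: (si_ge0 S (l2B ly l2'))].
have T (u v : nat -> R) : u n @[n --> \oo] --> (0 : R) -> v n @[n --> \oo] --> (0 : R) ->
    3 * (Cd ^+ 2 * u n + Cd ^+ 2 * v n + V n) @[n --> \oo] --> (0 : R).
  move=> hu hv.
  exact: (cvg0_scale 3 (cvg0_add (cvg0_add (cvg0_scale _ hu) (cvg0_scale _ hv)) cV)).
have Ta := T (a 0%N) (a 1%N) (B1 0%N isT) (B1 1%N isT).
have Tb := T (b 0%N) (b 1%N) (B2 0%N isT) (B2 1%N isT).
exact: (cvg0_add Ta Tb).
Qed.

End TestFunction.

End Sequence.
End Consistency.

(** * Weak comparison of difference quotients and gradients *)

Section WeakConsistency.
Context {R : realType}.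
Variable Q : rectangle R.
Hypotheses (HW : xW Q < xE Q) (HS : yS Q < yN Q).
Local Notation Om := (Omega Q).
Local Notation MP := (measurableTypeR R * measurableTypeR R)%type.
Local Notation mu := (@plane_measure R).
Local Notation mOm := (measurable_Omega Q).
Local Notation fOm := (finite_Omega HW HS).
Local Notation l2 := (@sq_integrable _ MP R mu Om).
Local Notation ipO := (@ip _ MP R mu Om).
Local Notation nrm := (seminorm ipO).
Local Notation S := (ip_semi_inner mOm fOm).
Local Notation l2B := (lsB (sq_linear_set mOm fOm)).
Local Notation test := (test_function Om).
Implicit Types (p q : R * R) (u w z : R * R -> R).
Local Opaque weak_derivative e1 e2.
Let ax1 : axis (e1 : R * R) := or_introl erefl.
Let ax2 : axis (e2 : R * R) := or_intror erefl.

Lemma cvg_sqrt0 (u : nat -> R) : u n @[n --> \oo] --> (0 : R) ->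
  Num.sqrt (u n) @[n --> \oo] --> (0 : R).
Proof.
by move=> h; rewrite -[X in _ --> X]sqrtr0; apply: (cvg_comp u Num.sqrt h); exact: sqrt_continuous.
Qed.

Lemma sqrt_le (x c : R) : 0 <= c -> x <= c ^+ 2 -> Num.sqrt x <= c.
Proof. by move=> c0 h; rewrite -(ger0_norm c0) -sqrtr_sqr; exact: ler_wsqrtr. Qed.

Lemma ip_cvg0 (u w : nat -> R * R -> R) (C : R) : (forall n, l2 (u n)) -> (forall n, l2 (w n)) ->
  (forall n, nrm (u n) <= C) -> nrm (w n) @[n --> \oo] --> (0 : R) ->
  ipO (u n) (w n) @[n --> \oo] --> (0 : R).
Proof.
move=> lu lw uC hw; apply/norm_cvg0P.
apply: (cvg0_squeeze (v := fun n => C * nrm (w n))); last exact: cvg0_scale.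
move=> n; rewrite normr_ge0/=; apply: (le_trans (si_CS_norm S (lu n) (lw n))).
by apply: ler_wpM2r; [exact: sqrtr_ge0|exact: uC].
Qed.

(** Weak convergence is only required against the one function [y0], in addition to a bound. *)
Lemma ip_weak_strong (x y : nat -> R * R -> R) (x0 y0 : R * R -> R) (C : R) :
  (forall n, l2 (x n)) -> l2 x0 -> (forall n, l2 (y n)) -> l2 y0 ->
  (forall n, nrm (x n) <= C) -> nrm (y n - y0) @[n --> \oo] --> (0 : R) ->
  ipO y0 (x n) @[n --> \oo] --> ipO y0 x0 ->
  ipO (x n) (y n) @[n --> \oo] --> ipO x0 y0.
Proof.
move=> lx lx0 ly ly0 xC hy hx.
have h := ip_cvg0 lx (fun n => l2B (ly n) ly0) xC hy.
have E n : ipO (x n) (y n) = ipO (x n) (y n - y0) + ipO y0 (x n).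
  rewrite (linear_onB (sq_linear_set mOm fOm) (si_linear_onr S (lx n)) (ly n) ly0).
  by rewrite (si_sym S ly0 (lx n)) subrK.
rewrite (si_sym S lx0 ly0) -[X in _ --> X]add0r; under eq_fun do rewrite E.
exact: cvgD.
Qed.

Lemma strong_weak (x : nat -> R * R -> R) (x0 y0 : R * R -> R) : (forall n, l2 (x n)) -> l2 x0 -> l2 y0 ->
  nrm (x n - x0) @[n --> \oo] --> (0 : R) -> ipO y0 (x n) @[n --> \oo] --> ipO y0 x0.
Proof.
move=> lx lx0 ly0 hx.
have h := ip_cvg0 (fun _ => ly0) (fun n => l2B (lx n) lx0) (fun _ => lexx _) hx.
have E n : ipO y0 (x n) = ipO y0 (x n - x0) + ipO y0 x0.
  by rewrite (linear_onB (sq_linear_set mOm fOm) (si_linear_onr S ly0) (lx n) lx0) subrK.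
rewrite -[X in _ --> X]add0r; under eq_fun do rewrite E.
by apply: cvgD => //; exact: cvg_cst.
Qed.

Lemma cvg_bounded (u : nat -> R) (l : R) : u n @[n --> \oo] --> l ->
  exists C : R, forall n, `|u n| <= C.
Proof.
move=> h; have [N _ hN] := cvg_near h ltr01.
exists (`|l| + 1 + \sum_(0 <= k < N) `|u k|) => n; have [Nn|nN] := leqP N n.
  have := hN n Nn => /= h1; apply: (@le_trans _ _ (`|l| + 1)); last by rewrite lerDl sumr_ge0.
  by rewrite -(subrK l (u n)) addrC (le_trans (ler_normD _ _))// lerD2l ltW.
by rewrite big_mkord (bigD1 (Ordinal nN))//= addrCA lerDl addr_ge0 ?sumr_ge0.
Qed.

Section Sequence.
Variables (I J : nat -> nat).
Hypotheses (hx : dx Q (I n) @[n --> \oo] --> (0 : R))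
  (hy : dy Q (J n) @[n --> \oo] --> (0 : R)).
Local Notation PC c n := (pc Q (I n) (J n) (c n)).

(** The limit [y0] is only square integrable, so the coefficient error is dominated by a multiple of
    [y0 ^+ 2] rather than by a constant. *)
Lemma array_mul (c : nat -> nat -> nat -> R) (c0 : R * R -> R)
    (y : nat -> R * R -> R) (y0 : R * R -> R) (C : R) :
  (forall n i j, (i <= I n)%N -> (j <= J n)%N -> `|c n i j| <= C) ->
  {ae mu, forall p, Om p -> PC c n p @[n --> \oo] --> c0 p} ->
  measurable_fun (Om : set MP) (c0 : MP -> R) -> (forall p, Om p -> `|c0 p| <= C) ->
  (forall n, l2 (y n)) -> l2 y0 -> nrm (y n - y0) @[n --> \oo] --> (0 : R) ->
  nrm ((fun p => PC c n p * y n p) - (fun p => c0 p * y0 p)) @[n --> \oo] --> (0 : R).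
Proof.
move=> cC hc mc0 c0C ly ly0 hy0.
have C0 : 0 <= `|C| by [].
have bc n (p : MP) : Om p -> `|PC c n p| <= `|C|.
  move=> Op; have [iI jJ] := pc_index HW HS (I n) (J n) Op.
  by apply: (le_trans (cC n _ _ iI jJ)); exact: ler_norm.
have bc0 (p : MP) : Om p -> `|c0 p| <= `|C|.
  by move=> Op; apply: (le_trans (c0C p Op)); exact: ler_norm.
have mc n : measurable_fun (Om : set MP) (PC c n : MP -> R) := pc_measurable HW HS _ _ _.
have lcy n : l2 (fun p => PC c n p * y0 p) := l2_bounded_mul (mc n) (bc n) ly0.
have lc0 : l2 (fun p => c0 p * y0 p) := l2_bounded_mul mc0 bc0 ly0.
have lcB n : l2 (fun p => PC c n p * (y n - y0) p) :=
  l2_bounded_mul (mc n) (bc n) (l2B (ly n) ly0).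
have K n : nrm ((fun p => PC c n p * y n p) - (fun p => c0 p * y0 p)) <=
    `|C| * nrm (y n - y0) + nrm ((fun p => PC c n p * y0 p) - (fun p => c0 p * y0 p)).
  have -> : (fun p => PC c n p * y n p) - (fun p => c0 p * y0 p) =
      (fun p => PC c n p * (y n - y0) p)
      + ((fun p => PC c n p * y0 p) - (fun p => c0 p * y0 p)).
    apply/funext => p; rewrite !fctE; ring.
  apply: (le_trans (seminormD S (lcB n) (l2B (lcy n) lc0))); rewrite lerD2r.
  exact: (nrm_bounded_mul HW HS C0 (mc n) (bc n) (l2B (ly n) ly0)).
apply: (cvg0_squeeze (v := fun n => `|C| * nrm (y n - y0) +
  nrm ((fun p => PC c n p * y0 p) - (fun p => c0 p * y0 p)))).
  by move=> n; rewrite sqrtr_ge0 K.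
apply: cvg0_add; first exact: cvg0_scale.
apply: cvg_sqrt0; rewrite /ip.
have -> : (0 : R) = \int[mu]_(p in Om) (fun=> 0) p.
  by rewrite (Rintegral_cst _ mOm) mul0r.
apply: (Rintegral_dominated mOm (h := fun p => (2 * `|C|) ^+ 2 * (y0 p * y0 p))).
- move=> n; exact: rint_measurable (sq_mul mOm (l2B (lcy n) lc0) (l2B (lcy n) lc0)).
- exact: measurable_cst.
- apply: ae_sub hc => p hp Op; have h := hp Op.
  have E n : ((fun p => PC c n p * y0 p) - (fun p => c0 p * y0 p)) p *
     ((fun p => PC c n p * y0 p) - (fun p => c0 p * y0 p)) p =
     y0 p ^+ 2 * ((PC c n p - c0 p) * (PC c n p - c0 p)).
    by rewrite !fctE; move: (pc _ _ _ _ _) (c0 p) (y0 p) => *; ring.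
  under eq_fun do rewrite E.
  have h0 : (PC c n p - c0 p) @[n --> \oo] --> (0 : R).
    by rewrite -(subrr (c0 p)); apply: cvgB => //; exact: cvg_cst.
  by apply: cvg0_scale; rewrite -(mulr0 (0 : R)); exact: cvgM.
- exact: (rintZ mOm _ (sq_mul mOm ly0 ly0)).
move=> n p Op; have h1 := bc n p Op; have h2 := bc0 p Op.
rewrite !fctE -!mulrBl (_ : _ * _ = (PC c n p - c0 p) ^+ 2 * (y0 p * y0 p)); last by ring.
rewrite normrM ger0_norm ?sqr_ge0// [X in _ * X]ger0_norm -?expr2 ?sqr_ge0//.
apply: ler_wpM2r; first exact: sqr_ge0.
have h3 : `|PC c n p - c0 p| <= 2 * `|C|.
  by apply: (le_trans (ler_normB _ _)); rewrite mulr2n mulrDl !mul1r lerD.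
by rewrite -real_normK ?num_real//; apply: lerXn2r; rewrite ?nnegrE ?mulr_ge0.
Qed.

(** Summation by parts produces a backward difference, whose index [i.-1] is wrong in the first
    column. The mask removes that column; its partner in the pairing is 0 there, and a given
    interior point eventually leaves it. *)
Lemma cvg_masked_x z : test z ->
  nrm (pc Q (I n) (J n) (fun i j => mask i (mask j (nabla_x Q (@on_grid R Q (I n) (J n) z) i.-1 j)))
    - (fun p : R * R => 'D_e1 z p)) @[n --> \oo] --> (0 : R).
Proof.
move=> tz; have [t1 d1] := test_derive ax1 tz.
have [K [K0 b1 b2 b3 b4]] := test_nabla_bounded HW HS I J tz.
apply: (array_l2 HW HS (c := fun n i j => mask i (mask j
  (nabla_x Q (@on_grid R Q (I n) (J n) z) i.-1 j))) (C := K)).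
- move=> n i j iI jJ; rewrite /mask; do 2?case: ifP => _; rewrite ?normr0//.
  by apply: b1; rewrite ?leqW// (leq_trans _ iI)// leq_pred.
- apply: aeW => p Op.
  apply: (@cvg_eventually _ (fun n => nabla_x Q (@on_grid R Q (I n) (J n) z)
     (ix Q (I n) p).-1 (iy Q (J n) p))).
    have [N _ hN] := cell_interior HW HS hx hy Op; exists N => // n /= Nn.
    by have [i0 j0] := hN n Nn; rewrite /pc /mask i0 j0.
  apply: (cvg_nabla_x HW HS hx hy (u1 := fun p : R * R => 'D_e1 z p) Op (test_bar tz)).
  + by have /(_ p) := test_continuous t1.
  + move=> n; have [iI _] := pc_index HW HS (I n) (J n) Op.
    by rewrite (leq_trans _ iI)// leq_pred.
  + by move=> n; have [] := cell_point_pred HW HS I J n Op.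
  + by move=> n; have [_ [_ [_]]] := cell_point HW HS I J n Op (leq0n 1); rewrite addn0.
- exact: sq_measurable (test_l2 HW HS t1).
- by move=> p _; exact: b3.
Qed.

Lemma cvg_masked_y z : test z ->
  nrm (pc Q (I n) (J n) (fun i j => mask i (mask j (nabla_y Q (@on_grid R Q (I n) (J n) z) i j.-1)))
    - (fun p : R * R => 'D_e2 z p)) @[n --> \oo] --> (0 : R).
Proof.
move=> tz; have [t1 d1] := test_derive ax2 tz.
have [K [K0 b1 b2 b3 b4]] := test_nabla_bounded HW HS I J tz.
apply: (array_l2 HW HS (c := fun n i j => mask i (mask j
  (nabla_y Q (@on_grid R Q (I n) (J n) z) i j.-1))) (C := K)).
- move=> n i j iI jJ; rewrite /mask; do 2?case: ifP => _; rewrite ?normr0//.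
  by apply: b2; rewrite ?leqW// (leq_trans _ jJ)// leq_pred.
- apply: aeW => p Op.
  apply: (@cvg_eventually _ (fun n => nabla_y Q (@on_grid R Q (I n) (J n) z)
     (ix Q (I n) p) (iy Q (J n) p).-1)).
    have [N _ hN] := cell_interior HW HS hx hy Op; exists N => // n /= Nn.
    by have [i0 j0] := hN n Nn; rewrite /pc /mask i0 j0.
  apply: (cvg_nabla_y HW HS hx hy (u1 := fun p : R * R => 'D_e2 z p) Op (test_bar tz)).
  + by have /(_ p) := test_continuous t1.
  + move=> n; have [_ jJ] := pc_index HW HS (I n) (J n) Op.
    by rewrite (leq_trans _ jJ)// leq_pred.
  + by move=> n; have [_ [_ []]] := cell_point HW HS I J n Op (leq0n 1); rewrite addn0.
  + by move=> n; have [] := cell_point_pred HW HS I J n Op.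
- exact: sq_measurable (test_l2 HW HS t1).
- by move=> p _; exact: b4.
Qed.

Lemma cvg_pc_test z : test z ->
  nrm (pc Q (I n) (J n) (at_ (@on_grid R Q (I n) (J n) z)) - z) @[n --> \oo] --> (0 : R).
Proof.
move=> tz; have [K [K0 hK]] := test_bounded tz.
apply: (array_l2 HW HS (c := fun n => at_ (@on_grid R Q (I n) (J n) z)) (C := K)).
- by move=> n i j iI jJ; rewrite grid_at ?leqW.
- apply: aeW => p Op; have h01 : 0 <= (0 : R) <= 1 by rewrite lexx ler01.
  have h := cvg_node HW HS hx hy Op (test_continuous tz (x := p)) h01 h01.
  apply: (cvg_eventually _ h); exists 0%N => // n _.
  have [iI jJ] := pc_index HW HS (I n) (J n) Op.
  by rewrite /pc grid_at ?leqW// !addr0.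
- exact: sq_measurable (test_l2 HW HS tz).
- by move=> p _; exact: hK.
Qed.

Section Bounded.
Variable v : forall n, @gridfun R (I n) (J n).
Hypothesis hv : forall n, H10h (v n).
Variable C : R.
Hypothesis vC : forall n, dirichlet Q (v n) <= C.
Local Notation ax n := (pc Q (I n) (J n) (nabla_x Q (v n))).
Local Notation ay n := (pc Q (I n) (J n) (nabla_y Q (v n))).
Local Notation av n := (pc Q (I n) (J n) (at_ (v n))).
Local Notation T n := (interpolant Q (v n)).

Lemma cellsum_sqr_ge0 n (c : nat -> nat -> R) : 0 <= cellsum Q (I n) (J n) (fun i j => c i j ^+ 2).
Proof. by apply: (cellsum_ge0 HW HS) => i j; exact: sqr_ge0. Qed.

Lemma nrm_ax n : nrm (ax n) <= Num.sqrt C /\ nrm (ay n) <= Num.sqrt C.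
Proof.
have h1 := cellsum_sqr_ge0 n (nabla_x Q (v n)).
have h2 := cellsum_sqr_ge0 n (nabla_y Q (v n)).
have E (c : nat -> nat -> R) : ipO (pc Q (I n) (J n) c) (pc Q (I n) (J n) c) =
    cellsum Q (I n) (J n) (fun i j => c i j ^+ 2) by rewrite (pc_ip HW HS).
by split; apply: ler_wsqrtr; rewrite E; apply: (le_trans _ (vC n)); rewrite ?lerDl ?lerDr.
Qed.

(** The distance is of the order of the mesh width times the root of the discrete energy, hence no
    convergence of [v] is needed. *)
Lemma nrm_T_pc : nrm (T n - av n) @[n --> \oo] --> (0 : R).
Proof.
apply: cvg_sqrt0.
apply: (cvg0_squeeze (v := fun n => 6 * C * (dx Q (I n) ^+ 2 + dy Q (J n) ^+ 2))).
  move=> n; have [_ _ h _] := interpolant_l2 HW HS (@hv n); have lT := H1_l2 (H10_H1 h).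
  rewrite (si_ge0 S (l2B lT (pc_l2 HW HS (I n) (J n) (at_ (v n)))))/=.
  apply: (le_trans (interpolant_pc HW HS (@hv n))); rewrite -!mulrA [_ * dirichlet _ _]mulrC.
  by rewrite ler_pM2l// ler_wpM2r// addr_ge0 ?sqr_ge0.
apply: cvg0_scale; apply: cvg0_add; rewrite -(mulr0 (0 : R)); under eq_fun do rewrite expr2;
  exact: cvgM.
Qed.

Lemma nrm_interpolant_bounded : exists K : R, forall n,
  [/\ nrm (interpolant_x Q (v n)) <= K, nrm (interpolant_y Q (v n)) <= K & nrm (T n) <= K].
Proof.
have [Cd [Cd0 hCd]] := @dramp_bounded R.
have hd n t : `|dramp (@smoothing R (I n) (J n)) t| <= Cd.
  by apply: hCd; [exact: smoothing_gt0|exact: smoothing_le4].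
pose G := 2 * Cd ^+ 2 * C; pose W := (2 * (xE Q - xW Q)) ^+ 2.
exists (Num.sqrt ((1 + W) * G)) => n; have [lx ly h _] := interpolant_l2 HW HS (@hv n).
have hG : gradsq Q (T n) <= G.
  by apply: (le_trans (gradsq_upper HW HS (hd n) (@hv n))); rewrite ler_wpM2l ?mulr_ge0 ?sqr_ge0.
have gx0 := si_ge0 S lx; have gy0 := si_ge0 S ly.
have G0 : 0 <= G by apply: le_trans hG; rewrite (gradsq_interpolant HW HS (@hv n)) addr_ge0.
have W0 : 0 <= W := sqr_ge0 _.
have h1 : G <= (1 + W) * G by rewrite ler_peMl// lerDl.
rewrite (gradsq_interpolant HW HS (@hv n)) in hG.
split; apply: ler_wsqrtr.
- by apply: le_trans h1; apply: (le_trans _ hG); rewrite lerDl.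
- by apply: le_trans h1; apply: (le_trans _ hG); rewrite lerDr.
apply: (le_trans (poincare_gradsq HW HS h)); rewrite (gradsq_interpolant HW HS (@hv n)).
apply: (@le_trans _ _ (W * G)); first by rewrite ler_wpM2l.
by rewrite ler_wpM2r// lerDr.
Qed.

Lemma nrm_av_bounded : exists K : R, forall n, nrm (av n) <= K.
Proof.
have [K hK] := nrm_interpolant_bounded; have [K' hK'] := cvg_bounded nrm_T_pc.
exists (K + K') => n; have [_ _ hT] := hK n.
have [_ _ h _] := interpolant_l2 HW HS (@hv n); have lT := H1_l2 (H10_H1 h).
have la := pc_l2 HW HS (I n) (J n) (at_ (v n)).
rewrite -(subKr (T n) (av n)).
apply: (le_trans (seminormB S lT (l2B lT la))); apply: lerD => //.
by apply: (le_trans (ler_norm _)); exact: hK'.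
Qed.

Lemma abel_test_x z n : test z ->
  ipO (pc Q (I n) (J n) (at_ (@on_grid R Q (I n) (J n) z))) (ax n) =
  - ipO (av n) (pc Q (I n) (J n) (fun i j => mask i (mask j (nabla_x Q (@on_grid R Q (I n) (J n) z) i.-1 j)))).
Proof.
move=> tz; rewrite !(pc_ip HW HS) -mulN1r -cellsumZ.
have dX : dx Q (I n) != 0 by rewrite gt_eqF ?(dx_gt0 HW).
have := @abel_x R Q (I n) (J n) (fun i j => at_ (v n) i j)
  (fun i j => at_ (@on_grid R Q (I n) (J n) z) i j / dx Q (I n)).
move=> E; apply: (etrans (etrans _ (E _))).
- by apply: eq_cellsum => i j _ _; rewrite /nabla_x; move: (_^-1) => k; ring.
- by move=> j jJ; rewrite !(H10h_at (@hv n)) ?(leqW jJ)//; auto.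
apply: eq_cellsum => i j iI jJ; rewrite /mask.
case: i iI => [|i] iI /=; first by rewrite (H10h_at (@hv n)) ?(leqW iI) ?(leqW jJ) ?mul0r ?mulr0//; auto.
case: j jJ => [|j] jJ /=; first by rewrite (H10h_at (@hv n)) ?(leqW iI) ?(leqW jJ) ?mul0r ?mulr0//; auto.
by rewrite /nabla_x; move: (_^-1) => k; ring.
Qed.

Lemma abel_test_y z n : test z ->
  ipO (pc Q (I n) (J n) (at_ (@on_grid R Q (I n) (J n) z))) (ay n) =
  - ipO (av n) (pc Q (I n) (J n) (fun i j => mask i (mask j (nabla_y Q (@on_grid R Q (I n) (J n) z) i j.-1)))).
Proof.
move=> tz; rewrite !(pc_ip HW HS) -mulN1r -cellsumZ.
have := @abel_y R Q (I n) (J n) (fun i j => at_ (v n) i j)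
  (fun i j => at_ (@on_grid R Q (I n) (J n) z) i j / dy Q (J n)).
move=> E; apply: (etrans (etrans _ (E _))).
- by apply: eq_cellsum => i j _ _; rewrite /nabla_y; move: (_^-1) => k; ring.
- by move=> j jJ; rewrite !(H10h_at (@hv n)) ?(leqW jJ)//; auto.
apply: eq_cellsum => i j iI jJ; rewrite /mask.
case: i iI => [|i] iI /=; first by rewrite (H10h_at (@hv n)) ?(leqW iI) ?(leqW jJ) ?mul0r ?mulr0//; auto.
case: j jJ => [|j] jJ /=; first by rewrite (H10h_at (@hv n)) ?(leqW iI) ?(leqW jJ) ?mul0r ?mulr0//; auto.
by rewrite /nabla_y; move: (_^-1) => k; ring.
Qed.

(** By [weak_l2] a smooth weight suffices. The derivative then moves to it on both sides, by
    [abel_x] for the difference quotient and by [ibp_test] for the gradient, and what is compared is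
    [v] with its interpolant. *)
Lemma consistency_x X0 : l2 X0 ->
  ipO X0 (ax n - interpolant_x Q (v n)) @[n --> \oo] --> (0 : R).
Proof.
move=> lX; have [K hK] := nrm_interpolant_bounded; have [Ka hKa] := nrm_av_bounded.
have la n : l2 (ax n) := pc_l2 HW HS _ _ _.
have lv n : l2 (av n) := pc_l2 HW HS _ _ _.
have lx n : l2 (interpolant_x Q (v n)) by have [] := interpolant_l2 HW HS (@hv n).
have lT n : l2 (T n) by have [_ _ h _] := interpolant_l2 HW HS (@hv n); exact: H1_l2 (H10_H1 h).
apply: (weak_l2 HW HS (C := Num.sqrt C + K) (fun n => l2B (la n) (lx n)) _ _ lX).
  move=> n; apply: (le_trans (seminormB S (la n) (lx n))); apply: lerD.
    exact: (nrm_ax n).1.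
  by have [] := hK n.
move=> z tz; have [t1 d1] := test_derive ax1 tz; have lz := test_l2 HW HS tz.
have l1 := test_l2 HW HS t1.
pose Z n := pc Q (I n) (J n) (at_ (@on_grid R Q (I n) (J n) z)).
pose M n := pc Q (I n) (J n) (fun i j => mask i (mask j
  (nabla_x Q (@on_grid R Q (I n) (J n) z) i.-1 j))).
have lZ n : l2 (Z n) := pc_l2 HW HS _ _ _.
have lM n : l2 (M n) := pc_l2 HW HS _ _ _.
(* Three errors, each a bounded sequence paired with a null one: sampling of [z], its backward
   difference, and interpolant against nodal array. *)
have E n : ipO z (ax n - interpolant_x Q (v n)) = - ipO (ax n) (Z n - z)
    + (- ipO (av n) (M n - (fun p : R * R => 'D_e1 z p)) + ipO (fun p : R * R => 'D_e1 z p) (T n - av n)).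
  rewrite (linear_onB (sq_linear_set mOm fOm) (si_linear_onr S lz) (la n) (lx n)).
  rewrite (linear_onB (sq_linear_set mOm fOm) (si_linear_onr S (la n)) (lZ n) lz).
  rewrite (linear_onB (sq_linear_set mOm fOm) (si_linear_onr S (lv n)) (lM n) l1).
  rewrite (linear_onB (sq_linear_set mOm fOm) (si_linear_onr S l1) (lT n) (lv n)).
  have i1 : ipO z (interpolant_x Q (v n)) = - ipO (fun p : R * R => 'D_e1 z p) (T n).
    rewrite -(ibp_test HW HS ax1 tz (interpolant_test HW HS (@hv n))).
    congr (ipO z _); apply/funext => p; apply/esym; apply: is_derive_val.
    exact: (is_derive_interpolant Q (v n) p).1.
  rewrite i1 (si_sym S lz (la n)) (si_sym S (la n) (lZ n)) (si_sym S l1 (lv n)).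
  rewrite [ipO (Z n) (ax n)](abel_test_x n tz) -/(M n).
  by move: (ipO _ _) (ipO _ _) (ipO _ _) (ipO _ _) => *; ring.
have c1 := ip_cvg0 la (fun n => l2B (lZ n) lz) (fun n => (nrm_ax n).1) (cvg_pc_test tz).
have c2 := ip_cvg0 lv (fun n => l2B (lM n) l1) hKa (cvg_masked_x tz).
have c3 := ip_cvg0 (fun=> l1) (fun n => l2B (lT n) (lv n)) (fun=> lexx _) nrm_T_pc.
have n1 := cvg0_scale (-1) c1; have n2 := cvg0_scale (-1) c2.
apply: (cvg_eventually _ (cvg0_add n1 (cvg0_add n2 c3))).
by exists 0%N => // n _; rewrite E !mulN1r.
Qed.

Lemma consistency_y X0 : l2 X0 ->
  ipO X0 (ay n - interpolant_y Q (v n)) @[n --> \oo] --> (0 : R).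
Proof.
move=> lX; have [K hK] := nrm_interpolant_bounded; have [Ka hKa] := nrm_av_bounded.
have la n : l2 (ay n) := pc_l2 HW HS _ _ _.
have lv n : l2 (av n) := pc_l2 HW HS _ _ _.
have lx n : l2 (interpolant_y Q (v n)) by have [] := interpolant_l2 HW HS (@hv n).
have lT n : l2 (T n) by have [_ _ h _] := interpolant_l2 HW HS (@hv n); exact: H1_l2 (H10_H1 h).
apply: (weak_l2 HW HS (C := Num.sqrt C + K) (fun n => l2B (la n) (lx n)) _ _ lX).
  move=> n; apply: (le_trans (seminormB S (la n) (lx n))); apply: lerD.
    exact: (nrm_ax n).2.
  by have [] := hK n.
move=> z tz; have [t1 d1] := test_derive ax2 tz; have lz := test_l2 HW HS tz.
have l1 := test_l2 HW HS t1.
pose Z n := pc Q (I n) (J n) (at_ (@on_grid R Q (I n) (J n) z)).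
pose M n := pc Q (I n) (J n) (fun i j => mask i (mask j
  (nabla_y Q (@on_grid R Q (I n) (J n) z) i j.-1))).
have lZ n : l2 (Z n) := pc_l2 HW HS _ _ _.
have lM n : l2 (M n) := pc_l2 HW HS _ _ _.
have E n : ipO z (ay n - interpolant_y Q (v n)) = - ipO (ay n) (Z n - z)
    + (- ipO (av n) (M n - (fun p : R * R => 'D_e2 z p)) + ipO (fun p : R * R => 'D_e2 z p) (T n - av n)).
  rewrite (linear_onB (sq_linear_set mOm fOm) (si_linear_onr S lz) (la n) (lx n)).
  rewrite (linear_onB (sq_linear_set mOm fOm) (si_linear_onr S (la n)) (lZ n) lz).
  rewrite (linear_onB (sq_linear_set mOm fOm) (si_linear_onr S (lv n)) (lM n) l1).
  rewrite (linear_onB (sq_linear_set mOm fOm) (si_linear_onr S l1) (lT n) (lv n)).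
  have i1 : ipO z (interpolant_y Q (v n)) = - ipO (fun p : R * R => 'D_e2 z p) (T n).
    rewrite -(ibp_test HW HS ax2 tz (interpolant_test HW HS (@hv n))).
    congr (ipO z _); apply/funext => p; apply/esym; apply: is_derive_val.
    exact: (is_derive_interpolant Q (v n) p).2.
  rewrite i1 (si_sym S lz (la n)) (si_sym S (la n) (lZ n)) (si_sym S l1 (lv n)).
  rewrite [ipO (Z n) (ay n)](abel_test_y n tz) -/(M n).
  by move: (ipO _ _) (ipO _ _) (ipO _ _) (ipO _ _) => *; ring.
have c1 := ip_cvg0 la (fun n => l2B (lZ n) lz) (fun n => (nrm_ax n).2) (cvg_pc_test tz).
have c2 := ip_cvg0 lv (fun n => l2B (lM n) l1) hKa (cvg_masked_y tz).
have c3 := ip_cvg0 (fun=> l1) (fun n => l2B (lT n) (lv n)) (fun=> lexx _) nrm_T_pc.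
have n1 := cvg0_scale (-1) c1; have n2 := cvg0_scale (-1) c2.
apply: (cvg_eventually _ (cvg0_add n1 (cvg0_add n2 c3))).
by exists 0%N => // n _; rewrite E !mulN1r.
Qed.

End Bounded.
End Sequence.
End WeakConsistency.

Lemma cvg_sum (R : realType) (u w : nat -> R) (a b : R) : u n @[n --> \oo] --> a ->
  w n @[n --> \oo] --> b -> (u n + w n) @[n --> \oo] --> a + b.
Proof. exact: cvgD. Qed.

Lemma abs0_le (R : realType) (x e : R) : 0 <= x -> x <= e -> `|x - 0| <= e.
Proof. by move=> x0 xe; rewrite subr0 ger0_norm. Qed.

Lemma thrice (R : realType) (x : R) : x + (x + x) <= 3 * x.
Proof. by rewrite (_ : 3 * x = x + (x + x))//; ring. Qed.

Lemma split23 (R : realType) (e : R) : 7 * (3 * (e / 23)) + (e / 23 + e / 23) <= e.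
Proof. by rewrite [leLHS](_ : _ = e)//; field. Qed.

(** * Limits of the discrete forms along sequences of grids *)

Section Limits.
Context {R : realType}.
Variable Q : rectangle R.
Hypotheses (HW : xW Q < xE Q) (HS : yS Q < yN Q).
Local Notation Om := (Omega Q).
Local Notation MP := (measurableTypeR R * measurableTypeR R)%type.
Local Notation mu := (@plane_measure R).
Local Notation mOm := (measurable_Omega Q).
Local Notation fOm := (finite_Omega HW HS).
Local Notation l2 := (@sq_integrable _ MP R mu Om).
Local Notation ipO := (@ip _ MP R mu Om).
Local Notation wd := (weak_derivative Om).
Local Notation nrm := (seminorm ipO).
Local Notation S := (ip_semi_inner mOm fOm).
Local Notation l2B := (lsB (sq_linear_set mOm fOm)).
Local Notation test := (test_function Om).
Implicit Types (p q : R * R) (u w z : R * R -> R).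
Local Opaque weak_derivative e1 e2.
Let ax1 : axis (e1 : R * R) := or_introl erefl.
Let ax2 : axis (e2 : R * R) := or_intror erefl.

Let m1 : measurable_fun (Om : set MP) ((fun=> 1) : MP -> R) := measurable_cst _.
Let b1 : forall p, Om p -> 1 <= (fun=> (1 : R)) p <= 1 := fun _ _ => introT andP (conj (lexx _) (lexx _)).
Local Notation G u := (Num.sqrt (gradsq Q u)).

Lemma grad_dist u w z : H1 Om u -> H1 Om w -> H1 Om z -> G (u - z) <= G (u - w) + G (w - z).
Proof.
move=> hu hw hz; have si := energy_si HW HS m1 ler01 b1.
have HB := lsB (H1_set HW HS).
have E x : H1 Om x -> G x = seminorm (energy Om (fun=> 1)) x.
  by move=> h; rewrite /seminorm (energy1E h).
have key (a b c a' b' c' : R) : a = a' -> b = b' -> c = c' -> a' <= b' + c' -> a <= b + c.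
  by move=> -> -> ->.
exact: (key _ _ _ _ _ _ (E _ (HB _ _ hu hz)) (E _ (HB _ _ hu hw)) (E _ (HB _ _ hw hz))
  (seminorm_dist si hu hw hz)).
Qed.

Lemma grad_distC u w : H1 Om u -> H1 Om w -> G (u - w) = G (w - u).
Proof.
move=> hu hw; have si := energy_si HW HS m1 ler01 b1.
have HB := lsB (H1_set HW HS).
have E x : H1 Om x -> G x = seminorm (energy Om (fun=> 1)) x.
  by move=> h; rewrite /seminorm (energy1E h).
exact: (etrans (E _ (HB _ _ hu hw)) (etrans (seminorm_distC si hu hw) (esym (E _ (HB _ _ hw hu))))).
Qed.

Lemma strong_bounded (x : nat -> R * R -> R) (x0 : R * R -> R) : (forall n, l2 (x n)) -> l2 x0 ->
  nrm (x n - x0) @[n --> \oo] --> (0 : R) -> exists C : R, forall n, nrm (x n) <= C.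
Proof.
move=> lx lx0 h; have [C hC] := cvg_bounded h.
exists (C + nrm x0) => n; rewrite -[x n](subrK x0).
apply: (le_trans (seminormD S (l2B (lx n) lx0) lx0)); rewrite lerD2r.
by apply: (le_trans (ler_norm _)).
Qed.

Lemma gradsq_ge0 u : H1 Om u -> 0 <= gradsq Q u.
Proof. by move=> h; apply: addr_ge0; [exact: (si_ge0 S (wd_l2 ax1 h))|exact: (si_ge0 S (wd_l2 ax2 h))]. Qed.

Lemma le_eq (x y : R) : x = y -> x <= y. Proof. by move=> ->. Qed.

Lemma nrm_wdB e u w : axis e -> H1 Om u -> H1 Om w -> nrm (wd e u - wd e w) <= G (u - w).
Proof.
move=> he hu hw; have HB := lsB (H1_set HW HS) hu hw; apply: ler_wsqrtr.
rewrite -(ipO_ae HW HS (wd_l2 he HB) (l2B (wd_l2 he hu) (wd_l2 he hw)) (wdB HW HS he hu hw)).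
exact: (wd_le_gradsq HW HS he HB).
Qed.

Section Sequence.
Variables (I J : nat -> nat).
Hypotheses (hx : dx Q (I n) @[n --> \oo] --> (0 : R))
  (hy : dy Q (J n) @[n --> \oo] --> (0 : R)).
Local Notation PC c n := (pc Q (I n) (J n) (c n)).
Local Notation grid z n := (@on_grid R Q (I n) (J n) z).

Lemma cvg_pc_nabla_test z : test z ->
  nrm (pc Q (I n) (J n) (nabla_x Q (grid z n)) - (fun p : R * R => 'D_e1 z p)) @[n --> \oo] --> (0 : R) /\
  nrm (pc Q (I n) (J n) (nabla_y Q (grid z n)) - (fun p : R * R => 'D_e2 z p)) @[n --> \oo] --> (0 : R).
Proof.
move=> tz; have [t1 d1] := test_derive ax1 tz; have [t2 d2] := test_derive ax2 tz.
have [K [K0 h1 h2 h3 h4]] := test_nabla_bounded HW HS I J tz; split.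
  apply: (array_l2 HW HS (c := fun n => nabla_x Q (grid z n)) (C := K)).
  - by move=> n i j iI jJ; apply: h1; rewrite ?leqW.
  - apply: aeW => p Op; have h := cvg_test_x HW HS hx hy tz Op (leq0n 1).
    by apply: (cvg_eventually _ h); exists 0%N => // n _; rewrite addn0.
  - exact: sq_measurable (test_l2 HW HS t1).
  - by move=> p _; exact: h3.
apply: (array_l2 HW HS (c := fun n => nabla_y Q (grid z n)) (C := K)).
- by move=> n i j iI jJ; apply: h2; rewrite ?leqW.
- apply: aeW => p Op; have h := cvg_test_y HW HS hx hy tz Op (leq0n 1).
  by apply: (cvg_eventually _ h); exists 0%N => // n _; rewrite addn0.
- exact: sq_measurable (test_l2 HW HS t2).
- by move=> p _; exact: h4.
Qed.

(** 49 is a convenient square above 256/7, the reciprocal of the constant in [gradsq_lower]. *)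
Lemma dirichlet_le n (v : @gridfun R (I n) (J n)) : H10h v ->
  dirichlet Q v <= 49 * gradsq Q (interpolant Q v).
Proof.
move=> hv; have := gradsq_lower HW HS hv.
have : 0 <= dirichlet Q v by apply: addr_ge0; apply: (cellsum_ge0 HW HS) => i j; exact: sqr_ge0.
by move: (dirichlet _ _) (gradsq _ _) => x y; lra.
Qed.

Lemma nrm_pc_nabla n (v : @gridfun R (I n) (J n)) : H10h v ->
  nrm (pc Q (I n) (J n) (nabla_x Q v)) <= 7 * G (interpolant Q v) /\
  nrm (pc Q (I n) (J n) (nabla_y Q v)) <= 7 * G (interpolant Q v).
Proof.
move=> hv; have h := dirichlet_le hv; have [_ _ hT _] := interpolant_l2 HW HS hv.
have g0 : 0 <= gradsq Q (interpolant Q v).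
  exact: (gradsq_ge0 (H10_H1 hT)).
have h1 := cellsum_sqr_ge0 HW HS I J n (nabla_x Q v).
have h2 := cellsum_sqr_ge0 HW HS I J n (nabla_y Q v).
have E (c : nat -> nat -> R) : ipO (pc Q (I n) (J n) c) (pc Q (I n) (J n) c) =
    cellsum Q (I n) (J n) (fun i j => c i j ^+ 2) by rewrite (pc_ip HW HS).
have s7 : (7 * G (interpolant Q v)) ^+ 2 = 49 * gradsq Q (interpolant Q v).
  by rewrite exprMn sqr_sqrtr//; congr (_ * _); ring.
split; apply: sqrt_le; rewrite ?mulr_ge0 ?sqrtr_ge0// s7 E; apply: (le_trans _ h).
  by rewrite lerDl.
by rewrite lerDr.
Qed.

Section Strong.
Variables (psi : forall n, @gridfun R (I n) (J n)) (psi0 : R * R -> R).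
Hypotheses (hpsi : forall n, H10h (psi n)) (hpsi0 : H10 Om psi0)
  (cpsi : G (interpolant Q (psi n) - psi0) @[n --> \oo] --> (0 : R)).
Local Notation T n := (interpolant Q (psi n)).

(** The grid functions are compared with samples of a test function close to the limit. For the
    samples the convergence is classical, and the discrete energy of the difference is controlled by
    its interpolant; this is the use of the lower energy bound. *)
Lemma strong_grad (e : R) : 0 < e -> \forall n \near \oo,
  nrm (pc Q (I n) (J n) (nabla_x Q (psi n)) - wd e1 psi0) <= e /\
  nrm (pc Q (I n) (J n) (nabla_y Q (psi n)) - wd e2 psi0) <= e.
Proof.
(* 23 = 7 * 3 + 2: three distances [de] between the interpolants, multiplied by the 7 of
   [nrm_pc_nabla], and two more on the side of the test function. *)
move=> e0; pose de : R := e / 23; have de0 : 0 < de by rewrite divr_gt0.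
have [z [tz hz]] := hpsi0.2 (de ^+ 2) (exprn_gt0 2 de0).
have Hp := H10_H1 hpsi0; have Hz := test_H1 HW HS tz; have HB := lsB (H1_set HW HS).
have gz : G (psi0 - z) <= de.
  apply: sqrt_le; first exact: ltW.
  have E : H1_normsq Om (psi0 \- z) = ipO (psi0 - z) (psi0 - z) + gradsq Q (psi0 - z) :=
    H1_normsqE (HB _ _ Hp Hz).
  apply: le_trans (ltW hz); rewrite E lerDr.
  exact: (si_ge0 S (H1_l2 (HB _ _ Hp Hz))).
have [c1 c2] := cvg_pc_nabla_test tz; have c3 := cvg_sqrt0 (interpolant_strong HW HS hx hy tz).
have [N1 _ k1] := cvg_near c1 de0; have [N2 _ k2] := cvg_near c2 de0.
have [N3 _ k3] := cvg_near c3 de0; have [N4 _ k4] := cvg_near cpsi de0.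
exists (maxn (maxn N1 N2) (maxn N3 N4)); first by [].
move=> n /=; rewrite !geq_max => /andP[/andP[n1 n2] /andP[n3 n4]].
have close0 (x d : R) : `|x - 0| < d -> x <= d.
  by rewrite subr0 => h; apply: (le_trans (ler_norm x)); exact: ltW.
have q1 := close0 _ _ (k1 n n1); have q2 := close0 _ _ (k2 n n2).
have q3 := close0 _ _ (k3 n n3); have q4 := close0 _ _ (k4 n n4).
have hZ : H10h (grid z n) := H10h_grid HW HS (test_out tz).
pose w : @gridfun R (I n) (J n) := (- 1) *: grid z n + psi n.
have hw : H10h w by apply: (@H10h_set R (I n) (J n)).2; [exact: hZ|exact: (@hpsi n)].
have Tw : interpolant Q w = T n - interpolant Q (grid z n).
  by rewrite interpolant_linear scaleN1r addrC.
have HTp : H1 Om (T n) by have [_ _ h _] := interpolant_l2 HW HS (@hpsi n); exact: H10_H1.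
have HTz : H1 Om (interpolant Q (grid z n)).
  by have [_ _ h _] := interpolant_l2 HW HS hZ; exact: H10_H1.
have gw : G (interpolant Q w) <= 3 * de.
  have q5 := le_trans (le_eq (grad_distC Hz HTz)) q3.
  have q6 := lerD q4 (le_trans (grad_dist Hp Hz HTz) (lerD gz q5)).
  have q7 : de + (de + de) <= 3 * de by exact: thrice.
  have q8 := le_trans (le_trans (grad_dist HTp Hp HTz) q6) q7.
  exact: (le_trans (le_eq (congr1 (fun x => G x) Tw)) q8).
have [wx wy] := nrm_pc_nabla hw.
have ex : pc Q (I n) (J n) (nabla_x Q w) =
    pc Q (I n) (J n) (nabla_x Q (psi n)) - pc Q (I n) (J n) (nabla_x Q (grid z n)).
  by apply/funext => p; rewrite !fctE /pc /nabla_x /w /at_ !mxE; move: (_^-1) => k; ring.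
have ey : pc Q (I n) (J n) (nabla_y Q w) =
    pc Q (I n) (J n) (nabla_y Q (psi n)) - pc Q (I n) (J n) (nabla_y Q (grid z n)).
  by apply/funext => p; rewrite !fctE /pc /nabla_y /w /at_ !mxE; move: (_^-1) => k; ring.
have fin (a b s t : R * R -> R) : l2 a -> l2 b -> l2 s -> l2 t -> nrm (a - b) <= 7 * (3 * de) ->
    nrm (b - s) <= de -> nrm (s - t) <= de -> nrm (a - t) <= e.
  move=> la lb ls lt r1 r2 r3; apply: (le_trans (seminorm_dist S la lb lt)).
  apply: (le_trans (lerD r1 (le_trans (seminorm_dist S lb ls lt) (lerD r2 r3)))).
  exact: split23.
have lD k : axis k -> l2 (fun p : R * R => 'D_k z p).
  by move=> hk; exact: (test_l2 HW HS (test_derive hk tz).1).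
have zp k : axis k -> nrm ((fun p : R * R => 'D_k z p) - wd k psi0) <= de.
  move=> hk; have h1 := le_trans (nrm_wdB hk Hz Hp) (le_trans (le_eq (grad_distC Hz Hp)) gz).
  have lz' := l2B (lD _ hk) (wd_l2 hk Hp); have lz'' := l2B (wd_l2 hk Hz) (wd_l2 hk Hp).
  apply: le_trans h1; apply: le_eq; apply: (nrm_ae HW HS lz' lz'').
  apply: ae_sub (wd_test HW HS hk tz) => p h Op.
  exact: (congr1 (fun x => x - wd k psi0 p) (esym (h Op))).
have w7 : 7 * G (interpolant Q w) <= 7 * (3 * de) by rewrite ler_pM2l.
have lpc c : l2 (pc Q (I n) (J n) c) := pc_l2 HW HS _ _ _.
split.
  exact: (fin _ _ _ _ (lpc _) (lpc _) (lD _ ax1) (wd_l2 ax1 Hp)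
    (le_trans (le_eq (congr1 (fun x => nrm x) (esym ex))) (le_trans wx w7)) q1 (zp _ ax1)).
exact: (fin _ _ _ _ (lpc _) (lpc _) (lD _ ax2) (wd_l2 ax2 Hp)
  (le_trans (le_eq (congr1 (fun x => nrm x) (esym ey))) (le_trans wy w7)) q2 (zp _ ax2)).
Qed.

Lemma strong_x : nrm (pc Q (I n) (J n) (nabla_x Q (psi n)) - wd e1 psi0) @[n --> \oo] --> (0 : R).
Proof.
apply: near_cvg => e e0; have [N _ hN] := strong_grad e0; exists N => // n /= Nn.
exact: (abs0_le (sqrtr_ge0 _) (hN n Nn).1).
Qed.

Lemma strong_y : nrm (pc Q (I n) (J n) (nabla_y Q (psi n)) - wd e2 psi0) @[n --> \oo] --> (0 : R).
Proof.
apply: near_cvg => e e0; have [N _ hN] := strong_grad e0; exists N => // n /= Nn.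
exact: (abs0_le (sqrtr_ge0 _) (hN n Nn).2).
Qed.

Lemma strong_dirichlet : exists C : R, forall n, dirichlet Q (psi n) <= C.
Proof.
have [C hC] := cvg_bounded cpsi; have Hp := H10_H1 hpsi0.
exists (49 * (C + G (psi0 - 0)) ^+ 2) => n.
have HT : H1 Om (T n) by have [_ _ h _] := interpolant_l2 HW HS (@hpsi n); exact: H10_H1.
apply: (le_trans (dirichlet_le (@hpsi n))); rewrite ler_pM2l//.
have H0 := ls0 (H1_set HW HS).
have g1 : G (T n - 0) <= C + G (psi0 - 0).
  apply: (le_trans (grad_dist HT Hp H0)); rewrite lerD2r.
  by apply: (le_trans (ler_norm _)).
have g0 : 0 <= gradsq Q (T n) := gradsq_ge0 HT.
have e0 : gradsq Q (T n) = G (T n - 0) ^+ 2 by rewrite subr0 sqr_sqrtr.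
rewrite e0; apply: lerXn2r; rewrite ?nnegrE ?sqrtr_ge0//.
exact: (le_trans (sqrtr_ge0 _) g1).
Qed.

Lemma strong_0 : nrm (pc Q (I n) (J n) (at_ (psi n)) - psi0) @[n --> \oo] --> (0 : R).
Proof.
have [C hC] := strong_dirichlet; have h := nrm_T_pc HW HS hx hy hpsi hC.
pose W := 2 * (xE Q - xW Q); have W0 : 0 <= W by rewrite mulr_ge0// subr_ge0 ltW.
have lp := H1_l2 (H10_H1 hpsi0).
apply: (cvg0_squeeze (v := fun n => nrm (T n - pc Q (I n) (J n) (at_ (psi n))) + W * G (T n - psi0))).
  move=> n; rewrite sqrtr_ge0/=.
  have [_ _ hT _] := interpolant_l2 HW HS (@hpsi n); have lT := H1_l2 (H10_H1 hT).
  have la : l2 (pc Q (I n) (J n) (at_ (psi n))) := pc_l2 HW HS _ _ _.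
  have hB := lsB (H10_set HW HS) hT hpsi0.
  have g0 : 0 <= gradsq Q (T n - psi0) := gradsq_ge0 (H10_H1 hB).
  have h3 : nrm (T n - psi0) <= W * G (T n - psi0).
    apply: sqrt_le; first by rewrite mulr_ge0 ?sqrtr_ge0.
    by rewrite exprMn sqr_sqrtr//; exact: (poincare_gradsq HW HS hB).
  exact: (le_trans (seminorm_dist S la lT lp) (lerD (le_eq (seminorm_distC S la lT)) h3)).
exact: (cvg0_add h (cvg0_scale W cpsi)).
Qed.

Lemma load_limit (c1 c2 c3 : nat -> nat -> nat -> R) (l1 l2' l3 : R * R -> R) (C : R) :
  (forall n i j, (i <= I n)%N -> (j <= J n)%N ->
     [/\ `|c1 n i j| <= C, `|c2 n i j| <= C & `|c3 n i j| <= C]) ->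
  {ae mu, forall p, Om p -> PC c1 n p @[n --> \oo] --> l1 p} ->
  {ae mu, forall p, Om p -> PC c2 n p @[n --> \oo] --> l2' p} ->
  {ae mu, forall p, Om p -> PC c3 n p @[n --> \oo] --> l3 p} ->
  [/\ measurable_fun (Om : set MP) (l1 : MP -> R), measurable_fun (Om : set MP) (l2' : MP -> R)
    & measurable_fun (Om : set MP) (l3 : MP -> R)] ->
  (forall p, Om p -> [/\ `|l1 p| <= C, `|l2' p| <= C & `|l3 p| <= C]) ->
  cellsum Q (I n) (J n) (fun i j => c1 n i j * nabla_x Q (psi n) i j)
  + cellsum Q (I n) (J n) (fun i j => c2 n i j * nabla_y Q (psi n) i j)
  + cellsum Q (I n) (J n) (fun i j => c3 n i j * at_ (psi n) i j) @[n --> \oo] -->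
  ipO (wd e1 psi0) l1 + ipO (wd e2 psi0) l2' + ipO psi0 l3.
Proof.
move=> hC a1 a2 a3 [m1' m2' m3'] bl; have Hp := H10_H1 hpsi0.
have key (c : nat -> nat -> nat -> R) (l : R * R -> R) (x : nat -> nat -> nat -> R) (x0 : R * R -> R) :
    (forall n i j, (i <= I n)%N -> (j <= J n)%N -> `|c n i j| <= C) ->
    {ae mu, forall p, Om p -> PC c n p @[n --> \oo] --> l p} ->
    measurable_fun (Om : set MP) (l : MP -> R) -> (forall p, Om p -> `|l p| <= C) ->
    l2 x0 -> nrm (PC x n - x0) @[n --> \oo] --> (0 : R) ->
    cellsum Q (I n) (J n) (fun i j => c n i j * x n i j) @[n --> \oo] --> ipO x0 l.
  move=> cC ca ml lC lx0 hxx; have ll := sq_bounded mOm fOm ml lC.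
  have lx n : l2 (PC x n) := pc_l2 HW HS _ _ _.
  have lc n : l2 (PC c n) := pc_l2 HW HS _ _ _.
  have [K hK] := strong_bounded lx lx0 hxx.
  have h := ip_weak_strong HW HS lx lx0 lc ll hK (array_l2 HW HS cC ca ml lC)
    (strong_weak HW HS lx lx0 ll hxx).
  apply: (cvg_eventually _ h); exists 0%N => // n _; rewrite (pc_ip HW HS).
  by apply: eq_cellsum => i j _ _; rewrite mulrC.
apply: cvgD; first apply: cvgD.
- apply: (key c1 l1 (fun n => nabla_x Q (psi n)) _ _ a1 m1' _ (wd_l2 ax1 Hp) strong_x).
    by move=> n i j iI jJ; have [] := hC n i j iI jJ.
  by move=> p Op; have [] := bl p Op.
- apply: (key c2 l2' (fun n => nabla_y Q (psi n)) _ _ a2 m2' _ (wd_l2 ax2 Hp) strong_y).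
    by move=> n i j iI jJ; have [] := hC n i j iI jJ.
  by move=> p Op; have [] := bl p Op.
apply: (key c3 l3 (fun n => at_ (psi n)) _ _ a3 m3' _ (H1_l2 Hp) strong_0).
  by move=> n i j iI jJ; have [] := hC n i j iI jJ.
by move=> p Op; have [] := bl p Op.
Qed.
End Strong.
Section Weak.
Variables (beta : R * R -> R) (m M : R).
Hypotheses (mb : measurable_fun (Om : set MP) (beta : MP -> R)) (m0 : 0 < m)
  (bb : forall p, Om p -> m <= beta p <= M).
Variables (v : forall n, @gridfun R (I n) (J n)) (v0 : R * R -> R).
Hypotheses (hv : forall n, H10h (v n)) (hv0 : H10 Om v0)
  (wv : weak_cvg Om beta \oo (fun n => interpolant Q (v n)) v0).
Local Notation T n := (interpolant Q (v n)).

Lemma energy_functional w : H10 Om w -> bounded_linear_functional Om beta (energy Om beta w).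
Proof.
move=> hw; have si := H10_energy_si HW HS mb m0 bb; split.
  exact: (si_linear_onr si hw).
exists (seminorm (energy Om beta) w) => u hu; exact: (si_CS_norm si hw hu).
Qed.

(** This extracts weak L^2 convergence of the gradients from weak convergence in H^1_0, which is
    phrased with functionals. *)
Lemma wd_functional e X0 : axis e -> l2 X0 ->
  bounded_linear_functional Om beta (fun u => ipO (wd e u) X0).
Proof.
move=> he lX; split.
  move=> c u w hu hw; have Hu := H10_H1 hu; have Hw := H10_H1 hw.
  have L := sq_linear_set mOm fOm; have lu := wd_l2 he Hu; have lw := wd_l2 he Hw.
  have h := ip_ae mOm (wd_l2 he ((H1_set HW HS).2 c _ _ Hu Hw)) (L.2 c _ _ lu lw) lX
    (wd_linear HW HS c he Hu Hw).
  exact: (etrans h (si_linear_on S lX c lu lw)).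
exists (Num.sqrt m^-1 * nrm X0) => u hu; have Hu := H10_H1 hu.
apply: (le_trans (si_CS_norm S (wd_l2 he Hu) lX)).
rewrite mulrAC ler_wpM2r ?sqrtr_ge0// /H10_norm -sqrtrM; last by rewrite invr_ge0 ltW.
by apply: ler_wsqrtr; exact: (wd_le_energy HW HS mb m0 bb he Hu).
Qed.

(** Weak convergence against the functionals [energy w] makes the interpolants pointwise bounded;
    uniform boundedness and the lower energy bound do the rest. *)
Lemma weak_dirichlet : exists C : R, forall n, dirichlet Q (v n) <= C.
Proof.
have si := H10_energy_si HW HS mb m0 bb.
have hT n : H10 Om (T n) by have [_ _ h _] := interpolant_l2 HW HS (@hv n).
have [w hw|C hC] := unif_bounded si (H10_complete HW HS mb m0 bb) hT.
  exact: (cvg_bounded (wv (energy_functional hw))).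
exists (49 * (m^-1 * C ^+ 2)) => n; apply: (le_trans (dirichlet_le (@hv n))).
rewrite ler_pM2l// ler_pdivlMl//.
have /andP[h _] := energy_bounds mb (ltW m0) bb (H10_H1 (hT n)).
apply: (le_trans h); rewrite -(seminorm_sqr si (hT n)).
by apply: lerXn2r; rewrite ?nnegrE ?sqrtr_ge0// (le_trans _ (hC n)) ?sqrtr_ge0.
Qed.

Lemma weak_x X0 : l2 X0 ->
  ipO X0 (pc Q (I n) (J n) (nabla_x Q (v n))) @[n --> \oo] --> ipO X0 (wd e1 v0).
Proof.
move=> lX; have [C hC] := weak_dirichlet.
have h := consistency_x HW HS hx hy hv hC lX; have h2 := wv (wd_functional ax1 lX).
have Hv := H10_H1 hv0.
have E n : ipO X0 (pc Q (I n) (J n) (nabla_x Q (v n))) =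
    ipO X0 (pc Q (I n) (J n) (nabla_x Q (v n)) - interpolant_x Q (v n)) + ipO (wd e1 (T n)) X0.
  have [lx _ hT [a1 _]] := interpolant_l2 HW HS (@hv n).
  have la : l2 (pc Q (I n) (J n) (nabla_x Q (v n))) := pc_l2 HW HS _ _ _.
  have e0 := ip_ae mOm (wd_l2 ax1 (H10_H1 hT)) lx lX a1.
  have e1' := linear_onB (sq_linear_set mOm fOm) (si_linear_onr S lX) la lx.
  have k (a b c d : R) : d = c -> b = a - c -> a = b + d by move=> -> ->; rewrite subrK.
  exact: (k _ _ _ _ (etrans e0 (si_sym S lx lX)) e1').
have h3 := cvg_sum h h2.
have e3 : 0 + ipO (wd e1 v0) X0 = ipO X0 (wd e1 v0).
  by rewrite add0r; exact: (si_sym S (wd_l2 ax1 Hv) lX).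
rewrite -e3; apply: (cvg_eventually _ h3); exists 0%N; first by [].
by move=> n _; exact: (esym (E n)).
Qed.

Lemma weak_y X0 : l2 X0 ->
  ipO X0 (pc Q (I n) (J n) (nabla_y Q (v n))) @[n --> \oo] --> ipO X0 (wd e2 v0).
Proof.
move=> lX; have [C hC] := weak_dirichlet.
have h := consistency_y HW HS hx hy hv hC lX; have h2 := wv (wd_functional ax2 lX).
have Hv := H10_H1 hv0.
have E n : ipO X0 (pc Q (I n) (J n) (nabla_y Q (v n))) =
    ipO X0 (pc Q (I n) (J n) (nabla_y Q (v n)) - interpolant_y Q (v n)) + ipO (wd e2 (T n)) X0.
  have [_ lx hT [_ a1]] := interpolant_l2 HW HS (@hv n).
  have la : l2 (pc Q (I n) (J n) (nabla_y Q (v n))) := pc_l2 HW HS _ _ _.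
  have e0 := ip_ae mOm (wd_l2 ax2 (H10_H1 hT)) lx lX a1.
  have e1' := linear_onB (sq_linear_set mOm fOm) (si_linear_onr S lX) la lx.
  have k (a b c d : R) : d = c -> b = a - c -> a = b + d by move=> -> ->; rewrite subrK.
  exact: (k _ _ _ _ (etrans e0 (si_sym S lx lX)) e1').
have h3 := cvg_sum h h2.
have e3 : 0 + ipO (wd e2 v0) X0 = ipO X0 (wd e2 v0).
  by rewrite add0r; exact: (si_sym S (wd_l2 ax2 Hv) lX).
rewrite -e3; apply: (cvg_eventually _ h3); exists 0%N; first by [].
by move=> n _; exact: (esym (E n)).
Qed.

(** The coefficient is attached to the strongly convergent factor, whose strong convergence survives
    multiplication by a bounded array that converges almost everywhere. *)
Lemma Bh_limit (psi : forall n, @gridfun R (I n) (J n)) (psi0 : R * R -> R) :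
  (forall n, H10h (psi n)) -> H10 Om psi0 ->
  G (interpolant Q (psi n) - psi0) @[n --> \oo] --> (0 : R) ->
  {ae mu, forall p, Om p -> pc Q (I n) (J n) (bx Q (I n) (J n) beta) p @[n --> \oo] --> beta p} ->
  {ae mu, forall p, Om p -> pc Q (I n) (J n) (by_ Q (I n) (J n) beta) p @[n --> \oo] --> beta p} ->
  Bh Q beta (v n) (psi n) @[n --> \oo] --> energy Om beta v0 psi0.
Proof.
move=> hpsi hpsi0 cpsi ab1 ab2; have [C hC] := weak_dirichlet.
have Hv := H10_H1 hv0; have Hp := H10_H1 hpsi0.
have bM p : Om p -> `|beta p| <= `|M|.
  move=> /bb /andP[h1 h2]; rewrite ger0_norm; last exact: (le_trans (ltW m0)).
  exact: (le_trans h2 (ler_norm M)).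
have M0 (x : R) : m <= x <= M -> `|x| <= `|M|.
  move=> /andP[h1 h2]; rewrite ger0_norm; last exact: (le_trans (ltW m0)).
  exact: (le_trans h2 (ler_norm M)).
have bx1 n i j : (i <= I n)%N -> (j <= J n)%N -> `|bx Q (I n) (J n) beta i j| <= `|M|.
  case: j => [|j] iI jJ; first by rewrite normr0.
  by apply: M0; apply: (bx_itv HW HS bb iI).
have by1 n i j : (i <= I n)%N -> (j <= J n)%N -> `|by_ Q (I n) (J n) beta i j| <= `|M|.
  case: i => [|i] iI jJ; first by rewrite normr0.
  by apply: M0; apply: (by_itv HW HS bb _ jJ).
have lpc n c : l2 (pc Q (I n) (J n) c) := pc_l2 HW HS _ _ _.
have lb (w : R * R -> R) : l2 w -> l2 (fun p => beta p * w p).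
  exact: l2_bounded_mul mb bM.
have s1 := array_mul HW HS bx1 ab1 mb bM (fun n => lpc n (nabla_x Q (psi n))) (wd_l2 ax1 Hp)
  (strong_x hpsi hpsi0 cpsi).
have s2 := array_mul HW HS by1 ab2 mb bM (fun n => lpc n (nabla_y Q (psi n))) (wd_l2 ax2 Hp)
  (strong_y hpsi hpsi0 cpsi).
have lx n : l2 (fun p => pc Q (I n) (J n) (bx Q (I n) (J n) beta) p
    * pc Q (I n) (J n) (nabla_x Q (psi n)) p) :=
  lpc n (fun i j => bx Q (I n) (J n) beta i j * nabla_x Q (psi n) i j).
have ly n : l2 (fun p => pc Q (I n) (J n) (by_ Q (I n) (J n) beta) p
    * pc Q (I n) (J n) (nabla_y Q (psi n)) p) :=
  lpc n (fun i j => by_ Q (I n) (J n) beta i j * nabla_y Q (psi n) i j).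
have lbx := lb _ (wd_l2 ax1 Hp); have lby := lb _ (wd_l2 ax2 Hp).
have r1 := ip_weak_strong HW HS (fun n => lpc n (nabla_x Q (v n))) (wd_l2 ax1 Hv) lx lbx
  (fun n => (nrm_ax HW HS hC n).1) s1 (weak_x lbx).
have r2 := ip_weak_strong HW HS (fun n => lpc n (nabla_y Q (v n))) (wd_l2 ax2 Hv) ly lby
  (fun n => (nrm_ax HW HS hC n).2) s2 (weak_y lby).
have eE : energy Om beta v0 psi0 = ipO (wd e1 v0) (fun p => beta p * wd e1 psi0 p)
    + ipO (wd e2 v0) (fun p => beta p * wd e2 psi0 p).
  have cE (b x y : R) : b * x * y = x * (b * y) by ring.
  apply: (etrans (energyE mb (ltW m0) bb Hv Hp)).
  have e1' : ipO (fun p => beta p * wd e1 v0 p) (wd e1 psi0) =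
      ipO (wd e1 v0) (fun p => beta p * wd e1 psi0 p).
    by apply: eq_Rintegral => p _; exact: cE.
  have e2' : ipO (fun p => beta p * wd e2 v0 p) (wd e2 psi0) =
      ipO (wd e2 v0) (fun p => beta p * wd e2 psi0 p).
    by apply: eq_Rintegral => p _; exact: cE.
  exact: (congr2 +%R e1' e2').
rewrite eE; apply: (cvg_eventually _ (cvg_sum r1 r2)); exists 0%N; first by [].
move=> n _; rewrite BhE//.
congr (_ + _).
  by apply: (etrans (pc_ip HW HS _ _ (nabla_x Q (v n)) (fun i j => bx Q (I n) (J n) beta i j * nabla_x Q (psi n) i j)));
    apply: eq_cellsum => i j _ _; rewrite mulrA [nabla_x _ _ _ _ * _]mulrC.
by apply: (etrans (pc_ip HW HS _ _ (nabla_y Q (v n)) (fun i j => by_ Q (I n) (J n) beta i j * nabla_y Q (psi n) i j)));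
  apply: eq_cellsum => i j _ _; rewrite mulrA [nabla_y _ _ _ _ * _]mulrC.
Qed.
End Weak.
End Sequence.
End Limits.

Lemma dist_le_add (R : realType) (x y a b : R) : `|x - y| <= a -> `|x| <= b -> y <= b + a.
Proof. by rewrite !ler_norml => /andP[h1 h2] /andP[h3 h4]; lra. Qed.

(** * Euclidean distance to a set *)

Section Distance.
Context {R : realType}.
Implicit Types (p q w : R * R) (A : set (R * R)).

Lemma norm2_ge0 p : 0 <= norm2 p. Proof. exact: sqrtr_ge0. Qed.

Lemma norm2_sqr p : norm2 p ^+ 2 = p.1 ^+ 2 + p.2 ^+ 2.
Proof. by rewrite sqr_sqrtr// addr_ge0 ?sqr_ge0. Qed.

Lemma norm2_scale (c : R) p : norm2 (c *: p) = `|c| * norm2 p.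
Proof.
by rewrite /norm2 /= !exprMn -mulrDr sqrtrM ?sqr_ge0// sqrtr_sqr.
Qed.

Lemma dot_le p q : p.1 * q.1 + p.2 * q.2 <= norm2 p * norm2 q.
Proof.
apply: (le_trans (ler_norm _)); rewrite -sqrtr_sqr -sqrtrM ?addr_ge0 ?sqr_ge0//.
apply: ler_wsqrtr; rewrite -subr_ge0 (_ : _ - _ = (p.1 * q.2 - p.2 * q.1) ^+ 2); last by ring.
exact: sqr_ge0.
Qed.

Lemma norm2D p q : norm2 (p + q) <= norm2 p + norm2 q.
Proof.
apply: sqrt_le; first by rewrite addr_ge0 ?norm2_ge0.
rewrite [leRHS]sqrrD !norm2_sqr /= -subr_ge0.
rewrite (_ : _ - _ = 2 * (norm2 p * norm2 q - (p.1 * q.1 + p.2 * q.2))); last by ring.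
by rewrite mulr_ge0// subr_ge0 dot_le.
Qed.

Lemma distance_le A p q : A q -> distance_to A p <= norm2 (p - q).
Proof.
move=> Aq; apply: ge_inf; last by exists q.
by exists 0 => _ [x _ <-]; exact: norm2_ge0.
Qed.

Lemma distance_lip A p q : A !=set0 -> distance_to A p <= distance_to A q + norm2 (p - q).
Proof.
move=> [a Aa]; rewrite -lerBlDr; apply: lb_le_inf; first by exists (norm2 (q - a)), a.
move=> _ [x Ax <-]; rewrite lerBlDr; apply: (le_trans (distance_le p Ax)).
by rewrite -[p - x](subrKA q) addrC; exact: norm2D.
Qed.

Lemma distance_attained A p : compact A -> A !=set0 ->
  exists2 q, A q & distance_to A p = norm2 (p - q).
Proof.
move=> cA [a Aa]; pose f (q : R * R) := norm2 (p - q).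
have cf : {within A, continuous f}.
  apply: continuous_subspaceT => q.
  apply: (cvg_comp (fun q : R * R => (p.1 - q.1) ^+ 2 + (p.2 - q.2) ^+ 2) Num.sqrt); last exact: sqrt_continuous.
  have c1 : (p.1 - x.1) @[x --> q] --> p.1 - q.1 by apply: cvgB; [exact: cvg_cst|exact: cvg_fst].
  have c2 : (p.2 - x.2) @[x --> q] --> p.2 - q.2 by apply: cvgB; [exact: cvg_cst|exact: cvg_snd].
  by apply: cvgD; rewrite expr2; under eq_fun do rewrite expr2; apply: cvgM.
have [q Aq hq] := compact_EVT_min (ex_intro _ a Aa) cA cf.
rewrite inE in Aq; exists q => //; apply/le_anti; rewrite (distance_le p Aq)/=.
apply: lb_le_inf; first by exists (norm2 (p - a)), a.
by move=> _ [x Ax <-]; apply: hq; rewrite inE.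
Qed.
End Distance.
Lemma mvt_abs (R : realType) (f f' : R -> R) (x0 r L e s : R) :
  (forall x, `|x - x0| <= r -> is_derive x 1 f (f' x) /\ `|f' x - L| <= e) -> `|s| <= r ->
  `|f (x0 + s) - f x0 - s * L| <= e * `|s|.
Proof.
move=> h hs.
have key (a b : R) : a < b -> (forall x, a <= x <= b -> is_derive x 1 f (f' x) /\ `|f' x - L| <= e) ->
    `|f b - f a - (b - a) * L| <= e * (b - a).
  move=> ab hd.
  have dab (x : R) : x \in `]a, b[ -> is_derive x 1 f (f' x).
    by rewrite in_itv /= => /andP[x1 x2]; have [] := hd x; rewrite ?(ltW x1) ?(ltW x2).
  have cab : {within `[a, b], continuous f}.
    apply: derivable_within_continuous => x; rewrite in_itv /= => hx.
    by have [[]] := hd x hx.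
  have [c] := MVT ab dab cab; rewrite in_itv /= => /andP[c1 c2] ->.
  have [_ hc] := hd c (introT andP (conj (ltW c1) (ltW c2))).
  rewrite [_ * L]mulrC -mulrBl normrM (gtr0_norm (_ : 0 < b - a)) ?subr_gt0//.
  by rewrite ler_wpM2r// subr_ge0 ltW.
move: hs; rewrite ler_norml => /andP[s1 s2]; case: (ltgtP s 0) => s0.
- have hb : x0 + s < x0 by lra.
  have := key _ _ hb; rewrite (_ : x0 - (x0 + s) = - s); last by ring.
  rewrite (ltr0_norm s0) -normrN => H; rewrite (_ : _ - _ = - (f x0 - f (x0 + s) - - s * L)); last by ring.
  rewrite normrN -[X in X <= _]normrN; apply: H => x /andP[x1 x2]; apply: h.
  by rewrite ler_norml; lra.
- have hb : x0 < x0 + s by lra.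
  have := key _ _ hb; rewrite (_ : x0 + s - x0 = s); last by ring.
  rewrite (gtr0_norm s0) => H; apply: H => x /andP[x1 x2]; apply: h.
  by rewrite ler_norml; lra.
by rewrite s0 addr0 mul0r subrr subr0 normr0 mulr0.
Qed.

(** * Geometry of the interface: unit gradient and null measure *)

Section InterfaceGeometry.
Context {R : realType}.
Variable Q : rectangle R.
Hypotheses (HW : xW Q < xE Q) (HS : yS Q < yN Q).
Local Notation Om := (Omega Q).
Local Notation MP := (measurableTypeR R * measurableTypeR R)%type.
Local Notation mu := (@plane_measure R).
Local Notation mOm := (measurable_Omega Q).
Local Notation fOm := (finite_Omega HW HS).
Local Notation rint u := (mu.-integrable Om (EFin \o u)).
Implicit Types (p q : R * R) (u z : R * R -> R).
Variables (phi phi1 phi2 : R * R -> R).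
Hypotheses (iphi : interface Q phi)
  (dphi : forall p, Om p -> is_derive p e1 phi (phi1 p) /\ is_derive p e2 phi (phi2 p))
  (C1 : Ck 1 Om phi1) (C2 : Ck 1 Om phi2).
Local Notation Ga := (Gamma Q phi).
Local Opaque e1 e2.

Lemma phi_within : {within Omega_bar Q, continuous phi}.
Proof. by case: iphi => /(_ 0%N) [h _] _ _ _; rewrite -(closure_Omega HW HS). Qed.

Lemma phi_continuous p : Om p -> {for p, continuous phi}.
Proof. by case: iphi => /(_ 0%N) h _ _ _ Op; apply: (Ck_continuous_at (@open_Omega R Q) Op h). Qed.

Lemma phi1_continuous p : Om p -> {for p, continuous phi1}.
Proof. by move=> Op; apply: (Ck_continuous_at (@open_Omega R Q) Op C1). Qed.

Lemma phi2_continuous p : Om p -> {for p, continuous phi2}.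
Proof. by move=> Op; apply: (Ck_continuous_at (@open_Omega R Q) Op C2). Qed.

Lemma continuous_box u p (e : R) : {for p, continuous u} -> 0 < e ->
  exists2 r : R, 0 < r & forall q, `|q.1 - p.1| < r -> `|q.2 - p.2| < r -> `|u q - u p| < e.
Proof.
move=> cu e0; have : nbhs p (u @^-1` [set x | `|x - u p| < e]).
  by apply: cu; apply/nbhs_ballP; exists e => // x /=; rewrite -ball_normE /= distrC.
by move=> /nbhs_box.
Qed.

Lemma phi_sign_near p : Om p -> exists2 r : R, 0 < r & forall q,
  `|q.1 - p.1| < r -> `|q.2 - p.2| < r -> Om q /\ (phi p != 0 -> 0 < phi q * phi p).
Proof.
move=> Op; have [r1 r10 h1] := open_box (@open_Omega R Q) Op.
have [p0|p0] := eqVneq (phi p) 0.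
  by exists r1 => // q q1 q2; split; [exact: h1|].
have p0' : 0 < `|phi p| by rewrite normr_gt0.
have [r2 r20 h2] := continuous_box (phi_continuous Op) p0'.
exists (Num.min r1 r2); first by rewrite lt_min r10.
move=> q; rewrite !lt_min => /andP[a1 a2] /andP[b1 b2]; split; first exact: h1.
move=> _; have := h2 q a2 b2; case: (ltgtP (phi p) 0) p0 => // hp _.
  by rewrite (ltr0_norm hp) ltr_norml => /andP[h3 h4]; rewrite nmulr_lgt0//; lra.
by rewrite (gtr0_norm hp) ltr_norml => /andP[h3 h4]; rewrite pmulr_lgt0//; lra.
Qed.

(* First-order expansion, from the mean value theorem along the two axes. *)
Lemma expansion p w (e : R) : Om p -> 0 < e -> norm2 w <= 1 -> exists2 r : R, 0 < r &
  forall t : R, 0 < t -> t < r ->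
    `|phi (p + t *: w) - phi p - t * (w.1 * phi1 p + w.2 * phi2 p)| <= e * t.
Proof.
move=> Op e0 w1; have [r1 r10 h1] := open_box (@open_Omega R Q) Op.
have e2' : 0 < e / 2 by rewrite divr_gt0.
have [r2 r20 h2] := continuous_box (phi1_continuous Op) e2'.
have [r3 r30 h3] := continuous_box (phi2_continuous Op) e2'.
have wc : `|w.1| <= 1 /\ `|w.2| <= 1.
  by split; apply: le_trans w1; rewrite -sqrtr_sqr; apply: ler_wsqrtr; rewrite ?lerDl ?lerDr sqr_ge0.
exists (Num.min r1 (Num.min r2 r3)); first by rewrite !lt_min r10 r20.
move=> t t0; rewrite !lt_min => /andP[t1 /andP[t2 t3]].
have small (x : R) : `|x| <= 1 -> `|t * x| <= t.
  by move=> hx; rewrite normrM (gtr0_norm t0) ler_piMr// ltW.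
have s1 := small _ wc.1; have s2 := small _ wc.2.
have near_p x y : `|x - p.1| <= t -> `|y - p.2| <= t ->
    [/\ Om (x, y), `|phi1 (x, y) - phi1 p| <= e / 2 & `|phi2 (x, y) - phi2 p| <= e / 2].
  move=> hx hy; split; first by apply: h1 => /=; exact: le_lt_trans t1.
    by apply/ltW/h2 => /=; exact: le_lt_trans t2.
  by apply/ltW/h3 => /=; exact: le_lt_trans t3.
have y1 : `|p.2 + t * w.2 - p.2| <= t by rewrite addrAC subrr add0r.
have k1 := @mvt_abs R (fun x => phi (x, p.2 + t * w.2)) (fun x => phi1 (x, p.2 + t * w.2))
  p.1 t (phi1 p) (e / 2) (t * w.1).
have k2 := @mvt_abs R (fun y => phi (p.1, y)) (fun y => phi2 (p.1, y)) p.2 t (phi2 p) (e / 2) (t * w.2).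
have z1 : `|p.1 - p.1| <= t by rewrite subrr normr0 ltW.
have {}k1 : `|phi (p.1 + t * w.1, p.2 + t * w.2) - phi (p.1, p.2 + t * w.2) - t * w.1 * phi1 p|
    <= e / 2 * `|t * w.1|.
  apply: k1 => // x hx; have [Ox b1' _] := near_p _ _ hx y1; split=> //.
  exact: (is_derive_e1 phi (x, _) _).1 (dphi Ox).1.
have {}k2 : `|phi (p.1, p.2 + t * w.2) - phi (p.1, p.2) - t * w.2 * phi2 p| <= e / 2 * `|t * w.2|.
  apply: k2 => // y hy'; have [Oy _ b2'] := near_p _ _ z1 hy'; split=> //.
  exact: (is_derive_e2 phi (_, y) _).1 (dphi Oy).2.
have -> : p + t *: w = (p.1 + t * w.1, p.2 + t * w.2) by [].
have -> : phi p = phi (p.1, p.2) by rewrite -surjective_pairing.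
have sE (A B D a' b' : R) : A - D - t * (w.1 * a' + w.2 * b') =
    A - B - t * w.1 * a' + (B - D - t * w.2 * b') by ring.
rewrite (sE _ (phi (p.1, p.2 + t * w.2))).
apply: (le_trans (ler_normD _ _)); apply: (le_trans (lerD k1 k2)).
have E : e * t = e / 2 * t + e / 2 * t by field.
by rewrite E lerD// ler_wpM2l// ltW.
Qed.

Lemma Gamma_compact : compact Ga.
Proof.
apply: (subclosed_compact _ (@compact_Omega_bar R Q)).
  case: iphi => _ _ <- _; rewrite /frontier setDE.
  by apply: closedI; [exact: closed_closure|apply: open_closedC; exact: open_interior].
by move=> p [h _]; rewrite -(closure_Omega HW HS).
Qed.

Lemma small_shift p w (r t : R) : norm2 w <= 1 -> 0 < t -> t < r ->
  `|(p + t *: w).1 - p.1| < r /\ `|(p + t *: w).2 - p.2| < r.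
Proof.
move=> w1 t0 tr.
have wc : `|w.1| <= 1 /\ `|w.2| <= 1.
  by split; apply: le_trans w1; rewrite -sqrtr_sqr; apply: ler_wsqrtr; rewrite ?lerDl ?lerDr sqr_ge0.
have key (x c : R) : `|c| <= 1 -> `|x + t * c - x| < r.
  move=> hc; rewrite addrAC subrr add0r normrM (gtr0_norm t0).
  by apply: le_lt_trans tr; rewrite ler_piMr// ltW.
by split; apply: key; [exact: wc.1|exact: wc.2].
Qed.

(* Along the segment to a nearest point of the interface the distance drops at
   unit speed, and it is 1-Lipschitz. *)
Lemma eikonal U p : open U -> (forall q, U q -> Om q -> `|phi q| = distance_to Ga q) ->
  U p -> Om p -> phi p != 0 -> phi1 p ^+ 2 + phi2 p ^+ 2 = 1.
Proof.
move=> oU hU Up Op p0.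
(* For an empty interface the infimum defining the distance takes the default value 0, against
   [phi p != 0]. *)
have G0 : Ga !=set0.
  apply/set0P/eqP => G0; move: (hU p Up Op); rewrite /distance_to G0 image_set0 inf0 => /eqP.
  by rewrite normr_eq0 (negbTE p0).
have [q Gq hq] := distance_attained p Gamma_compact G0.
have [r1 r10 h1] := open_box oU Up; have [r2 r20 h2] := phi_sign_near Op.
have pos : 0 < `|phi p| by rewrite normr_gt0.
have sgn (a b : R) : 0 < a * b -> `|a - b| = `| `|a| - `|b| |.
  move=> ab; case: (ltgtP b 0) => hb.
  - have ha : a < 0 by move: ab; rewrite nmulr_lgt0.
    by rewrite (ltr0_norm ha) (ltr0_norm hb) -normrN; congr `|_|; ring.
  - have ha : 0 < a by move: ab; rewrite pmulr_lgt0.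
    by rewrite (gtr0_norm ha) (gtr0_norm hb).
  - by move: ab; rewrite hb mulr0 ltxx.
have incr w t : norm2 w <= 1 -> 0 < t -> t < Num.min r1 r2 ->
    `|phi (p + t *: w) - phi p| = `|distance_to Ga (p + t *: w) - distance_to Ga p|.
  move=> w1 t0; rewrite lt_min => /andP[t1 t2].
  have [a1 a2] := small_shift p w1 t0 t1; have [b1 b2] := small_shift p w1 t0 t2.
  have [Oq /(_ p0) s] := h2 _ b1 b2.
  by rewrite (sgn _ _ s) (hU _ (h1 _ a1 a2) Oq) (hU _ Up Op).
pose g w := w.1 * phi1 p + w.2 * phi2 p.
have ex w (e : R) : norm2 w <= 1 -> 0 < e -> exists2 t : R, 0 < t & t < Num.min (Num.min r1 r2) `|phi p| /\
    `|phi (p + t *: w) - phi p - t * g w| <= e * t.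
  move=> w1 e0; have [r r0 hr] := expansion Op e0 w1.
  (* Below [r1] and [r2] so that the sign and the distance formula persist, below the expansion
     radius [r], and below [|phi p|] so as not to overshoot the nearest point. *)
  pose t := Num.min (Num.min (Num.min r1 r2) `|phi p|) r / 2.
  have m0 : 0 < Num.min (Num.min (Num.min r1 r2) `|phi p|) r by rewrite !lt_min r10 r20 pos.
  have t0 : 0 < t by rewrite divr_gt0.
  have tm : t < Num.min (Num.min (Num.min r1 r2) `|phi p|) r by rewrite /t ltr_pdivrMr// ltr_pMr// ltr1n.
  by move: (tm); rewrite lt_min => /andP[tm1 tm2]; exists t => //; split=> //; exact: hr.
have lower : 1 <= phi1 p ^+ 2 + phi2 p ^+ 2.
  pose w : R * R := `|phi p|^-1 *: (q - p).
  have nqp : norm2 (q - p) = `|phi p|.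
    by rewrite (hU p Up Op) hq -[q - p]opprB -scaleN1r norm2_scale normrN1 mul1r.
  have w1 : norm2 w = 1.
    by rewrite norm2_scale nqp ger0_norm ?invr_ge0// mulVf// gt_eqF.
  have step (e : R) : 0 < e -> 1 - e <= `|g w|.
    move=> e0; have [t t0 [tm ht]] := ex w e (le_eq w1) e0; rewrite lt_min in tm.
    case/andP: tm => tm tp; have := incr w t (le_eq w1) t0 tm.
    have d1 : distance_to Ga (p + t *: w) <= `|phi p| - t.
      apply: (le_trans (distance_le _ Gq)).
      have -> : p + t *: w - q = (- (1 - t / `|phi p|)) *: (q - p).
        rewrite /w scalerA [p + _]addrC -addrA -[p - q]opprB scaleNr scalerBl scale1r.
        by rewrite [in RHS]opprB.
      have hle : t / `|phi p| <= 1 by rewrite ler_pdivrMr// mul1r ltW.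
      rewrite norm2_scale nqp normrN ger0_norm ?subr_ge0//.
      by rewrite mulrBl mul1r divfK ?gt_eqF.
    rewrite -(hU p Up Op) => E.
    have d2 : t <= `|phi (p + t *: w) - phi p|.
      by rewrite E distrC; apply: (le_trans _ (ler_norm _)); lra.
    have d3 : t - e * t <= t * `|g w|.
      have -> : t * `|g w| = `|t * g w| by rewrite normrM (gtr0_norm t0).
      rewrite lerBlDr; apply: (le_trans d2).
      by rewrite -[phi _ - _](subrK (t * g w)) addrC (le_trans (ler_normD _ _))// lerD2l.
    by rewrite -(ler_pM2l t0); apply: le_trans d3; rewrite mulrBr mulr1 [e * t]mulrC.
  have g1 : 1 <= `|g w|.
    by apply/ler_addgt0Pr => e e0; rewrite -lerBlDr; exact: step.
  have g2 : g w ^+ 2 <= phi1 p ^+ 2 + phi2 p ^+ 2.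
    have -> : phi1 p ^+ 2 + phi2 p ^+ 2 = norm2 w ^+ 2 * (phi1 p ^+ 2 + phi2 p ^+ 2).
      by rewrite w1 expr1n mul1r.
    rewrite norm2_sqr /g -subr_ge0 (_ : _ - _ = (w.1 * phi2 p - w.2 * phi1 p) ^+ 2); last by ring.
    exact: sqr_ge0.
  by apply: le_trans g2; rewrite -real_normK ?num_real// expr_ge1.
apply/le_anti; rewrite lower andbT.
pose N := norm2 (phi1 p, phi2 p).
have NN : N ^+ 2 = phi1 p ^+ 2 + phi2 p ^+ 2 by rewrite norm2_sqr.
have N0 : 0 < N.
  by rewrite lt_neqAle norm2_ge0 andbT; apply/eqP => h; move: lower; rewrite -NN -h expr0n /= ler10.
(* For the upper bound the direction is that of the gradient, in which the slope is the full norm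
   [N]. *)
pose v : R * R := N^-1 *: (phi1 p, phi2 p).
have v1 : norm2 v = 1 by rewrite norm2_scale ger0_norm ?invr_ge0 ?(ltW N0)// mulVf// gt_eqF.
have gv : g v = N.
  have -> : g v = N^-1 * (phi1 p ^+ 2 + phi2 p ^+ 2).
    have ev : v.1 = N^-1 * phi1 p /\ v.2 = N^-1 * phi2 p by [].
    by rewrite /g ev.1 ev.2; ring.
  by rewrite -NN expr2 mulrA mulVf ?mul1r// gt_eqF.
rewrite -NN expr_le1 ?(ltW N0)//; apply/ler_addgt0Pr => e e0.
have [t t0 [tm ht]] := ex v e (le_eq v1) e0; rewrite lt_min in tm.
case/andP: tm => tm _; have E := incr v t (le_eq v1) t0 tm.
have nt : norm2 (t *: v) = t by rewrite norm2_scale v1 mulr1 gtr0_norm.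
have d1 : `|phi (p + t *: v) - phi p| <= t.
  rewrite E ler_norml; apply/andP; split.
    have := distance_lip p (p + t *: v) G0; rewrite opprD addrA subrr add0r.
    by rewrite -scaleN1r norm2_scale normrN1 mul1r nt; lra.
  by have := distance_lip (p + t *: v) p G0; rewrite addrAC subrr add0r nt; lra.
rewrite gv in ht; rewrite -(ler_pM2l t0) mulrDr mulr1 [t * e]mulrC.
exact: (dist_le_add ht d1).
Qed.

(** By continuity from [Omega_minus], whose frontier is the interface: every point of the interface
    is a limit of points with nonzero [phi]. *)
Lemma eikonal_Gamma U p : open U -> Ga `<=` U ->
  (forall q, U q -> Om q -> `|phi q| = distance_to Ga q) ->
  Ga p -> phi1 p ^+ 2 + phi2 p ^+ 2 = 1.
Proof.
move=> oU GU hU Gp; have GO : Ga `<=` Om by case: iphi.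
have Op := GO p Gp; have Up := GU p Gp.
have clp : closure (Omega_minus Q phi) p.
  by case: iphi => _ _ fr _; move: Gp; rewrite -fr => -[].
apply/eqP; rewrite -subr_eq0 -normr_eq0 eq_le normr_ge0 andbT; apply/ler_addgt0Pr => e e0.
rewrite add0r; pose u q := phi1 q ^+ 2 + phi2 q ^+ 2.
have cu : {for p, continuous u}.
  have c1 := phi1_continuous Op; have c2 := phi2_continuous Op.
  by apply: cvgD; rewrite /= expr2; under eq_fun do rewrite expr2; apply: cvgM.
have [r1 r10 h1] := continuous_box cu e0; have [r2 r20 h2] := open_box oU Up.
have nb : nbhs p [set q | `|q.1 - p.1| < Num.min r1 r2 /\ `|q.2 - p.2| < Num.min r1 r2].
  by apply/nbhs_box; exists (Num.min r1 r2) => //; rewrite lt_min r10.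
have [q [[Oq q0] [/= q1 q2]]] := clp _ nb.
rewrite !lt_min in q1 q2; case/andP: q1 => a1 a2; case/andP: q2 => b1 b2.
have E : u q = 1.
  by apply: (eikonal oU hU (h2 q a2 b2) Oq); rewrite lt_eqF.
by have := h1 q a1 b1; rewrite E distrC => /ltW.
Qed.

(** Off [U] the closed rectangle is compact and |phi| is positive on it, hence bounded below. *)
Lemma near_Gamma U : open U -> Ga `<=` U ->
  exists2 r : R, 0 < r & forall p, Omega_bar Q p -> `|phi p| < r -> U p.
Proof.
move=> oU GU; pose K := Omega_bar Q `\` U.
have cK : compact K.
  apply: (subclosed_compact _ (@compact_Omega_bar R Q)); last by move=> p [].
  by rewrite /K setDE; apply: closedI; [exact: closed_Omega_bar|exact: open_closedC].
have K0 p : K p -> phi p != 0.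
  move=> [Bp nU]; apply/eqP => p0; apply: nU; apply: GU; split=> //.
  by rewrite (closure_Omega HW HS).
have cphi : {within K, continuous phi} by apply: (continuous_subspaceW _ phi_within) => p [].
have cn : {within K, continuous (fun p => `|phi p|)}.
  move=> p; apply: (continuous_comp (f := phi : subspace K -> R)); first exact: cphi.
  exact: norm_continuous.
have [[a Ka]|/set0P/negP/negPn/eqP K00] := pselect (K !=set0).
  have [c cin hc] := compact_EVT_min (ex_intro _ a Ka) cK cn; rewrite inE in cin.
  exists `|phi c|; first by rewrite normr_gt0; exact: K0.
  move=> p Bp hp; apply: contrapT => nU; have Kp : K p by [].
  by move: hp; rewrite ltNge => /negP; apply; apply: hc; rewrite inE.
exists 1 => // p Bp _; apply: contrapT => nU.
by have : K p by []; rewrite K00.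
Qed.

Lemma dstep_bounded : exists C : R, 0 <= C /\ forall t : R, `|dstep t| <= C.
Proof.
have [C [C0 hC]] := @dtransition_bounded R.
exists (2 * C); split; first exact: mulr_ge0.
by move=> t; rewrite /dstep normrM ger0_norm// ler_wpM2l.
Qed.

(** The functions [phi * (1 - step (s k))] have derivatives that stay bounded and tend to the
    derivative of [phi] on the zero set and to 0 elsewhere. Times a test function they have integral
    0, and so does the limit; no regularity of the zero set enters. *)
Lemma level_ae e phie : axis e -> (forall p, Om p -> is_derive p e phi (phie p)) -> Ck 1 Om phie ->
  {ae mu, forall p, Om p -> phi p = 0 -> phie p = 0}.
Proof.
move=> he de Ce; have [Cp [Cp0 bp]] := Ck_bounded HW HS (Ck_le Ce).
have [Cphi [Cphi0 bphi]] : exists C : R, 0 <= C /\ forall p, Omega_bar Q p -> `|phi p| <= C.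
  by case: iphi => /(_ 0%N) h _ _ _; exact: (Ck_bounded HW HS h).
have [Cs [Cs0 bs]] := dstep_bounded.
pose g p : R := phie p * \1_([set 0] : set R) (phi p).
have g0 p : phi p = 0 -> g p = phie p by move=> p0; rewrite /g p0 indicE mem_set// mulr1.
have gn p : phi p != 0 -> g p = 0.
  by move=> p0; rewrite /g indicE memNset ?mulr0// => /eqP; rewrite (negbTE p0).
have cphie p : Om p -> {for p, continuous phie}.
  by move=> Op; apply: (Ck_continuous_at (@open_Omega R Q) Op Ce).
have mphi : measurable_fun (Om : set MP) (phi : MP -> R).
  by apply: Omega_measurable => p /set_mem Op; exact: phi_continuous.
have mphie : measurable_fun (Om : set MP) (phie : MP -> R).
  by apply: Omega_measurable => p /set_mem Op; exact: cphie.
have mg : measurable_fun (Om : set MP) (g : MP -> R).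
  apply: (measurable_funM mphie); apply: (measurableT_comp _ mphi).
  by apply: measurable_indic; exact: measurable_set1.
have gb p : Om p -> `|g p| <= Cp.
  move=> Op; have [p0|p0] := eqVneq (phi p) 0; last by rewrite gn// normr0.
  by rewrite g0//; apply: bp; exact: (Omega_sub_bar HW HS).
have ig : rint g := rint_bounded mOm fOm mg gb.
suff H : {ae mu, forall p, Om p -> g p = 0}.
  by apply: ae_sub H => p h Op p0; have := h Op; rewrite g0.
apply: (fundamental_lemma ig) => z tz.
have [t1 d1] := test_derive he tz; have [Cz [Cz0 bz]] := test_bounded tz.
have [Cz' [Cz'0 bz']] := test_bounded t1.
(* The square keeps the cut-off smooth where [phi] changes sign. *)
pose s k p : R := (k.+1%:R * phi p) ^+ 2.
pose w k p := phi p * (1 - step (s k p)) * z p.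
pose w1 k p := (phie p * (1 - step (s k p))
   - phi p * (dstep (s k p) * (2 * k.+1%:R ^+ 2 * phi p * phie p))) * z p
   + phi p * (1 - step (s k p)) * 'D_e z p.
have dw k p : Om p -> is_derive p e (w k) (w1 k p).
  move=> Op; have dp := de p Op.
  have h1 := is_derive_scale k.+1%:R dp; have h2 := is_derive_mul h1 h1.
  have h3 := is_derive_comp (u := fun q => k.+1%:R * phi q * (k.+1%:R * phi q)) (is_derive_step _) h2.
  have h4 := is_derive_sub (is_derive_cst (1 : R) p e) h3.
  have h5 := is_derive_mul (is_derive_mul dp h4) (d1 p).
  apply: (is_derive_ext h5) => [q|]; rewrite /w /w1 /s expr2 //.
  rewrite /cst; set X := dstep _; set Y := step _; move: X Y => X Y; ring.
have Cw k : Ck 1 Om (w k).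
  have [sp _ _ _] := iphi.
  apply: Ck_mul; first apply: Ck_mul; first exact: (sp 1%N).
    apply: Ck_sub; first exact: Ck_cst.
    by apply: Ck_step; rewrite /s; under eq_fun do rewrite expr2; apply: Ck_mul; apply: Ck_scale; exact: (sp 1%N).
  apply: (Ck_restrict _ _ (test_Ck tz 1%N)) => // p _.
  by rewrite closureT.
have cw k : {in Om, continuous (w1 k)}.
  have [_ [u1 [u2 [hu c1 c2]]]] := Cw k.
  move=> p /set_mem Op; have [he1|he2] := he.
    apply: (eq_continuous_at (@open_Omega R Q) Op (u := u1)).
      move=> q Oq; have := dw k q Oq; rewrite he1 => d; exact: (is_derive_unique d (hu q Oq).1).
    exact: (Ck_continuous_at (k := 0) (@open_Omega R Q) Op c1).
  apply: (eq_continuous_at (@open_Omega R Q) Op (u := u2)).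
    move=> q Oq; have := dw k q Oq; rewrite he2 => d; exact: (is_derive_unique d (hu q Oq).2).
  exact: (Ck_continuous_at (k := 0) (@open_Omega R Q) Op c2).
have [_ [K [cK KO z0]]] := tz.
have I0 k : \int[mu]_(p in Om) w1 k p = 0.
  apply: (integral_compact_derive HW HS he cK KO (dw k) (cw k)).
  by move=> p _ nK; rewrite /w z0 ?mulr0.
have out (t : R) : True -> 1 <= t -> step t = 1 /\ dstep t = 0.
  by move=> _ t1'; rewrite step1// dstep_out//; right.
pose B := (Cp + Cs * (2 * Cp)) * Cz + Cphi * Cz'.
have L : \int[mu]_(p in Om) w1 k p @[k --> \oo] --> \int[mu]_(p in Om) (g p * z p).
  apply: (Rintegral_dominated mOm (h := fun=> B)).
  - by move=> k; apply: Omega_measurable => p Op; exact: cw.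
  - exact: (measurable_funM mg (test_measurable tz)).
  - apply: aeW => p Op; have [p0|p0] := eqVneq (phi p) 0.
      apply: (cvg_eventually _ (cvg_cst (g p * z p))); exists 0%N => // k _.
      by rewrite g0// /w1 /s p0 mulr0 expr0n /= step0 ?invr_ge0//; ring.
    apply: (cvg_eventually _ (cvg_cst (g p * z p))).
    exists (Num.truncn (`|phi p|^-1)) => // k /= hk.
    have h1 : 1 <= s k p.
      rewrite /s -real_normK ?num_real// expr_ge1// normrM ger0_norm//.
      rewrite -ler_pdivrMr ?normr_gt0// mul1r; apply/ltW.
      have i0 : 0 <= `|phi p|^-1 by rewrite invr_ge0.
      have /andP[_ h] := truncn_itv i0.
      by apply: (lt_le_trans h); rewrite ler_nat ltnS.
    by rewrite /w1 (@out _ Logic.I h1).1 (@out _ Logic.I h1).2 gn//; ring.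
  - by apply: (rint_bounded mOm fOm (C := `|B|)) => //; exact: measurable_cst.
  move=> k p Op; have Bp := Omega_sub_bar HW HS Op; rewrite /w1.
  have n1 : `|1 - step (s k p)| <= 1.
    by have /andP[a1 a2] := step_itv (s k p); rewrite ger0_norm ?subr_ge0// gerBl.
  (* The factors growing with [k] combine with both factors [phi] into [s k p], which is below 1
     wherever [dstep] is nonzero. *)
  have n2 : `|phi p * (dstep (s k p) * (2 * k.+1%:R ^+ 2 * phi p * phie p))| <= Cs * (2 * Cp).
    have -> : phi p * (dstep (s k p) * (2 * k.+1%:R ^+ 2 * phi p * phie p)) =
      dstep (s k p) * (2 * s k p * phie p) by rewrite /s; ring.
    have [h1|h1] := leP 1 (s k p); first by rewrite (@out _ Logic.I h1).2 mul0r normr0 !mulr_ge0.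
    have s0 : 0 <= s k p := sqr_ge0 _.
    rewrite normrM; apply: ler_pM => //.
    rewrite normrM; apply: ler_pM => //; last exact: bp.
    by rewrite normrM !ger0_norm// ler_piMr// ltW.
  have n3 : `|phie p * (1 - step (s k p))| <= Cp.
    by rewrite normrM (le_trans _ (bp p Bp))// ler_piMr.
  have n4 : `|phi p * (1 - step (s k p))| <= Cphi.
    by rewrite normrM (le_trans _ (bphi p Bp))// ler_piMr.
  apply: (le_trans (ler_normD _ _)); apply: lerD; rewrite normrM ler_pM ?bz ?bz'//.
  by apply: (le_trans (ler_normB _ _)); exact: lerD.
apply/eqP; apply: contraT => l0; rewrite -normr_gt0 in l0.
have [N _ hN] := cvg_near L l0; have := hN N (leqnn N).
by rewrite /= I0 sub0r normrN ltxx.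
Qed.

(** Almost everywhere on the interface both partial derivatives vanish by [level_ae], while
    [eikonal_Gamma] makes their squares add up to 1. *)
Lemma Gamma_null : {ae mu, forall p, Om p -> phi p != 0}.
Proof.
case: (iphi) => _ _ _ [U [oU GU hU]].
have h1 := level_ae (or_introl erefl) (fun p Op => (dphi Op).1) C1.
have h2 := level_ae (or_intror erefl) (fun p Op => (dphi Op).2) C2.
apply: ae_sub2 h1 h2 => p k1 k2 Op; apply/eqP => p0.
have Gp : Ga p by split=> //; exact: subset_closure.
have := eikonal_Gamma oU GU hU Gp; rewrite (k1 Op p0) (k2 Op p0) expr0n addr0 => /eqP.
by rewrite eq_sym oner_eq0.
Qed.

(** The quotient defining the normal has denominator 1 near the interface, so the normal is the
    gradient there; the neighbourhood is expressed by |phi| in order to be tested at grid nodes and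
    by the cut-offs. *)
Lemma unit_near b nx ny : normal_field Q phi b nx ny -> exists2 r : R, 0 < r & forall p, Om p ->
  `|phi p| < r -> [/\ phi1 p ^+ 2 + phi2 p ^+ 2 = 1, nx p = phi1 p & ny p = phi2 p].
Proof.
move=> [[U' [oU' GU' hn]] _]; case: (iphi) => _ _ _ [U [oU GU hU]].
have [r r0 hr] := near_Gamma (openI oU oU') (fun p Gp => conj (GU p Gp) (GU' p Gp)).
exists r => // p Op pr; have [Up U'p] := hr p (Omega_sub_bar HW HS Op) pr.
have E : phi1 p ^+ 2 + phi2 p ^+ 2 = 1.
  have [p0|p0] := eqVneq (phi p) 0; last exact: (eikonal oU hU Up Op p0).
  by apply: (eikonal_Gamma oU GU hU); split=> //; exact: subset_closure.
have [-> ->] := hn p U'p Op; rewrite (is_derive_val (dphi Op).1) (is_derive_val (dphi Op).2).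
by rewrite /norm2 /= E sqrtr1 !divr1.
Qed.

End InterfaceGeometry.

(** * The divergence term of the functional *)

Section InterfaceIntegral.
Context {R : realType}.
Variable Q : rectangle R.
Hypotheses (HW : xW Q < xE Q) (HS : yS Q < yN Q).
Local Notation Om := (Omega Q).
Local Notation MP := (measurableTypeR R * measurableTypeR R)%type.
Local Notation mu := (@plane_measure R).
Local Notation mOm := (measurable_Omega Q).
Local Notation fOm := (finite_Omega HW HS).
Local Notation ipO := (@ip _ MP R mu Om).
Local Notation l2 := (@sq_integrable _ MP R mu Om).
Local Notation rint u := (mu.-integrable Om (EFin \o u)).
Local Notation test := (test_function Om).
Local Notation wd := (weak_derivative Om).
Implicit Types (p q : R * R) (u z : R * R -> R).
Variables (phi phi1 phi2 : R * R -> R).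
Hypotheses (iphi : interface Q phi)
  (dphi : forall p, Om p -> is_derive p e1 phi (phi1 p) /\ is_derive p e2 phi (phi2 p))
  (C1 : Ck 1 Om phi1) (C2 : Ck 1 Om phi2).
Local Notation Ga := (Gamma Q phi).
Local Notation Omm := (Omega_minus Q phi).
Local Notation Omp := (Omega_plus Q phi).
Local Opaque e1 e2 weak_derivative.

(** The strict inequality selects [Omega_minus] exactly, while the discrete chi also counts zeros of
    [phi]; the two differ on the interface only, a null set. *)
Definition neg p : R := if phi p < 0 then 1 else 0.

Lemma neg_itv p : 0 <= neg p <= 1. Proof. by rewrite /neg; case: ifP; rewrite ?lexx ?ler01. Qed.

Lemma phi_cont p : Om p -> {for p, continuous phi}.
Proof. exact: (phi_continuous iphi). Qed.

Lemma open_minus : open Omm.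
Proof.
rewrite openE => p [Op pn]; have [r r0 h] := phi_sign_near iphi Op.
apply/nbhs_box; exists r => // q q1 q2; have [Oq s] := h q q1 q2; split=> //.
by have := s (negbT (lt_eqF pn)); rewrite nmulr_lgt0.
Qed.

Lemma open_plus : open Omp.
Proof.
rewrite openE => p [Op pn]; have [r r0 h] := phi_sign_near iphi Op.
apply/nbhs_box; exists r => // q q1 q2; have [Oq s] := h q q1 q2; split=> //.
by have := s (negbT (gt_eqF pn)); rewrite pmulr_lgt0.
Qed.

Lemma closure_minus : closure Omm = Omm `|` Ga.
Proof.
case: (iphi) => _ _ fr _; rewrite -fr /frontier; apply/seteqP; split=> p.
  move=> cp; have [ip|nip] := pselect (interior Omm p); [left|by right].
  exact: interior_subset.
by case=> [mp|[]]//; exact: subset_closure.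
Qed.

Lemma measurable_neg : measurable_fun (Om : set MP) (neg : MP -> R).
Proof.
have mphi : measurable_fun (Om : set MP) (phi : MP -> R).
  by apply: Omega_measurable => p /set_mem Op; exact: phi_cont.
have E : neg = (fun p => \1_(`]-oo, 0[%classic : set R) (phi p)).
  apply/funext => p; rewrite /neg indicE; case: ifP => h; first by rewrite mem_set// /= in_itv.
  by rewrite memNset//= in_itv /= h.
rewrite E; apply: (measurableT_comp _ mphi).
by apply: measurable_indic; exact: measurable_itv.
Qed.

Lemma integral_minus u : \int[mu]_(p in Omm) u p = \int[mu]_(p in Om) (neg p * u p).
Proof.
rewrite /Rintegral [in LHS]integral_mkcond [in RHS]integral_mkcond; congr fine.
apply: eq_integral => p _; rewrite /patch.
have [Op|nO] := pselect (Om p); last first.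
  by rewrite !memNset// => -[].
rewrite [p \in Om]mem_set// /neg; have [h|h] := boolP (phi p < 0).
  by rewrite mem_set// mul1r.
by rewrite memNset ?mul0r// => -[_]; rewrite (negbTE h).
Qed.

Lemma beta_measurable m M beta : coefficient Q phi m M beta ->
  measurable_fun (Om : set MP) (beta : MP -> R).
Proof.
move=> [_ _ _ [bm [Cm hm]] [bp [Cp hp]]].
have GO : Ga `<=` Om by case: iphi.
have E : Om = (Omm `|` Ga) `|` Omp.
  apply/seteqP; split=> [p Op|p [[[]|/GO]|[]]]//.
  case: (ltgtP (phi p) 0) => h; [by left; left|by right|].
  by left; right; split=> //; exact: subset_closure.
have mA : measurable ((Omm `|` Ga) : set MP).
  by rewrite -closure_minus; apply: closed_measurable_plane; exact: closed_closure.
have mB : measurable (Omp : set MP) := open_measurable_plane open_plus.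
rewrite E; apply/measurable_funU => //; split.
  apply: (eq_measurable_fun (bm : MP -> R)); first by move=> p /set_mem h; rewrite hm.
  by apply: within_measurable => //; rewrite -closure_minus; exact: (Ck_continuous Cm).
apply: (eq_measurable_fun (bp : MP -> R)); first by move=> p /set_mem h; rewrite hp.
exact: (Ck_measurable open_plus Cp).
Qed.

Lemma beta_continuous m M beta p : coefficient Q phi m M beta -> Om p -> phi p != 0 ->
  {for p, continuous beta}.
Proof.
move=> [_ _ _ [bm [Cm hm]] [bp [Cp hp]]] Op; case: ltgtP => // h _.
  have Mp : Omm p by [].
  apply: (eq_continuous_at open_minus Mp (u := bm)); first by move=> q Mq; apply: hm; left.
  exact: (Ck_continuous_at open_minus Mp Cm).
have Mp : Omp p by [].
apply: (eq_continuous_at open_plus Mp (u := bp)); first by move=> q Mq; exact: hp.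
exact: (Ck_continuous_at open_plus Mp Cp).
Qed.

(** Equal to 1 where phi <= -1/(k+1) and to 0 where phi >= -1/(2(k+1)). The membership test discards
    negative values that [phi] may take outside the rectangle. *)
Definition cutoff k p : R := if `[< Omm p >] then step (- k.+1%:R * phi p) else 0.

Lemma cutoffE k p : Omm p -> cutoff k p = step (- k.+1%:R * phi p).
Proof. by move=> h; rewrite /cutoff asboolT. Qed.

Lemma cutoff_test k : test_function Omm (cutoff k) /\ test (cutoff k).
Proof.
have k0 : (0 : R) < k.+1%:R by [].
pose K := Omega_bar Q `&` [set p | phi p <= - (2 * k.+1%:R)^-1].
(* A point of the closed rectangle with negative [phi] lies in the closure of [Omega_minus], that
   is, in [Omega_minus] or on the interface, and it cannot be on the interface. *)
have KM : K `<=` Omm.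
  move=> p [Bp hp]; have pn : phi p < 0 by apply: (le_lt_trans hp); rewrite oppr_lt0 invr_gt0 mulr_gt0.
  have [Op|nO] := pselect (Om p); first by split.
  have cp : closure Om p by rewrite (closure_Omega HW HS).
  have : closure Omm p.
    move=> B Bn; have cphi := phi_within HW HS iphi.
    have nb : nbhs p (B `&` [set q | Omega_bar Q q -> phi q < 0]).
      apply: filterI => //.
      have n0 : nbhs (phi p) [set x : R | x < 0].
        by apply: open_nbhs_nbhs; split; [exact: open_lt|exact: pn].
      by have := (iffLR (subspace_continuousP _ _)) cphi p Bp _ n0; rewrite nbhs_simpl.
    have [q [Oq [Bq hq]]] := cp _ nb.
    by exists q; split=> //; split=> //; apply: hq; exact: (Omega_sub_bar HW HS).
  rewrite closure_minus => -[[]//|[_ p0]]; by move: pn; rewrite p0 ltxx.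
have cK : compact K.
  apply: (subclosed_compact _ (@compact_Omega_bar R Q)); last by move=> p [].
  have H := phi_within HW HS iphi.
  have cl : closed [set x : R | x <= - (2 * k.+1%:R)^-1] by exact: closed_le.
  rewrite /K setIC.
  have := continuous_closedP (phi : subspace (Omega_bar Q) -> R).
  move=> [/(_ H) /(_ _ cl) + _]; rewrite closed_subspaceP => -[V cV].
  have cB := @closed_Omega_bar R Q.
  move=> E; have -> : [set p | phi p <= - (2 * k.+1%:R)^-1] `&` Omega_bar Q = V `&` Omega_bar Q by rewrite E.
  exact: closedI.
have sm : smooth Omm (fun p => step (- k.+1%:R * phi p)).
  move=> n; apply: Ck_step; apply: Ck_scale.
  have [sp _ _ _] := iphi; apply: (Ck_restrict _ _ (sp n)); last by move=> p [].
  by apply: closure_subset => p [].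
have out p : ~ K p -> cutoff k p = 0.
  move=> nK; rewrite /cutoff; case: asboolP => // -[Op pn].
  apply: step0; rewrite leNgt; apply/negP => h; apply: nK; split; first exact: (Omega_sub_bar HW HS).
  rewrite /= invfM lerNr -[leLHS]mulrC ler_pdivrMl//; apply/ltW; move: h.
  by rewrite mulNr mulrN.
have on p : Omm p -> cutoff k p = step (- k.+1%:R * phi p) by exact: cutoffE.
split; first exact: (test_glue open_minus cK KM sm on out).
have [t1 _] := test_glue open_minus cK KM sm on out.
by split=> //; exists K; split=> // p /KM[].
Qed.
Lemma cutoff_cvg p : Om p -> cutoff k p @[k --> \oo] --> neg p.
Proof.
move=> Op; rewrite /neg; case: ifP => h; last first.
  apply: (@cvg_eventually R (fun=> 0)); last exact: cvg_cst.
  exists 0%N => // k _.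
  by rewrite /cutoff asboolF// => -[_]; rewrite h.
apply: (@cvg_eventually R (fun=> 1)); last exact: cvg_cst.
exists (Num.truncn (`|phi p|^-1)) => // k /= hk.
rewrite cutoffE// step1// mulNr -mulrN.
have p0 : 0 < - phi p by rewrite oppr_gt0.
have i0 : 0 <= `|phi p|^-1 by rewrite invr_ge0.
have /andP[_ h1] := truncn_itv i0.
rewrite -ler_pdivrMr// mul1r; apply: ltW; rewrite (ltr0_norm h) in h1 hk.
by apply: (lt_le_trans h1); rewrite ler_nat ltnS.
Qed.

Lemma cutoff_derive k e phie p : (forall q, Om q -> is_derive q e phi (phie q)) -> Omm p ->
  'D_e (cutoff k) p = dstep (- k.+1%:R * phi p) * (- k.+1%:R * phie p).
Proof.
move=> de Mp; apply: is_derive_val.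
apply: (is_derive_near_eq open_minus Mp (f := fun q => step (- k.+1%:R * phi q))).
  by move=> q Mq; rewrite cutoffE.
apply: (is_derive_comp (u := fun q => - k.+1%:R * phi q) (is_derive_step _)).
by apply: is_derive_scale; apply: de; case: Mp.
Qed.

Lemma cutoff_derive_out k e p : ~ Omm p -> 'D_e (cutoff k) p = 0.
Proof.
move=> nM; have [[_ [K [cK KM z0]]] _] := cutoff_test k.
have oK : open (~` K) by apply: closed_openC; apply: compact_closed => //; exact: norm_hausdorff.
apply: is_derive_val; apply: (is_derive_near_eq oK _ (f := fun=> 0)).
- by move=> /KM.
- by move=> q /z0.
Qed.

Lemma cutoff_limit x y (C : R) : l2 x -> measurable_fun (Om : set MP) (y : MP -> R) ->
  (forall p, Om p -> `|y p| <= C) ->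
  ipO x (fun p => y p * cutoff k p) @[k --> \oo] --> ipO x (fun p => neg p * y p).
Proof.
move=> lx my yC; have lxy : rint (fun p => x p * y p).
  have ly : l2 y := sq_bounded mOm fOm my yC; exact: (sq_mul mOm lx ly).
have mx := sq_measurable lx.
apply: (Rintegral_dominated mOm (h := fun p => `|x p * y p|)).
- move=> k; apply: (measurable_funM mx); apply: (measurable_funM my).
  exact: (test_measurable (cutoff_test k).2).
- by apply: (measurable_funM mx); apply: (measurable_funM measurable_neg).
- apply: aeW => p Op; rewrite [neg p * _]mulrC.
  by apply: cvgM; [exact: cvg_cst|apply: cvgM; [exact: cvg_cst|exact: cutoff_cvg]].
- exact: (integrable_norm lxy).
move=> k p Op; rewrite mulrA normrM ler_piMr// /cutoff; case: asboolP => _; last by rewrite normr0.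
by have /andP[a1 a2] := step_itv (- k.+1%:R * phi p); rewrite ger0_norm.
Qed.

Lemma eq_limit (u w : nat -> R) (l l' : R) : u n @[n --> \oo] --> l -> w n @[n --> \oo] --> l' ->
  (\forall n \near \oo, u n = w n) -> l = l'.
Proof.
move=> hu hw [N _ hN]; apply/eqP; rewrite -subr_eq0; apply: contraT => l0.
rewrite -normr_gt0 in l0; have e0 : 0 < `|l - l'| / 2 by rewrite divr_gt0.
have [N1 _ h1] := cvg_near hu e0; have [N2 _ h2] := cvg_near hw e0.
pose n := maxn N (maxn N1 N2).
have a := h1 n (leq_trans (leq_maxl _ _) (leq_maxr _ _)).
have b := h2 n (leq_trans (leq_maxr _ _) (leq_maxr _ _)).
rewrite /= (hN n (leq_maxl _ _)) in a; rewrite /= in b.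
have := le_lt_trans (ler_normB (w n - l') (w n - l)) (ltrD b a).
by rewrite -splitr opprB addrCA addrAC subrr add0r ltxx.
Qed.

(** The gradient of the cut-off lives in a strip that shrinks to the interface, where the normal is
    grad phi. There the given field may be exchanged for the smooth one, b grad phi, which is
    defined on the whole rectangle; integrating by parts back and removing the cut-off gives the
    right-hand side. *)
Lemma interface_integral b nx ny g1 g2 psi (C : R) : normal_field Q phi b nx ny ->
  (forall p, Om p -> is_derive p e1 (fun q => b q * phi1 q) (g1 p)) ->
  (forall p, Om p -> is_derive p e2 (fun q => b q * phi2 q) (g2 p)) ->
  {in Om, continuous (fun q => b q * phi1 q)} -> {in Om, continuous (fun q => b q * phi2 q)} ->
  {in Om, continuous g1} -> {in Om, continuous g2} ->
  (forall p, Om p -> [/\ `|b p * phi1 p| <= C, `|b p * phi2 p| <= C, `|g1 p| <= C & `|g2 p| <= C]) ->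
  H10 Om psi ->
  \int[mu]_(p in Omm) weak_divergence Omm (fun q => b q * psi q * nx q) (fun q => b q * psi q * ny q) p
  = ipO (wd e1 psi) (fun p => neg p * (b p * phi1 p)) + ipO (wd e2 psi) (fun p => neg p * (b p * phi2 p))
    + ipO psi (fun p => neg p * g1 p) + ipO psi (fun p => neg p * g2 p).
Proof.
move=> nf d1 d2 c1 c2 cg1 cg2 bC hpsi; have Hp := H10_H1 hpsi.
have [r r0 hr] := unit_near HW HS iphi dphi C1 C2 nf.
set d := weak_divergence Omm _ _.
have [iu iv id_ hd] : is_weak_divergence Omm (fun q => b q * psi q * nx q) (fun q => b q * psi q * ny q) d.
  by apply: xgetPex; exact: nf.2.
have mM : measurable (Omm : set MP) := open_measurable_plane open_minus.
have lp := H1_l2 Hp; have l1 := wd_l2 (or_introl erefl) Hp; have l2' := wd_l2 (or_intror erefl) Hp.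
have b1 p : Om p -> `|b p * phi1 p| <= C by move=> /bC[].
have b2 p : Om p -> `|b p * phi2 p| <= C by move=> /bC[].
have b3 p : Om p -> `|g1 p| <= C by move=> /bC[].
have b4 p : Om p -> `|g2 p| <= C by move=> /bC[].
have m1 := Omega_measurable c1; have m2 := Omega_measurable c2.
have m3 := Omega_measurable cg1; have m4 := Omega_measurable cg2.
have lhs : \int[mu]_(p in Omm) (d p * cutoff k p) @[k --> \oo] --> \int[mu]_(p in Omm) d p.
  apply: (Rintegral_dominated mM (h := fun p => `|d p|)).
  - move=> k; apply: (measurable_funM (rint_measurable id_)).
    apply: (measurable_funS mOm); last exact: (test_measurable (cutoff_test k).2).
    by move=> p [].
  - exact: (rint_measurable id_).
  - apply: aeW => p [Op pn]; rewrite -[X in _ --> X]mulr1; apply: cvgM; first exact: cvg_cst.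
    by have := cutoff_cvg Op; rewrite /neg pn.
  - exact: (integrable_norm id_).
  move=> k p _; rewrite normrM ler_piMr// /cutoff; case: asboolP => _; last by rewrite normr0.
  by have /andP[a1 a2] := step_itv (- k.+1%:R * phi p); rewrite ger0_norm.
have R1 := cutoff_limit l1 m1 b1; have R2 := cutoff_limit l2' m2 b2.
have R3 := cutoff_limit lp m3 b3; have R4 := cutoff_limit lp m4 b4.
apply: (eq_limit lhs (cvg_sum (cvg_sum (cvg_sum R1 R2) R3) R4)).
(* From this index on 1/(k+1) <= r, so the strip is inside the neighbourhood of [unit_near]. *)
exists (Num.truncn (r^-1)) => // k /= hk.
have kr : 1 <= k.+1%:R * r.
  have i0 : 0 <= r^-1 by rewrite invr_ge0 ltW.
  have /andP[_ h] := truncn_itv i0.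
  by rewrite -ler_pdivrMr// mul1r ltW// (lt_le_trans h)// ler_nat ltnS.
have [tM tz] := cutoff_test k.
have i1 := ibp_H10 HW HS (or_introl erefl) hpsi d1 c1 cg1 b1 b3 tz.
have i2 := ibp_H10 HW HS (or_intror erefl) hpsi d2 c2 cg2 b2 b4 tz.
have E : \int[mu]_(p in Omm) (d p * cutoff k p) =
    - (ipO psi (fun p => b p * phi1 p * 'D_e1 (cutoff k) p)
       + ipO psi (fun p => b p * phi2 p * 'D_e2 (cutoff k) p)).
  have [t1 _] := test_derive (or_introl erefl) tz; have [t2 _] := test_derive (or_intror erefl) tz.
  have q1 : l2 (fun p => b p * phi1 p * 'D_e1 (cutoff k) p) := l2_bounded_mul m1 b1 (test_l2 HW HS t1).
  have q2 : l2 (fun p => b p * phi2 p * 'D_e2 (cutoff k) p) := l2_bounded_mul m2 b2 (test_l2 HW HS t2).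
  rewrite /ip -(RintegralD mOm (sq_mul mOm lp q1) (sq_mul mOm lp q2)).
  apply/eqP; rewrite eq_sym eqr_oppLR; apply/eqP; rewrite -(hd _ tM) integral_minus.
  apply: eq_Rintegral => p /set_mem Op; rewrite /neg; case: ifP => pn; last first.
    have nM : ~ Omm p by move=> [_]; rewrite pn.
    by rewrite !(cutoff_derive_out k _ nM) !mulr0 addr0 mul0r.
  have Mp : Omm p by [].
  have D1 := cutoff_derive k (fun q Oq => (dphi Oq).1) Mp.
  have D2 := cutoff_derive k (fun q Oq => (dphi Oq).2) Mp.
  have [hlt|hge] := ltP `|phi p| r.
    by have [_ -> ->] := hr p Op hlt; rewrite mul1r; move: ('D_e1 _ _) ('D_e2 _ _) => x y; ring.
  (* Outside that neighbourhood the cut-off is locally constant, so the unknown normal is multiplied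
     by 0. *)
  have Z : dstep (- k.+1%:R * phi p) = 0.
    apply: dstep_out; right; rewrite mulNr -mulrN -(ltr0_norm pn).
    by apply: (le_trans kr); rewrite ler_pM2l.
  by rewrite D1 D2 Z !mul0r !mulr0 !addr0 mulr0.
have k0 (x y z p1 p2 p3 p4 : R) : z = - (x + y) -> x = - (p1 + p3) -> y = - (p2 + p4) ->
    z = p1 + p2 + p3 + p4 by move=> -> -> ->; ring.
exact: (k0 _ _ _ _ _ _ _ E i1 i2).
Qed.
End InterfaceIntegral.

(** * Unique solvability of the discrete problem *)

Section DiscreteSolvability.
Context {R : realType}.
Variable Q : rectangle R.
Hypotheses (HW : xW Q < xE Q) (HS : yS Q < yN Q).
Variables (I J : nat) (beta : R * R -> R) (m M : R).
Hypotheses (m0 : 0 < m) (bb : forall p, Omega Q p -> m <= beta p <= M).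
Local Notation grid := (@gridfun R I J).
Local Notation B := (Bh Q beta).
Implicit Types (u v psi : grid).

Definition interior_part v : grid :=
  \matrix_(i, j) if interior_point I J i j then v i j else 0.
Local Notation P := interior_part.

Lemma interior_part_H10h v : H10h (P v).
Proof. by move=> i j iI jJ /negbTE nij; rewrite /at_ mxE !inordK// nij. Qed.

Lemma interior_part_id v : H10h v -> P v = v.
Proof.
move=> hv; apply/matrixP => i j; rewrite mxE; case: ifP => // nij.
have := hv i j; rewrite /at_ !inord_val nij; move=> ->//; by rewrite -ltnS.
Qed.

Lemma interior_part_linear (c : R) u v : P (c *: u + v) = c *: P u + P v.
Proof. by apply/matrixP => i j; rewrite !mxE; case: ifP => // _; rewrite mulr0 addr0. Qed.

Lemma linear_delta0 (l : grid -> R) : (forall (c : R) u v, l (c *: u + v) = c * l u + l v) ->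
  (forall i j, l (delta_mx i j) = 0) -> forall u, l u = 0.
Proof.
move=> hl hd; have l0 : l 0 = 0.
  have := hl 1 0 0; rewrite scaler0 addr0 mul1r => /eqP.
  by rewrite -subr_eq0 opprD addrA subrr sub0r oppr_eq0 => /eqP.
have lsum (K : Type) (r : seq K) (f : K -> grid) : (forall k, l (f k) = 0) ->
    l (\sum_(k <- r) f k) = 0.
  move=> hf; elim: r => [|k r IH]; first by rewrite big_nil.
  by rewrite big_cons -[f k]scale1r hl hf IH mulr0 addr0.
move=> u; rewrite [u]matrix_sum_delta.
apply: (lsum _ _ (fun i => \sum_j u i j *: delta_mx i j)) => i.
apply: (lsum _ _ (fun j => u i j *: delta_mx i j)) => j.
by rewrite -[_ *: _]addr0 hl hd l0 mulr0 addr0.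
Qed.

(** The Gram map of the interior basis, completed by the identity at boundary nodes: this makes it
    an endomorphism of all grid functions, and its injectivity yields both existence and the
    boundary condition. *)
Definition gram v : grid :=
  \matrix_(i, j) if interior_point I J i j then B (P v) (P (delta_mx i j)) else v i j.

Lemma gram_linear : linear gram.
Proof.
move=> c u v; apply/matrixP => i j; rewrite !mxE; case: ifP => // _.
by rewrite interior_part_linear Bh_linear.
Qed.

HB.instance Definition _ := GRing.isLinear.Build R grid grid *:%R gram gram_linear.

(** All difference quotients in x vanish, so the boundary value 0 at the left end spreads along each
    row; the top row is itself a boundary row. *)
Lemma dirichlet_eq0 v : H10h v -> dirichlet Q v <= 0 -> v = 0.
Proof.
move=> hv d0.
have px : 0 <= cellsum Q I J (fun i j => nabla_x Q v i j ^+ 2).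
  by apply: (cellsum_ge0 HW HS) => i j; exact: sqr_ge0.
have py : 0 <= cellsum Q I J (fun i j => nabla_y Q v i j ^+ 2).
  by apply: (cellsum_ge0 HW HS) => i j; exact: sqr_ge0.
have cx : cellsum Q I J (fun i j => nabla_x Q v i j ^+ 2) <= 0.
  by move: d0; rewrite /dirichlet; move: (cellsum _ _ _ _) (cellsum _ _ _ _) px py => x y; lra.
have dX := dx_gt0 HW I; have dY := dy_gt0 HS J.
have ax0 i j : (i <= I)%N -> (j <= J)%N -> nabla_x Q v i j = 0.
  move=> iI jJ; apply/eqP; rewrite -sqrf_eq0 eq_le sqr_ge0 andbT.
  rewrite -(pmulr_lle0 _ dX) -(pmulr_lle0 _ dY); apply: le_trans cx.
  rewrite /cellsum !big_mkord (bigD1 (Ordinal (iI : (i < I.+1)%N)))//= big_mkord.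
  rewrite (bigD1 (Ordinal (jJ : (j < J.+1)%N)))//= -addrA lerDl; apply: addr_ge0.
    by apply: sumr_ge0 => k _; rewrite mulr_ge0 ?(ltW dY)// mulr_ge0 ?sqr_ge0 ?(ltW dX).
  by apply: sumr_ge0 => k _; rewrite big_mkord; apply: sumr_ge0 => l _;
    rewrite mulr_ge0 ?(ltW dY)// mulr_ge0 ?sqr_ge0 ?(ltW dX).
have at0 i j : (i <= I.+1)%N -> (j <= J)%N -> at_ v i j = 0.
  elim: i => [|i IH] iI jJ; first by rewrite (H10h_at hv) ?(leqW jJ)//; auto.
  have := ax0 i j iI jJ; rewrite /nabla_x IH ?(ltnW iI)// subr0 => /eqP.
  by rewrite mulf_eq0 invr_eq0 (gt_eqF dX) orbF => /eqP.
apply/matrixP => i j; rewrite mxE; have hi := ltn_ord i; have hj := ltn_ord j.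
have -> : v i j = at_ v i j by rewrite /at_ !inord_val.
case: (leqP j J) => h; first by apply: at0.
have -> : (j : nat) = J.+1 by apply/eqP; rewrite eqn_leq h -ltnS hj.
by rewrite (H10h_at hv)//; auto.
Qed.

Lemma Bh_eq0 v : H10h v -> B v v <= 0 -> v = 0.
Proof.
move=> hv h; have /andP[h1 _] := Bh_bounds HW HS bb hv.
by apply: dirichlet_eq0 => //; rewrite -(pmulr_rle0 _ m0); exact: (le_trans h1 h).
Qed.

Lemma Bh_linear_r (c : R) u v psi : B u (c *: v + psi) = c * B u v + B u psi.
Proof. by rewrite Bh_sym Bh_linear !(Bh_sym _ _ _ u). Qed.

Lemma gram_inj v : gram v = 0 -> v = 0.
Proof.
move=> g0.
have hv : H10h v.
  move=> i j iI jJ nij; have := congr1 (fun w : grid => at_ w i j) g0.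
  by rewrite /at_ !mxE !inordK// (negbTE nij).
have Pv := interior_part_id hv.
have l0 psi : B v (P psi) = 0.
  apply: (linear_delta0 (l := fun psi => B v (P psi))) => [c u w|i j].
    by rewrite interior_part_linear Bh_linear_r.
  have := congr1 (fun w : grid => w i j) g0; rewrite !mxE Pv; case: ifP => // nij _.
  have -> : P (delta_mx i j) = 0.
    apply/matrixP => k l; rewrite !mxE; case: ifP => // kl.
    by case: eqP => // ek; case: eqP => // el; rewrite ek el nij in kl.
  by rewrite -[0](scale0r (0 : grid)) -[_ *: _]addr0 Bh_linear_r mul0r add0r;
    apply/eqP; rewrite -(inj_eq (addrI (B v 0))) addr0 -[X in X + _]mul1r -Bh_linear_r scale1r addr0.
by apply: Bh_eq0 => //; rewrite -{2}Pv l0.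
Qed.

(** The matrix of [gram] has trivial kernel, hence is invertible. The right-hand side prescribes
    [- L] on interior basis functions and 0 at boundary nodes. *)
Lemma discrete_solvable (L : grid -> R) : linear_on (@H10h R I J) L ->
  exists! v, H10h v /\ forall psi, H10h psi -> - B v psi = L psi.
Proof.
move=> lL; pose A := lin_mx gram.
have Au : A \in unitmx.
  rewrite -row_free_unit -kermx_eq0; apply/rowV0P => w /sub_kermxP.
  rewrite -[w]vec_mxK mul_vec_lin => /(canRL mxvecK); rewrite linear0 => /gram_inj ->.
  by rewrite linear0.
pose t : grid := \matrix_(i, j) if interior_point I J i j then - L (P (delta_mx i j)) else 0.
pose v := vec_mx (mxvec t *m invmx A) : grid.
have gv : gram v = t.
  apply: (can_inj mxvecK); rewrite -mul_vec_lin /v vec_mxK.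
  exact: (mulmxKV Au).
have hv : H10h v.
  move=> i j iI jJ nij; have := congr1 (fun w : grid => at_ w i j) gv.
  by rewrite /at_ !mxE !inordK// (negbTE nij).
have Pv := interior_part_id hv.
have hP := interior_part_H10h.
have P0 : P 0 = 0 by rewrite interior_part_id//; exact: (ls0 (@H10h_set R I J)).
have L0 : L 0 = 0 := linear_on0 (@H10h_set R I J) lL.
have l0 psi : B v (P psi) + L (P psi) = 0.
  apply: (linear_delta0 (l := fun psi => B v (P psi) + L (P psi))) => [c u w|i j].
    by rewrite interior_part_linear Bh_linear_r (lL c _ _ (hP u) (hP w)); ring.
  have := congr1 (fun w : grid => w i j) gv; rewrite !mxE Pv; case: ifP => nij.
    by move=> ->; rewrite addNr.
  move=> _; have -> : P (delta_mx i j) = 0.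
    apply/matrixP => k l; rewrite !mxE; case: ifP => // kl.
    by case: eqP => // ek; case: eqP => // el; rewrite ek el nij in kl.
  rewrite L0 addr0; have := Bh_linear_r 1 v 0 0; rewrite scale1r addr0 mul1r => /eqP.
  by rewrite -subr_eq0 opprD addrA subrr sub0r oppr_eq0 => /eqP.
exists v; split.
  split=> // psi hp; have := l0 psi; rewrite (interior_part_id hp) => /eqP.
  by rewrite addr_eq0 => /eqP ->; rewrite opprK.
move=> w [hw hs]; have hvw : H10h (v - w) := lsB (@H10h_set R I J) hv hw.
apply/eqP; rewrite -subr_eq0; apply/eqP; apply: Bh_eq0 => //.
have := l0 (v - w); rewrite (interior_part_id hvw) -(hs _ hvw) => /eqP.
rewrite subr_eq0 => /eqP E.
have -> : B (v - w) (v - w) = B v (v - w) - B w (v - w).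
  have -> : v - w = -1 *: w + v by rewrite scaleN1r addrC.
  by rewrite Bh_linear mulN1r addrC.
by rewrite E subrr.
Qed.
End DiscreteSolvability.

(** * Elementary estimates for chi, the normal and the loads *)

Section SignAverage.
Context {R : realType}.
Implicit Types (s t r x y a c e : R).

Definition heavi s : R := if s <= 0 then 1 else 0.

(** [chi_x] and [chi_y] are by conversion this function of the two nodal values of [phi] on an
    edge. *)
Definition sign_avg s t : R :=
  let w := `|s| + `|t| in let th := if 0 < w then `|t| / w else 0 in
  heavi s * (1 - th) + heavi t * th.

Lemma sign_avg_itv s t : 0 <= sign_avg s t <= 1.
Proof.
rewrite /sign_avg /=; set th := if _ then _ else _.
have /andP[t0 t1] : 0 <= th <= 1.
  rewrite /th; case: ifP => w0; last by rewrite lexx ler01.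
  by rewrite divr_ge0 ?(ltW w0)//= ler_pdivrMr// mul1r lerDr.
by rewrite /heavi; case: ifP => _; case: ifP => _; apply/andP; split; move: t0 t1; move: th => z; lra.
Qed.

Lemma sign_avg_neg s t : s <= 0 -> t <= 0 -> sign_avg s t = 1.
Proof. by move=> hs ht; rewrite /sign_avg /heavi hs ht !mul1r subrK. Qed.

Lemma sign_avg_pos s t : 0 < s -> 0 < t -> sign_avg s t = 0.
Proof. by move=> hs ht; rewrite /sign_avg /heavi !leNgt hs ht /= !mul0r addr0. Qed.

(** [r], [s], [t] are three consecutive nodal values. If they lay on the same side of 0 both
    averages would be the same constant, so one of the neighbours is across 0 from [s]. *)
Lemma sign_avg_change r s t : sign_avg r s != sign_avg s t -> `|s| <= `|s - r| + `|s - t|.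
Proof.
have a1 := ler_norm (s - r); have a2 := ler_norm (s - t).
have a3 : - (s - r) <= `|s - r| by rewrite -normrN ler_norm.
have a4 : - (s - t) <= `|s - t| by rewrite -normrN ler_norm.
have a5 := normr_ge0 (s - r); have a6 := normr_ge0 (s - t).
case: (leP s 0) => hs.
  case: (leP r 0) => hr; case: (leP t 0) => ht; rewrite ?(ler0_norm hs);
    first (by rewrite !sign_avg_neg// eqxx); move=> _;
    move: (`|s - r|) (`|s - t|) a1 a2 a3 a4 a5 a6 => *; lra.
case: (leP r 0) => hr; case: (leP t 0) => ht; rewrite ?(gtr0_norm hs);
  last (by rewrite !sign_avg_pos// eqxx); move=> _;
  move: (`|s - r|) (`|s - t|) a1 a2 a3 a4 a5 a6 => *; lra.
Qed.

Lemma norm2_le x y : norm2 (x, y) <= `|x| + `|y|.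
Proof.
apply: sqrt_le; first by rewrite addr_ge0.
rewrite sqrrD !real_normK ?num_real// -addrA [_ *+ 2 + _]addrC addrA lerDl.
by rewrite mulrn_wge0// mulr_ge0.
Qed.

Lemma le_norm2 x y : `|x| <= norm2 (x, y) /\ `|y| <= norm2 (x, y).
Proof.
by split; rewrite -sqrtr_sqr; apply: ler_wsqrtr; rewrite /= ?lerDl ?lerDr sqr_ge0.
Qed.

Lemma quotient_le1 x n : `|x| <= n -> `|x / n| <= 1 :> R.
Proof.
move=> h; have n0 : 0 <= n := le_trans (normr_ge0 x) h.
rewrite normrM normfV (ger0_norm n0); move: n0; rewrite le_eqVlt => /orP[/eqP<-|n0].
  by rewrite invr0 mulr0 ler01.
by rewrite ler_pdivrMr// mul1r.
Qed.

(** If [n] is at most 1/2 then [e] is at least 1/4 and the trivial bound 2 is at most 8 e; otherwise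
    the numerator is within 3 e and division by [n] costs a factor below 2. *)
Lemma quotient_err x a n e : `|x| <= n -> `|a| <= 1 -> `|x - a| <= e -> `|n - 1| <= 2 * e ->
  `|x / n - a| <= 8 * e :> R.
Proof.
move=> xn a1 xa n1; have q1 := quotient_le1 xn.
have e0 : 0 <= e := le_trans (normr_ge0 _) xa.
have [h|h] := leP n 2^-1.
  apply: (le_trans (ler_normB _ _)); have e4 : 1 <= 4 * e.
    by move: n1; rewrite ler_norml => /andP[]; lra.
  move: (`|x / n|) (`|a|) q1 a1 => *; lra.
have n0 : 0 < n by apply: lt_trans h; rewrite invr_gt0.
have -> : x / n - a = (x - a * n) / n by rewrite mulrBl mulfK// gt_eqF.
rewrite normrM normfV (gtr0_norm n0) ler_pdivrMr//.
have h3 : `|x - a * n| <= 3 * e.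
  have -> : x - a * n = (x - a) - a * (n - 1) by ring.
  apply: (le_trans (ler_normB _ _)); rewrite normrM.
  have : `|a| * `|n - 1| <= 1 * (2 * e) by apply: ler_pM.
  by move: (`|x - a|) (`|a| * `|n - 1|) xa => *; lra.
apply: (le_trans h3); have : 8 * e * 2^-1 <= 8 * e * n by apply: ler_wpM2l; [lra|exact: ltW].
by move: (8 * e * n) => *; lra.
Qed.

Lemma unit_quotient x y a c e : a ^+ 2 + c ^+ 2 = 1 -> `|x - a| <= e -> `|y - c| <= e ->
  `|x / norm2 (x, y) - a| <= 8 * e /\ `|y / norm2 (x, y) - c| <= 8 * e.
Proof.
move=> ac xa yc; have N1 : norm2 (a, c) = 1 by rewrite /norm2 /= ac sqrtr1.
have [a1 c1] := le_norm2 a c; rewrite N1 in a1 c1.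
have [x1 y1] := le_norm2 x y.
have h1 : `|norm2 (x, y) - 1| <= 2 * e.
  have h := norm2D (x, y) (a - x, c - y); have h' := norm2D (a, c) (x - a, y - c).
  have e1' : (x, y) + (a - x, c - y) = (a, c) :> R * R.
    by congr pair; rewrite /= addrC subrK.
  have e2' : (a, c) + (x - a, y - c) = (x, y) :> R * R.
    by congr pair; rewrite /= addrC subrK.
  rewrite e1' N1 in h; rewrite e2' N1 in h'.
  have k := norm2_le (a - x) (c - y); have k' := norm2_le (x - a) (y - c).
  rewrite ![`|_ - x|]distrC ![`|_ - y|]distrC in k.
  rewrite ler_norml; move: (norm2 (x, y)) (norm2 (a - x, _)) (norm2 (x - a, _))
    (`|x - a|) (`|y - c|) h h' k k' xa yc => *; apply/andP; split; lra.
by split; apply: quotient_err.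
Qed.

(** [p] and [q] are one-sided slopes, [z] the derivative at the node, [k1] and [k0] second
    derivatives: the central quotient is the mean of [p] and [q]. *)
Lemma central_arith (A B C p q z h k1 k0 s1 s0 K : R) : 0 < h -> A - B = p * h -> B - C = q * h ->
  p - z = k1 * s1 -> z - q = k0 * s0 -> `|k1| <= K -> `|k0| <= K -> 0 <= s1 <= h -> 0 <= s0 <= h ->
  `|(A - C) / (2 * h) - z| <= K * h.
Proof.
move=> h0 e1' e2' e3 e4 hk1 hk0 /andP[s10 s1h] /andP[s00 s0h].
have -> : (A - C) / (2 * h) - z = (k1 * s1 - k0 * s0) / 2.
  have -> : A - C = (p + q) * h by rewrite mulrDl -e1' -e2'; ring.
  by rewrite -e3 -e4; field; rewrite gt_eqF.
have b1 : `|k1 * s1| <= K * h by rewrite normrM (ger0_norm s10); apply: ler_pM.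
have b0 : `|k0 * s0| <= K * h by rewrite normrM (ger0_norm s00); apply: ler_pM.
rewrite normrM [`|2^-1|]ger0_norm ?invr_ge0// ler_pdivrMr//.
apply: (le_trans (ler_normB _ _)).
by move: (`|k1 * s1|) (`|k0 * s0|) b1 b0 => *; lra.
Qed.

Lemma load_arith (B x y z c w : R) : `|x| <= B -> `|y| <= B -> `|z| <= B -> `|w| <= B ->
  0 <= c <= 1 -> `|x * y - x * z * c + w * c| <= B * B + B * B + B.
Proof.
move=> hx hy hz hw /andP[c0 c1].
have cn (t D : R) : `|t| <= D -> `|t * c| <= D.
  by move=> h; rewrite normrM (ger0_norm c0); apply: le_trans h; rewrite ler_piMr.
apply: (le_trans (ler_normD _ _)); apply: lerD; last exact: cn.
apply: (le_trans (ler_normB _ _)); apply: lerD; last apply: cn.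
  by rewrite normrM; apply: ler_pM.
by rewrite normrM; apply: ler_pM.
Qed.

Lemma jump_arith (n q d h E k : R) : 0 < d -> `|n| <= E * h -> h <= k * d -> `|q| <= 1 -> 0 <= E ->
  `|n * (q / d)| <= E * k.
Proof.
move=> d0 hn hk q1 E0; rewrite mulrA normrM normfV (gtr0_norm d0) ler_pdivrMr//.
rewrite normrM; apply: (@le_trans _ _ (E * h * 1)); first by apply: ler_pM.
by rewrite mulr1 -mulrA ler_wpM2l.
Qed.

Lemma load0_arith (f u n v w B D : R) : `|f| <= B -> `|u| <= B -> `|v| <= B -> `|n| <= D ->
  `|w| <= D -> `|f + (u + n) + (v + w)| <= 3 * B + 2 * D.
Proof.
move=> hf hu hv hn hw; apply: (le_trans (ler_normD _ _)).
have h1 := ler_normD f (u + n); have h2 := ler_normD u n; have h3 := ler_normD v w.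
move: (`|f + (u + n)|) (`|u + n|) (`|v + w|) (`|f|) (`|u|) (`|v|) (`|n|) (`|w|)
  h1 h2 h3 hf hu hv hn hw => *; lra.
Qed.
End SignAverage.

Lemma cvg_mul (R : realType) (u w : nat -> R) (a b : R) : u n @[n --> \oo] --> a ->
  w n @[n --> \oo] --> b -> (u n * w n) @[n --> \oo] --> a * b.
Proof. exact: cvgM. Qed.

Lemma cvg_diff (R : realType) (u w : nat -> R) (a b : R) : u n @[n --> \oo] --> a ->
  w n @[n --> \oo] --> b -> (u n - w n) @[n --> \oo] --> a - b.
Proof. exact: cvgB. Qed.

(** * Bounds and limits of the load arrays *)

Section LoadArrays.
Context {R : realType}.
Variable Q : rectangle R.
Hypotheses (HW : xW Q < xE Q) (HS : yS Q < yN Q).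
Local Notation Om := (Omega Q).
Implicit Types (p q : R * R) (u z : R * R -> R).
Local Opaque e1 e2.

(** Unlike [Ck 1], the derivatives are named and one constant bounds everything. They are controlled
    only inside the rectangle, which is where the mean value theorem evaluates them. *)
Record C1_data (u u1 u2 : R * R -> R) (B : R) : Prop := C1Data {
  c1_within : {within Omega_bar Q, continuous u};
  c1_derive : forall p, Om p -> is_derive p e1 u (u1 p) /\ is_derive p e2 u (u2 p);
  c1_continuous : forall p, Om p -> {for p, continuous u1} /\ {for p, continuous u2};
  c1_bound : forall p, Omega_bar Q p -> `|u p| <= B;
  c1_bound1 : forall p, Om p -> `|u1 p| <= B /\ `|u2 p| <= B }.

Lemma C1_dataP u : Ck 1 Om u -> exists u1 u2 (B : R), C1_data u u1 u2 B.
Proof.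
move=> Cu; have [B [B0 hB]] := Ck_bounded HW HS Cu.
case: (Cu) => cu [u1 [u2 [du D1 D2]]]; exists u1, u2.
have [B1 [B10 h1]] := Ck_bounded HW HS (D1 : Ck 0 Om u1); have [B2 [B20 h2]] := Ck_bounded HW HS (D2 : Ck 0 Om u2).
have oO := @open_Omega R Q.
exists (B + B1 + B2); split=> //.
- by rewrite -(closure_Omega HW HS).
- by move=> p Op; split; [exact: (Ck_continuous_at oO Op (D1 : Ck 0 Om u1))|exact: (Ck_continuous_at oO Op (D2 : Ck 0 Om u2))].
- by move=> p Bp; apply: (le_trans (hB p Bp)); rewrite -addrA lerDl addr_ge0.
move=> p /(Omega_sub_bar HW HS) Bp; split.
  by apply: (le_trans (h1 p Bp)); rewrite [B + _]addrC -addrA lerDl addr_ge0.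
by apply: (le_trans (h2 p Bp)); rewrite lerDr addr_ge0.
Qed.

Lemma C1_data_le u u1 u2 B B' : B <= B' -> C1_data u u1 u2 B -> C1_data u u1 u2 B'.
Proof.
move=> BB [h1 h2 h3 h4 h5]; split=> // p Op; first exact: (le_trans (h4 p Op) BB).
by have [k1 k2] := h5 p Op; split; [exact: (le_trans k1 BB)|exact: (le_trans k2 BB)].
Qed.

Lemma node_in I J i j : (0 < i <= I)%N -> (0 < j <= J)%N -> Om (gx Q I i%:R, gy Q J j%:R).
Proof. by move=> hi hj; split; [apply: (gx_lt HW)|apply: (gy_lt HS)]; apply: node_itv. Qed.

Lemma node_bar I J i j : (i <= I.+1)%N -> (j <= J.+1)%N -> Omega_bar Q (gx Q I i%:R, gy Q J j%:R).
Proof.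
by move=> hi hj; split; [apply: (gx_le HW)|apply: (gy_le HS)]; rewrite ler0n ler_nat.
Qed.

(** The mean value theorem is used on both sides of the node for [u], and then for [u1] between the
    node and the two points found. *)
Lemma central_x I J i j u u1 u2 u11 u12 (K : R) : C1_data u u1 u2 K -> C1_data u1 u11 u12 K ->
  (0 < i <= I)%N -> (0 < j <= J)%N ->
  `|phi_x Q I J u i j - u1 (gx Q I i%:R, gy Q J j%:R)| <= K * dx Q I.
Proof.
case: i => // i Du Du1 hi hj; have iI : (i < I)%N by case/andP: hi.
case/andP: (hj) => j0 jJ.
have [/= hx hy] := node_in hi hj.
have [/= /andP[x0 _] _] : Omega_bar Q (gx Q I i%:R, gy Q J j%:R) by apply: node_bar; rewrite leqW// ltnW.
have [/= /andP[_ x2] _] : Omega_bar Q (gx Q I i.+2%:R, gy Q J j%:R) := node_bar (iI : (i.+2 <= I.+1)%N) (leqW jJ).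
have dX := dx_gt0 HW I; have E01 := gxB Q I i; have E12 := gxB Q I i.+1.
have l01 : gx Q I i%:R < gx Q I i.+1%:R by rewrite -subr_gt0 E01.
have l12 : gx Q I i.+1%:R < gx Q I i.+2%:R by rewrite -subr_gt0 E12.
case/andP: hx => hx1 hx2.
have du p (Op : Om p) := (c1_derive Du Op).1; have du1 p (Op : Om p) := (c1_derive Du1 Op).1.
have [c1 /andP[c1a c1b] F1] := MVT_e1 (c1_within Du) du hy (ltW hx1) l12 x2.
have [c0 /andP[c0a c0b] F0] := MVT_e1 (c1_within Du) du hy x0 l01 (ltW hx2).
have [d1 /andP[d1a d1b] D1] := MVT_e1 (c1_within Du1) du1 hy (ltW hx1) c1a (le_trans (ltW c1b) x2).
have [d0 /andP[d0a d0b] D0] := MVT_e1 (c1_within Du1) du1 hy (le_trans x0 (ltW c0a)) c0b (ltW hx2).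
rewrite /phi_x !grid_at ?(leqW jJ) ?(leqW (ltnW iI))//.
rewrite E12 in F1; rewrite E01 in F0.
apply: (central_arith dX F1 F0 D1 D0).
- apply: (c1_bound1 Du1 _).1; split=> //=.
  by rewrite (lt_trans hx1 d1a) (lt_le_trans d1b)// (le_trans (ltW c1b)).
- apply: (c1_bound1 Du1 _).1; split=> //=.
  by rewrite (le_lt_trans x0 (lt_trans c0a d0a)) (lt_trans d0b).
- by move: c1a c1b; rewrite -E12 => *; apply/andP; split; lra.
by move: c0a c0b; rewrite -E01 => *; apply/andP; split; lra.
Qed.

Lemma central_y I J i j u u1 u2 u21 u22 (K : R) : C1_data u u1 u2 K -> C1_data u2 u21 u22 K ->
  (0 < i <= I)%N -> (0 < j <= J)%N ->
  `|phi_y Q I J u i j - u2 (gx Q I i%:R, gy Q J j%:R)| <= K * dy Q J.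
Proof.
case: j => // j Du Du1 hi hj; have jJ : (j < J)%N by case/andP: hj.
case/andP: (hi) => i0 iI.
have [/= hx hy] := node_in hi hj.
have [_ /= /andP[x0 _]] : Omega_bar Q (gx Q I i%:R, gy Q J j%:R) by apply: node_bar; rewrite leqW// ltnW.
have [_ /= /andP[_ x2]] : Omega_bar Q (gx Q I i%:R, gy Q J j.+2%:R) := node_bar (leqW iI) (jJ : (j.+2 <= J.+1)%N).
have dX := dy_gt0 HS J; have E01 := gyB Q J j; have E12 := gyB Q J j.+1.
have l01 : gy Q J j%:R < gy Q J j.+1%:R by rewrite -subr_gt0 E01.
have l12 : gy Q J j.+1%:R < gy Q J j.+2%:R by rewrite -subr_gt0 E12.
case/andP: hy => hx1 hx2.
have du p (Op : Om p) := (c1_derive Du Op).2; have du1 p (Op : Om p) := (c1_derive Du1 Op).2.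
have [c1 /andP[c1a c1b] F1] := MVT_e2 (c1_within Du) du hx (ltW hx1) l12 x2.
have [c0 /andP[c0a c0b] F0] := MVT_e2 (c1_within Du) du hx x0 l01 (ltW hx2).
have [d1 /andP[d1a d1b] D1] := MVT_e2 (c1_within Du1) du1 hx (ltW hx1) c1a (le_trans (ltW c1b) x2).
have [d0 /andP[d0a d0b] D0] := MVT_e2 (c1_within Du1) du1 hx (le_trans x0 (ltW c0a)) c0b (ltW hx2).
rewrite /phi_y !grid_at ?(leqW iI) ?(leqW (ltnW jJ))//.
rewrite E12 in F1; rewrite E01 in F0.
apply: (central_arith dX F1 F0 D1 D0).
- apply: (c1_bound1 Du1 _).2; split=> //=.
  by rewrite (lt_trans hx1 d1a) (lt_le_trans d1b)// (le_trans (ltW c1b)).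
- apply: (c1_bound1 Du1 _).2; split=> //=.
  by rewrite (le_lt_trans x0 (lt_trans c0a d0a)) (lt_trans d0b).
- by move: c1a c1b; rewrite -E12 => *; apply/andP; split; lra.
by move: c0a c0b; rewrite -E01 => *; apply/andP; split; lra.
Qed.

Variables (phi phi1 phi2 p11 p12 p21 p22 beta a a1 a2 b g g1 g2 f : R * R -> R).
Local Notation G1 := (fun p : R * R => b p * phi1 p).
Local Notation G2 := (fun p : R * R => b p * phi2 p).
Variables (G11 G12 G21 G22 : R * R -> R) (B r k : R).
Hypotheses (B0 : 0 <= B) (r0 : 0 < r) (k0 : 0 <= k).
Hypothesis unit : forall p, Om p -> `|phi p| < r -> phi1 p ^+ 2 + phi2 p ^+ 2 = 1.
Hypotheses (Dphi : C1_data phi phi1 phi2 B) (Dphi1 : C1_data phi1 p11 p12 B)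
  (Dphi2 : C1_data phi2 p21 p22 B) (Da : C1_data a a1 a2 B) (Dg : C1_data g g1 g2 B)
  (DG1 : C1_data G1 G11 G12 B) (DG2 : C1_data G2 G21 G22 B).
Hypotheses (bB : forall p, Omega_bar Q p -> `|b p| <= B) (fB : forall p, Omega_bar Q p -> `|f p| <= B)
  (betaB : forall p, Om p -> `|beta p| <= B).

(** The first term serves nodes with unit gradient, where [unit_quotient] applies. The second serves
    meshes so coarse that [2 * B * h >= r]: the trivial bound B (1 + B) is multiplied by a quantity
    that is at least 1. *)
Definition err_const : R := 8 * (B * B) + B * (1 + B) * (2 * B) / r.

Lemma err_const_ge0 : 0 <= err_const.
Proof.
rewrite /err_const addr_ge0// ?mulr_ge0//; first by rewrite addr_ge0.
by rewrite invr_ge0 ltW.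
Qed.

Lemma normal_err_bound I J i j : interior_point I J i j ->
  `|phi (gx Q I i%:R, gy Q J j%:R)| <= 2 * B * (dx Q I + dy Q J) ->
  `|normal_err_x Q I J phi b G1 i j| <= err_const * (dx Q I + dy Q J) /\
  `|normal_err_y Q I J phi b G2 i j| <= err_const * (dx Q I + dy Q J).
Proof.
move=> hij hphi; have /andP[hi hj] := hij; have Op := node_in hi hj.
have Bp := Omega_sub_bar HW HS Op.
case/andP: (hi) => i0 iI; case/andP: (hj) => j0 jJ.
rewrite /normal_err_x /normal_err_y hij !grid_at ?leqW//.
set p := (gx Q I i%:R, gy Q J j%:R) in Op Bp hphi *.
set h := dx Q I + dy Q J in hphi *.
have h0 : 0 < h by rewrite addr_gt0 ?(dx_gt0 HW) ?(dy_gt0 HS).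
have cx := central_x Dphi Dphi1 hi hj; have cy := central_y Dphi Dphi2 hi hj.
have [n1 n2] := le_norm2 (phi_x Q I J phi i j) (phi_y Q I J phi i j).
have q1 := quotient_le1 n1; have q2 := quotient_le1 n2.
have bp := bB Bp; have f1 := c1_bound Dphi1 Bp; have f2 := c1_bound Dphi2 Bp.
have step_ (n t c D : R) : `|n - t| <= c -> c * B <= D * h -> `|b p * n - b p * t| <= D * h.
  move=> hn hc; rewrite -mulrBr normrM; apply: le_trans hc; rewrite mulrC.
  by apply: ler_pM.
have E2 : 0 <= B * (1 + B) * (2 * B) / r.
  by rewrite mulr_ge0 ?invr_ge0 ?(ltW r0)// mulr_ge0// ?mulr_ge0// addr_ge0.
have eE : err_const * h = 8 * (B * B) * h + B * (1 + B) * (2 * B) / r * h := mulrDl _ _ _.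
(* The hypothesis on [phi] places the node in the region of unit gradient only when this quantity is
   below [r]. *)
have [small|large] := ltP (2 * B * h) r.
  have u1 := unit Op (le_lt_trans hphi small).
  have dX := ltW (dx_gt0 HW I); have dY := ltW (dy_gt0 HS J).
  have ex : `|phi_x Q I J phi i j - phi1 p| <= B * h.
    by apply: (le_trans cx); rewrite ler_wpM2l// /h lerDl.
  have ey : `|phi_y Q I J phi i j - phi2 p| <= B * h.
    by apply: (le_trans cy); rewrite ler_wpM2l// /h lerDr.
  have [k1 k2] := unit_quotient u1 ex ey.
  have hc : 8 * (B * h) * B <= err_const * h.
    rewrite eE; have -> : 8 * (B * h) * B = 8 * (B * B) * h by ring.
    by rewrite lerDl; apply: mulr_ge0 => //; exact: ltW.
  by split; [exact: (step_ _ _ _ _ k1 hc)|exact: (step_ _ _ _ _ k2 hc)].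
have hc : (1 + B) * B <= err_const * h.
  rewrite eE; apply: (@le_trans _ _ (B * (1 + B) * (2 * B) / r * h)).
    rewrite -mulrA [r^-1 * h]mulrC !mulrA ler_pdivlMr//.
    have -> : B * (1 + B) * 2 * B * h = (1 + B) * B * (2 * B * h) by ring.
    by apply: ler_wpM2l => //; rewrite mulr_ge0// addr_ge0.
  by rewrite lerDr; apply: mulr_ge0; [rewrite !mulr_ge0|exact: ltW].
by split; [apply: (step_ _ _ _ _ _ hc)|apply: (step_ _ _ _ _ _ hc)];
  apply: (le_trans (ler_normB _ _)); apply: lerD.
Qed.

Lemma chi_x_itv I J i j : 0 <= chi_x Q I J phi i j <= 1.
Proof. exact: sign_avg_itv. Qed.
Lemma chi_y_itv I J i j : 0 <= chi_y Q I J phi i j <= 1.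
Proof. exact: sign_avg_itv. Qed.

Definition load_const : R := B * B + B * B + B + (3 * B + 2 * (err_const * (1 + k))).

Lemma load_const_ge : B * B + B * B + B <= load_const /\ 3 * B + 2 * (err_const * (1 + k)) <= load_const.
Proof.
have e0 := err_const_ge0.
have h : 0 <= err_const * (1 + k) by rewrite mulr_ge0// addr_ge0.
have h2 : 0 <= B * B by rewrite mulr_ge0.
by rewrite /load_const; move: (err_const * (1 + k)) (B * B) B B0 h h2 => *; split; lra.
Qed.

Lemma load_const_ge0 : 0 <= load_const.
Proof. by apply: le_trans load_const_ge.1; rewrite !addr_ge0 ?mulr_ge0. Qed.

Lemma diff_itv (x y : R) : 0 <= x <= 1 -> 0 <= y <= 1 -> `|x - y| <= 1.
Proof. by move=> /andP[? ?] /andP[? ?]; rewrite ler_norml; apply/andP; split; lra. Qed.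

Lemma node_diff_x I J i j : (i <= I)%N -> (0 < j <= J)%N ->
  `|phi (gx Q I i.+1%:R, gy Q J j%:R) - phi (gx Q I i%:R, gy Q J j%:R)| <= B * dx Q I.
Proof.
move=> iI hj; case/andP: (hj) => j0 jJ.
have [c _ [E hc]] := nabla_x_bound HW HS (c1_within Dphi) (fun p Op => (c1_derive Dphi Op).1)
  (fun p Op => (c1_bound1 Dphi Op).1) iI hj.
have dX := dx_gt0 HW I; rewrite -E in hc.
move: hc; rewrite /nabla_x !grid_at ?(leqW iI) ?(leqW jJ)// normrM normfV (gtr0_norm dX).
by rewrite ler_pdivrMr.
Qed.

Lemma node_diff_y I J i j : (0 < i <= I)%N -> (j <= J)%N ->
  `|phi (gx Q I i%:R, gy Q J j.+1%:R) - phi (gx Q I i%:R, gy Q J j%:R)| <= B * dy Q J.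
Proof.
move=> hi jJ; case/andP: (hi) => i0 iI.
have [c _ [E hc]] := nabla_y_bound HW HS (c1_within Dphi) (fun p Op => (c1_derive Dphi Op).2)
  (fun p Op => (c1_bound1 Dphi Op).2) hi jJ.
have dX := dy_gt0 HS J; rewrite -E in hc.
move: hc; rewrite /nabla_y !grid_at ?(leqW iI) ?(leqW jJ)// normrM normfV (gtr0_norm dX).
by rewrite ler_pdivrMr.
Qed.

(** If the two edge values differ, [sign_avg_change] bounds [phi] at the common node by two of its
    increments, so the normal error there is O(h) and pays for the division by [dx]. The constant
    [k] compares the two mesh widths. *)
Lemma jump_bound_x I J i j : dy Q J <= k * dx Q I -> (0 < i <= I)%N -> (0 < j <= J)%N ->
  `|normal_err_x Q I J phi b G1 i j * ((chi_x Q I J phi i.-1 j - chi_x Q I J phi i j) / dx Q I)|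
  <= err_const * (1 + k).
Proof.
case: i => // i hk hi hj; rewrite /=; have dX := dx_gt0 HW I; have dY := dy_gt0 HS J.
have e0 := err_const_ge0; have iI : (i < I)%N by case/andP: hi.
case/andP: (hj) => j0 jJ.
have [->|neq] := eqVneq (chi_x Q I J phi i j) (chi_x Q I J phi i.+1 j).
  by rewrite subrr mul0r mulr0 normr0 mulr_ge0// addr_ge0.
have := sign_avg_change neq; rewrite !grid_at ?(leqW jJ) ?(leqW (ltnW iI)) ?(leqW iI)// => hs.
have hh : `|phi (gx Q I i.+1%:R, gy Q J j%:R)| <= 2 * B * (dx Q I + dy Q J).
  apply: (le_trans hs).
  have d1 := node_diff_x (ltnW iI) hj; have d2 := node_diff_x iI hj; rewrite distrC in d2.
  apply: (le_trans (lerD d1 d2)).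
  have : 0 <= B * dy Q J by rewrite mulr_ge0// ltW.
  by rewrite -mulrA mulrDr; move: (B * dx Q I) (B * dy Q J) => x y ?; lra.
have hij : interior_point I J i.+1 j by apply/andP.
apply: (jump_arith dX (normal_err_bound hij hh).1) => //.
  by rewrite mulrDl mul1r lerD2l.
by apply: diff_itv; exact: chi_x_itv.
Qed.

Lemma jump_bound_y I J i j : dx Q I <= k * dy Q J -> (0 < i <= I)%N -> (0 < j <= J)%N ->
  `|normal_err_y Q I J phi b G2 i j * ((chi_y Q I J phi i j.-1 - chi_y Q I J phi i j) / dy Q J)|
  <= err_const * (1 + k).
Proof.
case: j => // j hk hi hj; rewrite /=; have dX := dx_gt0 HW I; have dY := dy_gt0 HS J.
have e0 := err_const_ge0; have jJ : (j < J)%N by case/andP: hj.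
case/andP: (hi) => i0 iI.
have [->|neq] := eqVneq (chi_y Q I J phi i j) (chi_y Q I J phi i j.+1).
  by rewrite subrr mul0r mulr0 normr0 mulr_ge0// addr_ge0.
have := sign_avg_change neq; rewrite !grid_at ?(leqW iI) ?(leqW (ltnW jJ)) ?(leqW jJ)// => hs.
have hh : `|phi (gx Q I i%:R, gy Q J j.+1%:R)| <= 2 * B * (dx Q I + dy Q J).
  apply: (le_trans hs).
  have d1 := node_diff_y hi (ltnW jJ); have d2 := node_diff_y hi jJ; rewrite distrC in d2.
  apply: (le_trans (lerD d1 d2)).
  have : 0 <= B * dx Q I by rewrite mulr_ge0// ltW.
  by rewrite -mulrA mulrDr; move: (B * dx Q I) (B * dy Q J) => x y ?; lra.
have hij : interior_point I J i j.+1 by apply/andP.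
apply: (jump_arith dY (normal_err_bound hij hh).2) => //.
  by rewrite mulrDl mul1r addrC lerD2l.
by apply: diff_itv; exact: chi_y_itv.
Qed.

Lemma mul_itv (c x : R) : `|x| <= B -> 0 <= c <= 1 -> `|x * c| <= B.
Proof.
by move=> h /andP[c0 c1]; rewrite normrM (ger0_norm c0); apply: le_trans h; rewrite ler_piMr.
Qed.

Lemma load_bounded I J i j : dx Q I <= k * dy Q J -> dy Q J <= k * dx Q I ->
  (i <= I)%N -> (j <= J)%N ->
  [/\ `|load_x Q I J phi beta a g G1 i j| <= load_const,
      `|load_y Q I J phi beta a g G2 i j| <= load_const
    & `|load_0 Q I J phi b f G1 G2 i j| <= load_const].
Proof.
move=> hk1 hk2 iI jJ; have L0 := load_const_ge0.
split.
- case: j jJ => [|j] jJ; first by rewrite /load_x /mask normr0.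
  apply: le_trans load_const_ge.1; apply: load_arith; last exact: chi_x_itv.
  + by apply: betaB; split; [apply: (gx_lt HW); exact: half_itv|apply: (gy_lt HS); exact: node_itv].
  + by have [c _ [-> h]] := nabla_x_bound HW HS (c1_within Dg) (fun p Op => (c1_derive Dg Op).1)
      (fun p Op => (c1_bound1 Dg Op).1) iI (jJ : (0 < j.+1 <= J)%N).
  + by have [c _ [-> h]] := nabla_x_bound HW HS (c1_within Da) (fun p Op => (c1_derive Da Op).1)
      (fun p Op => (c1_bound1 Da Op).1) iI (jJ : (0 < j.+1 <= J)%N).
  rewrite grid_at; [|exact: iI|exact: (leqW jJ)].
  exact: (c1_bound DG1 (node_bar (iI : (i.+1 <= I.+1)%N) (leqW jJ))).
- case: i iI => [|i] iI; first by rewrite /load_y /mask normr0.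
  apply: le_trans load_const_ge.1; apply: load_arith; last exact: chi_y_itv.
  + by apply: betaB; split; [apply: (gx_lt HW); exact: node_itv|apply: (gy_lt HS); exact: half_itv].
  + by have [c _ [-> h]] := nabla_y_bound HW HS (c1_within Dg) (fun p Op => (c1_derive Dg Op).2)
      (fun p Op => (c1_bound1 Dg Op).2) (iI : (0 < i.+1 <= I)%N) jJ.
  + by have [c _ [-> h]] := nabla_y_bound HW HS (c1_within Da) (fun p Op => (c1_derive Da Op).2)
      (fun p Op => (c1_bound1 Da Op).2) (iI : (0 < i.+1 <= I)%N) jJ.
  rewrite grid_at; [|exact: (leqW iI)|exact: jJ].
  exact: (c1_bound DG2 (node_bar (leqW iI) (jJ : (j.+1 <= J.+1)%N))).
case: i iI => [|i] iI; first by rewrite /load_0 /mask normr0.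
case: j jJ => [|j] jJ; first by rewrite /load_0 /mask /= normr0.
apply: le_trans load_const_ge.2; apply: load0_arith.
- by rewrite grid_at ?leqW//; apply: fB; apply: node_bar; rewrite ?leqW.
- apply: mul_itv; last exact: chi_x_itv.
  by have [c _ [-> h]] := nabla_x_bound HW HS (c1_within DG1) (fun p Op => (c1_derive DG1 Op).1)
    (fun p Op => (c1_bound1 DG1 Op).1) iI (jJ : (0 < j.+1 <= J)%N).
- apply: mul_itv; last exact: chi_y_itv.
  by have [c _ [-> h]] := nabla_y_bound HW HS (c1_within DG2) (fun p Op => (c1_derive DG2 Op).2)
    (fun p Op => (c1_bound1 DG2 Op).2) (iI : (0 < i.+1 <= I)%N) jJ.
- exact: jump_bound_x.
exact: jump_bound_y.
Qed.

Section Sequence.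
Variables (I J : nat -> nat).
Hypotheses (hx : dx Q (I n) @[n --> \oo] --> (0 : R)) (hy : dy Q (J n) @[n --> \oo] --> (0 : R)).
Local Notation near_x i p := (forall n, `|gx Q (I n) (i n)%:R - p.1| <= 2 * dx Q (I n)).
Local Notation near_y j p := (forall n, `|gy Q (J n) (j n)%:R - p.2| <= 2 * dy Q (J n)).

Lemma cvg_grid_node u p (i j : nat -> nat) : {for p, continuous u} ->
  (forall n, (i n <= (I n).+1)%N) -> (forall n, (j n <= (J n).+1)%N) -> near_x i p -> near_y j p ->
  at_ (@on_grid R Q (I n) (J n) u) (i n) (j n) @[n --> \oo] --> u p.
Proof.
move=> cu iI jJ hi hj.
apply: (@cvg_eventually _ (fun n => u (gx Q (I n) (i n)%:R, gy Q (J n) (j n)%:R))).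
  by exists 0%N => // n _; rewrite grid_at.
have k1 n : `|gx Q (I n) (i n)%:R - p.1| <= 3 * dx Q (I n).
  by apply: (le_trans (hi n)); rewrite ler_pM2r ?(dx_gt0 HW)// ler_nat.
have k2 n : `|gy Q (J n) (j n)%:R - p.2| <= 3 * dy Q (J n).
  by apply: (le_trans (hj n)); rewrite ler_pM2r ?(dy_gt0 HS)// ler_nat.
exact: (cvg_mesh_point HW HS hx hy cu k1 k2).
Qed.

(** Off the interface both nodal values eventually have the sign of the limit; the weights [theta]
    play no part in the limit. *)
Lemma sign_eventually (s t : nat -> R) (l : R) : l != 0 -> s n @[n --> \oo] --> l ->
  t n @[n --> \oo] --> l ->
  \forall n \near \oo, sign_avg (s n) (t n) = if l < 0 then 1 else 0.
Proof.
move=> l0 hs ht; have e0 : 0 < `|l| by rewrite normr_gt0.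
have [N1 _ h1] := cvg_near hs e0; have [N2 _ h2] := cvg_near ht e0.
exists (maxn N1 N2) => // n /=; rewrite geq_max => /andP[n1 n2].
have /= a1' := h1 n n1; have /= a2' := h2 n n2.
case: (ltgtP l 0) l0 => // hl _.
  rewrite (ltr0_norm hl) !ltr_norml in a1' a2'.
  by apply: sign_avg_neg; move: a1' a2' => /andP[? ?] /andP[? ?]; lra.
rewrite (gtr0_norm hl) !ltr_norml in a1' a2'.
by apply: sign_avg_pos; move: a1' a2' => /andP[? ?] /andP[? ?]; lra.
Qed.

Variable p : R * R.
Hypotheses (Op : Om p) (phi0 : phi p != 0) (cbeta : {for p, continuous beta})
  (cphi : {for p, continuous phi}) (cG1 : {for p, continuous G1}) (cG2 : {for p, continuous G2})
  (cf : {for p, continuous f}).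
Local Notation PI n := (ix Q (I n) p).
Local Notation PJ n := (iy Q (J n) p).

Lemma near_ix : [/\ near_x (fun n => PI n) p, near_x (fun n => (PI n).+1) p,
  near_x (fun n => (PI n).-1) p & near_x (fun n => (PI n).-1.+1) p].
Proof.
have k1 n : `|gx Q (I n) (PI n)%:R - p.1| <= 2 * dx Q (I n).
  by have [_ [_ [+ _]]] := cell_point HW HS I J n Op (leq0n 1); rewrite addn0.
have k2 n : `|gx Q (I n) (PI n).+1%:R - p.1| <= 2 * dx Q (I n).
  by have [_ [_ [+ _]]] := cell_point HW HS I J n Op (leqnn 1); rewrite addn1.
split=> // n; first by have [] := cell_point_pred HW HS I J n Op.
by have := k1 n; have := k2 n; case: (PI n).
Qed.

Lemma near_iy : [/\ near_y (fun n => PJ n) p, near_y (fun n => (PJ n).+1) p,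
  near_y (fun n => (PJ n).-1) p & near_y (fun n => (PJ n).-1.+1) p].
Proof.
have k1 n : `|gy Q (J n) (PJ n)%:R - p.2| <= 2 * dy Q (J n).
  by have [_ [_ [_ +]]] := cell_point HW HS I J n Op (leq0n 1); rewrite addn0.
have k2 n : `|gy Q (J n) (PJ n).+1%:R - p.2| <= 2 * dy Q (J n).
  by have [_ [_ [_ +]]] := cell_point HW HS I J n Op (leqnn 1); rewrite addn1.
split=> // n; first by have [] := cell_point_pred HW HS I J n Op.
by have := k1 n; have := k2 n; case: (PJ n).
Qed.

Let iI n : (PI n <= I n)%N /\ (PJ n <= J n)%N := pc_index HW HS (I n) (J n) Op.
Let pI n : ((PI n).-1 <= I n)%N. Proof. exact: (leq_trans (leq_pred _) (iI n).1). Qed.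
Let pJ n : ((PJ n).-1 <= J n)%N. Proof. exact: (leq_trans (leq_pred _) (iI n).2). Qed.

Lemma chi_x_eventually : (\forall n \near \oo, chi_x Q (I n) (J n) phi (PI n) (PJ n) = neg phi p) /\
  (\forall n \near \oo, chi_x Q (I n) (J n) phi (PI n).-1 (PJ n) = neg phi p).
Proof.
have [x1 x2 x3 x4] := near_ix; have [y1 y2 y3 y4] := near_iy.
have jJ n : (PJ n <= (J n).+1)%N by rewrite leqW// (iI n).2.
split; apply: (sign_eventually phi0); apply: cvg_grid_node => // n;
  by rewrite ?(leqW (iI n).1) ?(leqW (pI n)) ?ltnS ?(iI n).1 ?pI.
Qed.

Lemma chi_y_eventually : (\forall n \near \oo, chi_y Q (I n) (J n) phi (PI n) (PJ n) = neg phi p) /\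
  (\forall n \near \oo, chi_y Q (I n) (J n) phi (PI n) (PJ n).-1 = neg phi p).
Proof.
have [x1 x2 x3 x4] := near_ix; have [y1 y2 y3 y4] := near_iy.
have jJ n : (PI n <= (I n).+1)%N by rewrite leqW// (iI n).1.
split; apply: (sign_eventually phi0); apply: cvg_grid_node => // n;
  by rewrite ?(leqW (iI n).2) ?(leqW (pJ n)) ?ltnS ?(iI n).2 ?pJ.
Qed.

Lemma eventually_cvg (u : nat -> R) (l : R) : (\forall n \near \oo, u n = l) -> u n @[n --> \oo] --> l.
Proof.
move=> [N _ h]; apply: (@cvg_eventually R (fun=> l)); last exact: cvg_cst.
by exists N => // n Nn; rewrite (h n Nn).
Qed.

Lemma cvg_beta_x : beta_x Q (I n) (J n) beta (PI n) (PJ n) @[n --> \oo] --> beta p.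
Proof.
have z1 : 0 <= (0 : R) <= 1 by rewrite lexx ler01.
have zh : 0 <= (2^-1 : R) <= 1 by apply/andP; split; lra.
have h := cvg_node HW HS hx hy (u := beta) Op cbeta zh z1.
apply: (@cvg_eventually R (fun n => beta (gx Q (I n) ((PI n)%:R + 2^-1), gy Q (J n) ((PJ n)%:R + 0)))).
  by exists 0%N => // n _; rewrite addr0.
exact: h.
Qed.

Lemma cvg_beta_y : beta_y Q (I n) (J n) beta (PI n) (PJ n) @[n --> \oo] --> beta p.
Proof.
have z1 : 0 <= (0 : R) <= 1 by rewrite lexx ler01.
have zh : 0 <= (2^-1 : R) <= 1 by apply/andP; split; lra.
have h := cvg_node HW HS hx hy (u := beta) Op cbeta z1 zh.
apply: (@cvg_eventually R (fun n => beta (gx Q (I n) ((PI n)%:R + 0), gy Q (J n) ((PJ n)%:R + 2^-1)))).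
  by exists 0%N => // n _; rewrite addr0.
exact: h.
Qed.

Lemma cvg_bx : pc Q (I n) (J n) (bx Q (I n) (J n) beta) p @[n --> \oo] --> beta p /\
  pc Q (I n) (J n) (by_ Q (I n) (J n) beta) p @[n --> \oo] --> beta p.
Proof.
have [N _ hN] := cell_interior HW HS hx hy Op.
split; [apply: (cvg_eventually _ cvg_beta_x)|apply: (cvg_eventually _ cvg_beta_y)];
  by exists N => // n Nn; have [h1 h2] := hN n Nn; rewrite /pc /bx /by_ /mask ?h1 ?h2.
Qed.

Lemma cvg_du_x u u1 u2 : C1_data u u1 u2 B ->
  nabla_x Q (@on_grid R Q (I n) (J n) u) (PI n) (PJ n) @[n --> \oo] --> u1 p.
Proof.
move=> D; have [x1 _ _ _] := near_ix; have [y1 _ _ _] := near_iy.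
apply: (cvg_nabla_x HW HS hx hy Op (c1_within D) (fun q Oq => (c1_derive D Oq).1)
  (c1_continuous D Op).1 _ x1 y1).
by move=> n; exact: (iI n).1.
Qed.

Lemma cvg_du_y u u1 u2 : C1_data u u1 u2 B ->
  nabla_y Q (@on_grid R Q (I n) (J n) u) (PI n) (PJ n) @[n --> \oo] --> u2 p.
Proof.
move=> D; have [x1 _ _ _] := near_ix; have [y1 _ _ _] := near_iy.
apply: (cvg_nabla_y HW HS hx hy Op (c1_within D) (fun q Oq => (c1_derive D Oq).2)
  (c1_continuous D Op).2 _ x1 y1).
by move=> n; exact: (iI n).2.
Qed.

Lemma cvg_load_x : pc Q (I n) (J n) (load_x Q (I n) (J n) phi beta a g G1) p @[n --> \oo] -->
  beta p * g1 p - beta p * a1 p * neg phi p + b p * phi1 p * neg phi p.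
Proof.
have [N _ hN] := cell_interior HW HS hx hy Op.
have [x1 x2 _ _] := near_ix; have [y1 _ _ _] := near_iy.
have cc := eventually_cvg chi_x_eventually.1.
have cG : at_ (@on_grid R Q (I n) (J n) G1) (PI n).+1 (PJ n) @[n --> \oo] --> G1 p.
  by apply: (cvg_grid_node cG1) => // n; rewrite ?(leqW (iI n).2) ?ltnS ?(iI n).1.
have key := cvg_sum (cvg_diff (cvg_mul cvg_beta_x (cvg_du_x Dg)) (cvg_mul (cvg_mul cvg_beta_x (cvg_du_x Da)) cc))
  (cvg_mul cG cc).
apply: (cvg_eventually _ key).
by exists N => // n Nn; have [h1 h2] := hN n Nn; rewrite /pc /load_x /mask h2.
Qed.

Lemma cvg_load_y : pc Q (I n) (J n) (load_y Q (I n) (J n) phi beta a g G2) p @[n --> \oo] -->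
  beta p * g2 p - beta p * a2 p * neg phi p + b p * phi2 p * neg phi p.
Proof.
have [N _ hN] := cell_interior HW HS hx hy Op.
have [x1 _ _ _] := near_ix; have [y1 y2 _ _] := near_iy.
have cc := eventually_cvg chi_y_eventually.1.
have cG : at_ (@on_grid R Q (I n) (J n) G2) (PI n) (PJ n).+1 @[n --> \oo] --> G2 p.
  by apply: (cvg_grid_node cG2) => // n; rewrite ?(leqW (iI n).1) ?ltnS ?(iI n).2.
have key := cvg_sum (cvg_diff (cvg_mul cvg_beta_y (cvg_du_y Dg)) (cvg_mul (cvg_mul cvg_beta_y (cvg_du_y Da)) cc))
  (cvg_mul cG cc).
apply: (cvg_eventually _ key).
by exists N => // n Nn; have [h1 h2] := hN n Nn; rewrite /pc /load_y /mask h1.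
Qed.

(** The terms with the normal error are eventually equal to 0, not merely small, because both
    neighbouring values of chi agree near a point off the interface. Nothing is thus required of the
    discrete normal at such points. *)
Lemma cvg_load_0 : pc Q (I n) (J n) (load_0 Q (I n) (J n) phi b f G1 G2) p @[n --> \oo] -->
  f p + (G11 p * neg phi p + 0) + (G22 p * neg phi p + 0).
Proof.
have [N _ hN] := cell_interior HW HS hx hy Op.
have [x1 _ _ _] := near_ix; have [y1 _ _ _] := near_iy.
have [ex1 ex2] := chi_x_eventually; have [ey1 ey2] := chi_y_eventually.
have zx : normal_err_x Q (I n) (J n) phi b G1 (PI n) (PJ n) *
    ((chi_x Q (I n) (J n) phi (PI n).-1 (PJ n) - chi_x Q (I n) (J n) phi (PI n) (PJ n)) / dx Q (I n))
    @[n --> \oo] --> (0 : R).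
  apply: eventually_cvg; case: ex1 => [N1 _ h1]; case: ex2 => [N2 _ h2].
  exists (maxn N1 N2) => // n /=; rewrite geq_max => /andP[n1 n2].
  by rewrite (h1 n n1) (h2 n n2) subrr mul0r mulr0.
have zy : normal_err_y Q (I n) (J n) phi b G2 (PI n) (PJ n) *
    ((chi_y Q (I n) (J n) phi (PI n) (PJ n).-1 - chi_y Q (I n) (J n) phi (PI n) (PJ n)) / dy Q (J n))
    @[n --> \oo] --> (0 : R).
  apply: eventually_cvg; case: ey1 => [N1 _ h1]; case: ey2 => [N2 _ h2].
  exists (maxn N1 N2) => // n /=; rewrite geq_max => /andP[n1 n2].
  by rewrite (h1 n n1) (h2 n n2) subrr mul0r mulr0.
have cF : at_ (@on_grid R Q (I n) (J n) f) (PI n) (PJ n) @[n --> \oo] --> f p.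
  by apply: (cvg_grid_node cf) => // n; rewrite ?(leqW (iI n).1) ?(leqW (iI n).2).
have key := cvg_sum (cvg_sum cF (cvg_sum (cvg_mul (cvg_du_x DG1) (eventually_cvg ex1)) zx))
  (cvg_sum (cvg_mul (cvg_du_y DG2) (eventually_cvg ey1)) zy).
apply: (cvg_eventually _ key).
by exists N => // n Nn; have [h1 h2] := hN n Nn; rewrite /pc /load_0 /mask h1 h2.
Qed.
End Sequence.
End LoadArrays.

(** * From the mesh filter to sequences of grids *)

Section MeshLimit.
Context {R : realType}.
Variable Q : rectangle R.
Hypotheses (HW : xW Q < xE Q) (HS : yS Q < yN Q).
Variable ratio : R.
Local Notation mesh0 := (mesh_to_0 Q ratio).

(** For a positive ratio this is at least 1 and bounds dx/dy as well as dy/dx. *)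
Definition aspect : R := 1 + ratio + ratio^-1.

Lemma grid_comparable I J : is_grid Q ratio I J ->
  [/\ 0 < aspect, dx Q I <= aspect * dy Q J, dy Q J <= aspect * dx Q I
    & dx Q I <= aspect * mesh Q I J /\ dy Q J <= aspect * mesh Q I J].
Proof.
move=> [_ _ E]; have dX := dx_gt0 HW I; have dY := dy_gt0 HS J.
have r0 : 0 < ratio by rewrite -E divr_gt0.
have r1 : 0 < ratio^-1 by rewrite invr_gt0.
have Ex : dx Q I = ratio * dy Q J by rewrite -E divfK// gt_eqF.
have Ey : dy Q J = ratio^-1 * dx Q I by rewrite Ex mulKf// gt_eqF.
have a0 : 0 < aspect by rewrite /aspect !addr_gt0.
have h1 : dx Q I <= aspect * dy Q J.
  by rewrite Ex ler_pM2r// /aspect; move: (ratio^-1) r1 => *; lra.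
have h2 : dy Q J <= aspect * dx Q I.
  by rewrite [leLHS]Ey ler_pM2r// /aspect; move: (ratio^-1) r1 => *; lra.
have a1 : 1 <= aspect by rewrite /aspect -addrA lerDl addr_ge0// ltW.
have k1 : dx Q I <= aspect * dx Q I by rewrite ler_peMl// ltW.
have k2 : dy Q J <= aspect * dy Q J by rewrite ler_peMl// ltW.
by split=> //; rewrite /mesh minEle; case: ifP.
Qed.

(** Properness cannot be claimed: if no grid has the given ratio, the base sets are empty and limits
    along the filter hold vacuously. *)
#[global] Instance mesh_filter : Filter mesh0.
Proof.
apply: filter_from_filter; first by exists 1 => /=.
move=> d d' /= d0 d0'; exists (Num.min d d'); first by rewrite /= lt_min d0.
by move=> IJ [g]; rewrite lt_min => /andP[h1 h2].
Qed.

(** By contraposition: if the limit failed, each scale 1/(n+1) would supply a grid violating it, and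
    these grids form a sequence whose two mesh widths tend to 0. *)
Lemma mesh_cvg (u : nat * nat -> R) (l : R) :
  (forall I J : nat -> nat, (forall n, is_grid Q ratio (I n) (J n)) ->
     dx Q (I n) @[n --> \oo] --> (0 : R) -> dy Q (J n) @[n --> \oo] --> (0 : R) ->
     u (I n, J n) @[n --> \oo] --> l) ->
  u IJ @[IJ --> mesh0] --> l.
Proof.
move=> H; apply: near_cvg => e e0; apply: contrapT => nex.
have /choice[c hc] : forall n : nat, exists IJ : nat * nat,
    [/\ is_grid Q ratio IJ.1 IJ.2, mesh Q IJ.1 IJ.2 < n.+1%:R^-1 & ~ (`|u IJ - l| <= e)].
  move=> n; apply: contrapT => nIJ; apply: nex.
  exists n.+1%:R^-1; first by rewrite /= invr_gt0.
  by move=> IJ [gr ms] /=; apply: contrapT => nle; apply: nIJ; exists IJ.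
have a0 : 0 < aspect by have [gr _ _] := hc 0%N; have [] := grid_comparable gr.
have z : aspect * n.+1%:R^-1 @[n --> \oo] --> (0 : R) by apply: cvg0_scale; exact: cvg_harmonic.
have hx : dx Q (c n).1 @[n --> \oo] --> (0 : R).
  apply: (cvg0_squeeze _ z) => n; have [gr ms _] := hc n.
  have [_ _ _ [h _]] := grid_comparable gr; rewrite (ltW (dx_gt0 HW _)) (le_trans h)//.
  by rewrite ler_pM2l// ltW.
have hy : dy Q (c n).2 @[n --> \oo] --> (0 : R).
  apply: (cvg0_squeeze _ z) => n; have [gr ms _] := hc n.
  have [_ _ _ [_ h]] := grid_comparable gr; rewrite (ltW (dy_gt0 HS _)) (le_trans h)//.
  by rewrite ler_pM2l// ltW.
have gr n : is_grid Q ratio (c n).1 (c n).2 by have [] := hc n.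
have [N _ hN] := cvg_near (H (fun n => (c n).1) (fun n => (c n).2) gr hx hy) e0.
have [_ _] := hc N; apply; have /= := hN N (leqnn N); rewrite -surjective_pairing => h.
exact: ltW.
Qed.

Lemma mesh_seq (u : nat * nat -> R) (l : R) (I J : nat -> nat) :
  (forall n, is_grid Q ratio (I n) (J n)) ->
  dx Q (I n) @[n --> \oo] --> (0 : R) -> dy Q (J n) @[n --> \oo] --> (0 : R) ->
  u IJ @[IJ --> mesh0] --> l -> u (I n, J n) @[n --> \oo] --> l.
Proof.
move=> gr hx hy hu; apply: near_cvg => e e0.
have [d d0 hd] := cvg_near hu e0.
have [N _ hN] := mesh_small HW HS hx hy d0; exists N => // n /= Nn.
have [h1 h2] := hN n Nn; apply/ltW; apply: (hd (I n, J n)); split=> /=; first exact: gr.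
by rewrite /mesh gt_min h1.
Qed.
End MeshLimit.

Lemma third_bound (R : realType) (a b c d x : R) :
  a <= b + c -> b < x / 3 -> c <= x / 3 -> d < x / 3 -> a + d <= x.
Proof. by move=> *; lra. Qed.

(** * The extension operator and the abstract convergence argument *)

Section Assembly.
Context {R : realType}.
Variable Q : rectangle R.
Hypotheses (HW : xW Q < xE Q) (HS : yS Q < yN Q).
Local Notation Om := (Omega Q).
Local Notation MP := (measurableTypeR R * measurableTypeR R)%type.
Local Notation mu := (@plane_measure R).
Local Notation mOm := (measurable_Omega Q).
Local Notation fOm := (finite_Omega HW HS).
Local Notation l2 := (@sq_integrable _ MP R mu Om).
Local Notation ipO := (@ip _ MP R mu Om).
Local Notation wd := (weak_derivative Om).
Local Notation nrm := (seminorm ipO).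
Local Notation S := (ip_semi_inner mOm fOm).
Local Notation l2B := (lsB (sq_linear_set mOm fOm)).
Local Notation test := (test_function Om).
Local Opaque weak_derivative e1 e2.
Let ax1 : axis (e1 : R * R) := or_introl erefl.
Let ax2 : axis (e2 : R * R) := or_intror erefl.
Local Notation G u := (Num.sqrt (gradsq Q u)).
Local Notation T v := (interpolant Q v).
Variables (ratio : R) (beta : R * R -> R) (m M : R).
Local Notation mesh0 := (mesh_to_0 Q ratio).
Hypotheses (mb : measurable_fun (Om : set MP) (beta : MP -> R)) (m0 : 0 < m)
  (bb : forall p, Om p -> m <= beta p <= M).
Local Notation energy := (energy Om beta).
Local Notation H10norm := (H10_norm Om beta).

Lemma interpolant_H10 I J (v : @gridfun R I J) : H10h v -> H10 Om (T v).
Proof. by move=> hv; have [_ _ h _] := interpolant_l2 HW HS hv. Qed.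

Lemma M_ge0 : 0 <= M.
Proof.
have /bb/andP[h1 h2] : Om ((xW Q + xE Q) / 2, (yS Q + yN Q) / 2).
  by split; rewrite /= !midf_lt.
exact: (le_trans (ltW m0) (le_trans h1 h2)).
Qed.

Lemma H10norm_le u : H1 Om u -> H10norm u <= Num.sqrt M * G u.
Proof.
move=> Hu; rewrite /H10_norm -sqrtrM ?M_ge0//; apply: ler_wsqrtr.
by have /andP[_ h] := energy_bounds mb (ltW m0) bb Hu; exact: h.
Qed.

Lemma G_le u : H1 Om u -> G u <= Num.sqrt m^-1 * H10norm u.
Proof.
move=> Hu; have mi : 0 <= m^-1 by rewrite invr_ge0 ltW.
rewrite /H10_norm -sqrtrM//; apply: ler_wsqrtr.
have /andP[h _] := energy_bounds mb (ltW m0) bb Hu.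
by rewrite ler_pdivlMl//; exact: h.
Qed.

Lemma normh_sqr I J (v : @gridfun R I J) : H10h v -> normh Q beta v ^+ 2 = Bh Q beta v v.
Proof. by move=> hv; exact: (seminorm_sqr (Bh_si HW HS I J m0 bb) hv). Qed.

Lemma G_normh : exists2 c : R, 0 <= c & forall I J (v : @gridfun R I J), H10h v ->
  G (T v) <= c * normh Q beta v.
Proof.
have [C [C0 hC]] := @dramp_bounded R.
have c0 : 0 <= 2 * C ^+ 2 / m by rewrite divr_ge0 ?(ltW m0)// mulr_ge0// sqr_ge0.
exists (Num.sqrt (2 * C ^+ 2 / m)); first exact: sqrtr_ge0.
move=> I J v hv; apply: sqrt_le; first by rewrite mulr_ge0 ?sqrtr_ge0.
rewrite exprMn (sqr_sqrtr c0) (normh_sqr hv).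
have h t : `|dramp (@smoothing R I J) t| <= C.
  by apply: hC; [exact: smoothing_gt0|exact: smoothing_le4].
apply: (le_trans (gradsq_upper HW HS h hv)).
have /andP[hb _] := Bh_bounds HW HS bb hv.
rewrite -[leRHS]mulrA; apply: ler_wpM2l; first by rewrite mulr_ge0// sqr_ge0.
by rewrite ler_pdivlMl//; exact: hb.
Qed.

Lemma interpolant_bounded : exists2 C0 : R, 0 < C0 & forall I J (v : @gridfun R I J), H10h v ->
  H10norm (T v) <= C0 * normh Q beta v.
Proof.
have [c c0 hc] := G_normh; exists (Num.sqrt M * c + 1).
  by rewrite ltr_pwDr// mulr_ge0 ?sqrtr_ge0.
move=> I J v hv; apply: (le_trans (H10norm_le (H10_H1 (interpolant_H10 hv)))).
rewrite mulrDl mul1r -mulrA; apply: (@le_trans _ _ (Num.sqrt M * (c * normh Q beta v))).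
  by apply: ler_wpM2l; [exact: sqrtr_ge0|exact: hc].
by rewrite lerDl sqrtr_ge0.
Qed.

(** An excess of [dx] makes existence immediate from the definition of the infimum. Minimising
    avoids choosing a test function for each grid: samples of any fixed test function compete on all
    grids. *)
Lemma near_minimiser I J (psi : R * R -> R) : exists w : @gridfun R I J, H10h w /\
  forall w' : @gridfun R I J, H10h w' -> G (T w - psi) <= G (T w' - psi) + dx Q I.
Proof.
pose E : set R := [set x | exists2 w : @gridfun R I J, H10h w & x = G (T w - psi)].
have lE : has_lbound E by exists 0 => x [w _ ->]; exact: sqrtr_ge0.
have iE : has_inf E.
  by split=> //; exists (G (T (0 : @gridfun R I J) - psi)); exists 0 => //; exact: (ls0 (@H10h_set R I J)).
have [x [w hw ->] hx] := inf_adherent (dx_gt0 HW I) iE.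
exists w; split=> // w' hw'; apply: (le_trans (ltW hx)); rewrite lerD2r.
by apply: ge_inf => //; exists w'.
Qed.

Definition approximant psi I J : @gridfun R I J := proj1_sig (cid (near_minimiser I J psi)).

Lemma approximant_H10h psi I J : H10h (approximant psi I J).
Proof. by rewrite /approximant; case: cid => w []. Qed.

Lemma approximant_le psi I J (w : @gridfun R I J) : H10h w ->
  G (T (approximant psi I J) - psi) <= G (T w - psi) + dx Q I.
Proof. exact: ((proj2_sig (cid (near_minimiser I J psi))).2 w). Qed.

Lemma H10_near psi (e : R) : H10 Om psi -> 0 < e -> exists2 z, test z & G (z - psi) <= e.
Proof.
move=> hp e0; have Hp := H10_H1 hp.
have e2' : 0 < e ^+ 2 by rewrite exprn_gt0.
have [z [tz hz]] := hp.2 _ e2'; exists z => //; have Hz := H10_H1 (test_H10 HW HS tz).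
have HB := lsB (H1_set HW HS) Hp Hz.
rewrite (grad_distC HW HS Hz Hp); apply: sqrt_le; first exact: ltW.
have hz' : H1_normsq Om (psi - z) < e ^+ 2 := hz.
rewrite (H1_normsqE HB) in hz'; apply: (le_trans _ (ltW hz')).
by rewrite lerDr; exact: (si_ge0 S (H1_l2 HB)).
Qed.

Section Sequence.
Variables (I J : nat -> nat).
Hypotheses (gr : forall n, is_grid Q ratio (I n) (J n))
  (hx : dx Q (I n) @[n --> \oo] --> (0 : R)) (hy : dy Q (J n) @[n --> \oo] --> (0 : R)).

Lemma approximant_cvg psi : H10 Om psi ->
  G (T (approximant psi (I n) (J n)) - psi) @[n --> \oo] --> (0 : R).
Proof.
move=> hp; apply: near_cvg => e e0; have e3 : 0 < e / 3 by rewrite divr_gt0.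
have [z tz hz] := H10_near hp e3; have Hz := H10_H1 (test_H10 HW HS tz); have Hp := H10_H1 hp.
have [N1 _ h1] := cvg_near (cvg_sqrt0 (interpolant_strong HW HS hx hy tz)) e3.
have [N2 _ h2] := cvg_near hx e3.
exists (maxn N1 N2) => // n /=; rewrite geq_max => /andP[n1 n2].
have /= k1 := h1 n n1; have /= k2 := h2 n n2.
have hZ : H10h (@on_grid R Q (I n) (J n) z) := H10h_grid HW HS (test_out tz).
have HT := H10_H1 (interpolant_H10 hZ).
apply: abs0_le; first exact: sqrtr_ge0.
apply: (le_trans (approximant_le psi hZ)).
have k3 := grad_dist HW HS HT Hz Hp.
have k1' := le_lt_trans (ler_norm _) k1; have k2' := le_lt_trans (ler_norm _) k2.
rewrite !subr0 in k1' k2'.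
exact: (third_bound k3 k1' hz k2').
Qed.

Lemma strong_G (u : nat -> R * R -> R) (w : R * R -> R) : (forall n, H10 Om (u n)) -> H10 Om w ->
  H10norm (u n - w) @[n --> \oo] --> (0 : R) -> G (u n - w) @[n --> \oo] --> (0 : R).
Proof.
move=> hu hw h; apply: (cvg0_squeeze _ (cvg0_scale (Num.sqrt m^-1) h)) => n.
rewrite sqrtr_ge0; apply: G_le.
exact: (lsB (H1_set HW HS) (H10_H1 (hu n)) (H10_H1 hw)).
Qed.

Lemma G_strong (u : nat -> R * R -> R) (w : R * R -> R) : (forall n, H10 Om (u n)) -> H10 Om w ->
  G (u n - w) @[n --> \oo] --> (0 : R) -> H10norm (u n - w) @[n --> \oo] --> (0 : R).
Proof.
move=> hu hw h; apply: (cvg0_squeeze _ (cvg0_scale (Num.sqrt M) h)) => n.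
rewrite sqrtr_ge0; apply: H10norm_le.
exact: (lsB (H1_set HW HS) (H10_H1 (hu n)) (H10_H1 hw)).
Qed.
End Sequence.

Lemma approximant_strong psi : H10 Om psi ->
  strong_cvg Om beta mesh0 (fun IJ => T (approximant psi IJ.1 IJ.2)) psi.
Proof.
move=> hp; apply: (mesh_cvg HW HS) => I J gr hx hy.
exact: (G_strong (fun n => interpolant_H10 (@approximant_H10h psi (I n) (J n))) hp
  (approximant_cvg hx hy hp)).
Qed.

(** A weak-strong pairing for a bounded sequence [X] that has no known weak limit; it is only
    asymptotic to [X'] in the weak sense. *)
Lemma cross_limit (X Y' X' : nat -> R * R -> R) (Y : R * R -> R) (C : R) :
  (forall n, l2 (X n)) -> (forall n, l2 (Y' n)) -> (forall n, l2 (X' n)) -> l2 Y ->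
  (forall n, nrm (X n) <= C) -> nrm (Y' n - Y) @[n --> \oo] --> (0 : R) ->
  ipO Y (X n - X' n) @[n --> \oo] --> (0 : R) ->
  (ipO (X n) (Y' n) - ipO Y (X' n)) @[n --> \oo] --> (0 : R).
Proof.
move=> lX lY' lX' lY XC h1 h2.
have k := ip_cvg0 HW HS lX (fun n => l2B (lY' n) lY) XC h1.
have E n : ipO (X n) (Y' n - Y) + ipO Y (X n - X' n) = ipO (X n) (Y' n) - ipO Y (X' n).
  have a := linear_onB (sq_linear_set mOm fOm) (si_linear_onr S (lX n)) (lY' n) lY.
  have b := linear_onB (sq_linear_set mOm fOm) (si_linear_onr S lY) (lX n) (lX' n).
  have c := si_sym S lY (lX n).
  have ar (t u v w x y : R) : t = x - y -> u = v - w -> v = y -> t + u = x - w.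
    by move=> -> -> ->; rewrite addrA subrK.
  exact: (ar _ _ _ _ _ _ a b c).
apply: (cvg_eventually _ (cvg0_add k h2)); exists 0%N; first by [].
by move=> n _; exact: (E n).
Qed.

(** * Functionals given by bounded load arrays that converge almost everywhere *)

Section Loads.
Variables (Fd : forall I J, @gridfun R I J -> R) (Fc : (R * R -> R) -> R)
  (LX LY L0 : nat -> nat -> nat -> nat -> R) (lx ly l0 : R * R -> R) (K : R).
Hypotheses
  (FdE : forall I J (psi : @gridfun R I J), H10h psi -> Fd psi =
     cellsum Q I J (fun i j => LX I J i j * nabla_x Q psi i j)
     + cellsum Q I J (fun i j => LY I J i j * nabla_y Q psi i j)
     + cellsum Q I J (fun i j => L0 I J i j * at_ psi i j))
  (LB : forall I J i j, is_grid Q ratio I J -> (i <= I)%N -> (j <= J)%N ->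
     [/\ `|LX I J i j| <= K, `|LY I J i j| <= K & `|L0 I J i j| <= K])
  (cvgL : forall I J : nat -> nat, dx Q (I n) @[n --> \oo] --> (0 : R) ->
     dy Q (J n) @[n --> \oo] --> (0 : R) ->
     [/\ {ae mu, forall p, Om p -> pc Q (I n) (J n) (LX (I n) (J n)) p @[n --> \oo] --> lx p},
         {ae mu, forall p, Om p -> pc Q (I n) (J n) (LY (I n) (J n)) p @[n --> \oo] --> ly p}
       & {ae mu, forall p, Om p -> pc Q (I n) (J n) (L0 (I n) (J n)) p @[n --> \oo] --> l0 p}])
  (ml : [/\ measurable_fun (Om : set MP) (lx : MP -> R), measurable_fun (Om : set MP) (ly : MP -> R)
     & measurable_fun (Om : set MP) (l0 : MP -> R)])
  (bl : forall p, Om p -> [/\ `|lx p| <= K, `|ly p| <= K & `|l0 p| <= K])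
  (FcE : forall psi, H10 Om psi -> Fc psi = ipO (wd e1 psi) lx + ipO (wd e2 psi) ly + ipO psi l0)
  (cvgb : forall I J : nat -> nat, dx Q (I n) @[n --> \oo] --> (0 : R) ->
     dy Q (J n) @[n --> \oo] --> (0 : R) ->
     {ae mu, forall p, Om p -> pc Q (I n) (J n) (bx Q (I n) (J n) beta) p @[n --> \oo] --> beta p} /\
     {ae mu, forall p, Om p -> pc Q (I n) (J n) (by_ Q (I n) (J n) beta) p @[n --> \oo] --> beta p}).

Lemma Fd_linear I J : linear_on (@H10h R I J) (@Fd I J).
Proof.
move=> c u v hu hv; have huv := (@H10h_set R I J).2 c u v hu hv.
have E (L : nat -> nat -> R) (d : @gridfun R I J -> nat -> nat -> R) :
    (forall i j, d (c *: u + v) i j = c * d u i j + d v i j) ->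
    cellsum Q I J (fun i j => L i j * d (c *: u + v) i j) =
    c * cellsum Q I J (fun i j => L i j * d u i j) + cellsum Q I J (fun i j => L i j * d v i j).
  by move=> h; rewrite -cellsumZ -cellsumD; apply: eq_cellsum => i j _ _; rewrite h; ring.
have A (x y z x1 y1 z1 x2 y2 z2 : R) : x = c * x1 + x2 -> y = c * y1 + y2 -> z = c * z1 + z2 ->
  x + y + z = c * (x1 + y1 + z1) + (x2 + y2 + z2) by move=> -> -> ->; ring.
rewrite (FdE huv) (FdE hu) (FdE hv); apply: A.
- by apply: (E _ (@nabla_x R Q I J)) => i j; rewrite /nabla_x /at_ !mxE; move: (_^-1) => *; ring.
- by apply: (E _ (@nabla_y R Q I J)) => i j; rewrite /nabla_y /at_ !mxE; move: (_^-1) => *; ring.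
by apply: (E _ (@at_ R I J)) => i j; rewrite /at_ !mxE.
Qed.

Lemma ll : [/\ l2 lx, l2 ly & l2 l0].
Proof.
case: ml => m1 m2 m3; split; [apply: (sq_bounded mOm fOm m1 (C := K))|
  apply: (sq_bounded mOm fOm m2 (C := K))|apply: (sq_bounded mOm fOm m3 (C := K))];
  by move=> p /bl[].
Qed.

Lemma Fd_bounded : exists2 C : R, 0 < C & forall I J (v : @gridfun R I J), is_grid Q ratio I J ->
  H10h v -> `|Fd v| <= C * normh Q beta v.
Proof.
have [c c0 hc] := G_normh.
pose A := Num.sqrt (K ^+ 2 * fine (mu Om)).
pose W := xE Q - xW Q; pose H := yN Q - yS Q.
(* Bounds the distance between interpolant and nodal array: 6 is from [interpolant_pc], 49 from
   [dirichlet_le], and the mesh widths are replaced by the side lengths to be independent of the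
   grid. *)
pose D := Num.sqrt (6 * (W ^+ 2 + H ^+ 2) * 49).
have W0 : 0 <= W by rewrite subr_ge0 ltW.
have H0 : 0 <= H by rewrite subr_ge0 ltW.
have D0 : 0 <= 6 * (W ^+ 2 + H ^+ 2) * 49 by rewrite mulr_ge0// mulr_ge0// addr_ge0 ?sqr_ge0.
have A0 : 0 <= A := sqrtr_ge0 _.
(* 14 is twice the 7 of [nrm_pc_nabla], once for each direction; [2 * W] is the Poincare
   constant. *)
have B0 : 0 <= A * (14 + (2 * W + D)).
  by rewrite mulr_ge0// addr_ge0// addr_ge0 ?sqrtr_ge0// mulr_ge0.
exists (A * (14 + (2 * W + D)) * c + 1); first by rewrite ltr_pwDr// mulr_ge0.
move=> I J v gr hv; have HT := interpolant_H10 hv; have HT1 := H10_H1 HT.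
have g0 := gradsq_ge0 HW HS HT1.
have lpc e : l2 (pc Q I J e) := pc_l2 HW HS _ _ _.
have nA (e : nat -> nat -> R) : (forall i j, (i <= I)%N -> (j <= J)%N -> `|e i j| <= K) ->
    nrm (pc Q I J e) <= A.
  move=> he; apply: ler_wsqrtr; apply: (ip_bounded mOm fOm (pc_measurable HW HS I J e)).
  by move=> p Op; have [iI jJ] := pc_index HW HS I J Op; exact: he.
have term (e e' : nat -> nat -> R) (x : R) : (forall i j, (i <= I)%N -> (j <= J)%N -> `|e i j| <= K) ->
    nrm (pc Q I J e') <= x -> `|cellsum Q I J (fun i j => e i j * e' i j)| <= A * x.
  move=> he hx; have E := pc_ip HW HS I J e e'; rewrite -E.
  apply: (le_trans (si_CS_norm S (lpc e) (lpc e'))); apply: ler_pM => //; try exact: sqrtr_ge0.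
  exact: nA.
have [nx ny] := nrm_pc_nabla HW HS (I := fun=> I) (J := fun=> J) (n := 0%N) hv.
have nT : nrm (T v) <= 2 * W * G (T v).
  apply: sqrt_le; first by rewrite mulr_ge0 ?sqrtr_ge0// mulr_ge0.
  by rewrite exprMn (sqr_sqrtr g0); exact: (poincare_gradsq HW HS HT).
have [gx gy] := grid_size Q I J.
have small (x y : R) (k : nat) : 0 <= x -> x * k.+1%:R = y -> x ^+ 2 <= y ^+ 2.
  move=> x0 <-; rewrite exprMn ler_peMr ?sqr_ge0// expr_ge1 ?ler1n//.
have sx := small _ _ _ (ltW (dx_gt0 HW I)) gx; have sy := small _ _ _ (ltW (dy_gt0 HS J)) gy.
have nD : nrm (T v - pc Q I J (at_ v)) <= D * G (T v).
  apply: sqrt_le; first by rewrite mulr_ge0 ?sqrtr_ge0.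
  rewrite exprMn (sqr_sqrtr g0) (sqr_sqrtr D0).
  apply: (le_trans (interpolant_pc HW HS hv)).
  have dl := dirichlet_le HW HS (I := fun=> I) (J := fun=> J) (n := 0%N) hv.
  rewrite -[6 * (W ^+ 2 + _) * 49 * _]mulrA; apply: ler_pM.
  - by rewrite mulr_ge0// addr_ge0 ?sqr_ge0.
  - apply: addr_ge0; apply: (cellsum_ge0 HW HS) => i j; exact: sqr_ge0.
  - by rewrite ler_pM2l//; apply: lerD.
  - exact: dl.
have na : nrm (pc Q I J (at_ v)) <= (2 * W + D) * G (T v).
  have lT := H1_l2 HT1.
  have E : pc Q I J (at_ v) = T v - (T v - pc Q I J (at_ v)) by rewrite opprB addrC subrK.
  rewrite mulrDl E; apply: (le_trans (seminormB S lT (l2B lT (lpc _)))); exact: (lerD nT nD).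
have h1 := term _ _ _ (fun i j iI jJ => let: And3 h _ _ := LB gr iI jJ in h) nx.
have h2 := term _ _ _ (fun i j iI jJ => let: And3 _ h _ := LB gr iI jJ in h) ny.
have h3 := term _ _ _ (fun i j iI jJ => let: And3 _ _ h := LB gr iI jJ in h) na.
rewrite (FdE hv); have t1 := ler_normD (cellsum Q I J (fun i j => LX I J i j * nabla_x Q v i j)
  + cellsum Q I J (fun i j => LY I J i j * nabla_y Q v i j)) (cellsum Q I J (fun i j => L0 I J i j * at_ v i j)).
apply: (le_trans t1); have t2 := ler_normD (cellsum Q I J (fun i j => LX I J i j * nabla_x Q v i j))
  (cellsum Q I J (fun i j => LY I J i j * nabla_y Q v i j)).
apply: (le_trans (lerD (le_trans t2 (lerD h1 h2)) h3)).
have E : A * (7 * G (T v)) + A * (7 * G (T v)) + A * ((2 * W + D) * G (T v)) =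
    A * (14 + (2 * W + D)) * G (T v).
  by move: (G (T v)) (2 * W + D) => x y; ring.
apply: (le_trans (le_eq E)).
have n0 : 0 <= normh Q beta v := sqrtr_ge0 _.
apply: (le_trans (ler_wpM2l B0 (hc _ _ _ hv))).
by rewrite mulrA [leRHS]mulrDl mul1r lerDl.
Qed.

Lemma Fc_functional : bounded_linear_functional Om beta Fc.
Proof.
have [lx2 ly2 l02] := ll.
have [L1 [c1 h1]] := wd_functional HW HS mb m0 bb ax1 lx2.
have [L2 [c2 h2]] := wd_functional HW HS mb m0 bb ax2 ly2.
have W0 : 0 <= 2 * (xE Q - xW Q) by rewrite mulr_ge0// subr_ge0 ltW.
split.
  move=> c u v hu hv; have huv := (H10_set HW HS).2 c u v hu hv.
  have L3 : ipO (c *: u + v) l0 = c * ipO u l0 + ipO v l0 :=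
    si_linear_on S l02 c (H1_l2 (H10_H1 hu)) (H1_l2 (H10_H1 hv)).
  have A (x y z x1 y1 z1 x2 y2 z2 : R) : x = c * x1 + x2 -> y = c * y1 + y2 -> z = c * z1 + z2 ->
    x + y + z = c * (x1 + y1 + z1) + (x2 + y2 + z2) by move=> -> -> ->; ring.
  have E := A _ _ _ _ _ _ _ _ _ (L1 c u v hu hv) (L2 c u v hu hv) L3.
  exact: (etrans (FcE huv) (etrans E (esym (congr2 (fun x y => c * x + y) (FcE hu) (FcE hv))))).
exists (c1 + c2 + 2 * (xE Q - xW Q) * Num.sqrt m^-1 * nrm l0) => u hu.
have Hu := H10_H1 hu; have lu := H1_l2 Hu.
have h3 : `|ipO u l0| <= 2 * (xE Q - xW Q) * Num.sqrt m^-1 * nrm l0 * H10norm u.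
  apply: (le_trans (si_CS_norm S lu l02)).
  have nu : nrm u <= 2 * (xE Q - xW Q) * (Num.sqrt m^-1 * H10norm u).
    apply: (@le_trans _ _ (2 * (xE Q - xW Q) * G u)); last by apply: ler_wpM2l => //; exact: (G_le Hu).
    apply: sqrt_le; first by rewrite mulr_ge0// sqrtr_ge0.
    by rewrite exprMn (sqr_sqrtr (gradsq_ge0 HW HS Hu)); exact: (poincare_gradsq HW HS hu).
  have n0 : 0 <= nrm l0 := sqrtr_ge0 _.
  apply: (le_trans (ler_wpM2r n0 nu)); apply: le_eq.
  by move: (H10norm u) (nrm l0) (Num.sqrt m^-1) => x y z; ring.
have A (x y z a b d n : R) : `|x| <= a * n -> `|y| <= b * n -> `|z| <= d * n ->
    `|x + y + z| <= (a + b + d) * n.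
  move=> k1 k2 k3; rewrite !mulrDl.
  by apply: (le_trans (ler_normD _ _)); apply: lerD => //; apply: (le_trans (ler_normD _ _)); apply: lerD.
exact: (le_trans (le_eq (congr1 Num.norm (FcE hu))) (A _ _ _ _ _ _ _ (h1 u hu) (h2 u hu) h3)).
Qed.

(** Existence is Riesz representation. Two solutions differ by a function of zero energy, which
    Poincare turns into equality almost everywhere. *)
Lemma weak_solvable : exists v, (H10 Om v /\ forall psi, H10 Om psi -> - energy v psi = Fc psi) /\
  forall v', (H10 Om v' /\ forall psi, H10 Om psi -> - energy v' psi = Fc psi) ->
    {ae mu, forall p, Om p -> v' p = v p}.
Proof.
have si := H10_energy_si HW HS mb m0 bb; have [FL [C FB]] := Fc_functional.
have L : linear_on (H10 Om) (fun u => - Fc u).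
  by move=> c u v hu hv; rewrite /= FL// opprD mulrN.
have LBd u : H10 Om u -> `|- Fc u| <= C * seminorm energy u by rewrite normrN; exact: FB.
have [v [hv sv _]] := riesz si (H10_complete HW HS mb m0 bb) (H10_set HW HS) (fun u h => h) L LBd.
exists v; split; first by split=> // psi hp; rewrite sv// opprK.
move=> v' [hv' sv']; have hd := lsB (H10_set HW HS) hv' hv.
have e0 : energy (v' - v) (v' - v) = 0.
  have E := linear_onB (H10_set HW HS) (si_linear_on si hd) hv' hv.
  have a := sv' _ hd; have b := sv _ hd.
  have A (x y z f : R) : x = y - z -> - y = f -> z = - f -> x = 0.
    by move=> -> <- ->; rewrite opprK subrr.
  exact: (A _ _ _ _ E a b).
have /andP[h _] := energy_bounds mb (ltW m0) bb (H10_H1 hd).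
have g0 : gradsq Q (v' - v) <= 0.
  by rewrite -(pmulr_rle0 _ m0); exact: (le_trans h (le_eq e0)).
have p0 := poincare_gradsq HW HS hd.
have ld := H1_l2 (H10_H1 hd).
have i0 : ipO (v' - v) (v' - v) = 0.
  apply/eqP; rewrite eq_le; apply/andP; split; last exact: (si_ge0 S ld).
  by apply: (le_trans p0); apply: mulr_ge0_le0 => //; exact: sqr_ge0.
apply: ae_sub (ip_eq0_ae mOm ld i0) => p k Op.
by apply/eqP; rewrite -subr_eq0; apply/eqP; exact: (k Op).
Qed.

Section LoadSequence.
Variables (I J : nat -> nat).
Hypotheses (gr : forall n, is_grid Q ratio (I n) (J n))
  (hx : dx Q (I n) @[n --> \oo] --> (0 : R)) (hy : dy Q (J n) @[n --> \oo] --> (0 : R)).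

Lemma Fd_limit (psi : forall n, @gridfun R (I n) (J n)) psi0 : (forall n, H10h (psi n)) ->
  H10 Om psi0 -> G (T (psi n) - psi0) @[n --> \oo] --> (0 : R) ->
  Fd (psi n) @[n --> \oo] --> Fc psi0.
Proof.
move=> hp hp0 cp; have [c1 c2 c3] := cvgL hx hy.
have h := load_limit HW HS hx hy hp hp0 cp (fun n i j => LB (gr n)) c1 c2 c3 ml bl.
rewrite (FcE hp0); apply: (cvg_eventually _ h); exists 0%N; first by [].
by move=> n _; rewrite (FdE (hp n)).
Qed.

(** The interpolants of [v] are bounded but not known to converge weakly, hence [cross_limit]
    instead of [Bh_limit]. *)
Lemma energy_consistency (v : forall n, @gridfun R (I n) (J n)) (C : R) w :
  (forall n, H10h (v n)) -> (forall n, dirichlet Q (v n) <= C) -> H10 Om w ->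
  (Bh Q beta (v n) (approximant w (I n) (J n)) - energy w (T (v n))) @[n --> \oo] --> (0 : R).
Proof.
move=> hv hC hw; have [ab1 ab2] := cvgb hx hy; have Hw := H10_H1 hw.
have hp n : H10h (approximant w (I n) (J n)) := @approximant_H10h w (I n) (J n).
have cp := approximant_cvg hx hy hw.
have bM p : Om p -> `|beta p| <= M.
  by move=> /bb /andP[k1 k2]; rewrite ger0_norm// (le_trans (ltW m0)).
have M0 (x : R) : m <= x <= M -> `|x| <= M.
  by move=> /andP[k1 k2]; rewrite ger0_norm// (le_trans (ltW m0)).
have bx1 n i j : (i <= I n)%N -> (j <= J n)%N -> `|bx Q (I n) (J n) beta i j| <= M.
  case: j => [|j] iI jJ; first by rewrite normr0 M_ge0.
  by apply: M0; apply: (bx_itv HW HS bb iI).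
have by1 n i j : (i <= I n)%N -> (j <= J n)%N -> `|by_ Q (I n) (J n) beta i j| <= M.
  case: i => [|i] iI jJ; first by rewrite normr0 M_ge0.
  by apply: M0; apply: (by_itv HW HS bb _ jJ).
have lpc n c : l2 (pc Q (I n) (J n) c) := pc_l2 HW HS _ _ _.
have lb (u : R * R -> R) : l2 u -> l2 (fun p => beta p * u p) by exact: l2_bounded_mul mb bM.
have s1 := array_mul HW HS bx1 ab1 mb bM (fun n => lpc n (nabla_x Q (approximant w (I n) (J n))))
  (wd_l2 ax1 Hw) (strong_x HW HS hx hy hp hw cp).
have s2 := array_mul HW HS by1 ab2 mb bM (fun n => lpc n (nabla_y Q (approximant w (I n) (J n))))
  (wd_l2 ax2 Hw) (strong_y HW HS hx hy hp hw cp).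
have lx' n : l2 (fun p => pc Q (I n) (J n) (bx Q (I n) (J n) beta) p
    * pc Q (I n) (J n) (nabla_x Q (approximant w (I n) (J n))) p) :=
  lpc n (fun i j => bx Q (I n) (J n) beta i j * nabla_x Q (approximant w (I n) (J n)) i j).
have ly' n : l2 (fun p => pc Q (I n) (J n) (by_ Q (I n) (J n) beta) p
    * pc Q (I n) (J n) (nabla_y Q (approximant w (I n) (J n))) p) :=
  lpc n (fun i j => by_ Q (I n) (J n) beta i j * nabla_y Q (approximant w (I n) (J n)) i j).
have lbx := lb _ (wd_l2 ax1 Hw); have lby := lb _ (wd_l2 ax2 Hw).
have lT1 n : l2 (interpolant_x Q (v n)) by have [] := interpolant_l2 HW HS (@hv n).
have lT2 n : l2 (interpolant_y Q (v n)) by have [] := interpolant_l2 HW HS (@hv n).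
have r1 := cross_limit (fun n => lpc n (nabla_x Q (v n))) lx' lT1 lbx
  (fun n => (nrm_ax HW HS hC n).1) s1 (consistency_x HW HS hx hy hv hC lbx).
have r2 := cross_limit (fun n => lpc n (nabla_y Q (v n))) ly' lT2 lby
  (fun n => (nrm_ax HW HS hC n).2) s2 (consistency_y HW HS hx hy hv hC lby).
apply: (cvg_eventually _ (cvg0_add r1 r2)); exists 0%N; first by [].
move=> n _; have [lt1 lt2 hT [a1 a2]] := interpolant_l2 HW HS (@hv n); have HT := H10_H1 hT.
have eE := energyE mb (ltW m0) bb Hw HT.
have ea1 := ip_ae mOm (wd_l2 ax1 HT) lt1 lbx a1.
have ea2 := ip_ae mOm (wd_l2 ax2 HT) lt2 lby a2.
have sy1 := si_sym S lbx (wd_l2 ax1 HT); have sy2 := si_sym S lby (wd_l2 ax2 HT).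
have sz1 := si_sym S lbx lt1; have sz2 := si_sym S lby lt2.
have b1 : ipO (pc Q (I n) (J n) (nabla_x Q (v n))) (fun p => pc Q (I n) (J n) (bx Q (I n) (J n) beta) p
    * pc Q (I n) (J n) (nabla_x Q (approximant w (I n) (J n))) p) =
    cellsum Q (I n) (J n) (fun i j => bx Q (I n) (J n) beta i j * nabla_x Q (v n) i j
      * nabla_x Q (approximant w (I n) (J n)) i j).
  by apply: (etrans (pc_ip HW HS _ _ (nabla_x Q (v n)) (fun i j => bx Q (I n) (J n) beta i j * nabla_x Q (approximant w (I n) (J n)) i j)));
    apply: eq_cellsum => i j _ _; rewrite mulrA [nabla_x _ _ _ _ * _]mulrC.
have b2 : ipO (pc Q (I n) (J n) (nabla_y Q (v n))) (fun p => pc Q (I n) (J n) (by_ Q (I n) (J n) beta) p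
    * pc Q (I n) (J n) (nabla_y Q (approximant w (I n) (J n))) p) =
    cellsum Q (I n) (J n) (fun i j => by_ Q (I n) (J n) beta i j * nabla_y Q (v n) i j
      * nabla_y Q (approximant w (I n) (J n)) i j).
  by apply: (etrans (pc_ip HW HS _ _ (nabla_y Q (v n)) (fun i j => by_ Q (I n) (J n) beta i j * nabla_y Q (approximant w (I n) (J n)) i j)));
    apply: eq_cellsum => i j _ _; rewrite mulrA [nabla_y _ _ _ _ * _]mulrC.
have BE := BhE Q beta (v n) (hp n).
have A (i1 i2 y1 y2 c1 c2 t1 t2 u1 u2 u1' u2' z1 z2 Bv En : R) : i1 = c1 -> i2 = c2 -> Bv = c1 + c2 ->
    En = t1 + t2 -> t1 = u1 -> t2 = u2 -> u1 = u1' -> u2 = u2' -> y1 = u1' -> y2 = u2' ->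
    i1 - y1 + (i2 - y2) = Bv - En.
  by move=> -> -> -> -> -> -> -> -> -> ->; ring.
exact: (A _ _ _ _ _ _ _ _ _ _ _ _ 0 0 _ _ b1 b2 BE eE sy1 sy2 ea1 ea2 sz1 sz2).
Qed.

(** No weakly convergent subsequence is extracted: each functional is followed directly along the
    whole sequence, and the a priori bound only serves to make the consistency error vanish.
    Symmetry of the energy turns the equation for [v0], tested with [w], into the value of the
    functional at [v0]. *)
Lemma solution_cvg (v : forall n, @gridfun R (I n) (J n)) v0 :
  (forall n, H10h (v n) /\ forall psi, H10h psi -> - Bh Q beta (v n) psi = Fd psi) ->
  H10 Om v0 -> (forall psi, H10 Om psi -> - energy v0 psi = Fc psi) ->
  weak_cvg Om beta \oo (fun n => T (v n)) v0.
Proof.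
move=> hs hv0 s0 L [Ll [C LC]]; have hv n : H10h (v n) := (hs n).1.
have si := H10_energy_si HW HS mb m0 bb.
have hT n : H10 Om (T (v n)) := interpolant_H10 (hv n).
have [w [hw sw _]] := riesz si (H10_complete HW HS mb m0 bb) (H10_set HW HS) (fun u h => h) Ll LC.
have [D D0 hD] := Fd_bounded.
(* A priori estimate: the discrete equation is tested with its own solution. *)
have vD n : dirichlet Q (v n) <= m^-1 * D ^+ 2.
  have /andP[hb _] := Bh_bounds HW HS bb (hv n).
  rewrite ler_pdivlMl//; apply: (le_trans hb); rewrite -(normh_sqr (hv n)).
  have n0 : 0 <= normh Q beta (v n) := sqrtr_ge0 _.
  have nn : normh Q beta (v n) ^+ 2 <= D * normh Q beta (v n).
    rewrite (normh_sqr (hv n)) -[Bh _ _ _ _]opprK ((hs n).2 _ (hv n)).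
    by apply: le_trans (hD _ _ _ (gr n) (hv n)); rewrite -normrN ler_norm.
  have A (x y : R) : 0 <= x -> 0 < y -> x ^+ 2 <= y * x -> x ^+ 2 <= y ^+ 2.
    move=> x0 y0; move: x0; rewrite le_eqVlt => /orP[/eqP<- _|x0].
      by rewrite expr0n sqr_ge0.
    by rewrite expr2 ler_pM2r// => xy; rewrite expr2; apply: ler_pM => //; exact: ltW.
  exact: A.
have ec := energy_consistency hv vD hw.
have fl := Fd_limit (fun n => @approximant_H10h w (I n) (J n)) hw (approximant_cvg hx hy hw).
have E n : - Fd (approximant w (I n) (J n)) -
    (Bh Q beta (v n) (approximant w (I n) (J n)) - energy w (T (v n))) = L (T (v n)).
  rewrite -((hs n).2 _ (@approximant_H10h w (I n) (J n))).
  have A (x y z : R) : y = z -> - - x - (x - y) = z by move=> ->; ring.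
  exact: (A _ _ _ (sw _ (hT n))).
have E0 : - Fc w - 0 = L v0.
  rewrite subr0; have a := s0 _ hw; have b := si_sym si hv0 hw; have c := sw _ hv0.
  have A (x y f l : R) : - x = f -> x = y -> y = l -> - f = l by move=> <- -> ->; rewrite opprK.
  exact: (A _ _ _ _ a b c).
rewrite -E0; apply: (cvg_eventually _ (cvg_diff (cvgN fl) ec)); exists 0%N; first by [].
by move=> n _; exact: (E n).
Qed.
End LoadSequence.
Lemma assembly : exists T : forall I J : nat, gridfun I J -> R * R -> R,
  (forall I J, is_grid Q ratio I J ->
     (forall psi : gridfun I J, H10h psi -> H10 Om (T I J psi)) /\
     (forall (c : R) (v psi : gridfun I J), H10h v -> H10h psi ->
        T I J (c *: v + psi) = c *: T I J v + T I J psi)) /\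
  (exists C0 C1 C2 C3 : R,
     (0 < C0 /\ 0 < C1 /\ 0 < C2 /\ 0 < C3) /\
     (forall I J, is_grid Q ratio I J -> forall psi : gridfun I J, H10h psi ->
        H10norm (T I J psi) <= C0 * normh Q beta psi) /\
     (forall psi : R * R -> R, H10 Om psi ->
        exists psih : forall I J : nat, gridfun I J,
          (forall I J, is_grid Q ratio I J -> H10h (psih I J)) /\
          strong_cvg Om beta mesh0 (fun IJ => T IJ.1 IJ.2 (psih IJ.1 IJ.2)) psi) /\
     (forall I J, is_grid Q ratio I J -> forall u v : gridfun I J,
        H10h u -> H10h v ->
        C1 * normh Q beta u ^+ 2 <= Bh Q beta u u /\
        `|Bh Q beta u v| <= C2 * normh Q beta u * normh Q beta v) /\
     (forall I J, is_grid Q ratio I J -> forall psi : gridfun I J, H10h psi ->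
        `|Fd psi| <= C3 * normh Q beta psi) /\
     (forall (vh psih : forall I J : nat, gridfun I J) (v psi : R * R -> R),
        (forall I J, is_grid Q ratio I J -> H10h (vh I J) /\ H10h (psih I J)) ->
        H10 Om v -> H10 Om psi ->
        weak_cvg Om beta mesh0 (fun IJ => T IJ.1 IJ.2 (vh IJ.1 IJ.2)) v ->
        strong_cvg Om beta mesh0 (fun IJ => T IJ.1 IJ.2 (psih IJ.1 IJ.2)) psi ->
        Bh Q beta (vh IJ.1 IJ.2) (psih IJ.1 IJ.2) @[IJ --> mesh0] --> energy v psi /\
        Fd (psih IJ.1 IJ.2) @[IJ --> mesh0] --> Fc psi)) /\
  (forall I J, is_grid Q ratio I J ->
     exists! vh : gridfun I J, H10h vh /\ forall psi, H10h psi -> - Bh Q beta vh psi = Fd psi) /\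
  (exists v : R * R -> R,
     (H10 Om v /\ forall psi, H10 Om psi -> - energy v psi = Fc psi) /\
     (forall v', (H10 Om v' /\ forall psi, H10 Om psi -> - energy v' psi = Fc psi) ->
        {ae mu, forall p, Om p -> v' p = v p}) /\
     (forall vh : forall I J : nat, gridfun I J,
        (forall I J, is_grid Q ratio I J ->
           H10h (vh I J) /\ forall psi, H10h psi -> - Bh Q beta (vh I J) psi = Fd psi) ->
        weak_cvg Om beta mesh0 (fun IJ => T IJ.1 IJ.2 (vh IJ.1 IJ.2)) v)).
Proof.
have [C0 C00 hC0] := interpolant_bounded; have [C3 C30 hC3] := Fd_bounded.
exists (fun I J v => T v); split; [|split; [|split]].
- move=> I J _; split; first by move=> psi hp; exact: (interpolant_H10 hp).
  by move=> c v psi _ _; exact: interpolant_linear.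
(* The discrete norm is the one induced by B^h, so coercivity is an identity and continuity is
   Cauchy-Schwarz, both with constant 1. *)
- exists C0, 1, 1, C3; split; first exact: (conj C00 (conj ltr01 (conj ltr01 C30))).
  split; first by move=> I J _ psi hp; exact: (hC0 I J psi hp).
  split.
    move=> psi hp; exists (approximant psi); split; last exact: (approximant_strong hp).
    by move=> I J _; exact: (@approximant_H10h psi I J).
  split.
    move=> I J _ u v hu hv; split.
      by apply: le_eq; rewrite mul1r; exact: (normh_sqr hu).
    by rewrite mul1r; exact: (si_CS_norm (Bh_si HW HS I J m0 bb) hu hv).
  split; first by move=> I J gr psi hp; exact: (hC3 I J psi gr hp).
  move=> vh psih v psi hh hv hpsi wv sp.
  have seq I J (gr : forall n, is_grid Q ratio (I n) (J n))
      (hx : dx Q (I n) @[n --> \oo] --> (0 : R)) (hy : dy Q (J n) @[n --> \oo] --> (0 : R)) :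
      G (T (psih (I n) (J n)) - psi) @[n --> \oo] --> (0 : R).
    have h := mesh_seq HW HS gr hx hy sp.
    exact: (strong_G (fun n => interpolant_H10 (hh _ _ (gr n)).2) hpsi h).
  split; apply: (mesh_cvg HW HS) => I J gr hx hy.
    have wv' : weak_cvg Om beta \oo (fun n => T (vh (I n) (J n))) v.
      by move=> L hL; exact: (mesh_seq HW HS gr hx hy (wv L hL)).
    have [ab1 ab2] := cvgb hx hy.
    exact: (Bh_limit HW HS hx hy mb m0 bb (fun n => (hh _ _ (gr n)).1) hv wv'
      (fun n => (hh _ _ (gr n)).2) hpsi (seq I J gr hx hy) ab1 ab2).
  exact: (Fd_limit gr hx hy (fun n => (hh _ _ (gr n)).2) hpsi (seq I J gr hx hy)).
- by move=> I J _; exact: (discrete_solvable HW HS m0 bb (@Fd_linear I J)).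
have [v [[hv sv] uv]] := weak_solvable; exists v; split; first by split.
split; first exact: uv.
move=> vh hs L hL; apply: (mesh_cvg HW HS) => I J gr hx hy.
exact: (solution_cvg gr hx hy (fun n => hs _ _ (gr n)) hv sv hL).
Qed.
End Loads.
End Assembly.

(** * The continuous functional as a pairing with bounded fluxes *)

Section FunctionalForm.
Context {R : realType}.
Variable Q : rectangle R.
Hypotheses (HW : xW Q < xE Q) (HS : yS Q < yN Q).
Local Notation Om := (Omega Q).
Local Notation MP := (measurableTypeR R * measurableTypeR R)%type.
Local Notation mu := (@plane_measure R).
Local Notation mOm := (measurable_Omega Q).
Local Notation fOm := (finite_Omega HW HS).
Local Notation l2 := (@sq_integrable _ MP R mu Om).
Local Notation ipO := (@ip _ MP R mu Om).
Local Notation wd := (weak_derivative Om).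
Local Notation S := (ip_semi_inner mOm fOm).
Local Opaque weak_derivative e1 e2.
Let ax1 : axis (e1 : R * R) := or_introl erefl.
Let ax2 : axis (e2 : R * R) := or_intror erefl.
Implicit Types (u w : R * R -> R).

(** A class closed under products and sums and contained in L^2, which square integrability alone
    would not give. *)
Definition bounded_measurable u :=
  measurable_fun (Om : set MP) (u : MP -> R) /\ exists C : R, forall p, Om p -> `|u p| <= C.
Local Notation bm := bounded_measurable.

Lemma bm_l2 u : bm u -> l2 u.
Proof. by move=> [mu' [C hC]]; exact: (sq_bounded mOm fOm mu' hC). Qed.

Lemma bmM u w : bm u -> bm w -> bm (fun p => u p * w p).
Proof.
move=> [mu' [C hC]] [mw [D hD]]; split; first exact: (measurable_funM mu' mw).
by exists (C * D) => p Op; rewrite normrM; apply: ler_pM => //; [exact: hC|exact: hD].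
Qed.

Lemma bmB u w : bm u -> bm w -> bm (fun p => u p - w p).
Proof.
move=> [mu' [C hC]] [mw [D hD]]; split; first exact: (measurable_funB mu' mw).
by exists (C + D) => p Op; apply: (le_trans (ler_normB _ _)); apply: lerD; [exact: hC|exact: hD].
Qed.

Lemma bmD u w : bm u -> bm w -> bm (fun p => u p + w p).
Proof.
move=> [mu' [C hC]] [mw [D hD]]; split; first exact: (measurable_funD mu' mw).
by exists (C + D) => p Op; apply: (le_trans (ler_normD _ _)); apply: lerD; [exact: hC|exact: hD].
Qed.

Lemma bm_continuous u (C : R) : (forall p, Om p -> {for p, continuous u}) ->
  (forall p, Om p -> `|u p| <= C) -> bm u.
Proof. by move=> cu uC; split; [apply: Omega_measurable => p /set_mem; exact: cu|exists C]. Qed.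

Lemma c1_continuous0 u u1 u2 (B : R) p : C1_data Q u u1 u2 B -> Om p -> {for p, continuous u}.
Proof.
move=> D Op; apply: (within_continuous_at (@open_Omega R Q) Op).
by rewrite (closure_Omega HW HS); exact: (c1_within D).
Qed.

Lemma C1_data_deriv u u1 u2 w1 w2 (B : R) : C1_data Q u u1 u2 B ->
  (forall p, Om p -> is_derive p e1 u (w1 p) /\ is_derive p e2 u (w2 p)) -> C1_data Q u w1 w2 B.
Proof.
move=> D dw; have E p : Om p -> w1 p = u1 p /\ w2 p = u2 p.
  move=> Op; have [d1 d2] := dw p Op; have [k1 k2] := c1_derive D Op.
  by split; [exact: (is_derive_unique d1 k1)|exact: (is_derive_unique d2 k2)].
split=> [|//|p Op|p Bp|p Op]; first exact: (c1_within D).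
- have oO := @open_Omega R Q; have [k1 k2] := c1_continuous D Op.
  by split; [apply: (eq_continuous_at oO Op _ k1)|apply: (eq_continuous_at oO Op _ k2)] => q /E[].
- exact: (c1_bound D Bp).
by have [-> ->] := E p Op; exact: (c1_bound1 D Op).
Qed.

Lemma le_sum_norm (s : seq R) (x : R) : x \in s -> x <= \sum_(y <- s) `|y|.
Proof.
move=> xs; rewrite (big_rem x)//=; apply: (le_trans (ler_norm x)).
by rewrite lerDl sumr_ge0.
Qed.

Variables (phi phi1 phi2 beta a a1 a2 b g g1 g2 f nx ny G11 G12 G21 G22 : R * R -> R) (m M B : R).
Hypotheses (iphi : interface Q phi)
  (dphi : forall p, Om p -> is_derive p e1 phi (phi1 p) /\ is_derive p e2 phi (phi2 p))
  (C1 : Ck 1 Om phi1) (C2 : Ck 1 Om phi2)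
  (coef : coefficient Q phi m M beta) (nf : normal_field Q phi b nx ny)
  (Da : C1_data Q a a1 a2 B) (Dg : C1_data Q g g1 g2 B)
  (DG1 : C1_data Q (fun p => b p * phi1 p) G11 G12 B) (DG2 : C1_data Q (fun p => b p * phi2 p) G21 G22 B)
  (cf : forall p, Om p -> {for p, continuous f})
  (fB : forall p, Om p -> `|f p| <= B) (betaB : forall p, Om p -> `|beta p| <= B).

Definition flux_x p := beta p * g1 p - beta p * a1 p * neg phi p + b p * phi1 p * neg phi p.
Definition flux_y p := beta p * g2 p - beta p * a2 p * neg phi p + b p * phi2 p * neg phi p.
(** The zeros are the limits of the normal error terms, kept so that this is literally the limit in
    [cvg_load_0]. *)
Definition source p := f p + (G11 p * neg phi p + 0) + (G22 p * neg phi p + 0).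

Let bbeta : bm beta.
Proof. by split; [exact: (beta_measurable iphi coef)|exists B]. Qed.
Let bneg : bm (neg phi).
Proof.
split; [exact: (measurable_neg iphi)|exists 1 => p _].
by have /andP[h1 h2] := neg_itv phi p; rewrite ger0_norm.
Qed.
Let bm1 u u1 u2 : C1_data Q u u1 u2 B -> [/\ bm u, bm u1 & bm u2].
Proof.
move=> D; split.
- apply: (bm_continuous (C := B)) => p Op; first exact: (c1_continuous0 D Op).
  by apply: (c1_bound D); exact: (Omega_sub_bar HW HS).
- by apply: (bm_continuous (C := B)) => p Op; [exact: (c1_continuous D Op).1|exact: (c1_bound1 D Op).1].
by apply: (bm_continuous (C := B)) => p Op; [exact: (c1_continuous D Op).2|exact: (c1_bound1 D Op).2].
Qed.
Let bf : bm f := bm_continuous cf fB.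

Lemma flux_bm : [/\ bm flux_x, bm flux_y & bm source].
Proof.
have [_ ba1 ba2] := bm1 Da; have [_ bg1 bg2] := bm1 Dg.
have [bG1 bG11 _] := bm1 DG1; have [bG2 _ bG22] := bm1 DG2.
have z : bm (fun=> 0) by split; [exact: measurable_cst|exists 0 => p _; rewrite normr0].
split.
- exact: (bmD (bmB (bmM bbeta bg1) (bmM (bmM bbeta ba1) bneg)) (bmM bG1 bneg)).
- exact: (bmD (bmB (bmM bbeta bg2) (bmM (bmM bbeta ba2) bneg)) (bmM bG2 bneg)).
exact: (bmD (bmD bf (bmD (bmM bG11 bneg) z)) (bmD (bmM bG22 bneg) z)).
Qed.

(** The first three terms only need the indicator of [Omega_minus] moved into the integrand; the
    divergence term is [interface_integral], which removes [nx] and [ny]. *)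
Lemma functionalE psi : H10 Om psi -> functional Q phi beta a b g f nx ny psi =
  ipO (wd e1 psi) flux_x + ipO (wd e2 psi) flux_y + ipO psi source.
Proof.
move=> hp; have Hp := H10_H1 hp; have lp := H1_l2 Hp.
have lw1 := wd_l2 ax1 Hp; have lw2 := wd_l2 ax2 Hp.
have [_ ba1 ba2] := bm1 Da; have [_ bg1 bg2] := bm1 Dg.
have [bG1 bG11 _] := bm1 DG1; have [bG2 _ bG22] := bm1 DG2.
have LS := sq_linear_set mOm fOm.
have lin3 x u v w : l2 x -> bm u -> bm v -> bm w ->
    ipO x (fun p => u p - v p + w p) = ipO x u - ipO x v + ipO x w.
  move=> lx /bm_l2 lu /bm_l2 lv /bm_l2 lw.
  have e1' := linear_onD (si_linear_onr S lx) (lsB LS lu lv) lw.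
  have e2' := linear_onB LS (si_linear_onr S lx) lu lv.
  exact: (etrans e1' (congr1 (fun t => t + ipO x w) e2')).
have sum3 x u v w : l2 x -> bm u -> bm v -> bm w ->
    ipO x (fun p => u p + v p + w p) = ipO x u + ipO x v + ipO x w.
  move=> lx /bm_l2 lu /bm_l2 lv /bm_l2 lw.
  have e1' := linear_onD (si_linear_onr S lx) (lsD LS lu lv) lw.
  have e2' := linear_onD (si_linear_onr S lx) lu lv.
  exact: (etrans e1' (congr1 (fun t => t + ipO x w) e2')).
have bg1' := bmM bbeta bg1; have bg2' := bmM bbeta bg2.
have ba1' := bmM (bmM bbeta ba1) bneg; have ba2' := bmM (bmM bbeta ba2) bneg.
have fx := lin3 _ _ _ _ lw1 bg1' ba1' (bmM bG1 bneg).
have fy := lin3 _ _ _ _ lw2 bg2' ba2' (bmM bG2 bneg).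
have fs := sum3 _ _ _ _ lp bf (bmM bneg bG11) (bmM bneg bG22).
have es : source = (fun p => f p + neg phi p * G11 p + neg phi p * G22 p).
  by apply/funext => p; rewrite /source !addr0 [G11 p * _]mulrC [G22 p * _]mulrC.
have add u w (x y : R * R -> R) : l2 x -> l2 y -> bm u -> bm w ->
    \int[mu]_(p in Om) (x p * u p + y p * w p) = ipO x u + ipO y w.
  by move=> lx ly /bm_l2 lu /bm_l2 lw; exact: (RintegralD mOm (sq_mul mOm lx lu) (sq_mul mOm ly lw)).
have t1 : \int[mu]_(p in Om) (f p * psi p) = ipO psi f.
  by apply: eq_Rintegral => p _; exact: mulrC.
have alg (c x y z w : R) : c * (x * y + z * w) = y * (c * x) + w * (c * z) by ring.
have t2 : \int[mu]_(p in Om) (beta p * ('D_e1 g p * wd e1 psi p + 'D_e2 g p * wd e2 psi p)) =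
    ipO (wd e1 psi) (fun p => beta p * g1 p) + ipO (wd e2 psi) (fun p => beta p * g2 p).
  apply: etrans (add _ _ _ _ lw1 lw2 bg1' bg2'); apply: eq_Rintegral => p /set_mem Op.
  rewrite (is_derive_val (c1_derive Dg Op).1) (is_derive_val (c1_derive Dg Op).2).
  exact: alg.
have alg' (n c x y z w : R) : n * (c * (x * y + z * w)) = y * (c * x * n) + w * (c * z * n) by ring.
have t3 : \int[mu]_(p in Omega_minus Q phi)
      (beta p * ('D_e1 a p * wd e1 psi p + 'D_e2 a p * wd e2 psi p)) =
    ipO (wd e1 psi) (fun p => beta p * a1 p * neg phi p) +
    ipO (wd e2 psi) (fun p => beta p * a2 p * neg phi p).
  apply: (etrans (integral_minus Q phi _)).
  apply: etrans (add _ _ _ _ lw1 lw2 ba1' ba2'); apply: eq_Rintegral => p /set_mem Op.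
  rewrite (is_derive_val (c1_derive Da Op).1) (is_derive_val (c1_derive Da Op).2).
  exact: alg'.
have inc (u : R * R -> R) : (forall p, Om p -> {for p, continuous u}) -> {in Om, continuous u}.
  by move=> h p /set_mem; exact: h.
have bC p : Om p -> [/\ `|b p * phi1 p| <= B, `|b p * phi2 p| <= B, `|G11 p| <= B & `|G22 p| <= B].
  move=> Op; have Bp := Omega_sub_bar HW HS Op.
  by split; [exact: (c1_bound DG1 Bp)|exact: (c1_bound DG2 Bp)|exact: (c1_bound1 DG1 Op).1|
    exact: (c1_bound1 DG2 Op).2].
have t4 := interface_integral HW HS iphi dphi C1 C2 nf
  (fun p Op => (c1_derive DG1 Op).1) (fun p Op => (c1_derive DG2 Op).2)
  (inc _ (fun p Op => c1_continuous0 DG1 Op)) (inc _ (fun p Op => c1_continuous0 DG2 Op))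
  (inc _ (fun p Op => (c1_continuous DG1 Op).1)) (inc _ (fun p Op => (c1_continuous DG2 Op).2)) bC hp.
have n1 : ipO (wd e1 psi) (fun p => neg phi p * (b p * phi1 p)) =
    ipO (wd e1 psi) (fun p => b p * phi1 p * neg phi p).
  by apply: eq_Rintegral => p _; congr (_ * _); exact: mulrC.
have n2 : ipO (wd e2 psi) (fun p => neg phi p * (b p * phi2 p)) =
    ipO (wd e2 psi) (fun p => b p * phi2 p * neg phi p).
  by apply: eq_Rintegral => p _; congr (_ * _); exact: mulrC.
have A (T1 T2 T3 T4 s x1 x2 x3 x3' y1 y2 y3 y3' p1 p2 X Y P : R) :
    T1 = s -> T2 = x1 + y1 -> T3 = x2 + y2 -> T4 = x3' + y3' + p1 + p2 -> x3' = x3 -> y3' = y3 ->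
    X = x1 - x2 + x3 -> Y = y1 - y2 + y3 -> P = s + p1 + p2 -> T1 + T2 - T3 + T4 = X + Y + P.
  by move=> -> -> -> -> -> -> -> -> ->; ring.
rewrite es; exact: (A _ _ _ _ _ _ _ _ _ _ _ _ _ _ _ _ _ _ t1 t2 t3 t4 n1 n2 fx fy fs).
Qed.
End FunctionalForm.

Theorem theorem5p1 (R : realType) (Q : rectangle R)
    (phi beta a b g f nx ny : R * R -> R) (m M ratio : R) :
  xW Q < xE Q -> yS Q < yN Q ->
  interface Q phi ->
  normal_field Q phi b nx ny ->
  coefficient Q phi m M beta ->
  Ck 1 (Omega Q) a -> Ck 1 (Omega Q) b -> Ck 1 (Omega Q) g -> Ck 1 (Omega Q) f ->
  (forall p, frontier (Omega Q) p -> a p = 0 /\ b p = 0) ->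
  exists T : forall I J : nat, gridfun I J -> R * R -> R,
    (* linear operators from H10h to H10 *)
    (forall I J, is_grid Q ratio I J ->
       (forall psi : gridfun I J, H10h psi -> H10 (Omega Q) (T I J psi)) /\
       (forall (c : R) (v psi : gridfun I J), H10h v -> H10h psi ->
          T I J (c *: v + psi) = c *: T I J v + T I J psi)) /\
    (exists C0 C1 C2 C3 : R,
       (0 < C0 /\ 0 < C1 /\ 0 < C2 /\ 0 < C3) /\
       (* (1)(i) *)
       (forall I J, is_grid Q ratio I J -> forall psi : gridfun I J, H10h psi ->
          H10_norm (Omega Q) beta (T I J psi) <= C0 * normh Q beta psi) /\
       (* (1)(ii) *)
       (forall psi : R * R -> R, H10 (Omega Q) psi ->
          exists psih : forall I J : nat, gridfun I J,
            (forall I J, is_grid Q ratio I J -> H10h (psih I J)) /\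
            strong_cvg (Omega Q) beta (mesh_to_0 Q ratio)
              (fun IJ => T IJ.1 IJ.2 (psih IJ.1 IJ.2)) psi) /\
       (* (1)(iii) *)
       (forall I J, is_grid Q ratio I J -> forall u v : gridfun I J,
          H10h u -> H10h v ->
          C1 * normh Q beta u ^+ 2 <= Bh Q beta u u /\
          `|Bh Q beta u v| <= C2 * normh Q beta u * normh Q beta v) /\
       (* (1)(iv) *)
       (forall I J, is_grid Q ratio I J -> forall psi : gridfun I J, H10h psi ->
          `|Fh Q phi beta a b g f psi| <= C3 * normh Q beta psi) /\
       (* (1)(v) *)
       (forall (vh psih : forall I J : nat, gridfun I J) (v psi : R * R -> R),
          (forall I J, is_grid Q ratio I J ->
             H10h (vh I J) /\ H10h (psih I J)) ->
          H10 (Omega Q) v -> H10 (Omega Q) psi ->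
          weak_cvg (Omega Q) beta (mesh_to_0 Q ratio)
            (fun IJ => T IJ.1 IJ.2 (vh IJ.1 IJ.2)) v ->
          strong_cvg (Omega Q) beta (mesh_to_0 Q ratio)
            (fun IJ => T IJ.1 IJ.2 (psih IJ.1 IJ.2)) psi ->
          Bh Q beta (vh IJ.1 IJ.2) (psih IJ.1 IJ.2)
            @[IJ --> mesh_to_0 Q ratio] --> energy (Omega Q) beta v psi /\
          Fh Q phi beta a b g f (psih IJ.1 IJ.2)
            @[IJ --> mesh_to_0 Q ratio]
            --> functional Q phi beta a b g f nx ny psi)) /\
    (* (2), including that both weak problems are uniquely solvable *)
    (forall I J, is_grid Q ratio I J ->
       exists! vh : gridfun I J, discrete_solution Q phi beta a b g f vh) /\
    (exists v : R * R -> R,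
       weak_solution Q phi beta a b g f nx ny v /\
       (forall v', weak_solution Q phi beta a b g f nx ny v' ->
          {ae plane_measure, forall p, Omega Q p -> v' p = v p}) /\
       (forall vh : forall I J : nat, gridfun I J,
          (forall I J, is_grid Q ratio I J ->
             discrete_solution Q phi beta a b g f (vh I J)) ->
          weak_cvg (Omega Q) beta (mesh_to_0 Q ratio)
            (fun IJ => T IJ.1 IJ.2 (vh IJ.1 IJ.2)) v)).
Proof.
move=> HW HS iphi nf coef Ca Cb Cg Cf _.
case: (coef) => m0 mM bb _ _; case: (iphi) => sphi _ _ _.
(* Two orders of smoothness make the gradient of [phi] a [Ck 1] field, as the central differences
   and the derivatives of b grad phi require. *)
case: (sphi 2%N) => _ [phi1 [phi2 [dphi C1 C2]]].
have [r r0 hr] := unit_near HW HS iphi dphi C1 C2 nf.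
have [q1 [q2 [Bphi D0]]] := C1_dataP HW HS (sphi 1%N).
have Dphi := C1_data_deriv D0 dphi.
have [p11 [p12 [B1 D1]]] := C1_dataP HW HS C1.
have [p21 [p22 [B2 D2]]] := C1_dataP HW HS C2.
have [a1 [a2 [Ba Da]]] := C1_dataP HW HS Ca.
have [g1 [g2 [Bg Dg]]] := C1_dataP HW HS Cg.
have [G11 [G12 [BG1 DG1]]] := C1_dataP HW HS (Ck_mul Cb C1).
have [G21 [G22 [BG2 DG2]]] := C1_dataP HW HS (Ck_mul Cb C2).
have [Bb [_ hb]] := Ck_bounded HW HS Cb; have [Bf [_ hf]] := Ck_bounded HW HS Cf.
(* One constant for all data: the sum of the absolute values dominates every entry. *)
pose s := [:: Bphi; B1; B2; Ba; Bg; BG1; BG2; Bb; Bf; M].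
pose B := \sum_(x <- s) `|x|.
have B0 : 0 <= B by apply: sumr_ge0.
have leB x : x \in s -> x <= B := @le_sum_norm R s x.
have mem (i : nat) : (i < 10)%N -> nth 0 s i <= B by move=> i10; apply: leB; exact: mem_nth.
have {D0} Dphi' := C1_data_le (mem 0%N isT) Dphi.
have D1' := C1_data_le (mem 1%N isT) D1; have D2' := C1_data_le (mem 2%N isT) D2.
have Da' := C1_data_le (mem 3%N isT) Da; have Dg' := C1_data_le (mem 4%N isT) Dg.
have DG1' := C1_data_le (mem 5%N isT) DG1; have DG2' := C1_data_le (mem 6%N isT) DG2.
have bB p : Omega_bar Q p -> `|b p| <= B by move=> h; exact: (le_trans (hb p h) (mem 7%N isT)).
have fB p : Omega_bar Q p -> `|f p| <= B by move=> h; exact: (le_trans (hf p h) (mem 8%N isT)).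
have betaB p : Omega Q p -> `|beta p| <= B.
  move=> /bb /andP[h1 h2]; rewrite ger0_norm ?(le_trans (ltW m0) h1)//.
  exact: (le_trans h2 (mem 9%N isT)).
have fO p : Omega Q p -> `|f p| <= B by move=> /(Omega_sub_bar HW HS); exact: fB.
have cf p : Omega Q p -> {for p, continuous f}.
  by move=> Op; exact: (Ck_continuous_at (@open_Omega R Q) Op Cf).
have unit p : Omega Q p -> `|phi p| < r -> phi1 p ^+ 2 + phi2 p ^+ 2 = 1.
  by move=> Op h; have [] := hr p Op h.
(* For a ratio that no grid realises [aspect] may be negative, whereas the load bounds are stated
   for a nonnegative constant. *)
pose k := `|aspect ratio|; have k0 : 0 <= k := normr_ge0 _.
have G0 := Gamma_null HW HS iphi dphi C1 C2.
pose K := load_const B r k.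
have LB I J i j : is_grid Q ratio I J -> (i <= I)%N -> (j <= J)%N ->
    [/\ `|load_x Q I J phi beta a g (fun p => b p * phi1 p) i j| <= K,
        `|load_y Q I J phi beta a g (fun p => b p * phi2 p) i j| <= K
      & `|load_0 Q I J phi b f (fun p => b p * phi1 p) (fun p => b p * phi2 p) i j| <= K].
  move=> gr iI jJ; have [_ h1 h2 _] := grid_comparable HW HS gr.
  apply: (load_bounded HW HS B0 r0 k0 unit Dphi' D1' D2' Da' Dg' DG1' DG2' bB fB betaB _ _ iI jJ).
    by apply: (le_trans h1); apply: ler_wpM2r; [exact: ltW (dy_gt0 HS J)|exact: ler_norm].
  by apply: (le_trans h2); apply: ler_wpM2r; [exact: ltW (dx_gt0 HW I)|exact: ler_norm].
have cb p : Omega Q p -> phi p != 0 -> {for p, continuous beta}.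
  by move=> Op p0; exact: (beta_continuous iphi coef Op p0).
have cphi p : Omega Q p -> {for p, continuous phi}.
  by move=> Op; exact: (c1_continuous0 HW HS Dphi' Op).
have cvgL I J (hx : dx Q (I n) @[n --> \oo] --> (0 : R)) (hy : dy Q (J n) @[n --> \oo] --> (0 : R)) :
    [/\ {ae plane_measure, forall p, Omega Q p -> pc Q (I n) (J n)
          (load_x Q (I n) (J n) phi beta a g (fun p => b p * phi1 p)) p @[n --> \oo]
          --> flux_x phi phi1 beta a1 b g1 p},
        {ae plane_measure, forall p, Omega Q p -> pc Q (I n) (J n)
          (load_y Q (I n) (J n) phi beta a g (fun p => b p * phi2 p)) p @[n --> \oo]
          --> flux_y phi phi2 beta a2 b g2 p}
      & {ae plane_measure, forall p, Omega Q p -> pc Q (I n) (J n)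
          (load_0 Q (I n) (J n) phi b f (fun p => b p * phi1 p) (fun p => b p * phi2 p)) p @[n --> \oo]
          --> source phi f G11 G22 p}].
  split; apply: ae_sub G0 => p h Op; have p0 := h Op.
  - exact: (cvg_load_x HW HS Da' Dg' hx hy Op p0 (cb p Op p0) (cphi p Op) (c1_continuous0 HW HS DG1' Op)).
  - exact: (cvg_load_y HW HS Da' Dg' hx hy Op p0 (cb p Op p0) (cphi p Op) (c1_continuous0 HW HS DG2' Op)).
  exact: (cvg_load_0 HW HS DG1' DG2' hx hy Op p0 (cphi p Op) (cf p Op)).
have [[ml1 _] [ml2 _] [ml3 _]] := flux_bm HW HS iphi coef Da' Dg' DG1' DG2' cf fO betaB.
have bl p : Omega Q p -> [/\ `|flux_x phi phi1 beta a1 b g1 p| <= K,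
    `|flux_y phi phi2 beta a2 b g2 p| <= K & `|source phi f G11 G22 p| <= K].
  move=> Op; have Bp := Omega_sub_bar HW HS Op; have [K1 K2] := load_const_ge B0 r0 k0.
  have [ha1 ha2] := c1_bound1 Da' Op; have [hg1 hg2] := c1_bound1 Dg' Op.
  have ni := neg_itv phi p; have e0 := err_const_ge0 B0 r0.
  have D00 : `|0 : R| <= err_const B r * (1 + k) by rewrite normr0 mulr_ge0// addr_ge0.
  split.
  - exact: (le_trans (load_arith (betaB p Op) hg1 ha1 (c1_bound DG1' Bp) ni) K1).
  - exact: (le_trans (load_arith (betaB p Op) hg2 ha2 (c1_bound DG2' Bp) ni) K1).
  exact: (le_trans (load0_arith (fO p Op) (mul_itv (c1_bound1 DG1' Op).1 ni)
    (mul_itv (c1_bound1 DG2' Op).2 ni) D00 D00) K2).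
have FcE psi (hp : H10 (Omega Q) psi) :=
  functionalE HW HS iphi dphi C1 C2 coef nf Da' Dg' DG1' DG2' cf fO betaB hp.
have cvgb I J (hx : dx Q (I n) @[n --> \oo] --> (0 : R)) (hy : dy Q (J n) @[n --> \oo] --> (0 : R)) :
    {ae plane_measure, forall p, Omega Q p ->
       pc Q (I n) (J n) (bx Q (I n) (J n) beta) p @[n --> \oo] --> beta p} /\
    {ae plane_measure, forall p, Omega Q p ->
       pc Q (I n) (J n) (by_ Q (I n) (J n) beta) p @[n --> \oo] --> beta p}.
  split; apply: ae_sub G0 => p h Op; have p0 := h Op.
    exact: (cvg_bx HW HS hx hy Op (cb p Op p0)).1.
  exact: (cvg_bx HW HS hx hy Op (cb p Op p0)).2.
exact: (assembly HW HS (beta_measurable iphi coef) m0 bb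
  (Fd := fun I J => @Fh R Q I J phi beta a b g f)
  (LX := fun I J => load_x Q I J phi beta a g (fun p => b p * phi1 p))
  (LY := fun I J => load_y Q I J phi beta a g (fun p => b p * phi2 p))
  (L0 := fun I J => load_0 Q I J phi b f (fun p => b p * phi1 p) (fun p => b p * phi2 p))
  (fun I J psi hp => FhE HW HS phi beta a b g f _ _ hp) LB cvgL (And3 ml1 ml2 ml3) bl FcE cvgb).
Qed.
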